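(* Consider the market described in the context. Suppose that the functions $i\mapsto c_i,\alpha_i,\lambda_i,k_i,r_i$ are all strictly positive and $\mathcal I$-measurable on $I$, and that $$\kappa_0:=(1+\beta)\int_I\lambda_i c_i^{\alpha_i}\,\iota(\mathrm di)<\infty .$$ Suppose also that, for all $i\in I$, $$\alpha_i\in\,]0,1[\quad\text{and}\quad \varepsilon_i:=\frac{(n_i-1)(1-\alpha_i)}{\alpha_i}-\frac{1-\overline\alpha}{1-\overline\alpha+\overline\alpha\gamma}>0,$$ and that $$\int_I\lambda_i\Bigl(q\,\frac{\alpha_i(n_i-1)}{(r_i-\mu)n_ik_i}\Bigr)^{\alpha_i/(1-\alpha_i)}\iota(\mathrm di)<\infty\quad\text{for all constants } q>0 .$$ For $i\in I$ and $\overline p\ge 0$ let $$\Psi_i^\star(\overline p)=\Bigl(\frac{\alpha_i(n_i-1)}{(r_i-\mu)n_ik_i}\Bigr)^{1/(1-\alpha_i)}\,\overline p^{(1+\beta)/(1-\alpha_i)},\qquad \mathbb\Psi^\star=\{\Psi_i^\star,\ i\in I\},$$ and let $$h^\star(\overline p)=\frac{\overline p^{1+\beta}}{\mathscr I[\mathbb\Psi^\star](\overline p)},\quad \varphi^\star=\mathscr I[\mathbb\Psi^\star]\circ (h^\star)^{\rm inv},\quad \Phi_i^\star(\overline x)=\Psi_i^\star\bigl((\overline x\,\varphi^\star(\overline x))^{1/(1+\beta)}\bigr),\quad \mathbb\Phi^\star=\{\Phi^\star_i,\ i\in I\},$$ where $(h^\star)^{\rm inv}$ is the inverse function of $h^\star$.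 Then a competitive production equilibrium is given by the solution $P^\star$ to the equation $$P^\star=\bigl(X\,\mathscr I[\mathbb\Psi^\star](\overline P^\star)\bigr)^{1/(1+\beta)},\qquad \overline P^\star_t=\sup_{0\le s\le t}P^\star_s,$$ together with the expansion strategies $$C_i^\star(t)=c_i\vee\Psi_i^\star(\overline P^\star_t),\quad t\ge 0,\ i\in I,\qquad C_i^\star(0-)=c_i,$$ or, equivalently, by $$P^\star_t=\bigl(X_t\,\mathscr I[\mathbb\Phi^\star](\overline X_t)\bigr)^{1/(1+\beta)}\quad\text{and}\quad C_i^\star(t)=c_i\vee\Phi_i^\star(\overline X_t),\qquad \overline X_t=\sup_{0\le s\le t}X_s .$$ Furthermore, $\mathscr I[\mathbb\Psi^\star]$ and $\mathscr I[\mathbb\Phi^\star]$ are differences of two convex functions, and the stochastic dynamics of the equilibrium price process are given by $$\mathrm d\ln P_t^\star=\frac{\mu-\frac12\sigma^2}{1+\beta}\,\mathrm dt+\frac1{1+\beta}\frac{(\mathscr I[\mathbb\Psi^\star])'_-(\overline P_t^\star)}{\mathscr I[\mathbb\Psi^\star](\overline P_t^\star)}\,\mathrm d\overline P_t^\star+\frac{\sigma}{1+\beta}\,\mathrm dW_t$$ $$\phantom{\mathrm d\ln P_t^\star}=\frac{\mu-\frac12\sigma^2}{1+\beta}\,\mathrm dt+\frac1{1+\beta}\frac{(\mathscr I[\mathbb\Phi^\star])'_-(\overline X_t)}{\mathscr I[\mathbb\Phi^\star](\overline X_t)}\,\mathrm d\overline X_t+\frac{\sigma}{1+\beta}\,\mathrm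 dW_t,$$ with initial condition $P_0^\star=\bigl(X_0\,\mathscr I[\mathbb\Phi^\star](X_0)\bigr)^{1/(1+\beta)}$.
   Context: Setting. $(\Omega,\mathcal F,(\mathcal F_t),\mathsf P)$ is a filtered probability space supporting a standard one-dimensional $(\mathcal F_t)$-Brownian motion $W$; $\mathsf E$ is expectation under $\mathsf P$. $(I,\mathcal I,\iota)$ is a $\sigma$-finite non-atomic measure space indexing producers, with $\iota(I)>0$, $\{i\}\in\mathcal I$ and $\iota(\{i\})=0$ for all $i\in I$. Producer $i$ has initial capability $c_i>0$, production exponent $\alpha_i\in\,]0,1[$, and constants $\lambda_i>0$, $k_i>0$, and discounting rate $r_i>0$. The constants $\beta>0$ and $\delta>0$ are such that $\gamma:=(1+\beta)/(\delta+\beta)\in\,]0,1[$. The base demand is $D_t=D_0\exp(\widetilde\mu t+\widetilde\sigma W_t)$ with constants $D_0>0$, $\widetilde\mu\in\mathbb R$, $\widetilde\sigma>0$, and $X:=D^\gamma$, so that $X$ is the geometric Brownian motion $$\mathrm dX_t=\mu X_t\,\mathrm dt+\sigma X_t\,\mathrm dW_t,\quad X_0=D_0^\gamma,$$ with constants $\sigma=\gamma\widetilde\sigma>0$ and $\mu=\gamma\widetilde\mu+\tfrac12\gamma^2\widetilde\sigma^2\in\mathbb R$. Constants. For $i\in I$, $m_i<0<n_i$ are the two roots of $\frac12\sigma^2\ell^2+(\mu-\frac12\sigma^2)\ell-r_i=0$. Also $\overline\alpha:=\inf\{a\in\,]0,1]\mid\iota(\alpha>a)=0\}$, the $\iota$-essential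 supremum of $i\mapsto\alpha_i$. Operator $\mathscr I$. For a family $\mathbb X=\{\mathcal X_i,\ i\in I\}$ of functions $\mathcal X_i:[0,\infty)\to[0,\infty)$, jointly measurable in $(z,i)$, $$\mathscr I[\mathbb X](z)=\Bigl((1+\beta)\int_I\lambda_i\bigl(c_i^{\alpha_i}\vee\mathcal X_i^{\alpha_i}(z)\bigr)\iota(\mathrm di)\Bigr)^{-\gamma},\quad z\ge0 .$$ A function $f:[0,\infty)\to\mathbb R$ is the difference of two convex functions if and only if it is absolutely continuous with left-hand derivative that is a function of finite variation; $f'_-$ denotes its left-hand derivative. Admissible strategies. For $i\in I$, $\mathcal A_i$ is the set of all $(\mathcal F_t)$-adapted increasing processes $C_i$ with càdlàg sample paths such that $C_i(0-)=c_i$ and $\mathsf E\bigl[\int_0^\infty e^{-r_it}C_i^{\alpha_i}(t)X_t\,\mathrm dt\bigr]<\infty$. The family $\mathcal A$ consists of all collections $\{C_i,\ i\in I\}$ with $C_i\in\mathcal A_i$ for all $i\in I$ and such that $((\omega,t),i)\mapsto C_i(\omega,t)$ is $\mathcal P\otimes\mathcal I$-measurable, where $\mathcal P$ is the progressive $\sigma$-algebra on $\Omega\times[0,\infty)$. Performance index. Given a price process $P$, $$\widetilde J^{(i)}_{c_i}(C_i\mid P)=\mathsf E\Bigl[\int_0^\infty e^{-r_it}C_i^{\alpha_i}(t)P_t^{1+\beta}\,\mathrm dt-k_i\int_{[0,\infty[}e^{-r_it}\,\mathrm dC_i(t)\Bigr],$$ where the second integral includes the possible jump $C_i(0)-C_i(0-)$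 at time $0$. Competitive production equilibrium. It consists of a continuous $(\mathcal F_t)$-adapted price process $P$ and a family $\{C_i^\star,\ i\in I\}\in\mathcal A$ such that the market-clearing condition $$P_t=X_t^{1/(1+\beta)}\Bigl((1+\beta)\int_I (C_i^{\star})^{\alpha_i}(t)\,\lambda_i\,\iota(\mathrm di)\Bigr)^{-\gamma/(1+\beta)},\quad t\ge0,$$ holds and $\widetilde J^{(i)}_{c_i}(C_i^\star\mid P)=\sup_{C_i\in\mathcal A_i}\widetilde J^{(i)}_{c_i}(C_i\mid P)$ for all $i\in I$. *)

(* Defs.v *)
From HB Require Import structures.
From mathcomp Require Import all_boot all_order all_algebra.
From mathcomp Require Import all_classical all_reals all_analysis.

Set Implicit Arguments.
Unset Strict Implicit.
Unset Printing Implicit Defensive.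

Import Order.TTheory GRing.Theory Num.Theory.
Import numFieldNormedType.Exports.

Local Open Scope classical_set_scope.
Local Open Scope ring_scope.

Section real_functions.
Context {R : realType}.
Implicit Types f : R -> R.

Definition left_derivative f (x : R) : R :=
  lim ((h^-1 * (f (x + h) - f x)) @[h --> 0^'-]).

(* Continuity of f1 and f2 only matters at 0, the boundary of the domain: it
   rules out a jump there, as the description of these functions as absolutely
   continuous ones with a left derivative of finite variation does. *)
Definition difference_of_convex f :=
  exists f1 f2 : R -> R,
    [/\ convex_function (`[0, +oo[%classic : set R) f1,
        convex_function (`[0, +oo[%classic : set R) f2,
        {within `[0, +oo[, continuous f1},
        {within `[0, +oo[, continuous f2} &
        forall x, 0 <= x -> f x = f1 x - f2 x].

Definition cadlag f :=
  right_continuous f /\ forall t, cvg (f x @[x --> t^'-]).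

(* The Lebesgue-Stieltjes measure df; the zero measure (a dummy value) when f
   is not nondecreasing and right-continuous on the whole line. *)
Definition stieltjes f : {measure set (measurableTypeR R) -> \bar R} :=
  match pselect (nondecreasing f /\ right_continuous f) with
  | left H => lebesgue_stieltjes_measure
      (HB.pack_for (cumulative R R) f
         (isCumulative.Build R _ R f (proj1 H) (proj2 H)))
  | right _ => mzero
  end.

End real_functions.

(* Processes and filtrations are indexed by R; unless stated otherwise only the
   times t >= 0 matter. *)

Section stochastic_basis.
Context {R : realType} {d : measure_display} {Omega : measurableType d}.
Variable F : R -> set (set Omega).
Implicit Types Y : R -> Omega -> R.

Definition is_filtration :=
  [/\ forall t, 0 <= t -> sigma_algebra setT (F t),
      forall t, 0 <= t -> F t `<=` measurable &
      forall s t, 0 <= s -> s <= t -> F s `<=` F t].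

Definition adapted Y :=
  forall t, 0 <= t -> forall B : set R, measurable B -> F t (Y t @^-1` B).

Definition continuous_paths Y :=
  forall w, {within `[0, +oo[, continuous (fun t => Y t w)}.

(* normal_prob is parametrised by the standard deviation. *)
Definition is_brownian (P : probability Omega R) (W : R -> Omega -> R) :=
  [/\ forall w, W 0 w = 0,
      adapted W,
      continuous_paths W,
      forall s t, 0 <= s -> s < t -> forall B : set R, measurable B ->
        P ((W t \- W s) @^-1` B) = normal_prob 0 (Num.sqrt (t - s)) B &
      forall s t, 0 <= s -> s < t ->
        forall (A : set Omega) (B : set R), F s A -> measurable B ->
        P (A `&` (W t \- W s) @^-1` B) =
        (P A * P ((W t \- W s)%R @^-1` B))%E].

Definition running_sup Y (t : R) (w : Omega) : R :=
  sup [set Y s w | s in `[0, t]].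

Definition progressive : set (set (Omega * R)) :=
  [set A | A `<=` [set x | 0 <= x.2] /\
     forall t, 0 <= t ->
       <<s [set x : Omega * R | 0 <= x.2 <= t],
           [set A' `*` B | A' in F t &
              B in [set B : set R | measurable B /\ B `<=` `[0, t]]] >>
         (A `&` [set x | 0 <= x.2 <= t])].

End stochastic_basis.

Record market (R : realType) (I : Type) := Market {
  beta : R;
  delta : R;
  D0 : R;
  mu_tilde : R;
  sigma_tilde : R;
  cap : I -> R;   (* initial capabilities c_i *)
  alpha : I -> R;
  lam : I -> R;
  cost : I -> R;  (* constants k_i *)
  rate : I -> R   (* discounting rates r_i *)
}.

Section market.
Context {R : realType} {dI : measure_display} {I : measurableType dI}.
Variables (iota : {sigma_finite_measure set I -> \bar R}) (M : market R I).

Definition gamma : R := (1 + beta M) / (delta M + beta M).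

Definition sigma : R := gamma * sigma_tilde M.

Definition mu : R := gamma * mu_tilde M + gamma ^+ 2 * sigma_tilde M ^+ 2 / 2.

Definition characteristic (i : I) (l : R) : R :=
  sigma ^+ 2 / 2 * l ^+ 2 + (mu - sigma ^+ 2 / 2) * l - rate M i.

Definition characteristic_roots (m n : I -> R) :=
  forall i, [/\ m i < 0, 0 < n i,
    characteristic i (m i) = 0 & characteristic i (n i) = 0].

Definition nonatomic :=
  forall A : set I, measurable A -> (0 < iota A)%E ->
  exists B : set I,
    [/\ measurable B, B `<=` A, (0 < iota B)%E & (iota B < iota A)%E].

(* The point 1 is added because inf set0 = 0 here, while the essential supremum
   of alpha is 1 when iota (alpha > a) > 0 for all a in ]0, 1[. *)
Definition alpha_bar : R :=
  inf ([set a | 0 < a < 1 /\ iota [set i | a < alpha M i] = 0%E]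
       `|` [set 1]).

(* If the integral is infinite, then its real value is 0 by convention, and so
   is the result since 0 `^ (- gamma) = 0 for gamma > 0; this agrees with
   +oo `^ (- gamma) = 0. *)
Definition Iop (XX : I -> R -> R) (z : R) : R :=
  ((1 + beta M) *
   \int[iota]_i (lam M i *
     Num.max (cap M i `^ alpha M i) (XX i z `^ alpha M i))) `^ (- gamma).

Section equilibrium_functions.
Variable n : I -> R.

Definition Psi_const (i : I) : R :=
  (alpha M i * (n i - 1)) / ((rate M i - mu) * n i * cost M i).

Definition epsilon (i : I) : R :=
  (n i - 1) * (1 - alpha M i) / alpha M i
  - (1 - alpha_bar) / (1 - alpha_bar + alpha_bar * gamma).

Definition Psi_star (i : I) (p : R) : R :=
  Psi_const i `^ (1 - alpha M i)^-1 *
  p `^ ((1 + beta M) / (1 - alpha M i)).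

Definition h_star (p : R) : R := p `^ (1 + beta M) / Iop Psi_star p.

Definition h_star_inv : R -> R := 'pinv_(fun=> 0) `[0, +oo[%classic h_star.

Definition phi_star : R -> R := Iop Psi_star \o h_star_inv.

Definition Phi_star (i : I) (x : R) : R :=
  Psi_star i ((x * phi_star x) `^ (1 + beta M)^-1).

End equilibrium_functions.

Section stochastic_market.
Context {d : measure_display} {Omega : measurableType d}.
Variables (P : probability Omega R) (F : R -> set (set Omega)).
Variable W : R -> Omega -> R.

Definition base_demand (t : R) (w : Omega) : R :=
  D0 M * expR (mu_tilde M * t + sigma_tilde M * W t w).

Definition X (t : R) (w : Omega) : R := base_demand t w `^ gamma.

(* A strategy is indexed by the whole line and equal to c_i on ]-oo, 0[, which
   encodes C(0-) = c_i; then dC charges 0 with the initial jump C(0) - c_i. *)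
Definition admissible (i : I) : set (R -> Omega -> R) :=
  [set C | [/\ adapted F C,
     forall w, nondecreasing (fun t => C t w),
     forall w, cadlag (fun t => C t w),
     forall t w, t < 0 -> C t w = cap M i &
     (\int[P]_w \int[lebesgue_measure]_(t in `[0%R, +oo[)
        (expR (- rate M i * t) * C t w `^ alpha M i * X t w)%:E < +oo)%E]].

Definition admissible_family (C : I -> R -> Omega -> R) :=
  (forall i, admissible i (C i)) /\
  forall B : set R, measurable B ->
    <<s [set x : (Omega * R) * I | 0 <= x.1.2],
        [set A `*` J | A in progressive F & J in measurable] >>
      [set x | 0 <= x.1.2 /\ B (C x.2 x.1.2 x.1.1)].

Definition performance (i : I) (p C : R -> Omega -> R) : \bar R :=
  (\int[P]_w
     (\int[lebesgue_measure]_(t in `[0%R, +oo[)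
        (expR (- rate M i * t) * C t w `^ alpha M i
         * p t w `^ (1 + beta M))%:E
      - (cost M i)%:E *
        \int[stieltjes (fun t => C t w)]_(t in `[0%R, +oo[)
          (expR (- rate M i * t))%:E))%E.

Definition price_process (p : R -> Omega -> R) :=
  continuous_paths p /\ adapted F p.

Definition market_clearing (p : R -> Omega -> R) (C : I -> R -> Omega -> R) :=
  forall t w, 0 <= t ->
    p t w = X t w `^ (1 + beta M)^-1 *
      ((1 + beta M) * \int[iota]_i (C i t w `^ alpha M i * lam M i))
        `^ (- (gamma / (1 + beta M))).

Definition equilibrium (p : R -> Omega -> R) (C : I -> R -> Omega -> R) :=
  [/\ price_process p,
      admissible_family C,
      market_clearing p C &
      forall i, performance i p (C i) =
        ereal_sup [set performance i p Ci | Ci in admissible i]].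

Definition price_equation (n : I -> R) (p : R -> Omega -> R) :=
  price_process p /\
  forall t w, 0 <= t ->
    p t w = (X t w * Iop (Psi_star n) (running_sup p t w)) `^ (1 + beta M)^-1.

Definition expansion (n : I -> R) (p : R -> Omega -> R)
    (i : I) (t : R) (w : Omega) : R :=
  if t < 0 then cap M i
  else Num.max (cap M i) (Psi_star n i (running_sup p t w)).

(* Integral form, for a. e. w and all t >= 0, of
   d (ln p) = (mu - sigma^2 / 2) / (1 + beta) dt
     + 1 / (1 + beta) * f'_-(Ybar) / f(Ybar) dYbar + sigma / (1 + beta) dW
   with Ybar the running supremum of Y; dYbar is the Stieltjes measure of Ybar
   extended to ]-oo, 0[ by its value at 0. *)
Definition price_dynamics (p : R -> Omega -> R) (f : R -> R)
    (Y : R -> Omega -> R) :=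
  \forall w \ae P, forall t, 0 <= t ->
    (ln (p t w))%:E =
    ((ln (p 0%R w) + (mu - sigma ^+ 2 / 2) / (1 + beta M) * t)%:E
     + ((1 + beta M)^-1)%:E *
       \int[stieltjes (fun s => running_sup Y (Num.max s 0%R) w)]_(s in `]0%R, t])
         (left_derivative f (running_sup Y s w) / f (running_sup Y s w))%:E
     + (sigma / (1 + beta M) * W t w)%:E)%E.

Definition standing_assumptions :=
  [/\ [/\ 0 < beta M, 0 < delta M & 0 < gamma < 1],
      0 < D0 M /\ 0 < sigma_tilde M,
      is_filtration F /\ is_brownian F P W,
      nonatomic /\ (0 < iota setT)%E &
      forall i : I, measurable [set i] /\ iota [set i] = 0%E].

End stochastic_market.

End market.

(* Main.v *)
(** Write Y = P^(1+beta). With kap y = (1+beta) \int lam_i max (c_i^alpha_i, (K_i y)^e_i),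
    K_i = Psi_const i and e_i = alpha_i / (1 - alpha_i), one has Iop Psi p = kap (p^(1+beta))^(-gamma).
    Hence h_star is, up to the power 1+beta, the increasing bijection H y = y kap (y)^gamma, its
    inverse y(x) is the shadow price, and Iop Phi x = phi x with x phi x = y(x). The price equation
    amounts to h_star (sup P) = sup X, which gives existence and uniqueness.

    Optimality needs no stochastic calculus. Concavity of C |-> C^alpha and the form of C* bound
    the gain of C over C* by the discounted integral of (X / Xbar) (C - C* ), minus the cost
    k r E \int e^(-r s) (C - C* ) ds. For the geometric Brownian motion X,
      E [ \int_t^oo e^(-r (s - t)) X_s / sup_[t,s] X ds | F_t ] = (1 - 1/n) / (r - mu).
    As X_s / sup_[0,s] X <= X_s / sup_[t,s] X, with equality when X_t = sup_[0,t] X, every C earns at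
    most its cost on that integral and C*, which grows only at running maxima of X, earns
    exactly its cost. The identity comes from a discretization of time, along which
    p - p^n / n is nearly conserved (p the drawdown ratio), and C* has finite payoff because
    (sup X)^q is discounted-integrable for q < n.

    kap is a difference of convex functions termwise, hence so is kap^(-gamma). For phi, the
    function x phi x is concave as the inverse of H, which is convex by Minkowski's inequality;
    so u |-> phi (1/u) is concave, and F x = 2 \int_0^1 phi (x/t) dt and F - phi are both convex.
    Since the running supremum is continuous and nondecreasing, ln f of it is recovered from its
    Stieltjes differential, pathwise. *)

Require Import Defs.
From HB Require Import structures.
From mathcomp Require Import all_boot all_order all_algebra.
From mathcomp Require Import all_classical all_reals all_analysis.
From mathcomp Require Import measurable_realfun.
From mathcomp Require Import ring lra.

Set Implicit Arguments.
Unset Strict Implicit.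
Unset Printing Implicit Defensive.

Import Order.TTheory GRing.Theory Num.Theory.
Import numFieldNormedType.Exports.

Local Open Scope classical_set_scope.
Local Open Scope ring_scope.

(** * Moments of Brownian increments *)

(** The function p - p^n / n is dictated by reflection: the drawdown ratio p = X / sup X is
    reflected at 1, its power p^n grows at the rate r and is neutral under discounting, and the
    coefficient 1 / n makes the derivative vanish at 1. In the mean, e^(-r t) (p - p^n / n)
    therefore loses (r - mu) e^(-r t) p per unit of time. Its initial value 1 - 1 / n, divided by r
    - mu, is the factor that [Psi_const] balances against the unit cost k. The fraction in [epsilon]
    is a growth exponent. Types with alpha >= a make capacity grow at least like y^s, s = a / (1 -
    a), so the shadow price y(x) grows at most like x^th with th = 1 / (1 + gamma s); as a
    approaches the essential supremum, th approaches that fraction. The optimal output is then of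
    order (sup X)^q with q = 1 + th alpha / (1 - alpha), and a positive [epsilon] leaves room for q
    < n. Continuity on [0, +oo[ is mostly carried as continuity of x |-> f (max 0 x) on the whole
    line, a form that composes without boundary cases. *)

Section normal_mgf.
Context {R : realType}.
Local Notation leb := (@lebesgue_measure R).

Definition centered_normal (s : R) : probability (measurableTypeR R) R :=
  normal_prob 0 s.

(** The normal law is dominated by Lebesgue measure, but its Radon-Nikodym derivative is an abstract
    function; it agrees almost everywhere with the density because both integrate to the law on
    every measurable set. *)
Lemma ge0_integral_centered_normal (s : R) (f : R -> \bar R) :
  measurable_fun setT f -> (forall x, 0 <= f x)%E ->
  (\int[centered_normal s]_x f x =
   \int[leb]_x (f x * (normal_pdf 0 s x)%:E))%E.
Proof.
move=> mf f0.
have dom : centered_normal s `<< leb by exact: normal_prob_dominates.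
rewrite -(Radon_Nikodym_SigmaFinite.change_of_variables dom)//.
apply: ae_eq_integral => //.
- apply: emeasurable_funM => //.
  exact: measurable_int (Radon_Nikodym_SigmaFinite.f_integrable _).
- by apply: emeasurable_funM => //; apply/measurable_EFinP; exact: measurable_normal_pdf.
- apply: ae_eqe_mul2l; apply: integral_ae_eq => //.
  + exact: Radon_Nikodym_SigmaFinite.f_integrable.
  + by apply/measurable_EFinP; exact: measurable_normal_pdf.
  + move=> E ED mE.
    exact/esym/(Radon_Nikodym_SigmaFinite.f_integral dom mE).
Qed.

(** Completing the square: tilting the centred density by exp (a x) gives a multiple of the density
    centred at a s^2, which integrates to 1. *)
Lemma normal_mgf (s a : R) : s != 0 ->
  (\int[centered_normal s]_x (expR (a * x))%:E = (expR (a ^+ 2 * s ^+ 2 / 2))%:E)%E.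
Proof.
move=> s0; rewrite ge0_integral_centered_normal//; last first.
  by apply/measurable_EFinP; apply: measurableT_comp.
transitivity (\int[leb]_x ((expR (a ^+ 2 * s ^+ 2 / 2))%:E *
   (normal_pdf (a * s ^+ 2) s x)%:E))%E.
  apply: eq_integral => x _; rewrite -!EFinM; congr EFin.
  rewrite !normal_pdfE// /normal_fun.
  rewrite mulrCA [RHS]mulrCA; congr (_ * _).
  rewrite -!expRD; congr expR; field.
  by rewrite s0.
rewrite ge0_integralZl//; last 2 first.
- by apply/measurable_EFinP; exact: measurable_normal_pdf.
- by move=> x _; rewrite lee_fin normal_pdf_ge0.
by rewrite integral_normal_pdf mule1.
Qed.

End normal_mgf.

(** [F s] is a bare family of sets. Passing through the generated sigma-algebra gives access to the
    closure properties of measurable functions, and for a filtration it adds no set. *)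
Definition filtration_measurable {R : realType} {d} {Omega : measurableType d}
    (F : R -> set (set Omega)) (s : R) (f : Omega -> R) :=
  @measurable_fun _ _ (g_sigma_algebraType (F s)) R setT f.

Section filtration.
Context {R : realType} {d : measure_display} {Omega : measurableType d}.
Variables (F : R -> set (set Omega)) (hF : is_filtration F).
Local Notation fmeas := (filtration_measurable F).

Lemma filtration_measurableP (s : R) (f : Omega -> R) : 0 <= s ->
  fmeas s f <-> forall B : set R, measurable B -> F s (f @^-1` B).
Proof.
move=> s0; have [sF _ _] := hF; have sFs := sF _ s0.
have mE : <<s F s >> = F s by rewrite sigma_algebra_id.
split => [mf B mB|h _ B mB].
  by rewrite -mE -[f @^-1` B]setTI; exact: mf.
by rewrite setTI /= /measurable/= mE; exact: h.
Qed.

Lemma filtration_measurableW (s t : R) f : 0 <= s -> s <= t ->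
  fmeas s f -> fmeas t f.
Proof.
move=> s0 st /(filtration_measurableP _ s0) h.
apply/filtration_measurableP; first exact: le_trans st.
by move=> B mB; have [_ _ FF] := hF; apply: (FF s t) => //; exact: h.
Qed.

Lemma filtration_measurable_fun (s : R) f : 0 <= s ->
  fmeas s f -> measurable_fun setT f.
Proof.
move=> s0 /(filtration_measurableP _ s0) h _ B mB; rewrite setTI.
by have [_ FF _] := hF; exact: (FF _ s0) (h _ mB).
Qed.

End filtration.

Section brownian.
Context {R : realType} {d : measure_display} {Omega : measurableType d}.
Variables (P : probability Omega R) (F : R -> set (set Omega)).
Variable W : R -> Omega -> R.
Hypotheses (hF : is_filtration F) (hW : is_brownian F P W).
Local Notation fmeas := (filtration_measurable F).

Lemma brownian_measurable s : 0 <= s -> fmeas s (W s).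
Proof.
by move=> s0; apply/(filtration_measurableP hF) => // B mB; have [_ aW _ _ _] := hW; exact: aW.
Qed.

(** The law of the pair (U, W t - W s) agrees with a product law on rectangles, hence everywhere,
    and Tonelli factors the integral. *)
Lemma increment_independent (s t : R) (U : Omega -> R) (f : R -> R) :
  0 <= s -> s < t -> fmeas s U -> (forall w, 0 <= U w) ->
  measurable_fun setT f -> (forall x, 0 <= f x) ->
  (\int[P]_w (U w * f (W t w - W s w))%:E =
   (\int[P]_w (U w)%:E) * \int[centered_normal (Num.sqrt (t - s))]_x (f x)%:E)%E.
Proof.
move=> s0 st mU U0 mf f0.
have t0 : 0 <= t by rewrite (le_trans s0)// ltW.
have mU' := filtration_measurable_fun hF s0 mU.
have mD : measurable_fun setT (W t \- W s)%R.
  by apply: measurable_funB; apply: (filtration_measurable_fun hF _ (brownian_measurable _)).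
pose D := (W t \- W s)%R.
have mp : measurable_fun setT (fun w => (U w, D w : measurableTypeR R)).
  exact/measurable_fun_pair.
pose Um : {mfun Omega >-> R} := HB.pack U (isMeasurableFun.Build _ _ _ _ U mU').
pose phi : {mfun Omega >-> (R * measurableTypeR R)%type} :=
  HB.pack (fun w => (U w, D w)) (isMeasurableFun.Build _ _ _ _ _ mp).
pose N := centered_normal (Num.sqrt (t - s)).
(* The positive part makes the integrand nonnegative on the whole plane; it changes nothing on the
   range of U. *)
pose g (x : R * measurableTypeR R) : \bar R := (Num.max x.1 0 * f x.2)%:E.
have mg : measurable_fun setT g.
  apply/measurable_EFinP; apply: measurable_funM.
    by apply: measurable_maxr => //.
  exact: measurableT_comp.
have g0 x : (0 <= g x)%E by rewrite lee_fin mulr_ge0// le_max lexx orbT.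
have law : forall A B, measurable A -> measurable B ->
    pushforward P phi (A `*` B) = (distribution P Um A * N B)%E.
  move=> A B mA mB; rewrite /pushforward /=.
  have [_ _ _ hN hI] := hW.
  have -> : (fun w => (U w, D w)) @^-1` (A `*` B) = U @^-1` A `&` D @^-1` B.
    by apply/seteqP; split.
  rewrite hI//; last by move/(filtration_measurableP hF): mU; exact.
  by rewrite hN.
transitivity (\int[P]_w (g \o phi) w)%E.
  apply: eq_integral => w _; rewrite /g /phi /=.
  by rewrite max_l.
rewrite -(@ge0_integral_pushforward _ _ _ _ R phi (measurable_funPT phi) P setT g)//; last first.
rewrite (eq_measure_integral (distribution P Um \x N)%E); last first.
  by move=> A mA _; apply/esym; apply: product_measure_unique.
rewrite fubini_tonelli1//.
under eq_integral => x _.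
  rewrite /fubini_F.
  under eq_integral => y _ do rewrite /g /= EFinM.
  rewrite ge0_integralZl//; last 3 first.
    by apply/measurable_EFinP.
    by move=> y _; rewrite lee_fin.
    by rewrite lee_fin le_max lexx orbT.
  over.
rewrite ge0_integralZr//; last 3 first.
- by apply/measurable_EFinP; exact: measurable_maxr.
- by move=> x _; rewrite lee_fin le_max lexx orbT.
- by apply: integral_ge0 => x _; rewrite lee_fin.
congr (_ * _)%E.
rewrite ge0_integral_pushforward//; last first.
- by move=> x _; rewrite lee_fin le_max lexx orbT.
- by apply/measurable_EFinP; exact: measurable_maxr.
by apply: eq_integral => w _; rewrite /= max_l.
Qed.

(** The case s = t is treated apart: independence is stated for s < t, and the moment generating
    function for a nonzero deviation. *)
Lemma integral_expR_increment (s t a : R) (U : Omega -> R) :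
  0 <= s -> s <= t -> fmeas s U -> (forall w, 0 <= U w) ->
  (\int[P]_w (U w * expR (a * (W t w - W s w)))%:E =
   (\int[P]_w (U w)%:E) * (expR (a ^+ 2 / 2 * (t - s)))%:E)%E.
Proof.
move=> s0; rewrite le_eqVlt => /predU1P[<-|st] mU U0.
  rewrite subrr mulr0 expR0 mule1; apply: eq_integral => w _.
  by rewrite subrr mulr0 expR0 mulr1.
rewrite (increment_independent (f := fun x => expR (a * x)))//; last first.
  by apply: measurableT_comp.
rewrite normal_mgf ?gt_eqF ?sqrtr_gt0 ?subr_gt0//.
by rewrite sqr_sqrtr ?subr_ge0 1?ltW// mulrAC.
Qed.

End brownian.

(** * Running suprema *)

Section msup.
Context {R : realType}.
Implicit Types f : R -> R.

(** The left end is free because drawdowns are restarted at times other than 0; [running_sup] is the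
    case a = 0. *)
Definition msup f (a b : R) : R := sup [set f s | s in `[a, b]].

Definition grid_floor (a h s : R) : nat := Num.truncn ((s - a) / h).

Lemma grid_floorP (a h s : R) : 0 < h -> a <= s ->
  a + (grid_floor a h s)%:R * h <= s < a + (grid_floor a h s).+1%:R * h.
Proof.
move=> h0 as_; have /truncn_itv : 0 <= (s - a) / h by rewrite divr_ge0 ?subr_ge0// ltW.
rewrite -/(grid_floor a h s) => /andP[l u]; apply/andP; split.
  by rewrite -lerBrDl -ler_pdivlMr.
by rewrite -ltrBlDl -ltr_pdivrMr.
Qed.

Lemma grid_floor_eq (a h s : R) (j : nat) : 0 < h ->
  a + j%:R * h <= s < a + j.+1%:R * h -> grid_floor a h s = j.
Proof.
move=> h0 /andP[l u]; apply: truncn_def; apply/andP; split.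
  by rewrite ler_pdivlMr// lerBrDl.
by rewrite ltr_pdivrMr// ltrBlDl.
Qed.

Fixpoint grid_max f (a h : R) (j : nat) : R :=
  if j is j'.+1 then Num.max (grid_max f a h j') (f (a + j%:R * h)) else f a.

Lemma grid_max_ge f (a h : R) (l j : nat) : (l <= j)%N ->
  f (a + l%:R * h) <= grid_max f a h j.
Proof.
elim: j => [|j IH] /=; first by rewrite leqn0 => /eqP ->; rewrite mul0r addr0.
rewrite leq_eqVlt => /predU1P[->|]; first by rewrite le_max lexx orbT.
by rewrite ltnS le_max => /IH ->.
Qed.

(** The next grid point lies strictly to the right of t, so that right-continuity of a path is
    enough to approximate it by grid values. *)
Lemma grid_right_cvg (a t : R) (h : nat -> R) : a <= t ->
  (forall m, 0 < h m) -> h m @[m --> \oo] --> 0 ->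
  a + (grid_floor a (h m) t).+1%:R * h m @[m --> \oo] --> t.
Proof.
move=> at_ h0 hcvg; apply/cvgrPdist_lt => e e0.
have [N _ hN] : \forall m \near \oo, `|0 - h m| < e by move/cvgrPdist_lt : hcvg; exact.
exists N => // m /hN /=; rewrite sub0r normrN gtr0_norm// => hm.
have /andP[g1 g2] := grid_floorP (h0 m) at_.
rewrite distrC gtr0_norm ?subr_gt0// ltrBlDl; rewrite -natr1; lra.
Qed.

Lemma cvg_harmonic_scale (k : nat) : (fun m => (m.+1%:R : R)^-1 ^+ k.+1) @ \oo --> (0:R).
Proof.
have := @cvg_harmonic R.
elim: k => [|k IH] h; first by under eq_fun do rewrite expr1.
under eq_fun do rewrite exprS.
by rewrite -[0](mulr0 0); apply: cvgM => //; exact: IH.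
Qed.

Section continuous.
Variable f : R -> R.
Hypothesis cf : {within `[0, +oo[, continuous f}.

Lemma within_itv_continuous (a b : R) : 0 <= a -> {within `[a, b], continuous f}.
Proof.
move=> a0; apply: continuous_subspaceW cf => x /=; rewrite !in_itv/= andbT.
by move=> /andP[ax _]; exact: le_trans ax.
Qed.

Lemma msup_attained (a b : R) : 0 <= a -> a <= b ->
  exists2 s : R, a <= s <= b & msup f a b = f s.
Proof.
move=> a0 ab; have [c cab cmax] := EVT_max ab (within_itv_continuous (b := b) a0).
exists c; first by move: cab; rewrite in_itv.
apply/eqP; rewrite eq_le; apply/andP; split.
  apply: ge_sup; first by exists (f c), c.
  by move=> _ [s /= sab <-]; exact: cmax.
apply: ub_le_sup; last by exists c.
by exists (f c) => _ [s /= sab <-]; exact: cmax.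
Qed.

Lemma msup_ub (a b s : R) : 0 <= a -> a <= s <= b -> f s <= msup f a b.
Proof.
move=> a0 /andP[as_ sb]; have ab : a <= b by exact: le_trans sb.
have [c cab cmax] := EVT_max ab (within_itv_continuous (b := b) a0).
apply: ub_le_sup; last by exists s => //=; rewrite in_itv/= as_.
by exists (f c) => _ [u /= uab <-]; exact: cmax.
Qed.

Lemma msup_le (a b c : R) : a <= b -> (forall s, a <= s <= b -> f s <= c) -> msup f a b <= c.
Proof.
move=> ab h; apply: ge_sup; first by exists (f a), a => //=; rewrite in_itv/= lexx.
by move=> _ [s /= sab <-]; apply: h; move: sab; rewrite in_itv.
Qed.

Lemma msup_point (a : R) : msup f a a = f a.
Proof.
rewrite /msup set_itv1 (_ : [set f s | s in [set a]] = [set f a]) ?sup1//.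
exact: image_set1.
Qed.

Lemma msup_monor (a b c : R) : 0 <= a -> a <= b -> b <= c -> msup f a b <= msup f a c.
Proof.
move=> a0 ab bc; apply: msup_le => // s /andP[as_ sb]; apply: msup_ub => //.
by rewrite as_ (le_trans sb).
Qed.

Lemma msup_monol (a b c : R) : 0 <= a -> a <= b -> b <= c -> msup f b c <= msup f a c.
Proof.
move=> a0 ab bc; apply: msup_le => // s /andP[bs sc]; apply: msup_ub => //.
by rewrite sc (le_trans ab).
Qed.

Lemma msup_cat (a b c : R) : 0 <= a -> a <= b -> b <= c ->
  msup f a c = Num.max (msup f a b) (msup f b c).
Proof.
move=> a0 ab bc; apply/eqP; rewrite eq_le; apply/andP; split.
  apply: msup_le; first exact: le_trans bc.
  move=> s /andP[as_ sc]; rewrite le_max.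
  have [sb|/ltW bs] := leP s b; first by rewrite msup_ub// as_.
  by rewrite (@msup_ub b)  ?orbT ?bs//; exact: le_trans ab.
by rewrite ge_max msup_monor// msup_monol.
Qed.

Lemma within_itv_near (t e : R) : 0 <= t -> 0 < e ->
  exists2 dl : R, 0 < dl & forall s, 0 <= s -> `|s - t| < dl -> `|f s - f t| < e.
Proof.
move=> t0 e0.
move/continuous_within_itvcyP: (cf) => [cin c0].
have [t_eq|t_neq] := eqVneq t 0.
  subst t; move/cvgrPdist_lt : c0 => /(_ _ e0).
  rewrite /at_right !near_withinE => -[dl /= dl0 h].
  exists dl => // s s0 sd; have [->|sn0] := eqVneq s 0; first by rewrite subrr normr0.
  rewrite distrC; apply: h => //=; first by rewrite distrC.
  by rewrite lt_neqAle eq_sym sn0.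
have tpos : 0 < t by rewrite lt_neqAle eq_sym t_neq.
have /cvgrPdist_lt /(_ _ e0)[dl /= dl0 h] : f x @[x --> t] --> f t.
  by apply: cin; rewrite in_itv/= tpos.
exists dl => // s s0 sd; rewrite distrC; apply: h => /=.
by rewrite distrC.
Qed.

Lemma msup_near (a t e : R) : 0 <= a -> a <= t -> 0 < e ->
  exists2 dl : R, 0 < dl & forall s, a <= s -> `|s - t| < dl ->
    `|msup f a s - msup f a t| < e.
Proof.
move=> a0 at_ e0; have t0 := le_trans a0 at_.
have e20 : 0 < e / 2 by rewrite divr_gt0.
have [dl dl0 h] := within_itv_near t0 e20.
exists dl => // s as_ sd.
have s0 := le_trans a0 as_.
have key (u v : R) : a <= u -> u <= v -> (forall y, u <= y <= v -> `|y - t| < dl) ->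
    `|msup f a v - msup f a u| < e.
  move=> au uv huv.
  have u0 := le_trans a0 au.
  have mm := msup_monor a0 au uv.
  rewrite ger0_norm ?subr_ge0// (msup_cat a0 au uv).
  rewrite ltrBlDr gt_max ltrDr e0/=.
  have [y yuv ->] := msup_attained u0 uv.
  have y0 : 0 <= y by move: yuv => /andP[uy _]; exact: le_trans uy.
  have fy := h _ y0 (huv _ yuv).
  have fu := h _ u0 (huv u _).
  have {}fu : `|f u - f t| < e / 2 by apply: fu; rewrite lexx.
  have : f u <= msup f a u by apply: msup_ub => //; rewrite au lexx.
  move: fy fu; rewrite !ltr_norml => /andP[? ?] /andP[? ?] ?; lra.
have [st|/ltW ts] := leP s t.
  rewrite distrC; apply: key => // y /andP[sy yt].
  move: sd; rewrite !ltr_norml => /andP[? ?]; apply/andP; split; lra.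
apply: key => // y /andP[ty ys].
move: sd; rewrite !ltr_norml => /andP[? ?]; apply/andP; split; lra.
Qed.

Lemma msup_continuous (a : R) : 0 <= a ->
  continuous (fun s => msup f a (Num.max a s)).
Proof.
move=> a0 t; apply/cvgrPdist_lt => e e0.
have am : a <= Num.max a t by rewrite le_max lexx.
have [dl dl0 h] := msup_near a0 am e0.
exists dl => //= s sd; rewrite distrC; apply: h; first by rewrite le_max lexx.
apply: le_lt_trans sd; rewrite distrC.
by case: (leP a t) => at_; case: (leP a s) => as_; rewrite ?subrr ?normr0//;
  rewrite !ler_norml; apply/andP; split; rewrite ?ler_norml; have := ler_norm (t - s);
  have := ler_norm (s - t); rewrite distrC => ? ?; lra.
Qed.

(** By continuity a strict inequality survives at a nearby rational offset from a. This replaces the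
    supremum over an interval by a countable one that never looks beyond t; the offset 0 covers a
    maximum attained at a itself. *)
Lemma msup_gtP (a t x : R) : 0 <= a -> a <= t ->
  x < msup f a t <-> exists q : rat, [/\ 0 <= q, a + ratr q <= t & x < f (a + ratr q)].
Proof.
move=> a0 at_; split => [|[q [q0 qt xq]]]; last first.
  by apply: (lt_le_trans xq); apply: msup_ub => //; rewrite qt lerDl ler0q q0.
have [s /andP[as_ st] ->] := msup_attained a0 at_ => xs.
have s0 := le_trans a0 as_.
have e0 : 0 < f s - x by rewrite subr_gt0.
have [dl dl0 h] := within_itv_near s0 e0.
move: as_; rewrite le_eqVlt => /predU1P[as_|as_].
  by exists 0; rewrite rmorph0 addr0 as_.
have [q] := @rat_in_itvoo R (Num.max 0 (s - a - dl)) (s - a) ltac:(rewrite gt_max subr_gt0 as_ ltrBlDr ltrDl dl0//).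
rewrite in_itv/= gt_max => /andP[/andP[q0 qd] qs].
exists q; split; first by rewrite -(ler0q R) ltW.
  by rewrite (le_trans _ st)// -lerBrDl ltW.
have := h (a + ratr q); rewrite addr_ge0 ?(ltW q0)// => /(_ isT).
rewrite !ltr_norml => /(_ _)/andP[|]; first by apply/andP; split; lra.
by lra.
Qed.

Lemma grid_max_le_msup (a h : R) (j : nat) : 0 <= a -> 0 <= h ->
  grid_max f a h j <= msup f a (a + j%:R * h).
Proof.
move=> a0 h0; elim: j => [|j IH] /=; first by rewrite mul0r addr0 msup_point.
have a1 : a <= a + j%:R * h by rewrite lerDl mulr_ge0.
have jj : a + j%:R * h <= a + j.+1%:R * h by rewrite lerD2l ler_wpM2r// ler_nat.
rewrite ge_max msup_ub ?lexx ?(le_trans a1)// andbT.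
by apply: (le_trans IH); exact: msup_monor.
Qed.

(** The last grid point before a maximizer is within one mesh of it, and continuity at the maximizer
    does the rest; in the other direction the grid maximum never exceeds the supremum. *)
Lemma grid_max_cvg (a s : R) (h : nat -> R) : 0 <= a -> a <= s ->
  (forall m, 0 < h m) -> h m @[m --> \oo] --> 0 ->
  grid_max f a (h m) (grid_floor a (h m) s) @[m --> \oo] --> msup f a s.
Proof.
move=> a0 as_ h0 hcvg; apply/cvgrPdist_lt => e e0.
have [s0 /andP[as0 s0s] ms] := msup_attained a0 as_.
have s00 : 0 <= s0 by exact: le_trans as0.
have [dl dl0 hdl] := within_itv_near s00 e0.
have [N _ hN] : \forall m \near \oo, `|0 - h m| < dl by move/cvgrPdist_lt : hcvg; exact.
exists N => // m /hN /=; rewrite sub0r normrN gtr0_norm// => hm.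
have /andP[l1 l2] := grid_floorP (h0 m) as0.
set l := grid_floor a (h m) s0 in l1 l2.
set j := grid_floor a (h m) s.
have lj : (l <= j)%N.
  have /andP[_ j2] := grid_floorP (h0 m) as_.
  have : a + l%:R * h m < a + j.+1%:R * h m.
    by apply: le_lt_trans j2; exact: le_trans s0s.
  by rewrite ltrD2l ltr_pM2r// ltr_nat ltnS.
have al : a <= a + l%:R * h m by rewrite lerDl mulr_ge0// ltW.
have fl := grid_max_ge f a (h m) lj.
have : `|f (a + l%:R * h m) - f s0| < e.
  apply: hdl; first exact: le_trans al.
  rewrite distrC ger0_norm ?subr_ge0// ltrBlDr; apply: (lt_trans l2).
  by rewrite -natr1; lra.
have gm : grid_max f a (h m) j <= msup f a s.
  apply: (le_trans (grid_max_le_msup _ a0 (ltW (h0 m)))).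
  apply: msup_monor => //; first by rewrite lerDl mulr_ge0// ltW.
  by have /andP[] := grid_floorP (h0 m) as_.
rewrite ltr_norml => /andP[? ?]; rewrite ger0_norm ?subr_ge0// ms.
by lra.
Qed.

End continuous.
End msup.

(** * Joint measurability in scenario and time, and Tonelli on half-lines *)

Section joint_measurability.
Context {R : realType} {d : measure_display} {T : measurableType d}.
Local Notation TR := (T * measurableTypeR R)%type.
Local Notation leb := (@lebesgue_measure R).

Lemma measurable_from (a : R) : measurable [set x : TR | a <= x.2].
Proof.
have -> : [set x : TR | a <= x.2] = setT `*` `[a, +oo[%classic.
  by apply/seteqP; split => -[w t] /=; rewrite in_itv/= andbT => // -[].
by apply: measurableX.
Qed.

(** On each of the countably many cells the index is constant, so the preimage is a countable union
    over cells. *)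
Lemma measurable_fun_grid (a h : R) (g : nat -> TR -> R) : 0 < h ->
  (forall j, measurable_fun setT (g j)) ->
  measurable_fun [set x : TR | a <= x.2] (fun x => g (grid_floor a h x.2) x).
Proof.
move=> h0 mg _ B mB.
have -> : [set x : TR | a <= x.2] `&` (fun x => g (grid_floor a h x.2) x) @^-1` B =
  \bigcup_j ((setT `*` `[a + j%:R * h, a + j.+1%:R * h[%classic) `&` (g j @^-1` B)).
  apply/seteqP; split => [[w t] /= [at_ Bt]|[w t] [j _ [/= [_ tj] Bt]]].
    exists (grid_floor a h t) => //; split => //=; split => //.
    by rewrite in_itv/= grid_floorP.
  move: tj; rewrite in_itv/= => tj; split.
    by move: tj => /andP[+ _]; apply: le_trans; rewrite lerDl mulr_ge0// ltW.
  by rewrite (grid_floor_eq h0 tj).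
apply: bigcup_measurable => j _; apply: measurableI; first exact: measurableX.
by rewrite -[X in measurable X]setTI; exact: mg.
Qed.

(** A process with right-continuous paths is the pointwise limit of processes frozen on the cells of
    ever finer grids, at the value of the right end of the cell. *)
Lemma joint_measurable (a : R) (Y : R -> T -> R) :
  (forall t, a <= t -> measurable_fun setT (Y t)) ->
  (forall w t, a <= t -> Y x w @[x --> t^'+] --> Y t w) ->
  measurable_fun [set x : TR | a <= x.2] (fun x => Y x.2 x.1).
Proof.
move=> mY cY.
pose h m : R := m.+1%:R^-1.
have h0 m : 0 < h m by rewrite invr_gt0.
have hcvg : h m @[m --> \oo] --> 0 by exact: cvg_harmonic.
apply: (@measurable_fun_cvg _ _ _ _ (fun m (x : TR) => Y (a + (grid_floor a (h m) x.2).+1%:R * h m) x.1)).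
  move=> m; apply: (@measurable_fun_grid a (h m) (fun j x => Y (a + j.+1%:R * h m) x.1)) => // j.
  apply: measurableT_comp => //; apply: mY.
  by rewrite lerDl mulr_ge0// ltW.
move=> [w t] /= at_.
have /cvg_at_rightP/(_ _) := cY w t at_; apply; split => m.
  by have /andP[] := grid_floorP (h0 m) at_.
exact: (grid_right_cvg at_ h0 hcvg).
Qed.

(** Together with [integral_snd_from], this lets a discounted expectation be read in either order of
    integration, or as one integral over the product space. *)
Lemma integral_fst_from (P : {sigma_finite_measure set T -> \bar R}) (a : R) (f : R -> T -> R) :
  measurable_fun [set x : TR | a <= x.2] (fun x => f x.2 x.1) ->
  (forall t w, a <= t -> 0 <= f t w) ->
  (\int[P]_w \int[leb]_(t in `[a, +oo[) (f t w)%:E =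
   \int[P \x leb]_(x in [set x | (a <= x.2)%R]) (f x.2 x.1)%:E)%E.
Proof.
move=> mf f0.
pose G := (fun x : TR => (f x.2 x.1)%:E) \_ [set x : TR | a <= x.2].
have mG : measurable_fun setT G.
  apply/(measurable_restrictT _ (measurable_from a)).
  exact/measurable_EFinP.
have G0 x : (0 <= G x)%E.
  by apply: erestrict_ge0 => y ay; rewrite lee_fin f0.
rewrite [RHS]integral_mkcond -/G fubini_tonelli1//.
apply: eq_integral => w _; rewrite /fubini_F [LHS]integral_mkcond.
apply: eq_integral => t _; rewrite /G !patchE.
have [at_|at_] := leP a t; first by rewrite !mem_set//= in_itv/= at_.
by rewrite !memNset//= ?in_itv/= ?andbT; apply/negP; rewrite -ltNge.
Qed.

Lemma measurable_fun_snd_from (P : {sigma_finite_measure set T -> \bar R}) (a : R) (f : R -> T -> R) :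
  measurable_fun [set x : TR | a <= x.2] (fun x => f x.2 x.1) ->
  (forall t w, a <= t -> 0 <= f t w) ->
  measurable_fun `[a, +oo[ (fun t : R => \int[P]_w (f t w)%:E)%E.
Proof.
move=> mf f0.
pose G := (fun x : TR => (f x.2 x.1)%:E) \_ [set x : TR | a <= x.2].
have mG : measurable_fun setT G.
  apply/(measurable_restrictT _ (measurable_from a)).
  exact/measurable_EFinP.
have G0 x : (0 <= G x)%E.
  by apply: erestrict_ge0 => y ay; rewrite lee_fin f0.
have := @measurable_fun_fubini_tonelli_G _ _ _ _ _ P G mG G0.
move/measurable_funTS => /(_ `[a, +oo[%classic).
apply: eq_measurable_fun => t; rewrite inE/= in_itv/= andbT => at_.
by apply: eq_integral => w _; rewrite /G patchE mem_set.
Qed.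

Lemma integral_snd_from (P : {sigma_finite_measure set T -> \bar R}) (a : R) (f : R -> T -> R) :
  measurable_fun [set x : TR | a <= x.2] (fun x => f x.2 x.1) ->
  (forall t w, a <= t -> 0 <= f t w) ->
  (\int[leb]_(t in `[a, +oo[) \int[P]_w (f t w)%:E =
   \int[P \x leb]_(x in [set x | (a <= x.2)%R]) (f x.2 x.1)%:E)%E.
Proof.
move=> mf f0.
pose G := (fun x : TR => (f x.2 x.1)%:E) \_ [set x : TR | a <= x.2].
have mG : measurable_fun setT G.
  apply/(measurable_restrictT _ (measurable_from a)).
  exact/measurable_EFinP.
have G0 x : (0 <= G x)%E.
  by apply: erestrict_ge0 => y ay; rewrite lee_fin f0.
rewrite [RHS]integral_mkcond -/G fubini_tonelli2//.
rewrite integral_mkcond; apply: eq_integral => t _; rewrite /fubini_G /G patchE.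
have [at_|at_] := leP a t.
  rewrite mem_set/= ?in_itv/= ?at_//.
  by apply: eq_integral => w _; rewrite patchE mem_set.
rewrite memNset/= ?in_itv/= ?andbT; last by apply/negP; rewrite -ltNge.
rewrite [RHS]integral0_eq// => w _; rewrite patchE memNset//=.
by apply/negP; rewrite -ltNge.
Qed.

End joint_measurability.

(** * Inequalities for powers and for the overshoot *)

Section real_inequalities.
Context {R : realType}.
Implicit Types (a n p q c L dl : R).

Lemma powR_bernoulli n p : 1 <= n -> 0 < p -> 1 + n * (p - 1) <= p `^ n.
Proof.
move=> n1 p0; have n0 : 0 < n by rewrite (lt_le_trans ltr01).
(* AM-GM in the form [p <= p^n / n + (1 - 1/n)], via [1 + x <= expR x] applied to both terms divided by p *)
have e1 := expR_ge1Dx ((n - 1) * ln p).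
have e2 := expR_ge1Dx (- ln p).
have -> : p `^ n = p * expR ((n - 1) * ln p).
  by rewrite /powR gt_eqF// mulrBl mul1r expRB lnK ?posrE// mulrCA divff ?gt_eqF// mulr1.
have : p * (1 + (n - 1) * ln p) <= p * expR ((n - 1) * ln p) by rewrite ler_pM2l.
have : p * (1 - ln p) <= 1.
  apply: (@le_trans _ _ (p * expR (- ln p))); first by rewrite ler_pM2l.
  by rewrite expRN lnK ?posrE// divff ?gt_eqF.
nra.
Qed.

(** Both halves come from 1 + x <= exp x: once at x = - n ln q, once in the form ln q <= q - 1. *)
Lemma powR_sub1_le n q dl : 0 < n -> 1 <= q -> q <= expR dl ->
  q `^ n - 1 <= n * expR (n * dl) * (q - 1).
Proof.
move=> n0 q1 qd; have q0 : 0 < q by rewrite (lt_le_trans ltr01).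
have e1 := expR_ge1Dx (- (n * ln q)).
have l1 : ln q <= q - 1.
  by have := le_ln1Dx (x := q - 1); rewrite subrKC; apply; lra.
have l0 : 0 <= ln q by rewrite ln_ge0.
have ld : ln q <= dl by rewrite -ler_expR lnK.
have -> : q `^ n = expR (n * ln q) by rewrite /powR gt_eqF.
have : expR (n * ln q) * (1 - n * ln q) <= 1.
  rewrite -[leRHS](expRxMexpNx_1 (n * ln q)) ler_pM2l ?expR_gt0//.
have : expR (n * ln q) <= expR (n * dl) by rewrite ler_expR ler_pM2l.
have := expR_gt0 (n * ln q) => ? ? ?.
apply: (@le_trans _ _ (expR (n * ln q) * (n * ln q))); first lra.
rewrite [n * expR _]mulrC -mulrA; apply: ler_pM => //.
- by rewrite mulr_ge0// ltW.
- by rewrite ler_pM2l.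
Qed.

(* p - p^n / n is stationary at p = 1: cutting the ratio q > 1 down to 1 changes it by this
   second-order amount only. *)
Definition overshoot n q : R := (q `^ n - 1) / n - (q - 1).

Lemma overshoot_ge0 n q : 1 <= n -> 1 <= q -> 0 <= overshoot n q.
Proof.
move=> n1 q1; have n0 : 0 < n by rewrite (lt_le_trans ltr01).
have := powR_bernoulli n1 (lt_le_trans ltr01 q1).
by rewrite /overshoot subr_ge0 ler_pdivlMr// => ?; lra.
Qed.

(** Two regimes. While q <= exp dl the overshoot is of second order, at most dl (q^n - 1). Beyond
    exp dl, a moment of higher order n + L pays for the tail with the factor exp (- L dl). Both dl
    and L stay free until the mesh tends to 0. *)
Lemma overshoot_le n p g dl L : 1 <= n -> 0 < p -> p <= 1 -> 0 < g -> 0 <= dl -> 0 <= L ->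
  overshoot n (Num.max 1 (p * g)) <=
    dl * (Num.max 1 (p * g) `^ n - 1) + expR (- (L * dl)) * g `^ (n + L).
Proof.
move=> n1 p0 p1 g0 dl0 L0; have n0 : 0 < n by rewrite (lt_le_trans ltr01).
set q := Num.max 1 (p * g).
have q1 : 1 <= q by rewrite le_max lexx.
have q0 : 0 < q by rewrite (lt_le_trans ltr01).
have qn1 : 1 <= q `^ n by rewrite -[leLHS](powRr0 q) ler_powR// ltW.
have [qd|qd] := leP q (expR dl).
  have := powR_sub1_le n0 q1 qd; set E := expR (n * dl) => h.
  have E0 : 0 < E by exact: expR_gt0.
  have e1 := expR_ge1Dx (- (n * dl)).
  have EE : E * expR (- (n * dl)) = 1 by rewrite expRxMexpNx_1.
  have h2 : (q `^ n - 1) * expR (- (n * dl)) <= n * (q - 1).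
    rewrite -(ler_pM2l E0) mulrCA EE mulr1; lra.
  apply: (@le_trans _ _ (dl * (q `^ n - 1))).
    rewrite /overshoot -(ler_pM2l n0) mulrBr mulrCA divff ?gt_eqF// mulr1.
    nra.
  by rewrite lerDl mulr_ge0 ?expR_ge0 ?powR_ge0.
have qE : q = p * g.
  rewrite /q max_r//; move: qd; rewrite /q lt_max => /orP[|/ltW]; last first.
    by apply: le_trans; rewrite -expR0 ler_expR.
  by rewrite ltNge -[X in X <= _]expR0 ler_expR dl0.
apply: (@le_trans _ _ (q `^ n)).
  rewrite /overshoot; have : (q `^ n - 1) / n <= q `^ n - 1.
    by rewrite ler_pdivrMr// ler_peMr// subr_ge0.
  lra.
apply: (@le_trans _ _ (expR (- (L * dl)) * q `^ (n + L))); last first.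
  apply: (@le_trans _ _ (expR (- (L * dl)) * g `^ (n + L))).
    rewrite ler_pM2l ?expR_gt0// ge0_ler_powR ?nnegrE ?(ltW q0) ?(ltW g0) ?addr_ge0 ?(ltW n0)//.
    by rewrite qE ler_piMl// ltW.
  by rewrite lerDr mulr_ge0// subr_ge0.
rewrite powRD ?(gt_eqF q0) ?implybT// mulrCA ler_peMr ?powR_ge0//.
have : expR dl `^ L <= q `^ L.
  by rewrite ge0_ler_powR ?nnegrE ?expR_ge0 ?(ltW q0)// ltW.
by rewrite -expRM => h; rewrite -(expRxMexpNx_1 (L * dl)) mulrC ler_pM2l ?expR_gt0// [L * dl]mulrC.
Qed.

(* AM-GM with weights [(n - q)/n] and [q/n] *)
Lemma powR_young n q x : 0 < q -> q < n -> 1 <= x ->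
  (n / (n - q)) * x `^ q <= 1 + q / (n - q) * x `^ n.
Proof.
move=> q0 qn x1; have x0 : 0 < x by rewrite (lt_le_trans ltr01).
have nq : 0 < n - q by rewrite subr_gt0.
have n0 : 0 < n by exact: lt_trans qn.
have := @powR_bernoulli (n / q) (x `^ q) _ (powR_gt0 _ x0).
rewrite ler_pdivlMr// mul1r => /(_ (ltW qn)).
rewrite -powRrM [q * _]mulrC divfK ?gt_eqF// => h.
have -> : n / (n - q) * x `^ q = (n * x `^ q) / (n - q) by rewrite mulrAC.
rewrite ler_pdivrMr// mulrDl mulrAC divfK ?gt_eqF// mul1r.
have : q * (1 + n / q * (x `^ q - 1)) <= q * x `^ n by rewrite ler_pM2l.
by rewrite mulrDr mulr1 mulrA [q * (n / q)]mulrC divfK ?gt_eqF// => ?; lra.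
Qed.

End real_inequalities.

Lemma measurable_funV_gt0 {R : realType} {d} {T : measurableType d} (D : set T) (f : T -> R) :
  (forall x, D x -> 0 < f x) -> measurable_fun D f ->
  measurable_fun D (fun x => (f x)^-1).
Proof.
move=> f0 mf; apply: (eq_measurable_fun (fun x => f x `^ (-1))).
  by move=> x /[!inE] Dx; rewrite powR_inv1// ltW// f0.
exact: (measurableT_comp (measurable_powR (-1)) mf).
Qed.

Section process_measurability.
Context {R : realType} {d : measure_display} {Omega : measurableType d}.
Variables (F : R -> set (set Omega)) (hF : is_filtration F).
Variable Y : R -> Omega -> R.
Hypotheses (cY : continuous_paths Y) (mY : forall t, 0 <= t -> filtration_measurable F t (Y t)).
Local Notation TR := (Omega * measurableTypeR R)%type.

Lemma msup_filtration_measurable (a t : R) : 0 <= a -> a <= t ->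
  filtration_measurable F t (fun w => msup (Y^~ w) a t).
Proof.
move=> a0 at_; rewrite /filtration_measurable => _mT.
apply: (measurability _ (RGenOInfty.measurableE R)) => //.
move=> _ [_ [x ->] <-]; rewrite setTI.
have -> : (fun w => msup (Y^~ w) a t) @^-1` `]x, +oo[ =
  \bigcup_(q in [set q : rat | (0 <= q) && (a + ratr q <= t)])
    (Y (a + ratr q) @^-1` `]x, +oo[).
  apply/seteqP; split => [w /=|w [q /= /andP[q0 qt]]]; rewrite !in_itv/= !andbT.
    by move/(msup_gtP (@cY w) x a0 at_) => [q [q0 qt xq]]; exists q; rewrite /= ?q0 ?in_itv/= ?andbT.
  by move=> xq; apply/(msup_gtP (@cY w) x a0 at_); exists q.
rewrite bigcup_mkcond; apply: bigcupT_measurable_rat => q.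
case: ifPn => [|_]; last exact: measurable0.
rewrite inE/= => /andP[q0 qt].
have q0' : 0 <= a + ratr q by rewrite addr_ge0// ler0q.
rewrite -[_ @^-1` _]setTI.
exact: (filtration_measurableW hF q0' qt (mY q0')).
Qed.

Lemma msup_joint_measurable (a : R) : 0 <= a ->
  measurable_fun [set x : TR | a <= x.2] (fun x => msup (Y^~ x.1) a x.2).
Proof.
move=> a0; apply: (@joint_measurable _ _ _ a (fun t w => msup (Y^~ w) a t)).
  move=> t at_; apply: (filtration_measurable_fun hF (le_trans a0 at_)).
  exact: msup_filtration_measurable.
move=> w t at_; apply/cvgrPdist_lt => e e0.
have [dl dl0 h] := msup_near (@cY w) a0 at_ e0.
rewrite /at_right near_withinE; exists dl => //= s sd ts.
by rewrite distrC; apply: h; rewrite 1?distrC// (le_trans at_)// ltW.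
Qed.

Lemma process_joint_measurable :
  measurable_fun [set x : TR | 0 <= x.2] (fun x => Y x.2 x.1).
Proof.
apply: joint_measurable.
  by move=> t t0; apply: (filtration_measurable_fun hF t0); exact: mY.
move=> w t t0; apply/cvgrPdist_lt => e e0.
have [dl dl0 h] := within_itv_near (@cY w) t0 e0.
rewrite /at_right near_withinE; exists dl => //= s sd ts.
by rewrite distrC; apply: h; rewrite 1?distrC// (le_trans t0)// ltW.
Qed.

Lemma grid_max_measurable (a h : R) (j : nat) : 0 <= a -> 0 <= h ->
  filtration_measurable F (a + j%:R * h) (fun w => grid_max (Y^~ w) a h j).
Proof.
move=> a0 h0; elim: j => [|j IH] /=.
  by rewrite mul0r addr0; apply: mY.
have a1 : 0 <= a + j%:R * h by rewrite addr_ge0// mulr_ge0.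
apply: measurable_maxr; last by apply: mY; rewrite addr_ge0// mulr_ge0.
apply: (filtration_measurableW hF a1 _ IH).
by rewrite lerD2l ler_wpM2r// ler_nat.
Qed.

End process_measurability.

(** * Discounted drawdowns of a geometric Brownian motion *)

Section cells.
Context {R : realType}.
Local Notation leb := (@lebesgue_measure R).

Lemma integral_cells (a h : R) (f : R -> \bar R) : 0 < h ->
  measurable_fun `[a, +oo[ f -> (forall s, a <= s -> (0 <= f s)%E) ->
  (\int[leb]_(s in `[a, +oo[) f s =
   \sum_(j <oo) \int[leb]_(s in `[(a + j%:R * h)%R, (a + j.+1%:R * h)%R[) f s)%E.
Proof.
move=> h0 mf f0.
have cells : `[a, +oo[%classic = \bigcup_j `[a + j%:R * h, a + j.+1%:R * h[%classic.
  apply/seteqP; split => [s /=|s [j _ /=]]; rewrite !in_itv/= ?andbT.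
    by move=> as_; exists (grid_floor a h s) => //=; rewrite in_itv/= grid_floorP.
  by move=> /andP[+ _]; apply: le_trans; rewrite lerDl mulr_ge0// ltW.
rewrite cells ge0_integral_bigcup//.
- by rewrite -cells.
- by move=> s; rewrite -cells /= in_itv/= andbT => /f0.
- apply/trivIsetP => i j _ _ ij; apply/seteqP; split => // s /= [].
  rewrite !in_itv/= => si sj; move/eqP: ij; apply.
  by rewrite -(grid_floor_eq h0 si) (grid_floor_eq h0 sj).
Qed.

Lemma integral_expR_cell (c a p q k : R) : c != 0 -> p < q ->
  (\int[leb]_(s in `[p, q[) (k * expR (- c * (s - a)))%:E =
   (k * (expR (- c * (p - a)) - expR (- c * (q - a))) / c)%:E)%E.
Proof.
move=> c0 pq; rewrite integral_itv_bndo_bndc//; last first.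
  apply/measurable_EFinP; apply: measurable_funTS; apply: measurable_funM => //.
  apply: measurableT_comp => //; apply: measurable_funM => //.
  exact: measurable_funB.
pose G (s : R) := - (k / c) * expR (- c * (s - a)).
have dG (s : R) : is_derive s 1 G (k * expR (- c * (s - a))).
  rewrite /G; apply: is_derive_eq.
  rewrite /GRing.scale/= !(mulr0, mul0r, addr0, add0r, subr0, mulr1, oppr0, scale0r, scaler0).
  field => //.
rewrite (@continuous_FTC2 _ _ G)//.
- by rewrite -EFinB; congr EFin; rewrite /G; field.
- apply: continuous_subspaceT => s.
  apply: cvgM; first exact: cvg_cst.
  apply: continuous_comp; last exact: continuous_expR.
  apply: cvgM; first exact: cvg_cst.
  by apply: cvgB; [exact: cvg_id|exact: cvg_cst].
- split.
  + by move=> s _; have [] := dG s.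
  + apply: cvg_at_right_filter.
    by apply/differentiable_continuous/derivable1_diffP; have [] := dG p.
  + apply: cvg_at_left_filter.
    by apply/differentiable_continuous/derivable1_diffP; have [] := dG q.
- by move=> s _; rewrite derive1E; have [_ ->] := dG s.
Qed.

Lemma integral_expR_from (c a k : R) : 0 < c -> 0 <= k ->
  (\int[leb]_(s in `[a, +oo[) (k * expR (- c * (s - a)))%:E = (k / c)%:E)%E.
Proof.
move=> c0 k0; rewrite (@integral_cells a 1)//; first last.
- by move=> s as_; rewrite lee_fin mulr_ge0// expR_ge0.
- apply/measurable_EFinP; apply: measurable_funTS; apply: measurable_funM => //.
  apply: measurableT_comp => //; apply: measurable_funM => //.
  exact: measurable_funB.
apply/cvg_lim => //.
rewrite (_ : (fun _ => _) = (fun N => (k / c - k / c * expR (- c) ^+ N)%:E)); last first.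
  apply/funext => N; elim: N => [|N IH]; first by rewrite big_geq// expr0 mulr1 subrr.
  rewrite big_nat_recr//= IH integral_expR_cell ?gt_eqF//; last by rewrite ltrD2l !mulr1 ltr_nat.
  rewrite -EFinD; congr EFin.
  have E (j : nat) : expR (- c * (a + j%:R * 1 - a)) = expR (- c) ^+ j.
    by rewrite -expRM_natr; congr expR; ring.
  by rewrite !E exprS; field; rewrite gt_eqF.
apply: cvg_EFin; first exact: nearW.
rewrite -[X in _ --> X]subr0; apply: cvgB; first exact: cvg_cst.
rewrite -[0](mulr0 (k / c)); apply: cvgM; first exact: cvg_cst.
apply: cvg_expr; rewrite ger0_norm ?expR_ge0// -[ltRHS]expR0 ltr_expR.
by rewrite oppr_lt0.
Qed.

End cells.

Section resolvent_sums.
Context {R : realType}.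
Variables (n r c h : R) (X Y : nat -> R) (Xi : R).
Hypotheses (n_gt1 : 1 < n) (h0 : 0 < h) (r0 : 0 < r).
Hypotheses (Xi0 : 0 <= Xi) (X0 : X 0 = Xi) (Y0 : Y 0 = Xi).
Hypotheses (Y_ge0 : forall j, 0 <= Y j) (YX : forall j, Y j <= X j) (XXi : forall j, X j <= Xi).

(** X j and Y j stand for the weighted means of p and p^n at the grid time j h, so V is the
    discounted mean of p - p^n / n, and S is the discounted sum of p that the decrease of V pays
    for. *)
Let V j := expR (- (r * (j%:R * h))) * (X j - Y j / n).
Let S N := \sum_(j < N) expR (- (r * (j%:R * h))) * (1 - expR (- ((r - c) * h))) * X j.

Let stepE j : expR (- (r * (j.+1%:R * h))) = expR (- (r * (j%:R * h))) * expR (- (r * h)).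
Proof. by rewrite -expRD -natr1; congr expR; ring. Qed.

Let stepX j : expR (- (r * (j.+1%:R * h))) * (X j * expR (c * h)) =
  expR (- (r * (j%:R * h))) * expR (- ((r - c) * h)) * X j.
Proof.
rewrite stepE -mulrA -[RHS]mulrA; congr (_ * _).
by rewrite [X j * _]mulrC mulrA -expRD; congr (expR _ * _); ring.
Qed.

Let stepY j : expR (- (r * (j.+1%:R * h))) * (Y j * expR (r * h)) =
  expR (- (r * (j%:R * h))) * Y j.
Proof.
rewrite stepE -mulrA; congr (_ * _).
by rewrite mulrCA -expRD addNr expR0 mulr1.
Qed.

Let V_ge0 j : 0 <= V j.
Proof.
rewrite /V mulr_ge0 ?expR_ge0// subr_ge0 (le_trans _ (YX j))//.
by rewrite ler_pdivrMr ?(lt_trans _ n_gt1)// ler_peMr// ltW.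
Qed.

(** V 0 - V N telescopes into the sum, V 0 = (1 - 1 / n) Xi because the ratio starts at 1, and V N
    is at most the discounted Xi. *)
Lemma resolvent_sum_ge (N : nat) :
  (forall j, X j * expR (c * h) - Y j * expR (r * h) / n <= X j.+1 - Y j.+1 / n) ->
  (1 - n^-1) * Xi - expR (- (r * (N%:R * h))) * Xi <=
  \sum_(j < N) expR (- (r * (j%:R * h))) * (1 - expR (- ((r - c) * h))) * X j.
Proof.
move=> hs; suff hV : V 0 - V N <= S N.
  apply: le_trans hV; rewrite /V mul0r mulr0 oppr0 expR0 mul1r X0 Y0.
  rewrite mulrBl mul1r [n^-1 * _]mulrC lerD2l lerN2 ler_pM2l ?expR_gt0//.
  rewrite lerBlDr (le_trans (XXi N))// lerDl divr_ge0// ltW// (lt_trans _ n_gt1)//.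
elim: N => [|N IH]; first by rewrite subrr /S big_ord0.
rewrite /S big_ord_recr /= -/(S N).
have h3 : expR (- (r * (N.+1%:R * h))) * (X N * expR (c * h) - Y N * expR (r * h) / n) <= V N.+1.
  by rewrite ler_pM2l ?expR_gt0.
have h1 := stepX N; have h2 := stepY N.
have h2n := congr1 (fun z => z / n) h2.
move: IH h1 h2 h2n h3; rewrite /V.
move: (expR (- (r * (N%:R * h)))) (expR (- (r * (N.+1%:R * h)))) (expR (c * h)) (expR (r * h))
  (expR (- ((r - c) * h))) (n^-1) (S N) (expR (- (r * (0%:R * h))) * _).
by move=> *; lra.
Qed.

(** The terms in dl telescope too, since Y is multiplied by exp (r h) before being cut: altogether
    they cost at most dl Xi. The constant errors B, summed against the discount, cost at most B / (r
    h). *)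
Lemma resolvent_sum_le (N : nat) (dl B : R) : 0 <= dl -> 0 <= B ->
  (forall j, X j.+1 - Y j.+1 / n <= X j * expR (c * h) - Y j * expR (r * h) / n
     + dl * (Y j * expR (r * h) - Y j.+1) + B) ->
  \sum_(j < N) expR (- (r * (j%:R * h))) * (1 - expR (- ((r - c) * h))) * X j <=
  (1 - n^-1 + dl) * Xi + B / (r * h).
Proof.
move=> dl0 B0 hs; have rh0 : 0 < r * h by exact: mulr_gt0.
pose e j := expR (- (r * (j%:R * h))).
suff hV : S N <= V 0 - V N + dl * (Y 0 - e N * Y N) + B / (r * h) * (1 - e N).
  apply: (le_trans hV); rewrite {1}/V mul0r mulr0 oppr0 expR0 mul1r X0 Y0.
  have := V_ge0 N; have := expR_ge0 (- (r * (N%:R * h))) : 0 <= e N.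
  move: (Y_ge0 N) => yN eN vN.
  have : 0 <= dl * (e N * Y N) by rewrite !mulr_ge0.
  have : 0 <= B / (r * h) * e N by rewrite mulr_ge0// divr_ge0// ltW.
  by rewrite mulrBr mulrBr mulr1 mulrDl mulrBl mul1r [n^-1 * _]mulrC; lra.
elim: N => [|N IH].
  by rewrite /S big_ord0 /e mul0r mulr0 oppr0 expR0 !mul1r !subrr !mulr0 !addr0.
rewrite /S big_ord_recr /= -/(S N).
have h3 : V N.+1 <= e N.+1 * (X N * expR (c * h) - Y N * expR (r * h) / n
     + dl * (Y N * expR (r * h) - Y N.+1) + B).
  by rewrite ler_pM2l ?expR_gt0.
have h1 := stepX N; have h2 := stepY N.
have h2n := congr1 (fun z => z / n) h2.
have h2d := congr1 (fun z => dl * z) h2.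
have hB : e N.+1 * B <= B / (r * h) * (e N - e N.+1).
  rewrite [B / _ * _]mulrAC ler_pdivlMr// [_ * B]mulrC -mulrA ler_wpM2l//.
  have eN : e N = e N.+1 * expR (r * h) by rewrite /e stepE -mulrA -expRD addNr expR0 mulr1.
  rewrite eN -[X in _ - X]mulr1 -mulrBr ler_pM2l ?expR_gt0//.
  by rewrite lerBrDl expR_ge1Dx.
move: IH h1 h2 h2n h2d h3 hB; rewrite /V /e.
move: (expR (- (r * (N%:R * h)))) (expR (- (r * (N.+1%:R * h)))) (expR (c * h)) (expR (r * h))
  (expR (- ((r - c) * h))) (n^-1) (S N) (expR (- (r * (0%:R * h))) * _) (B / (r * h)).
by move=> *; lra.
Qed.

End resolvent_sums.

Section ge0_expectation.
Context {R : realType} {d : measure_display} {T : measurableType d}.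
Variable P : {measure set T -> \bar R}.

Lemma ge0_integralD_fin (f g : T -> R) :
  measurable_fun setT f -> measurable_fun setT g ->
  (forall w, 0 <= f w) -> (forall w, 0 <= g w) ->
  (\int[P]_w (f w + g w)%:E = \int[P]_w (f w)%:E + \int[P]_w (g w)%:E)%E.
Proof.
move=> mf mg f0 g0; rewrite -ge0_integralD//.
- by move=> w _; rewrite lee_fin.
- exact/measurable_EFinP.
- by move=> w _; rewrite lee_fin.
- exact/measurable_EFinP.
Qed.

Lemma ge0_integralZl_fin (k : R) (f : T -> R) : measurable_fun setT f -> 0 <= k ->
  (forall w, 0 <= f w) ->
  (\int[P]_w (k * f w)%:E = k%:E * \int[P]_w (f w)%:E)%E.
Proof.
move=> mf k0 f0; rewrite -ge0_integralZl//.
- exact/measurable_EFinP.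
- by move=> w _; rewrite lee_fin.
Qed.

Lemma ge0_le_integral_fin (f g : T -> R) :
  measurable_fun setT f -> measurable_fun setT g ->
  (forall w, 0 <= f w) -> (forall w, f w <= g w) ->
  (\int[P]_w (f w)%:E <= \int[P]_w (g w)%:E)%E.
Proof.
move=> mf mg f0 fg; apply: ge0_le_integral => //.
- by move=> w _; rewrite lee_fin.
- exact/measurable_EFinP.
- exact/measurable_EFinP.
- by move=> w _; rewrite lee_fin.
Qed.

Lemma ge0_integral_fin_num (f : T -> R) : (forall w, 0 <= f w) ->
  (\int[P]_w (f w)%:E < +oo)%E ->
  (\int[P]_w (f w)%:E = (fine (\int[P]_w (f w)%:E))%:E)%E.
Proof.
move=> f0 foo; rewrite fineK// ge0_fin_numE//.
by apply: integral_ge0 => w _; rewrite lee_fin.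
Qed.

End ge0_expectation.

(** Here q is the power (p g)^n before the cut and M the power max (1, p g)^n, so q - (M - 1) is the
    power after it; the form keeps every term nonnegative, ready to be integrated. *)
Lemma overshoot_combine {R : realType} (x o dl q M K g : R) : 0 <= x ->
  o <= dl * (M - 1) + K * g ->
  x * o + dl * (x * (q - (M - 1))) <= dl * (x * q) + K * (x * g).
Proof. by move=> x0 /(ler_wpM2l x0); lra. Qed.

Lemma overshoot_balance {R : realType} (e dl A D K Xi Q : R) :
  e + dl * D <= dl * A + K * (Xi * Q) -> e <= dl * (A - D) + K * Q * Xi.
Proof. by lra. Qed.

Lemma fin_num_addl {R : realType} (a b : R) (x : \bar R) :
  (a%:E = b%:E + x)%E -> x \is a fin_num.
Proof. by case: x. Qed.

Section ratio_step.
Context {R : realType} {d : measure_display} {Omega : measurableType d}.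
Variables (P : {measure set Omega -> \bar R}) (xi p g : Omega -> R).
Hypotheses (mxi : measurable_fun setT xi) (mp : measurable_fun setT p)
  (mg : measurable_fun setT g).
Hypotheses (xi0 : forall w, 0 <= xi w) (p_gt0 : forall w, 0 < p w)
  (p_le1 : forall w, p w <= 1) (g_gt0 : forall w, 0 < g w).
Hypothesis fin_xi : (\int[P]_w (xi w)%:E < +oo)%E.
Variables (n h : R) (rho : R -> R).
Hypothesis n1 : 1 < n.
Hypothesis momentS : forall a,
  (\int[P]_w (xi w * p w `^ a * g w `^ a)%:E =
   (\int[P]_w (xi w * p w `^ a)%:E) * (expR (rho a * h))%:E)%E.
Hypothesis moment_g : forall a,
  (\int[P]_w (xi w * g w `^ a)%:E = (\int[P]_w (xi w)%:E) * (expR (rho a * h))%:E)%E.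

(** One step of the drawdown ratio: a factor g, then a cut at 1 when a new maximum is set. The
    independence of g from the past enters through the two moment hypotheses. *)
Let p' w := Num.min 1 (p w * g w).
Local Notation moment f a := (fine (\int[P]_w (xi w * f w `^ a)%:E)%E).

Let n0 : 0 < n. Proof. exact: lt_trans n1. Qed.

Lemma measurable_moment (f : Omega -> R) a : measurable_fun setT f ->
  measurable_fun setT (fun w => xi w * f w `^ a).
Proof. by move=> mf; apply: measurable_funM => //; exact: (measurableT_comp (measurable_powR a)). Qed.

Lemma moment_ge0 (f : Omega -> R) a : 0 <= moment f a.
Proof. by rewrite fine_ge0//; apply: integral_ge0 => w _; rewrite lee_fin mulr_ge0// powR_ge0. Qed.

Lemma moment_fin (f : Omega -> R) a : measurable_fun setT f ->
  (forall w, 0 < f w) -> (forall w, f w <= 1) -> 0 <= a ->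
  (\int[P]_w (xi w * f w `^ a)%:E = (moment f a)%:E)%E.
Proof.
move=> mf f0 f1 a0; apply: ge0_integral_fin_num.
  by move=> w; rewrite mulr_ge0// powR_ge0.
apply: le_lt_trans fin_xi; apply: ge0_le_integral_fin => //.
- exact: measurable_moment.
- by move=> w; rewrite mulr_ge0// powR_ge0.
- by move=> w; rewrite ler_piMr// -[leRHS](powRr0 (f w)) ger_powR// f0 f1.
Qed.

Lemma moment_anti (f : Omega -> R) a b : measurable_fun setT f ->
  (forall w, 0 < f w) -> (forall w, f w <= 1) -> 0 <= a -> a <= b ->
  moment f b <= moment f a.
Proof.
move=> mf f0 f1 a0 ab; rewrite -lee_fin -!moment_fin//; last exact: le_trans ab.
apply: ge0_le_integral_fin; [exact: measurable_moment|exact: measurable_moment| |].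
- by move=> w; rewrite mulr_ge0// powR_ge0.
- by move=> w; rewrite ler_wpM2l// ger_powR// f0 f1.
Qed.

Let mq : measurable_fun setT (fun w => p w * g w).
Proof. exact: measurable_funM. Qed.

Let mp' : measurable_fun setT p'.
Proof. exact: measurable_minr. Qed.

Let p'_gt0 w : 0 < p' w. Proof. by rewrite lt_min ltr01 mulr_gt0. Qed.
Let p'_le1 w : p' w <= 1. Proof. by rewrite ge_min lexx. Qed.

Let over w := overshoot n (Num.max 1 (p w * g w)).

Let over_ge0 w : 0 <= over w.
Proof. by rewrite overshoot_ge0 ?le_max ?lexx// ltW. Qed.

Let mover : measurable_fun setT over.
Proof.
have mm : measurable_fun setT (fun w => Num.max 1 (p w * g w)) by exact: measurable_maxr.
apply: measurable_funB; last exact: measurable_funB.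
apply: measurable_funM => //; apply: measurable_funB => //.
exact: (measurableT_comp (measurable_powR n)).
Qed.

Let mxo : measurable_fun setT (fun w => xi w * over w).
Proof. exact: measurable_funM. Qed.

Let xp (f : Omega -> R) a w : 0 <= xi w * f w `^ a.
Proof. by rewrite mulr_ge0// powR_ge0. Qed.

Let xo w : 0 <= xi w * over w.
Proof. by rewrite mulr_ge0. Qed.

Let momentq a : (\int[P]_w (xi w * (p w * g w) `^ a)%:E =
   (\int[P]_w (xi w * p w `^ a)%:E) * (expR (rho a * h))%:E)%E.
Proof.
by rewrite -momentS; apply: eq_integral => w _; rewrite powRM ?ltW// mulrA.
Qed.

Let balance (a b c e f : R) : c + n^-1 * b = n^-1 * f + a + e -> c - f / n = a - b / n + e.
Proof. by rewrite ![_ / n]mulrC; move: (n^-1) => ni *; lra. Qed.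

(** Cutting at 1 changes p - p^n / n by exactly the overshoot. The identity is first written with
    nonnegative terms on both sides, so that it integrates in the extended reals before the
    overshoot is known to have a finite mean; finiteness is read off from it afterwards. *)
Let moment_balance : exists2 e : R,
  moment p' 1 - moment p' n / n =
    moment p 1 * expR (rho 1 * h) - moment p n * expR (rho n * h) / n + e &
  (\int[P]_w (xi w * over w)%:E)%E = e%:E.
Proof.
have ni0 : 0 <= n^-1 by rewrite invr_ge0 ltW.
have : (\int[P]_w (xi w * p' w `^ 1)%:E + n^-1%:E * \int[P]_w (xi w * (p w * g w) `^ n)%:E =
  n^-1%:E * \int[P]_w (xi w * p' w `^ n)%:E + \int[P]_w (xi w * (p w * g w) `^ 1)%:E
  + \int[P]_w (xi w * over w)%:E)%E.
  rewrite -(ge0_integralZl_fin P (measurable_moment n mq) ni0 (xp _ n)).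
  rewrite -(ge0_integralZl_fin P (measurable_moment n mp') ni0 (xp _ n)).
  have mnq : measurable_fun setT (fun w => n^-1 * (xi w * (p w * g w) `^ n)).
    by apply: measurable_funM => //; exact: measurable_moment.
  have mnp : measurable_fun setT (fun w => n^-1 * (xi w * p' w `^ n)).
    by apply: measurable_funM => //; exact: measurable_moment.
  have nq0 w : 0 <= n^-1 * (xi w * (p w * g w) `^ n) by rewrite mulr_ge0// mulr_ge0// powR_ge0.
  have np0 w : 0 <= n^-1 * (xi w * p' w `^ n) by rewrite mulr_ge0// mulr_ge0// powR_ge0.
  rewrite -(ge0_integralD_fin P (measurable_moment 1 mp') mnq (xp _ 1) nq0).
  rewrite -(ge0_integralD_fin P mnp (measurable_moment 1 mq) np0 (xp _ 1)).
  rewrite -ge0_integralD_fin//; last 2 first.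
  - by apply: measurable_funD => //; exact: measurable_moment.
  - by move=> w; rewrite addr_ge0// mulr_ge0// powR_ge0.
  apply: eq_integral => w _; congr EFin; rewrite /p' /over /overshoot.
  have q0 : 0 < p w * g w by rewrite mulr_gt0.
  rewrite !powRr1; last 2 first.
  - exact: ltW.
  - by rewrite le_min ler01 ltW.
  by have [q1|q1] := leP 1 (p w * g w); rewrite powR1; ring.
move=> H.
rewrite !momentq (moment_fin mp' p'_gt0 p'_le1 ler01) (moment_fin mp' p'_gt0 p'_le1 (ltW n0)) in H.
rewrite (moment_fin mp p_gt0 p_le1 ler01) (moment_fin mp p_gt0 p_le1 (ltW n0)) in H.
rewrite -!EFinM -!EFinD in H.
exists (fine (\int[P]_w (xi w * over w)%:E)).
  apply: balance; apply: EFin_inj; rewrite [RHS]EFinD fineK -?H//.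
  exact: fin_num_addl H.
by rewrite fineK//; exact: fin_num_addl H.
Qed.

Lemma ratio_step_ge :
  moment p 1 * expR (rho 1 * h) - moment p n * expR (rho n * h) / n <=
  moment p' 1 - moment p' n / n.
Proof.
have [e he eE] := moment_balance.
have e0 : 0 <= e by rewrite -lee_fin -eE; apply: integral_ge0 => w _; rewrite lee_fin.
by rewrite he lerDl.
Qed.

Lemma ratio_step_le (dl L : R) : 0 <= dl -> 0 <= L ->
  moment p' 1 - moment p' n / n <=
  moment p 1 * expR (rho 1 * h) - moment p n * expR (rho n * h) / n
  + dl * (moment p n * expR (rho n * h) - moment p' n)
  + expR (- (L * dl)) * expR (rho (n + L) * h) * fine (\int[P]_w (xi w)%:E)%E.
Proof.
move=> dl0 L0; have [e he eE] := moment_balance.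
have mgL := measurable_moment (n + L) mg.
have ho w := overshoot_le (ltW n1) (p_gt0 w) (p_le1 w) (g_gt0 w) dl0 L0.
have K0 := expR_ge0 (- (L * dl)).
move: ho K0; move: (expR (- (L * dl))) => K ho K0.
have H : (\int[P]_w (xi w * over w)%:E + dl%:E * \int[P]_w (xi w * p' w `^ n)%:E <=
   dl%:E * \int[P]_w (xi w * (p w * g w) `^ n)%:E +
   K%:E * \int[P]_w (xi w * g w `^ (n + L))%:E)%E.
  rewrite -(ge0_integralZl_fin P (measurable_moment n mq) dl0 (xp _ n)).
  rewrite -(ge0_integralZl_fin P (measurable_moment n mp') dl0 (xp _ n)).
  rewrite -(ge0_integralZl_fin P mgL K0 (xp _ (n + L))).
  have mdq : measurable_fun setT (fun w => dl * (xi w * (p w * g w) `^ n)).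
    by apply: measurable_funM => //; exact: measurable_moment.
  have mdp : measurable_fun setT (fun w => dl * (xi w * p' w `^ n)).
    by apply: measurable_funM => //; exact: measurable_moment.
  have mdg : measurable_fun setT (fun w => K * (xi w * g w `^ (n + L))).
    exact: measurable_funM.
  have dq0 w : 0 <= dl * (xi w * (p w * g w) `^ n) by rewrite mulr_ge0// mulr_ge0// powR_ge0.
  have dp0 w : 0 <= dl * (xi w * p' w `^ n) by rewrite mulr_ge0// mulr_ge0// powR_ge0.
  have dg0 w : 0 <= K * (xi w * g w `^ (n + L)) by rewrite mulr_ge0// mulr_ge0// powR_ge0.
  rewrite -(ge0_integralD_fin P mxo mdp xo dp0).
  rewrite -(ge0_integralD_fin P mdq mdg dq0 dg0).
  apply: ge0_le_integral_fin.
  - exact: measurable_funD.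
  - exact: measurable_funD.
  - by move=> w; rewrite addr_ge0.
  - move=> w.
    (* The cut removes from the n-th power precisely max (1, p g)^n - 1, the quantity that bounds
       the overshoot. The error thus becomes a difference of moments, which telescopes over the
       steps. *)
    have -> : p' w `^ n = (p w * g w) `^ n - (Num.max 1 (p w * g w) `^ n - 1).
      by rewrite /p'; have [q1|q1] := leP 1 (p w * g w); rewrite powR1; ring.
    exact: overshoot_combine (ho w).
rewrite momentq moment_g eE in H.
rewrite (moment_fin mp' p'_gt0 p'_le1 (ltW n0)) (moment_fin mp p_gt0 p_le1 (ltW n0)) in H.
rewrite (ge0_integral_fin_num xi0 fin_xi) in H.
rewrite -!EFinM -!EFinD lee_fin in H.
by rewrite he -[leRHS]addrA lerD2l; exact: overshoot_balance.
Qed.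

End ratio_step.

Section gbm.
Context {R : realType} {d : measure_display} {Omega : measurableType d}.
Variables (P : probability Omega R) (F : R -> set (set Omega)).
Variable W : R -> Omega -> R.
Hypotheses (hF : is_filtration F) (hW : is_brownian F P W).
Variables (x0 nu sg : R).
Hypothesis x0_gt0 : 0 < x0.
Local Notation fmeas := (filtration_measurable F).
Local Notation TR := (Omega * measurableTypeR R)%type.
Local Notation leb := (@lebesgue_measure R).

Definition gbm (t : R) (w : Omega) : R := x0 * expR (nu * t + sg * W t w).
Local Notation X := gbm.

(* E X_t^a = x0^a exp (growth a * t). *)
Definition growth (a : R) : R := nu * a + sg ^+ 2 * a ^+ 2 / 2.

Lemma gbm_gt0 t w : 0 < X t w.
Proof. by rewrite mulr_gt0// expR_gt0. Qed.

Lemma gbm_continuous : continuous_paths X.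
Proof.
move=> w; have [_ _ cW _ _] := hW.
apply/subspace_continuousP => t tin.
apply: cvgM; first exact: cvg_cst.
apply: (cvg_comp _ expR); last exact: continuous_expR.
apply: cvgD.
  apply: cvgM; first exact: cvg_cst.
  exact: cvg_within.
apply: cvgM; first exact: cvg_cst.
by have /subspace_continuousP := cW w; exact.
Qed.

Lemma gbm_fmeas t : 0 <= t -> fmeas t (X t).
Proof.
move=> t0; rewrite /filtration_measurable; apply: measurable_funM => //.
apply: measurableT_comp => //; apply: measurable_funD => //.
apply: measurable_funM => //.
exact: (brownian_measurable hF hW).
Qed.

(** A power of X t / X s is the exponential of a Brownian increment with drift: it factors out of
    any weight known at time s, and its mean is explicit. *)
Lemma gbm_increment (s t a : R) (U : Omega -> R) :
  0 <= s -> s <= t -> fmeas s U -> (forall w, 0 <= U w) ->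
  (\int[P]_w (U w * (X t w / X s w) `^ a)%:E =
   (\int[P]_w (U w)%:E) * (expR (growth a * (t - s)))%:E)%E.
Proof.
move=> s0 st mU U0.
have mW u : 0 <= u -> measurable_fun setT (W u).
  by move=> u0; apply: (filtration_measurable_fun hF u0); exact: (brownian_measurable hF hW).
transitivity (\int[P]_w ((expR (nu * a * (t - s)))%:E *
    (U w * expR (a * sg * (W t w - W s w)))%:E))%E.
  apply: eq_integral => w _; rewrite -EFinM; congr EFin.
  rewrite mulrCA; congr (_ * _).
  rewrite /gbm invfM mulrACA divff ?gt_eqF// mul1r -expRN -expRD -expRM -expRD.
  by congr expR; ring.
rewrite ge0_integralZl//; last 2 first.
- apply/measurable_EFinP; apply: measurable_funM.
    exact: (filtration_measurable_fun hF s0).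
  apply: measurableT_comp => //; apply: measurable_funM => //.
  by apply: measurable_funB; apply: mW => //; exact: le_trans st.
- by move=> w _; rewrite lee_fin mulr_ge0// expR_ge0.
rewrite (integral_expR_increment hF hW _ s0 st mU U0) muleCA -EFinM -expRD.
by congr (_ * (expR _)%:E)%E; rewrite /growth; ring.
Qed.

Section grid.
Variables (t0 : R) (xi : Omega -> R).
Hypotheses (t00 : 0 <= t0) (mxi : fmeas t0 xi) (xi0 : forall w, 0 <= xi w).
Hypothesis fin_xi : (\int[P]_w (xi w)%:E < +oo)%E.
Variable h : R.
Hypothesis h0 : 0 < h.

Let G j w := X (t0 + j%:R * h) w.
Let Mx j w := grid_max (X^~ w) t0 h j.
Let p j w := G j w / Mx j w.
Let g j w := X (t0 + j.+1%:R * h) w / X (t0 + j%:R * h) w.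

Let tj0 j : 0 <= t0 + j%:R * h.
Proof. by rewrite addr_ge0// mulr_ge0// ltW. Qed.

Let tjS j : t0 + j%:R * h <= t0 + j.+1%:R * h.
Proof. by rewrite lerD2l ler_wpM2r// ?ler_nat// ltW. Qed.

Let tjS' j : t0 + j.+1%:R * h - (t0 + j%:R * h) = h.
Proof. by rewrite -natr1; ring. Qed.

Let G_gt0 j w : 0 < G j w. Proof. exact: gbm_gt0. Qed.

Let Mx_gt0 j w : 0 < Mx j w.
Proof. by apply: lt_le_trans (G_gt0 j w) _; exact: grid_max_ge. Qed.

Let p_gt0 j w : 0 < p j w. Proof. by rewrite divr_gt0. Qed.
Let g_gt0 j w : 0 < g j w. Proof. by rewrite divr_gt0// gbm_gt0. Qed.

Let p_le1 j w : p j w <= 1.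
Proof. by rewrite ler_pdivrMr// mul1r; exact: grid_max_ge. Qed.

Let p0E w : p 0 w = 1.
Proof. by rewrite /p /G /Mx /= mul0r addr0 divff// gt_eqF// gbm_gt0. Qed.

Let pS j w : p j.+1 w = Num.min 1 (p j w * g j w).
Proof.
have pg : p j w * g j w = G j.+1 w / Mx j w.
  by rewrite /p /g -/(G j w) -/(G j.+1 w); field; rewrite !gt_eqF.
rewrite pg /p {1}/Mx /= -/(Mx j w) -/(G j.+1 w).
have [le|lt] := leP (G j.+1 w) (Mx j w).
  by rewrite min_r// ler_pdivrMr// mul1r.
by rewrite divff ?gt_eqF// min_l// ler_pdivlMr// mul1r ltW.
Qed.

Let mMx j : fmeas (t0 + j%:R * h) (Mx j).
Proof. exact: (grid_max_measurable hF gbm_fmeas t00 (ltW h0)). Qed.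

Let mp j : fmeas (t0 + j%:R * h) (p j).
Proof.
rewrite /filtration_measurable; apply: measurable_funM; first exact: gbm_fmeas.
by apply: measurable_funV_gt0 => //; exact: mMx.
Qed.

Let mxij j : fmeas (t0 + j%:R * h) xi.
Proof. by apply: (filtration_measurableW hF t00 _ mxi); rewrite lerDl mulr_ge0// ltW. Qed.

Let mxipa j a : fmeas (t0 + j%:R * h) (fun w => xi w * p j w `^ a).
Proof.
rewrite /filtration_measurable; apply: measurable_funM; first exact: mxij.
apply: (measurableT_comp (measurable_powR a)); exact: mp.
Qed.

Let mfun j (f : Omega -> R) : fmeas (t0 + j%:R * h) f -> measurable_fun setT f.
Proof. exact: filtration_measurable_fun. Qed.

Let mg j : measurable_fun setT (g j).
Proof.
apply: measurable_funM; first by apply: (@mfun j.+1); exact: gbm_fmeas.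
apply: measurable_funV_gt0; first by move=> w _; exact: gbm_gt0.
by apply: (@mfun j); exact: gbm_fmeas.
Qed.

Let mxi' : measurable_fun setT xi. Proof. exact: (filtration_measurable_fun hF t00). Qed.

Variables (n r : R).
Hypotheses (n1 : 1 < n) (r_growth : growth n = r) (r0 : 0 < r).
Hypothesis cr : growth 1 < r.

Let Xi := fine (\int[P]_w (xi w)%:E)%E.
Let moment j a := fine (\int[P]_w (xi w * p j w `^ a)%:E)%E.

Let momentS j a : (\int[P]_w (xi w * p j w `^ a * g j w `^ a)%:E =
   (\int[P]_w (xi w * p j w `^ a)%:E) * (expR (growth a * h))%:E)%E.
Proof.
rewrite /g gbm_increment; [by rewrite tjS'|exact: tj0|exact: tjS|exact: mxipa|].
by move=> w; rewrite mulr_ge0// powR_ge0.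
Qed.

Let moment_g j a : (\int[P]_w (xi w * g j w `^ a)%:E =
   (\int[P]_w (xi w)%:E) * (expR (growth a * h))%:E)%E.
Proof. by rewrite /g gbm_increment; [rewrite tjS'|exact: tj0|exact: tjS|exact: mxij|]. Qed.

Let mp' j : measurable_fun setT (p j). Proof. by apply: (@mfun j); exact: mp. Qed.

Let pSE j : p j.+1 = (fun w => Num.min 1 (p j w * g j w)).
Proof. by apply/funext => w; rewrite pS. Qed.

Let momentE j a : 0 <= a -> (\int[P]_w (xi w * p j w `^ a)%:E = (moment j a)%:E)%E.
Proof. by move=> a0; rewrite (moment_fin mxi' xi0 fin_xi (mp' j) (p_gt0 j) (p_le1 j) a0). Qed.

Let moment0 a : moment 0 a = Xi.
Proof. by congr fine; apply: eq_integral => w _; rewrite p0E powR1 mulr1. Qed.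

Let moment_Xi j : moment j 1 <= Xi.
Proof.
have -> : Xi = moment j 0.
  by congr fine; apply: eq_integral => w _; rewrite powRr0 mulr1.
by apply: (moment_anti mxi' xi0 fin_xi (mp' j) (p_gt0 j) (p_le1 j)).
Qed.

Let moment_n1 j : moment j n <= moment j 1.
Proof. by apply: (moment_anti mxi' xi0 fin_xi (mp' j) (p_gt0 j) (p_le1 j)); rewrite ?ltW. Qed.

Let moment_pos j a : 0 <= moment j a. Proof. exact: moment_ge0. Qed.

Let step_ge j :
  moment j 1 * expR (growth 1 * h) - moment j n * expR (r * h) / n <=
  moment j.+1 1 - moment j.+1 n / n.
Proof.
rewrite /moment !pSE -r_growth.
exact: (ratio_step_ge mxi' (mp' j) (mg j) xi0 (p_gt0 j) (p_le1 j) (g_gt0 j) fin_xi n1 (momentS j)).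
Qed.

Let step_le j (dl L : R) : 0 <= dl -> 0 <= L ->
  moment j.+1 1 - moment j.+1 n / n <=
  moment j 1 * expR (growth 1 * h) - moment j n * expR (r * h) / n
  + dl * (moment j n * expR (r * h) - moment j.+1 n)
  + expR (- (L * dl)) * expR (growth (n + L) * h) * Xi.
Proof.
move=> dl0 L0.
rewrite /moment !pSE -r_growth.
exact: (ratio_step_le mxi' (mp' j) (mg j) xi0 (p_gt0 j) (p_le1 j) (g_gt0 j) fin_xi n1
  (momentS j) (moment_g j) dl0 L0).
Qed.

(** X runs in continuous time while the maximum is frozen at the last grid point. Within a cell the
    mean is then an exact exponential, at the price of a ratio that may exceed 1. *)
Definition grid_ratio (s : R) (w : Omega) : R :=
  xi w * expR (- r * (s - t0)) * (X s w / grid_max (X^~ w) t0 h (grid_floor t0 h s)).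

Lemma measurable_grid_ratio :
  measurable_fun [set x : TR | t0 <= x.2] (fun x => grid_ratio x.2 x.1).
Proof.
apply: measurable_funM.
  apply: measurable_funTS; apply: measurable_funM; first exact: measurableT_comp.
  apply: measurableT_comp => //; apply: measurable_funM => //.
  exact: measurable_funB.
apply: measurable_funM.
  have := process_joint_measurable hF gbm_continuous gbm_fmeas.
  apply: measurable_funS; first exact: measurable_from.
  by move=> x /=; exact: le_trans.
apply: measurable_funV_gt0.
  by move=> x _; exact: Mx_gt0.
apply: (@measurable_fun_grid _ _ _ t0 h (fun j x => Mx j x.1)) => // j.
apply: (measurableT_comp (f := Mx j)) => //; apply: (@mfun j); exact: mMx.
Qed.

Lemma grid_ratio_ge0 s w : 0 <= grid_ratio s w.
Proof. by rewrite !mulr_ge0 ?expR_ge0 ?invr_ge0// ltW// ?gbm_gt0//; exact: Mx_gt0. Qed.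

(** On a cell, X s is its value at the left end times an independent factor of growth rate
    [growth 1], so each cell integrates in closed form. *)
Lemma integral_grid_ratio :
  (\int[P \x leb]_(x in [set x | t0 <= x.2]%R) (grid_ratio x.2 x.1)%:E =
   \sum_(j <oo) (expR (- (r * (j%:R * h))) * (1 - expR (- ((r - growth 1) * h))) * moment j 1 / (r - growth 1))%:E)%E.
Proof.
rewrite -(@integral_snd_from _ _ _ P t0 grid_ratio); last 2 first.
- exact: measurable_grid_ratio.
- by move=> *; exact: grid_ratio_ge0.
have inner j s : t0 + j%:R * h <= s < t0 + j.+1%:R * h ->
    (\int[P]_w (grid_ratio s w)%:E = (expR (- (r * (j%:R * h))) * moment j 1 * expR (- (r - growth 1) * (s - (t0 + j%:R * h))))%:E)%E.
  move=> sj; have /andP[sj1 sj2] := sj.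
  transitivity (\int[P]_w ((expR (- r * (s - t0)))%:E *
     ((xi w * p j w `^ 1) * (X s w / X (t0 + j%:R * h) w) `^ 1)%:E))%E.
    apply: eq_integral => w _; rewrite -EFinM /grid_ratio; congr EFin.
    rewrite (grid_floor_eq h0 sj) -/(Mx j w) !powRr1 ?ltW// ?divr_gt0 ?gbm_gt0//.
    rewrite /p /G; field.
    by rewrite !gt_eqF// gbm_gt0.
  rewrite ge0_integralZl//; last 2 first.
  - apply/measurable_EFinP; apply: measurable_funM => //.
      by apply: (measurable_moment mxi').
    apply: (measurableT_comp (measurable_powR 1)); apply: measurable_funM.
      by apply: (filtration_measurable_fun hF _ (gbm_fmeas _)); exact: le_trans sj1.
    apply: measurable_funV_gt0; first by move=> w _; exact: gbm_gt0.
    by apply: (@mfun j); exact: gbm_fmeas.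
  - by move=> w _; rewrite lee_fin !mulr_ge0// powR_ge0.
  rewrite gbm_increment//; last by move=> w; rewrite mulr_ge0// powR_ge0.
  rewrite -/(moment j 1) momentE// -!EFinM; congr EFin.
  have key : expR (- r * (s - t0)) * expR (growth 1 * (s - (t0 + j%:R * h))) =
      expR (- (r * (j%:R * h))) * expR (- (r - growth 1) * (s - (t0 + j%:R * h))).
    by rewrite -!expRD; congr expR; ring.
  by rewrite mulrCA key; ring.
rewrite (@integral_cells _ t0 h)//; first last.
- by move=> s _; apply: integral_ge0 => w _; rewrite lee_fin grid_ratio_ge0.
- exact: (measurable_fun_snd_from _ measurable_grid_ratio (fun t w _ => grid_ratio_ge0 t w)).
apply: eq_eseriesr => j _.
transitivity (\int[leb]_(s in `[(t0 + j%:R * h)%R, (t0 + j.+1%:R * h)%R[)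
  (expR (- (r * (j%:R * h))) * moment j 1 * expR (- (r - growth 1) * (s - (t0 + j%:R * h))))%:E)%E.
  by apply: eq_integral => s; rewrite inE/= in_itv/= => sj; rewrite (inner j).
rewrite integral_expR_cell; last 2 first.
- by rewrite subr_eq0 gt_eqF.
- by rewrite ltrD2l ltr_pM2r// ltr_nat.
congr EFin; rewrite subrr mulr0 expR0 tjS' mulNr; ring.
Qed.

(** A partial sum of the series; the term exp (- r N h) Xi is the price of stopping after N cells
    and vanishes as N grows. *)
Lemma integral_grid_ratio_ge (N : nat) :
  ((((1 - n^-1) * Xi - expR (- (r * (N%:R * h))) * Xi) / (r - growth 1))%:E <=
  \int[P \x leb]_(x in [set x | t0 <= x.2]%R) (grid_ratio x.2 x.1)%:E)%E.
Proof.
rewrite integral_grid_ratio.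
apply: le_trans (nneseries_lim_ge N _); last first.
  move=> j _ _; rewrite lee_fin !mulr_ge0 ?expR_ge0 ?invr_ge0 ?subr_ge0 ?(ltW cr)//.
    by rewrite -[leRHS]expR0 ler_expR oppr_le0 mulr_ge0 ?subr_ge0 ?ltW.
rewrite sumEFin lee_fin -mulr_suml ler_pM2r ?invr_gt0 ?subr_gt0// big_mkord.
by apply: (@resolvent_sum_ge _ n r (growth 1) h (moment^~ 1) (moment^~ n) Xi) => // j.
Qed.

(** The tail of the overshoot is charged once per step, whence its division by r h: for a fixed L
    this blows up as the mesh shrinks, so L has to grow with it. *)
Lemma integral_grid_ratio_le (dl L : R) : 0 <= dl -> 0 <= L ->
  (\int[P \x leb]_(x in [set x | t0 <= x.2]%R) (grid_ratio x.2 x.1)%:E <=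
  (((1 - n^-1 + dl) * Xi + expR (- (L * dl)) * expR (growth (n + L) * h) * Xi / (r * h)) / (r - growth 1))%:E)%E.
Proof.
move=> dl0 L0; rewrite integral_grid_ratio.
apply: lime_le.
  apply: is_cvg_nneseries => j _ _; rewrite lee_fin !mulr_ge0 ?expR_ge0 ?invr_ge0 ?subr_ge0 ?(ltW cr)//.
    by rewrite -[leRHS]expR0 ler_expR oppr_le0 mulr_ge0 ?subr_ge0 ?ltW.
apply: nearW => N.
rewrite sumEFin lee_fin -mulr_suml ler_pM2r ?invr_gt0 ?subr_gt0// big_mkord.
apply: (@resolvent_sum_le _ n r (growth 1) h (moment^~ 1) (moment^~ n) Xi) => //.
- by rewrite mulr_ge0 ?mulr_ge0 ?expR_ge0// -(moment0 1).
- by move=> j; exact: step_le.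
Qed.

End grid.
End gbm.

Section expected_drawdown.
Context {R : realType} {d : measure_display} {Omega : measurableType d}.
Variables (P : probability Omega R) (F : R -> set (set Omega)).
Variable W : R -> Omega -> R.
Hypotheses (hF : is_filtration F) (hW : is_brownian F P W).
Variables (x0 nu sg : R).
Hypothesis x0_gt0 : 0 < x0.
Local Notation fmeas := (filtration_measurable F).
Local Notation TR := (Omega * measurableTypeR R)%type.
Local Notation leb := (@lebesgue_measure R).
Local Notation X := (gbm W x0 nu sg).

Let X_gt0 t w : 0 < X t w. Proof. exact: gbm_gt0. Qed.
Let cX w : {within `[0, +oo[, continuous (X^~ w)}. Proof. exact: (gbm_continuous hW). Qed.
Let mX t : 0 <= t -> fmeas t (X t). Proof. exact: (gbm_fmeas hF hW). Qed.

Lemma msup_gbm_gt0 t0 s w : 0 <= t0 -> t0 <= s -> 0 < msup (X^~ w) t0 s.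
Proof.
move=> t00 t0s; apply: lt_le_trans (X_gt0 s w) _.
by apply: (msup_ub (@cX w)) => //; rewrite t0s lexx.
Qed.

Lemma measurable_gbm_from t0 : 0 <= t0 ->
  measurable_fun [set x : TR | t0 <= x.2] (fun x => X x.2 x.1).
Proof.
move=> t00; have := process_joint_measurable hF (gbm_continuous hW (x0 := x0) (nu := nu) (sg := sg)) (@mX).
apply: measurable_funS; first exact: measurable_from.
by move=> x /=; exact: le_trans.
Qed.

Lemma measurable_drawdown t0 : 0 <= t0 ->
  measurable_fun [set x : TR | t0 <= x.2] (fun x => X x.2 x.1 / msup (X^~ x.1) t0 x.2).
Proof.
move=> t00; apply: measurable_funM; first exact: measurable_gbm_from.
apply: measurable_funV_gt0; first by move=> x /= t0s; exact: msup_gbm_gt0.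
exact: (msup_joint_measurable hF (gbm_continuous hW (x0 := x0) (nu := nu) (sg := sg)) (@mX)).
Qed.

Lemma measurable_discount r t0 :
  measurable_fun [set x : TR | t0 <= x.2] (fun x => expR (- r * (x.2 - t0))).
Proof.
apply: measurable_funTS; apply: measurableT_comp => //; apply: measurable_funM => //.
exact: measurable_funB.
Qed.

(** The extra exponent L = m + 1 is tied to the mesh (m + 1)^-2: as [growth] is quadratic, its value
    at n + L times the mesh stays bounded, while exp (- L dl) divided by the mesh vanishes. The
    cubic term of the exponential series, with 3! = 6, beats the square in the mesh. *)
Lemma overshoot_rate_cvg n r dl : 1 < n -> 0 < r -> 0 < dl ->
  (fun m : nat => expR (- (m.+1%:R * dl)) * expR (growth nu sg (n + m.+1%:R) * (m.+1%:R^-1 ^+ 2))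
     / (r * (m.+1%:R^-1 ^+ 2))) @ \oo --> (0 : R).
Proof.
move=> n1 r0 dl0; have n0 : 0 < n by exact: lt_trans n1.
pose C := `|nu| * (n + 1) + sg ^+ 2 * (n + 1) ^+ 2 / 2.
have hC (m : nat) : growth nu sg (n + m.+1%:R) * (m.+1%:R^-1 ^+ 2) <= C.
  have M1 : 1 <= m.+1%:R :> R by rewrite ler1n.
  set M : R := m.+1%:R in M1 *; have M0 : 0 < M by exact: lt_le_trans M1.
  have nM : n + M <= (n + 1) * M by nra.
  rewrite /growth exprVn ler_pdivrMr ?exprn_gt0// /C mulrDl.
  apply: lerD.
    apply: (@le_trans _ _ (`|nu| * (n + M))).
      by rewrite ler_wpM2r ?ler_norm// addr_ge0// ltW.
    rewrite -[leRHS]mulrA ler_wpM2l//; apply: (le_trans nM).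
    by rewrite ler_wpM2l ?expr2 ?addr_ge0 ?(ltW n0)// ler_peMl// ltW.
  rewrite -mulrA [_ / 2]mulrC mulrA -[X in _ <= X * _]mulrA -[X in _ <= X]mulrA.
  rewrite -mulrA ler_wpM2l ?sqr_ge0// [leLHS]mulrC [leRHS]mulrAC ler_wpM2r ?invr_ge0//.
  by rewrite -exprMn ler_pXn2r// nnegrE ?addr_ge0 ?mulr_ge0 ?addr_ge0// ltW.
apply: (@squeeze_cvgr _ _ _ _ (fun=> 0) (fun m : nat => 6 * expR C / (r * dl ^+ 3) * m.+1%:R^-1)); last 2 first.
- exact: cvg_cst.
- rewrite -[0](mulr0 (6 * expR C / (r * dl ^+ 3))); apply: cvgM; first exact: cvg_cst.
  exact: cvg_harmonic.
apply: nearW => m; apply/andP; split.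
  by rewrite !mulr_ge0 ?expR_ge0// invr_ge0 mulr_ge0 ?exprn_ge0 ?invr_ge0// ltW.
have M0 : 0 < m.+1%:R :> R by rewrite ltr0n.
set M : R := m.+1%:R in M0 *.
have e3 : (M * dl) ^+ 3 / 6 <= expR (M * dl).
  have := @expR_ge1Dxn R (M * dl) 2 (ltW (mulr_gt0 M0 dl0)).
  by rewrite (_ : 3`! = 6)//; apply: le_trans; rewrite lerDr.
rewrite expRN.
have e4 : (expR (M * dl))^-1 <= 6 / (M * dl) ^+ 3.
  rewrite -[leRHS]invrK invf_div lef_pV2 ?posrE ?expR_gt0// divr_gt0// exprn_gt0// mulr_gt0//.
apply: (@le_trans _ _ (6 / (M * dl) ^+ 3 * expR C / (r * M^-1 ^+ 2))).
  rewrite ler_pM2r ?invr_gt0 ?mulr_gt0 ?exprn_gt0 ?invr_gt0//.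
  apply: ler_pM => //; rewrite ?invr_ge0 ?expR_ge0// ler_expR; exact: hC.
rewrite le_eqVlt; apply/orP; left; apply/eqP; field.
by rewrite !gt_eqF.
Qed.

Variables (n r : R).
Hypotheses (n1 : 1 < n) (r_growth : growth nu sg n = r) (r0 : 0 < r).

Section conditional.
Hypothesis cr : growth nu sg 1 < r.
Variables (t0 : R) (xi : Omega -> R).
Hypotheses (t00 : 0 <= t0) (mxi : fmeas t0 xi) (xi0 : forall w, 0 <= xi w).
Hypothesis fin_xi : (\int[P]_w (xi w)%:E < +oo)%E.

Let D : set TR := [set x | t0 <= x.2].
Let h (m : nat) : R := m.+1%:R^-1 ^+ 2.
Let h0 m : 0 < h m. Proof. by rewrite exprn_gt0// invr_gt0. Qed.
Let f (x : TR) : \bar R := (xi x.1 * expR (- r * (x.2 - t0)) * (X x.2 x.1 / msup (X^~ x.1) t0 x.2))%:E.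
Let g (x : TR) : \bar R := (xi x.1 * expR (- r * (x.2 - t0)) * (X x.2 x.1 / X t0 x.1))%:E.
Let f_ m (x : TR) : \bar R := (grid_ratio W x0 nu sg t0 xi (h m) r x.2 x.1)%:E.
Let Xi := fine (\int[P]_w (xi w)%:E)%E.
Let Xi0 : 0 <= Xi.
Proof. by rewrite fine_ge0//; apply: integral_ge0 => w _; rewrite lee_fin. Qed.

Let mxi' : measurable_fun setT xi. Proof. exact: (filtration_measurable_fun hF t00). Qed.

Let mdisc : measurable_fun D (fun x : TR => xi x.1 * expR (- r * (x.2 - t0))).
Proof.
apply: measurable_funM; last exact: measurable_discount.
by apply: measurable_funTS; exact: measurableT_comp.
Qed.

Let mg : measurable_fun D (fun x : TR => xi x.1 * expR (- r * (x.2 - t0)) * (X x.2 x.1 / X t0 x.1)).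
Proof.
apply: measurable_funM => //; apply: measurable_funM; first exact: measurable_gbm_from.
apply: measurable_funTS; apply: measurable_funV_gt0 => //.
by apply: (measurableT_comp (f := X t0)) => //; exact: (filtration_measurable_fun hF t00 (mX t00)).
Qed.

Let g_ge0 s w : 0 <= xi w * expR (- r * (s - t0)) * (X s w / X t0 w).
Proof. by rewrite !mulr_ge0 ?expR_ge0// ?invr_ge0 ltW. Qed.

(** Replacing the maximum by its initial value X t0 dominates the ratios of all grids at once; the
    dominating function is integrable because X grows at a rate below r. *)
Let ig : (P \x leb)%E.-integrable D g.
Proof.
apply/integrableP; split; first exact/measurable_EFinP.
under eq_integral => x _ do rewrite /g gee0_abs ?lee_fin ?g_ge0//.
rewrite -(@integral_snd_from _ _ _ P t0 (fun s w => xi w * expR (- r * (s - t0)) * (X s w / X t0 w)))//.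
rewrite (_ : integral _ _ _ = \int[leb]_(s in `[t0, +oo[) (Xi * expR (- (r - growth nu sg 1) * (s - t0)))%:E)%E.
  by rewrite integral_expR_from ?subr_gt0// ltry.
apply: eq_integral => s; rewrite inE/= in_itv/= andbT => t0s.
transitivity (\int[P]_w ((expR (- r * (s - t0)))%:E * (xi w * (X s w / X t0 w) `^ 1)%:E))%E.
  apply: eq_integral => w _; rewrite -EFinM; congr EFin.
  by rewrite powRr1 ?divr_ge0 ?ltW//; ring.
rewrite ge0_integralZl//; last 2 first.
- apply/measurable_EFinP; apply: measurable_funM => //.
  apply: (measurableT_comp (measurable_powR 1)); apply: measurable_funM.
    by apply: (filtration_measurable_fun hF _ (mX _)); exact: le_trans t0s.
  by apply: measurable_funV_gt0 => //; exact: (filtration_measurable_fun hF t00 (mX t00)).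
- by move=> w _; rewrite lee_fin mulr_ge0// powR_ge0.
rewrite (gbm_increment hF hW nu sg x0_gt0 1 t00 t0s mxi xi0).
rewrite (ge0_integral_fin_num xi0 fin_xi) -/Xi -!EFinM; congr EFin.
rewrite mulrCA; congr (_ * _); rewrite -expRD; congr expR; ring.
Qed.

Let f_f x : D x -> f_ ^~ x @ \oo --> f x.
Proof.
case: x => s w /=; rewrite /D/= => t0s.
apply: cvg_EFin; first exact: nearW.
rewrite /grid_ratio/=.
apply: cvgM; first exact: cvg_cst.
apply: cvgM; first exact: cvg_cst.
apply: cvgV; first by rewrite gt_eqF// msup_gbm_gt0.
apply: (grid_max_cvg (@cX s)) => //.
exact: (cvg_harmonic_scale 1).
Qed.

Let f_g m x : D x -> (`|f_ m x| <= g x)%E.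
Proof.
case: x => w s; rewrite /D/= => t0s.
rewrite /f_ /= ger0_norm; last exact: grid_ratio_ge0.
rewrite lee_fin /grid_ratio/= ler_wpM2l ?mulr_ge0 ?expR_ge0// ler_wpM2l ?(ltW (X_gt0 _ _))//.
rewrite lef_pV2 ?posrE//.
  by have := grid_max_ge (X^~ w) t0 (h m) (leq0n (grid_floor t0 (h m) s)); rewrite mul0r addr0.
apply: lt_le_trans (X_gt0 t0 w) _.
by have := grid_max_ge (X^~ w) t0 (h m) (leq0n (grid_floor t0 (h m) s)); rewrite mul0r addr0.
Qed.

(** This is a conditional expectation given the information at t0, tested against nonnegative
    weights xi of finite mean. Dominated convergence passes from grid maxima to the running
    supremum, and the two grid bounds pinch the limit. *)
Lemma expected_drawdown :
  (\int[P \x leb]_(x in [set x | t0 <= x.2]%R)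
     (xi x.1 * expR (- r * (x.2 - t0)) * (X x.2 x.1 / msup (X^~ x.1) t0 x.2))%:E =
   ((1 - n^-1) / (r - growth nu sg 1) * fine (\int[P]_w (xi w)%:E))%:E)%E.
Proof.
have n0 : 0 < n by exact: lt_trans n1.
have rc0 : 0 < r - growth nu sg 1 by rewrite subr_gt0.
have [_ _ cI] := @dominated_convergence _ _ _ (P \x leb)%E D (measurable_from t0) f_ f g
  (fun m => (measurable_EFinP _ _).2 (measurable_grid_ratio hF hW nu sg x0_gt0 t00 mxi (h0 m) r))
  ((measurable_EFinP _ _).2 (measurable_funM mdisc (measurable_drawdown t00)))
  (aeW _ f_f) ig (aeW _ (fun x m => @f_g m x)).
apply/eqP; rewrite eq_le; apply/andP; split.
  apply/lee_addgt0Pr => e e0; rewrite -EFinD.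
  (* Two error terms of size at most dl Xi will appear; with this dl their sum is at most e (r -
     growth 1). Using Xi + 1 avoids a division by 0. *)
  pose dl := e * (r - growth nu sg 1) / (2 * (Xi + 1)).
  have Xi1 : 0 < Xi + 1 by rewrite ltr_wpDl.
  have dl0 : 0 < dl by rewrite divr_gt0 ?mulr_gt0.
  apply: cvge_le cI.
  have /cvgrPdist_lt /(_ _ dl0)[N _ hN] := overshoot_rate_cvg n1 r0 dl0.
  exists N => // m /hN /=; rewrite sub0r normrN => hm.
  apply: (le_trans (integral_grid_ratio_le hF hW x0_gt0 t00 mxi xi0 fin_xi (h0 m) n1 r_growth r0 cr (ltW dl0) (ler0n _ m.+1))).
  rewrite -/Xi lee_fin.
  have -> : (1 - n^-1) / (r - growth nu sg 1) * Xi + e =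
      ((1 - n^-1) * Xi + e * (r - growth nu sg 1)) / (r - growth nu sg 1).
    by field; rewrite !gt_eqF.
  rewrite ler_pM2r ?invr_gt0//.
  have {}hm := le_lt_trans (ler_norm _) hm.
  rewrite /h [_ * Xi / _]mulrAC.
  apply: (@le_trans _ _ ((1 - n^-1 + dl) * Xi + dl * Xi)).
    by rewrite lerD2l ler_wpM2r// ltW.
  rewrite mulrDl -addrA lerD2l -mulrDl -mulr2n -mulr_natl /dl.
  have -> : 2 * (e * (r - growth nu sg 1) / (2 * (Xi + 1))) * Xi =
      e * (r - growth nu sg 1) * (Xi / (Xi + 1)) by field; rewrite gt_eqF.
  by rewrite ler_piMr ?mulr_ge0 ?(ltW e0) ?(ltW rc0)// ler_pdivrMr// mul1r lerDl.
apply: cvge_ge cI; apply: nearW => m.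
apply: (@cvge_le _ \oo _ _ (fun N : nat => (((1 - n^-1) * Xi - expR (- (r * (N%:R * h m))) * Xi) / (r - growth nu sg 1))%:E)).
  by apply: nearW => N; exact: (integral_grid_ratio_ge hF hW x0_gt0 t00 mxi xi0 fin_xi (h0 m) n1 r_growth cr).
apply: cvg_EFin; first exact: nearW.
rewrite [X in _ --> X]mulrAC; apply: cvgM; last exact: cvg_cst.
rewrite -[X in _ --> X]subr0; apply: cvgB; first exact: cvg_cst.
rewrite -[0](mul0r Xi); apply: cvgM; last exact: cvg_cst.
under eq_fun do rewrite mulrCA [_%:R * _]mulrC -mulNr expRM_natr.
apply: cvg_expr; rewrite ger0_norm ?expR_ge0// -[ltRHS]expR0 ltr_expR.
by rewrite oppr_lt0 mulr_gt0.
Qed.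

End conditional.
End expected_drawdown.

(** As a function of M, the expression M^q + q / (n - q) M^(q - n) X^n decreases up to its
    stationary point M = X, so raising the maximum to X cannot increase it. In terms of X / M this
    is [powR_young]. *)
Lemma max_step_le {R : realType} (n q M X : R) : 0 < q -> q < n -> 0 < M -> 0 < X ->
  Num.max M X `^ q + q / (n - q) * (Num.max M X `^ (- (n - q)) * X `^ n) <=
  M `^ q + q / (n - q) * (M `^ (- (n - q)) * X `^ n).
Proof.
move=> q0 qn M0 X0; have nq : 0 < n - q by rewrite subr_gt0.
have [MX|XM] := leP M X; last by [].
have x1 : 1 <= X / M by rewrite ler_pdivlMr// mul1r.
have x0 : 0 < X / M by rewrite divr_gt0.
have XE : X = X / M * M by rewrite divfK// gt_eqF.
have := powR_young q0 qn x1; move: x0 x1 XE; move: (X / M) => x x0 x1 XE h.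
rewrite {}XE !powRM ?(ltW x0) ?(ltW M0)//.
have e1 : x `^ (- (n - q)) * x `^ n = x `^ q.
  by rewrite -powRD ?(gt_eqF x0) ?implybT//; congr powR; ring.
have e2 : M `^ (- (n - q)) * M `^ n = M `^ q.
  by rewrite -powRD ?(gt_eqF M0) ?implybT//; congr powR; ring.
have -> : x `^ (- (n - q)) * M `^ (- (n - q)) * (x `^ n * M `^ n) = x `^ q * M `^ q.
  by rewrite mulrACA e1 e2.
have -> : M `^ (- (n - q)) * (x `^ n * M `^ n) = x `^ n * M `^ q by rewrite mulrCA e2.
have -> : x `^ q * M `^ q + q / (n - q) * (x `^ q * M `^ q) = n / (n - q) * x `^ q * M `^ q.
  by field; rewrite gt_eqF.
have -> : M `^ q + q / (n - q) * (x `^ n * M `^ q) = (1 + q / (n - q) * x `^ n) * M `^ q.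
  by ring.
by rewrite ler_wpM2r// powR_ge0.
Qed.

Lemma powR_continuous_gt0 {R : realType} (q x : R) : 0 < x -> {for x, continuous (fun y : R => y `^ q)}.
Proof.
move=> x0; apply/differentiable_continuous/derivable1_diffP.
by apply: derivable_powR; rewrite in_itv/= x0.
Qed.

(** * Discounted moments of the running maximum *)

Section running_max_moments.
Context {R : realType} {d : measure_display} {Omega : measurableType d}.
Variables (P : probability Omega R) (F : R -> set (set Omega)).
Variable W : R -> Omega -> R.
Hypotheses (hF : is_filtration F) (hW : is_brownian F P W).
Variables (x0 nu sg : R).
Hypothesis x0_gt0 : 0 < x0.
Local Notation fmeas := (filtration_measurable F).
Local Notation TR := (Omega * measurableTypeR R)%type.
Local Notation leb := (@lebesgue_measure R).
Local Notation X := (gbm W x0 nu sg).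
Variables (n r q : R).
Hypotheses (q0 : 0 < q) (qn : q < n) (r_growth : growth nu sg n = r) (r0 : 0 < r).

Let X_gt0 t w : 0 < X t w. Proof. exact: gbm_gt0. Qed.
Let cX w : {within `[0, +oo[, continuous (X^~ w)}. Proof. exact: (gbm_continuous hW). Qed.
Let mX t : 0 <= t -> fmeas t (X t). Proof. exact: (gbm_fmeas hF hW). Qed.

Let nq : 0 < n - q. Proof. by rewrite subr_gt0. Qed.
Let c := q / (n - q).
Let c0 : 0 < c. Proof. by rewrite divr_gt0. Qed.

Section grid.
Variable h : R.
Hypothesis h0 : 0 < h.

Let G j w := X (0 + j%:R * h) w.
Let M j w := grid_max (X^~ w) 0 h j.

Let t_ge0 j : 0 <= 0 + j%:R * h.
Proof. by rewrite add0r mulr_ge0// ltW. Qed.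

Let M_gt0 j w : 0 < M j w.
Proof. by apply: lt_le_trans (X_gt0 (0 + j%:R * h) w) _; exact: grid_max_ge. Qed.

Let mM j : fmeas (0 + j%:R * h) (M j).
Proof. exact: (grid_max_measurable hF mX (lexx 0) (ltW h0)). Qed.

Let mM' j : measurable_fun setT (M j).
Proof. apply: (filtration_measurable_fun hF (t_ge0 j)); exact: mM. Qed.

Let mG' j : measurable_fun setT (G j).
Proof. apply: (filtration_measurable_fun hF (t_ge0 j)); exact: mX. Qed.

(* By max_step_le, A + q / (n - q) B does not increase when the maximum absorbs one more point. *)
Let A j : \bar R := (\int[P]_w (M j w `^ q)%:E)%E.
Let B j : \bar R := (\int[P]_w (M j w `^ (- (n - q)) * G j w `^ n)%:E)%E.

Let mMp j p : measurable_fun setT (fun w => M j w `^ p).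
Proof. exact: (measurableT_comp (measurable_powR p) (@mM' j)). Qed.

Let mGp j p : measurable_fun setT (fun w => G j w `^ p).
Proof. exact: (measurableT_comp (measurable_powR p) (@mG' j)). Qed.

Let mMG i j k : measurable_fun setT (fun w => M i w `^ (- (n - q)) * G j w `^ k).
Proof. by apply: measurable_funM; [exact: mMp|exact: mGp]. Qed.

Let MG_ge0 i j k w : 0 <= M i w `^ (- (n - q)) * G j w `^ k.
Proof. by rewrite mulr_ge0 ?powR_ge0. Qed.

Let BS j : (\int[P]_w (M j w `^ (- (n - q)) * G j.+1 w `^ n)%:E = B j * (expR (r * h))%:E)%E.
Proof.
have tS : 0 + j%:R * h <= 0 + j.+1%:R * h by rewrite lerD2l ler_wpM2r ?ler_nat// ltW.
have := @gbm_increment _ _ _ _ _ _ hF hW x0 nu sg x0_gt0 _ _ n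
  (fun w => M j w `^ (- (n - q)) * G j w `^ n) (t_ge0 j) tS.
rewrite r_growth (_ : 0 + j.+1%:R * h - (0 + j%:R * h) = h); last by rewrite -natr1; ring.
move=> H; rewrite /B -H.
- apply: eq_integral => w _; congr EFin; rewrite -mulrA -powRM ?divr_ge0 ?(ltW (X_gt0 _ _))//.
  by rewrite /G [X (0 + j%:R * h) w * _]mulrC divfK// gt_eqF.
- rewrite /filtration_measurable; apply: measurable_funM.
    exact: (measurableT_comp (measurable_powR (- (n - q))) (@mM j)).
  exact: (measurableT_comp (measurable_powR n) (@mX _ (t_ge0 j))).
- by move=> w; exact: MG_ge0.
Qed.

Let AB_step j : (A j.+1 + c%:E * B j.+1 <= A j + c%:E * (B j * (expR (r * h))%:E))%E.
Proof.
rewrite -BS /A /B.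
rewrite -(ge0_integralZl_fin P (mMG j.+1 j.+1 n) (ltW c0) (MG_ge0 j.+1 j.+1 n)).
rewrite -(ge0_integralZl_fin P (mMG j j.+1 n) (ltW c0) (MG_ge0 j j.+1 n)).
have mc i : measurable_fun setT (fun w => c * (M i w `^ (- (n - q)) * G j.+1 w `^ n)).
  by apply: measurable_funM => //; exact: mMG.
have c0' i w : 0 <= c * (M i w `^ (- (n - q)) * G j.+1 w `^ n).
  by rewrite mulr_ge0 ?MG_ge0// ltW.
rewrite -(ge0_integralD_fin P (mMp j.+1 q) (mc j.+1) (fun w => powR_ge0 _ _) (c0' j.+1)).
rewrite -(ge0_integralD_fin P (mMp j q) (mc j) (fun w => powR_ge0 _ _) (c0' j)).
apply: ge0_le_integral_fin.
- exact: measurable_funD.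
- exact: measurable_funD.
- by move=> w; rewrite addr_ge0 ?powR_ge0.
- by move=> w; apply: max_step_le => //; exact: M_gt0.
Qed.

Let start : A 0 = (x0 `^ q)%:E /\ B 0 = (x0 `^ q)%:E.
Proof.
have Xx0 w : X 0 w = x0 by rewrite /gbm; have [-> _ _ _ _] := hW; rewrite !mulr0 addr0 expR0 mulr1.
have Ic (k : R) : (\int[P]_w k%:E = k%:E)%E.
  rewrite (integral_cst P measurableT k%:E) -[RHS]mule1; congr (_ * _)%E.
  exact: (probability_setT P).
split.
  by rewrite /A -[RHS]Ic; apply: eq_integral => w _; rewrite /M /= Xx0.
rewrite /B -[RHS]Ic; apply: eq_integral => w _; rewrite /M /G /= mul0r addr0 Xx0.
by rewrite -powRD ?(gt_eqF x0_gt0) ?implybT//; congr (_ `^ _)%:E; ring.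
Qed.

(** Finiteness propagates along [AB_step] from the deterministic starting value x0^q. *)
Let AB_fin j : exists a b : R, [/\ A j = a%:E, B j = b%:E, 0 <= a & 0 <= b].
Proof.
have A0 k : (0 <= A k)%E by apply: integral_ge0 => w _; rewrite lee_fin powR_ge0.
have B0 k : (0 <= B k)%E by apply: integral_ge0 => w _; rewrite lee_fin.
elim: j => [|j [a [b [Aa Bb a0 b0]]]].
  by exists (x0 `^ q), (x0 `^ q); have [-> ->] := start; rewrite powR_ge0.
have := AB_step j; rewrite Aa Bb -!EFinM -EFinD => H.
have := A0 j.+1; have := B0 j.+1; move: H.
have cB : (0 <= c%:E * B j.+1)%E by rewrite mule_ge0// lee_fin ltW.
case: (A j.+1) => [a'| |] //; last by rewrite addye ?gt_eqF// ?(lt_le_trans _ cB).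
case: (B j.+1) => [b'| |] //; last by rewrite gt0_muley ?lte_fin// addey.
by move=> _ b'0 a'0; exists a', b'; split.
Qed.

Let Sum N := \sum_(j < N) (expR (- (r * (j%:R * h))) - expR (- (r * (j.+1%:R * h)))) * fine (A j).

(** The induction carries the discounted remainder A + c B: before the maximum is updated, B grows
    by exp (r h) in a step, and the discount takes this back, so only the part spent on A is
    lost. *)
Let Sum_le N : Sum N <= (1 + c) * x0 `^ q.
Proof.
suff : Sum N + expR (- (r * (N%:R * h))) * (fine (A N) + c * fine (B N)) <= (1 + c) * x0 `^ q.
  apply: le_trans; rewrite lerDl mulr_ge0 ?expR_ge0//.
  by have [a [b [-> -> a0 b0]]] := AB_fin N; rewrite addr_ge0// mulr_ge0// ltW.
elim: N => [|N IH].
  rewrite /Sum big_ord0 mul0r mulr0 oppr0 expR0 mul1r add0r.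
  by have [-> ->] := start; rewrite /= mulrDl mul1r.
rewrite /Sum big_ord_recr /= -/(Sum N).
have := AB_step N.
have [a [b [-> -> a0 b0]]] := AB_fin N.+1.
have [a1 [b1 [Aa1 Bb1 a10 b10]]] := AB_fin N.
rewrite Aa1 Bb1 /= -!EFinM -!EFinD lee_fin => H.
have := ler_wpM2l (expR_ge0 (- (r * (N.+1%:R * h)))) H.
have eE : expR (- (r * (N.+1%:R * h))) * expR (r * h) = expR (- (r * (N%:R * h))).
  by rewrite -expRD -natr1; congr expR; ring.
move: IH; rewrite Aa1 Bb1 /= -{}eE.
move: (expR (- (r * (N.+1%:R * h)))) (expR (r * h)) (Sum N) ((1 + c) * _) => e1 e2 s0 u.
by move=> *; lra.
Qed.

Let mint : measurable_fun [set x : TR | 0 <= x.2]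
  (fun x => expR (- r * (x.2 - 0)) * grid_max (X^~ x.1) 0 h (grid_floor 0 h x.2) `^ q).
Proof.
apply: measurable_funM; first exact: measurable_discount.
apply: (@measurable_fun_grid _ _ _ 0 h (fun j x => M j x.1 `^ q)) => // j.
exact: (measurableT_comp (mMp j q)).
Qed.

Lemma grid_max_moment :
  (\int[P \x leb]_(x in [set x | 0 <= x.2]%R)
    (expR (- r * (x.2 - 0)) * grid_max (X^~ x.1) 0 h (grid_floor 0 h x.2) `^ q)%:E <=
   ((1 + c) * x0 `^ q / r)%:E)%E.
Proof.
have f0 s w : 0 <= expR (- r * (s - 0)) * grid_max (X^~ w) 0 h (grid_floor 0 h s) `^ q.
  by rewrite mulr_ge0 ?expR_ge0 ?powR_ge0.
rewrite -(@integral_snd_from _ _ _ P 0 (fun s w => expR (- r * (s - 0)) * grid_max (X^~ w) 0 h (grid_floor 0 h s) `^ q))//.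
rewrite (integral_cells h0); last 2 first.
- exact: (measurable_fun_snd_from _ mint).
- by move=> s _; apply: integral_ge0 => w _; rewrite lee_fin.
have cell j : (\int[leb]_(s in `[(0 + j%:R * h)%R, (0 + j.+1%:R * h)%R[)
    \int[P]_w (expR (- r * (s - 0)) * grid_max (X^~ w) 0 h (grid_floor 0 h s) `^ q)%:E =
    (((expR (- (r * (j%:R * h))) - expR (- (r * (j.+1%:R * h)))) * fine (A j)) / r)%:E)%E.
  transitivity (\int[leb]_(s in `[(0 + j%:R * h)%R, (0 + j.+1%:R * h)%R[)
    (fine (A j) * expR (- r * (s - 0)))%:E)%E.
    apply: eq_integral => s; rewrite inE/= in_itv/= => sj.
    rewrite EFinM muleC.
    have -> : (fine (A j))%:E = A j by have [a [b [-> _ _ _]]] := AB_fin j.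
    rewrite /A -(ge0_integralZl_fin P (mMp j q) (expR_ge0 _) (fun w => powR_ge0 _ _)).
    by apply: eq_integral => w _; rewrite (grid_floor_eq h0 sj).
  rewrite integral_expR_cell ?gt_eqF//; last by rewrite ltrD2l ltr_pM2r// ltr_nat.
  by rewrite !add0r !subr0 !mulNr [fine _ * _]mulrC.
under eq_eseriesr do rewrite cell.
have dec j : expR (- (r * (j.+1%:R * h))) <= expR (- (r * (j%:R * h))).
  by rewrite ler_expR lerN2 ler_wpM2l ?(ltW r0)// ler_wpM2r ?(ltW h0)// ler_nat.
apply: lime_le.
  apply: is_cvg_nneseries => j _ _; rewrite lee_fin divr_ge0 ?(ltW r0)// mulr_ge0 ?subr_ge0//.
  by have [a [b [-> _ a0 _]]] := AB_fin j.
apply: nearW => N; rewrite sumEFin lee_fin -mulr_suml ler_pM2r ?invr_gt0// big_mkord.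
exact: Sum_le.
Qed.

Lemma measurable_grid_max_moment : measurable_fun [set x : TR | 0 <= x.2]
  (fun x => expR (- r * (x.2 - 0)) * grid_max (X^~ x.1) 0 h (grid_floor 0 h x.2) `^ q).
Proof. exact: mint. Qed.

End grid.

(** The bound of [grid_max_moment] does not depend on the mesh, so Fatou's lemma transfers it to the
    limit. *)
Lemma running_max_moment :
  (\int[P \x leb]_(x in [set x | 0 <= x.2]%R)
    (expR (- r * (x.2 - 0)) * msup (X^~ x.1) 0 x.2 `^ q)%:E < +oo)%E.
Proof.
pose h (m : nat) : R := m.+1%:R^-1.
have h0 m : 0 < h m by rewrite invr_gt0.
pose f_ m (x : TR) : \bar R :=
  (expR (- r * (x.2 - 0)) * grid_max (X^~ x.1) 0 (h m) (grid_floor 0 (h m) x.2) `^ q)%:E.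
have f_ge0 m x : (0 <= f_ m x)%E by rewrite lee_fin mulr_ge0 ?expR_ge0 ?powR_ge0.
have mf m : measurable_fun [set x : TR | 0 <= x.2] (f_ m).
  by apply/measurable_EFinP; exact: measurable_grid_max_moment.
apply: (@le_lt_trans _ _ ((1 + c) * x0 `^ q / r)%:E); last by rewrite ltry.
rewrite (_ : integral _ _ _ = \int[P \x leb]_(x in [set x | 0 <= x.2]%R) limn_einf (f_ ^~ x))%E.
  apply: le_trans (fatou _ (measurable_from 0) mf (fun m x _ => f_ge0 m x)) _.
  rewrite limn_einf_lim; apply: lime_le; first exact: is_cvg_einfs.
  apply: nearW => m; apply: le_trans (grid_max_moment (h0 m)).
  by apply: ereal_inf_lbound; exists m => //=.
apply: eq_integral => -[w s]; rewrite inE/= => s0.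
suff /cvg_limn_einf_sup[-> _] : f_ ^~ (w, s) @ \oo --> (expR (- r * (s - 0)) * msup (X^~ w) 0 s `^ q)%:E by [].
apply: cvg_EFin; first exact: nearW.
apply: cvgM; first exact: cvg_cst.
have M0 : 0 < msup (X^~ w) 0 s.
  by have := @msup_gbm_gt0 _ _ _ P F W hW x0 nu sg x0_gt0 0 s w (lexx 0) s0.
have gc : grid_max (X^~ w) 0 (h m) (grid_floor 0 (h m) s) @[m --> \oo] --> msup (X^~ w) 0 s.
  by apply: (grid_max_cvg (@cX w)) => //; exact: cvg_harmonic.
apply: (cvg_comp _ (fun x : R => x `^ q)); first exact: gc.
exact: powR_continuous_gt0.
Qed.

End running_max_moments.

Lemma within_unif_continuous {R : realType} (f : R -> R) (T e : R) :
  {within `[0, +oo[, continuous f} -> 0 < e ->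
  exists2 dl : R, 0 < dl & forall s t, 0 <= s -> 0 <= t -> t <= T -> `|s - t| < dl ->
    `|f s - f t| < e.
Proof.
move=> cf e0.
have e20 : 0 < e / 2 by rewrite divr_gt0.
have nc := (compact_near_coveringP (`[0, T]%classic : set R)).1 (@segment_compact R 0 T).
have [] := nc R (0^'+) (fun dl t => 0 <= t -> forall s, 0 <= s -> `|s - t| < dl ->
  `|f s - f t| < e) _.
  move=> x; rewrite /= in_itv/= => /andP[x0 xT].
  have [dl dl0 hdl] := within_itv_near cf x0 e20.
  exists ([set y | `|x - y| < dl / 2], [set y : R | 0 < y < dl / 2]) => /=.
    split; first by exists (dl / 2) => /=; rewrite ?divr_gt0.
    exists (dl / 2) => /=; first by rewrite divr_gt0.
    by move=> y /=; rewrite sub0r normrN => yd y0; rewrite y0 (le_lt_trans (ler_norm _) yd).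
  move=> [t y] /= [xt /andP[y0 yd]] t0 s s0 st.
  have tx : `|t - x| < dl by rewrite distrC (lt_trans xt)// ltr_pdivrMr// ltr_pMr// ltr1n.
  have sx : `|s - x| < dl.
    rewrite (le_lt_trans (ler_distD t _ _))// (splitr dl) ltrD// ?(lt_trans st)//.
    by rewrite distrC.
  rewrite (le_lt_trans (ler_distD (f x) _ _))// (splitr e) ltrD//; first exact: hdl.
  by rewrite distrC hdl.
move=> dl /= dl0 H; exists (dl / 2); first by rewrite divr_gt0.
move=> s t s0 t0 tT st; apply: (H (dl / 2)) => //=.
- by rewrite sub0r normrN gtr0_norm ?divr_gt0// ltr_pdivrMr// ltr_pMr// ltr1n.
- by rewrite divr_gt0.
- by rewrite in_itv/= t0.
Qed.

Section increments.
Context {R : realType} {d : measure_display} {Omega : measurableType d}.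
Variables (P : probability Omega R).
Local Notation TR := (Omega * measurableTypeR R)%type.
Local Notation leb := (@lebesgue_measure R).

(** Exchanges a sum up to the current cell for a series whose term l acts from the time (l + k) h
    on. With k = 0 a cell counts its own term, with k = 1 only the terms of earlier cells. *)
Lemma integral_grid_series (h : R) (k : nat) (g : nat -> TR -> R) : 0 < h ->
  (forall l, measurable_fun [set x : TR | (l + k)%:R * h <= x.2] (g l)) ->
  (forall l x, 0 <= x.2 -> 0 <= g l x) ->
  (\int[P \x leb]_(x in [set x | 0 <= x.2]%R)
     (\sum_(l < (grid_floor 0 h x.2).+1 - k) g l x)%:E =
   \sum_(l <oo) \int[P \x leb]_(x in [set x | (l + k)%:R * h <= x.2]%R) (g l x)%:E)%E.
Proof.
move=> h0 mg g0.
have lk0 l : 0 <= (l + k)%:R * h by rewrite mulr_ge0// ltW.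
pose G l := (fun x : TR => (g l x)%:E) \_ [set x : TR | (l + k)%:R * h <= x.2].
have mG l : measurable_fun setT (G l).
  apply/(measurable_restrictT _ (measurable_from _)).
  by apply/measurable_EFinP; exact: mg.
have G0 l x : (0 <= G l x)%E.
  by apply: erestrict_ge0 => y /= ay; rewrite lee_fin g0// (le_trans (lk0 l)).
transitivity (\int[P \x leb]_(x in [set x | 0 <= x.2]%R) \sum_(l <oo) G l x)%E.
  apply: eq_integral => x; rewrite inE/= => x0.
  have /andP[fl fu] := grid_floorP h0 x0; rewrite !add0r in fl fu.
  set N := ((grid_floor 0 h x.2).+1 - k)%N.
  rewrite (nneseries_split 0 N)// add0n [X in (_ + X)%E]eseries0 ?adde0; last first.
    move=> l Nl _; rewrite /G patchE memNset//= ; apply/negP; rewrite -ltNge.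
    apply: lt_le_trans fu _; rewrite ler_pM2r// ler_nat.
    by rewrite addnC -leq_subLR.
  rewrite big_mkord -sumEFin; apply: eq_bigr => l _.
  rewrite /G patchE mem_set//=; apply: le_trans fl; rewrite ler_pM2r// ler_nat.
  by have := ltn_ord l; rewrite /N ltn_subRL addnC ltnS.
rewrite integral_nneseries//; last 2 first.
- by apply: measurable_from.
- by move=> l; apply: measurable_funTS.
apply: eq_eseriesr => l _; rewrite integral_mkcond [RHS]integral_mkcond.
apply: eq_integral => x _; rewrite /G !patchE.
have [a0|a0] := boolP (x \in [set x : TR | (l + k)%:R * h <= x.2]); last by case: ifP.
by rewrite mem_set//=; move: a0; rewrite inE/=; exact: le_trans.
Qed.

Lemma integral_discounted (r t : R) (b : Omega -> R) : 0 < r ->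
  measurable_fun setT b -> (forall w, 0 <= b w) ->
  (\int[P \x leb]_(x in [set x | t <= x.2]%R) (expR (- r * x.2) * b x.1)%:E =
   (expR (- r * t) / r)%:E * \int[P]_w (b w)%:E)%E.
Proof.
move=> r0 mb b0.
have me : measurable_fun [set x : TR | t <= x.2] (fun x => expR (- r * x.2) * b x.1).
  apply: measurable_funTS; apply: measurable_funM; last exact: (measurableT_comp mb).
  by apply: measurableT_comp => //; exact: measurable_funM.
rewrite -(@integral_fst_from _ _ _ P t (fun s w => expR (- r * s) * b w))//; last first.
  by move=> s w _; rewrite mulr_ge0// expR_ge0.
rewrite -ge0_integralZl_fin// ?divr_ge0 ?expR_ge0 ?(ltW r0)//.
apply: eq_integral => w _.
have := @integral_expR_from R r t (b w * expR (- r * t)) r0 (mulr_ge0 (b0 w) (expR_ge0 _)).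
have -> : expR (- r * t) / r * b w = b w * expR (- r * t) / r by ring.
move=> <-; apply: eq_integral => s _; congr EFin.
by rewrite -mulrA -expRD mulrC; congr (_ * expR _); ring.
Qed.

End increments.

Lemma ratio_le_max {R : realType} (y z u v : R) : 0 < z -> 0 < y -> y <= v -> y <= u ->
  0 < v -> 0 < u -> y / u * (z / v) <= z / Num.max u v.
Proof.
move=> z0 y0 yv yu v0 u0; rewrite ler_pdivlMr; last by rewrite lt_max u0.
have [_|_] := leP u v.
  have -> : y / u * (z / v) * v = y / u * z by field; rewrite !gt_eqF.
  by rewrite ler_piMl ?(ltW z0)// ler_pdivrMr// mul1r.
have -> : y / u * (z / v) * u = y / v * z by field; rewrite !gt_eqF.
by rewrite ler_piMl ?(ltW z0)// ler_pdivrMr// mul1r.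
Qed.

(** * The drawdown ratio weighted by an increasing capacity *)

Section drawdown_of_capital.
Context {R : realType} {d : measure_display} {Omega : measurableType d}.
Variables (P : probability Omega R) (F : R -> set (set Omega)).
Variable W : R -> Omega -> R.
Hypotheses (hF : is_filtration F) (hW : is_brownian F P W).
Variables (x0 nu sg : R).
Hypothesis x0_gt0 : 0 < x0.
Local Notation fmeas := (filtration_measurable F).
Local Notation TR := (Omega * measurableTypeR R)%type.
Local Notation leb := (@lebesgue_measure R).
Local Notation X := (gbm W x0 nu sg).
Variables (n r : R).
Hypotheses (n1 : 1 < n) (r_growth : growth nu sg n = r) (r0 : 0 < r).
Hypothesis cr : growth nu sg 1 < r.

Let X_gt0 t w : 0 < X t w. Proof. exact: gbm_gt0. Qed.
Let cX w : {within `[0, +oo[, continuous (X^~ w)}. Proof. exact: (gbm_continuous hW). Qed.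
Let mX t : 0 <= t -> fmeas t (X t). Proof. exact: (gbm_fmeas hF hW). Qed.
Let M_gt0 t0 s w : 0 <= t0 -> t0 <= s -> 0 < msup (X^~ w) t0 s.
Proof. exact: (msup_gbm_gt0 hW). Qed.

Let disc (x : TR) := expR (- r * x.2).
Let ratio t0 (x : TR) := X x.2 x.1 / msup (X^~ x.1) t0 x.2.
(** The discounted mean, per unit of capacity, of a drawdown ratio restarted at 1. *)
Let kp := (1 - n^-1) / (r - growth nu sg 1).

Let mdisc (D : set TR) : measurable_fun D disc.
Proof.
by apply: measurable_funTS; apply: measurableT_comp => //; exact: measurable_funM.
Qed.

Let mratio t0 : 0 <= t0 -> measurable_fun [set x : TR | t0 <= x.2] (ratio t0).
Proof. by move=> t00; exact: (measurable_drawdown hF hW). Qed.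

Let ratio_ge0 t0 x : 0 <= t0 -> t0 <= x.2 -> 0 <= ratio t0 x.
Proof. by move=> t00 t0x; rewrite divr_ge0// ltW// M_gt0. Qed.

Let ratio_le1 t0 x : 0 <= t0 -> t0 <= x.2 -> ratio t0 x <= 1.
Proof.
move=> t00 t0x; rewrite ler_pdivrMr ?M_gt0// mul1r.
by apply: (msup_ub (@cX x.1)) => //; rewrite t0x lexx.
Qed.

Let ratio_mono t0 x : 0 <= t0 -> t0 <= x.2 -> ratio 0 x <= ratio t0 x.
Proof.
move=> t00 t0x; rewrite /ratio ler_pM2l// lef_pV2 ?posrE ?M_gt0//; last exact: le_trans t0x.
exact: (msup_monol (@cX x.1)).
Qed.

Let kp_ge0 : 0 <= kp.
Proof.
rewrite divr_ge0 ?subr_ge0 ?(ltW cr)// invf_le1 ?(ltW n1)//; exact: lt_trans n1.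
Qed.

Lemma discounted_drawdown_from (t : R) (b : Omega -> R) : 0 <= t -> fmeas t b ->
  (forall w, 0 <= b w) -> (\int[P]_w (b w)%:E < +oo)%E ->
  (\int[P \x leb]_(x in [set x | t <= x.2]%R) (disc x * ratio t x * b x.1)%:E =
   (kp * expR (- r * t) * fine (\int[P]_w (b w)%:E))%:E)%E.
Proof.
move=> t0 mb b0 bfin.
have mb' : measurable_fun setT b by exact: (filtration_measurable_fun hF t0).
have := expected_drawdown hF hW x0_gt0 n1 r_growth r0 cr t0 mb b0 bfin.
move=> H; rewrite [kp * _]mulrC -mulrA EFinM -/kp -H -ge0_integralZl//; last 3 first.
- exact: measurable_from.
- apply/measurable_EFinP; apply: measurable_funM; last exact: mratio.
  apply: measurable_funM; last exact: measurable_discount.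
  by apply: measurable_funTS; exact: (measurableT_comp mb').
- by move=> x /= tx; rewrite lee_fin mulr_ge0 ?ratio_ge0// mulr_ge0// expR_ge0.
apply: eq_integral => x _; rewrite -EFinM; congr EFin.
rewrite /disc /ratio.
have -> : - r * x.2 = - r * t + - r * (x.2 - t) by ring.
by rewrite expRD; ring.
Qed.

Variable A : R -> Omega -> R.
Hypotheses (mA : forall t, 0 <= t -> fmeas t (A t))
  (A0 : forall t w, 0 <= t -> 0 <= A t w)
  (A_incr : forall s t w, 0 <= s -> s <= t -> A s w <= A t w)
  (A_rc : forall w t, 0 <= t -> A x w @[x --> t^'+] --> A t w).
Let JA := (\int[P \x leb]_(x in [set x | 0 <= x.2]%R) (disc x * A x.2 x.1)%:E)%E.
Hypothesis JA_fin : (JA < +oo)%E.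

Let mAj : measurable_fun [set x : TR | 0 <= x.2] (fun x => A x.2 x.1).
Proof.
apply: joint_measurable => // t t0; apply: (filtration_measurable_fun hF t0); exact: mA.
Qed.

Let mA' t : 0 <= t -> measurable_fun setT (A t).
Proof. by move=> t0; apply: (filtration_measurable_fun hF t0); exact: mA. Qed.

Let mdA : measurable_fun [set x : TR | 0 <= x.2] (fun x => disc x * A x.2 x.1).
Proof. exact: measurable_funM. Qed.

Let A_fin t : 0 <= t -> (\int[P]_w (A t w)%:E < +oo)%E.
Proof.
move=> t0; have : ((expR (- r * t) / r)%:E * \int[P]_w (A t w)%:E < +oo)%E.
  rewrite -(integral_discounted P t r0 (mA' t0) (fun w => A0 w t0)); apply: le_lt_trans JA_fin.
  have s0 : [set x : TR | t <= x.2] `<=` [set x : TR | 0 <= x.2] by move=> x /=; exact: le_trans.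
  apply: (@le_trans _ _ (\int[P \x leb]_(x in [set x | t <= x.2]%R) (disc x * A x.2 x.1)%:E)%E).
    apply: ge0_le_integral.
    - exact: measurable_from.
    - by move=> x _; rewrite lee_fin mulr_ge0 ?expR_ge0 ?A0.
    - apply/measurable_EFinP; apply: measurable_funM; first exact: mdisc.
      by apply: measurable_funTS; exact: (measurableT_comp (mA' t0)).
    - by apply/measurable_EFinP; apply: measurable_funS mdA => //; exact: measurable_from.
    - by move=> x /= tx; rewrite lee_fin ler_wpM2l ?expR_ge0// A_incr.
  apply: ge0_subset_integral => //; [exact: measurable_from|exact: measurable_from| |].
  - by apply/measurable_EFinP.
  - by move=> x /= tx; rewrite lee_fin mulr_ge0 ?expR_ge0 ?A0.
have I0 : (0 <= \int[P]_w (A t w)%:E)%E by apply: integral_ge0 => w _; rewrite lee_fin A0.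
move: I0; case: (integral _ _ _) => [a| |] //= _.
  by move=> _; rewrite ltry.
by rewrite gt0_muley// lte_fin divr_gt0 ?expR_gt0.
Qed.

Section upper.
Variable h : R.
Hypothesis h0 : 0 < h.
(** The growth of A over the cell l, the first one taking in A 0 as well. It is known only at the
    right end (l + 1) h, and on the cell j the sum up to j lies above A. *)
Let b (l : nat) w := if l is l'.+1 then A (l.+1%:R * h) w - A (l%:R * h) w else A (1%:R * h) w.

Let th0 (l : nat) : 0 <= l%:R * h. Proof. by rewrite mulr_ge0// ltW. Qed.
Let thS (l : nat) : l%:R * h <= l.+1%:R * h. Proof. by rewrite ler_pM2r// ler_nat. Qed.

Let b0 l w : 0 <= b l w.
Proof. by case: l => [|l]; rewrite /b ?A0// subr_ge0 A_incr. Qed.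

Let b_le l w : b l w <= A (l.+1%:R * h) w.
Proof. by case: l => [|l]; rewrite /b// lerBlDr lerDl A0. Qed.

Let mb l : fmeas (l.+1%:R * h) (b l).
Proof.
case: l => [|l]; first exact: mA.
apply: measurable_funB; first exact: mA.
by apply: (filtration_measurableW hF _ _ (@mA _ _)).
Qed.

Let mb' l : measurable_fun setT (b l).
Proof. by apply: (filtration_measurable_fun hF (th0 l.+1)); exact: mb. Qed.

Let b_fin l : (\int[P]_w (b l w)%:E < +oo)%E.
Proof.
apply: le_lt_trans (A_fin (th0 l.+1)).
by apply: ge0_le_integral_fin => //; exact: mA'.
Qed.

Let sum_b j w : \sum_(l < j.+1) b l w = A (j.+1%:R * h) w.
Proof.
elim: j => [|j IH]; first by rewrite big_ord_recl big_ord0 addr0.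
by rewrite big_ord_recr /= IH; ring.
Qed.

(** Up to (l + 1) h the ratio is merely bounded by 1; from then on the increment is known, the
    supremum is restarted there, and the exact mean applies. The wasted cell accounts for the excess
    exp (r h) - 1. *)
Let term_le l :
  (\int[P \x leb]_(x in [set x | (l + 0)%:R * h <= x.2]%R) (disc x * ratio 0 x * b l x.1)%:E <=
   (r * kp + expR (r * h) - 1)%:E *
   \int[P \x leb]_(x in [set x | (l + 1)%:R * h <= x.2]%R) (disc x * b l x.1)%:E)%E.
Proof.
rewrite addn0 addn1.
set D := [set x : TR | l.+1%:R * h <= x.2].
set S := [set x : TR | l%:R * h <= x.2 < l.+1%:R * h].
have DE : [set x : TR | l%:R * h <= x.2] = S `|` D.
  apply/seteqP; split => x /=; last first.
    by move=> [/andP[]//|]; exact: le_trans.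
  by move=> lx; have [|xl] := leP (l.+1%:R * h) x.2; [right|left; rewrite /S/= lx].
have mD : measurable D by exact: measurable_from.
have mS : measurable S.
  rewrite (_ : S = [set x : TR | l%:R * h <= x.2] `\` D); first by apply: measurableD; exact: measurable_from.
  apply/seteqP; split => x /=; first by move=> /andP[xl /lt_geF xD]; split => //; rewrite /D/= xD.
  by rewrite /S/= => -[-> /negP]; rewrite -ltNge.
have SD : [disjoint S & D].
  by rewrite disj_set2E; apply/eqP/seteqP; split => // x [/= /andP[_ /lt_geF]]; rewrite /D/= => ->.
have mf1 : measurable_fun setT (fun x : TR => (disc x * b l x.1)%:E).
  apply/measurable_EFinP; apply: measurable_funM; first exact: mdisc.
  exact: (measurableT_comp (@mb' l)).
have mf2 t : 0 <= t -> measurable_fun [set x : TR | t <= x.2] (fun x : TR => (disc x * ratio t x * b l x.1)%:E).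
  move=> t0; apply/measurable_EFinP; apply: measurable_funM; first by apply: measurable_funM => //; exact: mratio.
  by apply: measurable_funTS; exact: (measurableT_comp (@mb' l)).
have f10 x : (0 <= (disc x * b l x.1)%:E)%E by rewrite lee_fin mulr_ge0 ?expR_ge0.
have f20 t x : 0 <= t -> t <= x.2 -> (0 <= (disc x * ratio t x * b l x.1)%:E)%E.
  by move=> t0 tx; rewrite lee_fin mulr_ge0// mulr_ge0 ?expR_ge0// ratio_ge0.
have S0 x : S x -> 0 <= x.2 by move=> /= /andP[+ _]; exact: le_trans.
have D0 x : D x -> 0 <= x.2 by exact: le_trans.
have SP : (\int[P \x leb]_(x in S) (disc x * b l x.1)%:E + \int[P \x leb]_(x in D) (disc x * b l x.1)%:E
   = (expR (- r * (l%:R * h)) / r)%:E * \int[P]_w (b l w)%:E)%E.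
  rewrite -ge0_integral_setU//; last by apply: measurable_funTS.
  by rewrite -DE integral_discounted.
have DP := integral_discounted P (l.+1%:R * h) r0 (@mb' l) (b0 l).
have DK := discounted_drawdown_from (th0 l.+1) (mb (l := l)) (b0 l) (b_fin l).
rewrite -/D in DP DK; rewrite DP.
rewrite DE ge0_integral_setU//; last 2 first.
- rewrite -DE; apply: measurable_funS (mf2 0 (lexx 0)); first exact: measurable_from.
  by move=> x /=; exact: le_trans.
- by move=> x [/S0|/D0] x00; exact: f20.
have le1 : (\int[P \x leb]_(x in S) (disc x * ratio 0 x * b l x.1)%:E <=
            \int[P \x leb]_(x in S) (disc x * b l x.1)%:E)%E.
  apply: ge0_le_integral => //.
  - by move=> x /S0 x00; exact: f20.
  - by apply: measurable_funS (mf2 0 (lexx 0)); [exact: measurable_from|exact: S0].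
  - exact: measurable_funTS.
  - move=> x /S0 x00; rewrite lee_fin ler_wpM2r// ler_piMr ?expR_ge0//; exact: ratio_le1.
have le2 : (\int[P \x leb]_(x in D) (disc x * ratio 0 x * b l x.1)%:E <=
            \int[P \x leb]_(x in D) (disc x * ratio (l.+1%:R * h) x * b l x.1)%:E)%E.
  apply: ge0_le_integral => //.
  - by move=> x /D0 x00; exact: f20.
  - by apply: measurable_funS (mf2 0 (lexx 0)); [exact: measurable_from|exact: D0].
  - exact: mf2.
  - move=> x Dx; rewrite lee_fin ler_wpM2r// ler_wpM2l ?expR_ge0//; exact: ratio_mono.
apply: le_trans (leeD le1 le2) _; rewrite DK.
move: SP; rewrite DP (ge0_integral_fin_num (b0 l) (b_fin l)).
move: (fine _) => B; rewrite -!EFinM => SP.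
have := fin_num_addl _; move: SP; case: (integral _ _ _) => [s| |]//.
rewrite -!EFinD => -[sE] _; rewrite lee_fin.
have -> : s = expR (- r * (l%:R * h)) / r * B - expR (- r * (l.+1%:R * h)) / r * B by rewrite -sE addrK.
have -> : expR (- r * (l%:R * h)) = expR (r * h) * expR (- r * (l.+1%:R * h)).
  by rewrite -expRD -natr1; congr expR; ring.
move: (expR (r * h)) (expR (- r * _)) => u v.
by rewrite le_eqVlt; apply/orP; left; apply/eqP; rewrite /=; field; rewrite gt_eqF.
Qed.

(** A lies between the sums of increments with k = 1 and with k = 0. The larger sum bounds the
    left-hand side from above, the smaller one the right-hand side from below. *)
Lemma discounted_drawdown_le_grid :
  (\int[P \x leb]_(x in [set x | 0 <= x.2]%R) (disc x * ratio 0 x * A x.2 x.1)%:E <=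
   (r * kp + expR (r * h) - 1)%:E * JA)%E.
Proof.
have m0 := measurable_from (T := Omega) (0:R).
have mbT l : measurable_fun setT (fun x : TR => b l x.1) by exact: (measurableT_comp (@mb' l)).
have C0 : 0 <= r * kp + expR (r * h) - 1.
  rewrite -addrA; apply: addr_ge0; first by rewrite mulr_ge0// ltW.
  by rewrite subr_ge0 -[leLHS]expR0 ler_expR mulr_ge0 ?(ltW r0)// ltW.
have g10 l x : 0 <= x.2 -> 0 <= disc x * ratio 0 x * b l x.1.
  by move=> x00; rewrite mulr_ge0// mulr_ge0 ?expR_ge0// ratio_ge0.
have g20 l x : 0 <= disc x * b l x.1 by rewrite mulr_ge0 ?expR_ge0.
have mg1 l : measurable_fun [set x : TR | (l + 0)%:R * h <= x.2] (fun x => disc x * ratio 0 x * b l x.1).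
  apply: measurable_funM; last exact: measurable_funTS.
  apply: measurable_funM => //; apply: measurable_funS (mratio (lexx 0)) => //.
  by move=> x /=; exact: le_trans.
have mg2 l : measurable_fun [set x : TR | (l + 1)%:R * h <= x.2] (fun x => disc x * b l x.1).
  by apply: measurable_funM => //; exact: measurable_funTS.
apply: (@le_trans _ _ (\int[P \x leb]_(x in [set x | 0 <= x.2]%R)
    (\sum_(l < (grid_floor 0 h x.2).+1 - 0) disc x * ratio 0 x * b l x.1)%:E)%E).
  apply: ge0_le_integral => //.
  - by move=> x /= x00; rewrite lee_fin mulr_ge0 ?A0// mulr_ge0 ?expR_ge0// ratio_ge0.
  - apply/measurable_EFinP; apply: measurable_funM => //.
    by apply: measurable_funM => //; exact: mratio.
  - apply/measurable_EFinP.
    rewrite (_ : (fun x => _) = (fun x : TR => disc x * ratio 0 x *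
      \sum_(l < (grid_floor 0 h x.2).+1 - 0) b l x.1)); last by apply/funext => x; rewrite mulr_sumr.
    apply: measurable_funM; first by apply: measurable_funM => //; exact: mratio.
    apply: (@measurable_fun_grid _ _ _ 0 h (fun j x => \sum_(l < j.+1 - 0) b l x.1)) => // j.
    exact: measurable_sum.
  - move=> x /= x00; rewrite lee_fin -mulr_sumr subn0 sum_b.
    apply: ler_wpM2l; first by rewrite mulr_ge0 ?expR_ge0 ?ratio_ge0.
    apply: A_incr => //; have /andP[_] := grid_floorP h0 x00.
    by rewrite add0r => /ltW.
rewrite (integral_grid_series _ h0 mg1 g10).
apply: (@le_trans _ _ (\sum_(l <oo) (r * kp + expR (r * h) - 1)%:E *
   \int[P \x leb]_(x in [set x | (l + 1)%:R * h <= x.2]%R) (disc x * b l x.1)%:E)%E).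
  apply: lee_nneseries => l _; last exact: term_le.
  by move=> _; apply: integral_ge0 => x /= lx; rewrite lee_fin g10// (le_trans _ lx).
rewrite nneseriesZl; last by move=> l _; apply: integral_ge0 => x _; rewrite lee_fin.
rewrite -(integral_grid_series _ h0 mg2 (fun l x _ => g20 l x)).
apply: lee_wpmul2l; first by rewrite lee_fin.
apply: ge0_le_integral => //.
- by move=> x /= x00; rewrite lee_fin sumr_ge0.
- apply/measurable_EFinP.
  apply: (@measurable_fun_grid _ _ _ 0 h (fun j x => \sum_(l < j.+1 - 1) (disc x * b l x.1))) => // j.
  by apply: measurable_sum => l; exact: measurable_funM.
- by apply/measurable_EFinP; exact: mdA.
- move=> x /= x00; rewrite lee_fin -mulr_sumr subn1/=.
  apply: ler_wpM2l; first exact: expR_ge0.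
  have := grid_floorP h0 x00; rewrite !add0r.
  case: (grid_floor 0 h x.2) => [|j]; first by rewrite big_ord0 A0.
  by rewrite sum_b => /andP[jx _]; exact: A_incr.
Qed.

End upper.

(* Capacity installed at time t faces X / sup_[0,s] X, at most X / sup_[t,s] X, whose discounted
   mean is kp times that of a constant. *)
Lemma discounted_drawdown_le :
  (\int[P \x leb]_(x in [set x | 0 <= x.2]%R) (disc x * ratio 0 x * A x.2 x.1)%:E <=
   (r * kp)%:E * JA)%E.
Proof.
have JA0 : (0 <= JA)%E.
  by apply: integral_ge0 => x /= xx; rewrite lee_fin mulr_ge0 ?A0// expR_ge0.
have := discounted_drawdown_le_grid.
move: JA0 JA_fin; case: JA => [a| |]// a0 _ H; rewrite lee_fin in a0.
apply/lee_addgt0Pr => e e0.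
have a1 : 0 < a + 1 by rewrite ltr_wpDl.
have e1 : 0 < e / (a + 1) by rewrite divr_gt0.
(* The mesh h = ln (1 + e / (a + 1)) / r is the one for which exp (r h) - 1 equals e / (a + 1). *)
have l0 : 0 < ln (1 + e / (a + 1)) by rewrite ln_gt0// ltrDl.
have := H (ln (1 + e / (a + 1)) / r); rewrite divr_gt0// => /(_ isT) /le_trans; apply.
rewrite [r * (_ / r)]mulrC divfK ?gt_eqF// lnK ?posrE ?addr_gt0//.
rewrite -!EFinM -EFinD lee_fin -addrA [1 + _ - 1]addrAC subrr add0r mulrDl lerD2l.
by rewrite -mulrA ler_piMr ?(ltW e0)// mulrC ler_pdivrMr// mul1r lerDl.
Qed.

Hypothesis A_cont : forall w, {within `[0, +oo[, continuous (A^~ w)}.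
Hypothesis A_flat : forall s t w, 0 <= s -> s <= t -> A s w < A t w ->
  msup (X^~ w) 0 s < msup (X^~ w) 0 t.

Let grid_increment h (l : nat) w :=
  if l is l'.+1 then A (l%:R * h) w - A (l'%:R * h) w else A 0 w.
Let grid_ratio0 h (l : nat) w := X (l%:R * h) w / msup (X^~ w) 0 (l%:R * h).
Let gridsum h (x : TR) := \sum_(l < (grid_floor 0 h x.2).+1 - 0)
  (grid_increment h l x.1 * grid_ratio0 h l x.1).

Section lower.
Variable h : R.
Hypothesis h0 : 0 < h.
Local Notation a := (grid_increment h).
Local Notation rho := (grid_ratio0 h).

Let th0 (l : nat) : 0 <= l%:R * h. Proof. by rewrite mulr_ge0// ltW. Qed.
Let thS (l : nat) : l%:R * h <= l.+1%:R * h. Proof. by rewrite ler_pM2r// ler_nat. Qed.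

Let a0 l w : 0 <= a l w.
Proof. by case: l => [|l]; rewrite /grid_increment ?A0// subr_ge0 A_incr. Qed.

Let rho0 l w : 0 <= rho l w.
Proof. by rewrite /grid_ratio0 divr_ge0// ltW// M_gt0. Qed.

Let rho1 l w : rho l w <= 1.
Proof. exact: (@ratio_le1 0 (w, l%:R * h) (lexx 0) (th0 l)). Qed.

Let ma l : fmeas (l%:R * h) (a l).
Proof.
case: l => [|l]; first by rewrite mul0r; exact: mA.
apply: measurable_funB; first exact: mA.
by apply: (filtration_measurableW hF _ _ (@mA _ _)).
Qed.

Let mar l : fmeas (l%:R * h) (fun w => a l w * rho l w).
Proof.
apply: measurable_funM; first exact: ma.
apply: measurable_funM; first exact: mX.
apply: measurable_funV_gt0; first by move=> w _; exact: M_gt0.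
apply: (msup_filtration_measurable hF) => //; exact: (gbm_continuous hW).
Qed.

Let mar' l : measurable_fun setT (fun w => a l w * rho l w).
Proof. by apply: (filtration_measurable_fun hF (th0 l)); exact: mar. Qed.

Let ma' l : measurable_fun setT (a l).
Proof. by apply: (filtration_measurable_fun hF (th0 l)); exact: ma. Qed.

Let ar_le l w : a l w * rho l w <= A (l%:R * h) w.
Proof.
apply: (@le_trans _ _ (a l w)); first by rewrite ler_piMr ?a0 ?rho1.
by case: l => [|l]; rewrite /grid_increment ?mul0r// lerBlDr lerDl A0.
Qed.

Let ar_fin l : (\int[P]_w (a l w * rho l w)%:E < +oo)%E.
Proof.
apply: le_lt_trans (A_fin (th0 l)).
apply: ge0_le_integral_fin => //; first exact: mA'.
by move=> w; rewrite mulr_ge0 ?a0 ?rho0.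
Qed.

Let sum_a j w : \sum_(l < j.+1) a l w = A (j%:R * h) w.
Proof.
elim: j => [|j IH]; first by rewrite big_ord_recl big_ord0 addr0 /= mul0r.
by rewrite big_ord_recr /= IH; ring.
Qed.

(** The supremum over [0, s] is the larger of those before and after l h, and X at l h lies below
    both of them. *)
Let msup_rho l x : l%:R * h <= x.2 -> rho l x.1 * ratio (l%:R * h) x <= ratio 0 x.
Proof.
move=> lx; rewrite /ratio /grid_ratio0.
have x00 : 0 <= x.2 by exact: le_trans lx.
rewrite (msup_cat (@cX x.1) (lexx 0) (th0 l) lx).
have := M_gt0 x.1 (lexx 0) (th0 l); have := M_gt0 x.1 (th0 l) lx.
have m1 := msup_ub (@cX x.1) (s := l%:R * h) (lexx 0) (a := 0) (b := l%:R * h).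
have m2 := msup_ub (@cX x.1) (s := l%:R * h) (th0 l) (a := l%:R * h) (b := x.2).
have {m1} : X (l%:R * h) x.1 <= msup (X^~ x.1) 0 (l%:R * h) by apply: m1; rewrite th0 lexx.
have {m2} : X (l%:R * h) x.1 <= msup (X^~ x.1) (l%:R * h) x.2 by apply: m2; rewrite lexx.
have := X_gt0 (l%:R * h) x.1; have := X_gt0 x.2 x.1.
move: (X (l%:R * h) x.1) (X x.2 x.1) (msup _ 0 _) (msup _ _ _) => y z u v z0 y0 yv yu v0 u0.
exact: ratio_le_max.
Qed.

Lemma gridsum_ge0 x : 0 <= gridsum h x.
Proof. by apply: sumr_ge0 => l _; rewrite mulr_ge0. Qed.

Let gridsum_le x : 0 <= x.2 -> gridsum h x <= A x.2 x.1.
Proof.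
move=> x00; apply: (@le_trans _ _ (A ((grid_floor 0 h x.2)%:R * h) x.1)).
  rewrite -sum_a /gridsum subn0; apply: ler_sum => l _.
  by rewrite ler_piMr ?a0 ?rho1.
apply: A_incr => //; have /andP[+ _] := grid_floorP h0 x00.
by rewrite add0r.
Qed.

Lemma measurable_gridsum : measurable_fun [set x : TR | 0 <= x.2] (fun x => disc x * gridsum h x).
Proof.
apply: measurable_funM => //.
apply: (@measurable_fun_grid _ _ _ 0 h (fun j x => \sum_(l < j.+1 - 0) (a l x.1 * rho l x.1))) => // j.
by apply: measurable_sum => l; exact: (measurableT_comp (@mar' l)).
Qed.

Lemma discounted_drawdown_ge_grid :
  ((r * kp)%:E * \int[P \x leb]_(x in [set x | 0 <= x.2]%R) (disc x * gridsum h x)%:E <=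
   \int[P \x leb]_(x in [set x | 0 <= x.2]%R) (disc x * ratio 0 x * A x.2 x.1)%:E)%E.
Proof.
have m0 := measurable_from (T := Omega) (0:R).
have maT l : measurable_fun setT (fun x : TR => a l x.1) by exact: (measurableT_comp (@ma' l)).
have marT l : measurable_fun setT (fun x : TR => a l x.1 * rho l x.1) by exact: (measurableT_comp (@mar' l)).
have C0 : 0 <= r * kp by rewrite mulr_ge0// ltW.
have g10 l x : 0 <= x.2 -> 0 <= disc x * ratio 0 x * a l x.1.
  by move=> x00; rewrite mulr_ge0// mulr_ge0 ?expR_ge0// ratio_ge0.
have g20 l x : 0 <= disc x * (a l x.1 * rho l x.1) by rewrite mulr_ge0 ?expR_ge0// mulr_ge0.
have mr l : measurable_fun [set x : TR | l%:R * h <= x.2] (ratio 0).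
  by apply: measurable_funS (mratio (lexx 0)) => // x /=; exact: le_trans.
have mg1 l : measurable_fun [set x : TR | (l + 0)%:R * h <= x.2] (fun x => disc x * ratio 0 x * a l x.1).
  rewrite addn0; apply: measurable_funM; last exact: measurable_funTS.
  exact: measurable_funM.
have mg2 l : measurable_fun [set x : TR | (l + 0)%:R * h <= x.2] (fun x => disc x * (a l x.1 * rho l x.1)).
  by apply: measurable_funM => //; exact: measurable_funTS.
under eq_integral do rewrite /gridsum mulr_sumr.
rewrite (integral_grid_series _ h0 mg2 (fun l x _ => g20 l x)).
rewrite -nneseriesZl; last by move=> l _; apply: integral_ge0 => x _; rewrite lee_fin.
apply: (@le_trans _ _ (\sum_(l <oo) \int[P \x leb]_(x in [set x | (l + 0)%:R * h <= x.2]%R)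
    (disc x * ratio 0 x * a l x.1)%:E)%E).
  apply: lee_nneseries => l _.
    by move=> _; rewrite mule_ge0 ?lee_fin//; apply: integral_ge0 => x _; rewrite lee_fin.
  rewrite addn0 (integral_discounted _ _ r0 (@mar' l)) => [|w]; last by rewrite mulr_ge0.
  have := discounted_drawdown_from (th0 l) (mar (l := l)) (fun w => mulr_ge0 (a0 l w) (rho0 l w)) (ar_fin l).
  have := ge0_integral_fin_num (fun w => mulr_ge0 (a0 l w) (rho0 l w)) (ar_fin l).
  move: (fine _) => B -> E.
  have -> : ((r * kp)%:E * ((expR (- r * (l%:R * h)) / r)%:E * B%:E) = (kp * expR (- r * (l%:R * h)) * B)%:E)%E.
    by rewrite -!EFinM; congr EFin; field; rewrite gt_eqF.
  rewrite -E; apply: ge0_le_integral.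
  - exact: measurable_from.
  - by move=> x /= lx; rewrite lee_fin; apply: mulr_ge0; [rewrite mulr_ge0 ?expR_ge0 ?ratio_ge0|exact: mulr_ge0].
  - apply/measurable_EFinP; apply: measurable_funM; last exact: measurable_funTS.
    by apply: measurable_funM => //; exact: mratio.
  - by have := mg1 l; rewrite addn0 => ?; apply/measurable_EFinP.
  - move=> x /= lx; rewrite lee_fin.
    have := ler_wpM2l (mulr_ge0 (expR_ge0 (- r * x.2)) (a0 l x.1)) (msup_rho lx); rewrite /disc.
    move: (ratio 0 x) (ratio _ x) (rho l x.1) (a l x.1) (expR _) => u1 u2 u3 u4 u5 K.
    rewrite [leRHS]mulrAC; apply: le_trans K.
    by rewrite le_eqVlt; apply/orP; left; apply/eqP; ring.
rewrite -(integral_grid_series _ h0 mg1 g10).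
apply: ge0_le_integral => //.
- by move=> x /= x00; rewrite lee_fin sumr_ge0// => l _; exact: g10.
- apply/measurable_EFinP.
  rewrite (_ : (fun x => _) = (fun x : TR => disc x * ratio 0 x *
    \sum_(l < (grid_floor 0 h x.2).+1 - 0) a l x.1)); last by apply/funext => x; rewrite mulr_sumr.
  apply: measurable_funM; first by apply: measurable_funM => //; exact: mratio.
  apply: (@measurable_fun_grid _ _ _ 0 h (fun j x => \sum_(l < j.+1 - 0) a l x.1)) => // j.
  exact: measurable_sum.
- apply/measurable_EFinP; apply: measurable_funM => //.
  by apply: measurable_funM => //; exact: mratio.
- move=> x /= x00; rewrite lee_fin -mulr_sumr subn0 sum_a.
  apply: ler_wpM2l; first by rewrite mulr_ge0 ?expR_ge0 ?ratio_ge0.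
  apply: A_incr => //; have /andP[+ _] := grid_floorP h0 x00.
  by rewrite add0r.
Qed.

(** If A grows over a cell, X sets a new maximum in it. At the right end X is then below its maximum
    by at most an oscillation over one mesh, so the damping factor is at least 1 - e. *)
Lemma gridsum_near e dl (x : TR) : 0 <= x.2 -> h < dl ->
  (forall s t, 0 <= s -> 0 <= t -> t <= x.2 -> `|s - t| < dl -> `|X s x.1 - X t x.1| < e * X 0 x.1) ->
  (1 - e) * A ((grid_floor 0 h x.2)%:R * h) x.1 <= gridsum h x <= A x.2 x.1.
Proof.
move=> x00 hdl H; rewrite gridsum_le// andbT -sum_a /gridsum subn0 mulr_sumr.
apply: ler_sum => l _; rewrite mulrC.
have /andP[+ _] := grid_floorP h0 x00; rewrite add0r => jx.
have lx : l%:R * h <= x.2.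
  by apply: le_trans jx; rewrite ler_pM2r// ler_nat -ltnS.
have [al0|al0] := ltP 0 (a l x.1); last first.
  by have /eqP -> : a l x.1 == 0; rewrite ?eq_le ?al0 ?a0// !mul0r.
rewrite ler_pM2l// /grid_ratio0 ler_pdivlMr ?M_gt0//.
have [u /andP[u0 ul] uM] := msup_attained (@cX x.1) (lexx 0) (th0 l).
have X0M : X 0 x.1 <= msup (X^~ x.1) 0 (l%:R * h).
  by apply: (msup_ub (@cX x.1)) => //; rewrite lexx th0.
(* The maximizer u has to lie in the last cell: a maximizer before that cell would contradict
   [A_flat]. *)
suff ulh : l%:R * h - u <= h.
  have := H u (l%:R * h) u0 (th0 l) lx.
  rewrite distrC ger0_norm ?subr_ge0// (le_lt_trans ulh hdl) => /(_ isT).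
  rewrite -uM => /(le_lt_trans (ler_norm _)) K.
  have e0 : 0 < e.
    have := le_lt_trans (normr_ge0 _) (H 0 0 (lexx 0) (lexx 0) x00 _).
    by rewrite subrr normr0 (lt_trans h0 hdl) => /(_ isT); rewrite pmulr_lgt0.
  have := ler_wpM2l (ltW e0) X0M; rewrite mulrBl mul1r => K'.
  by rewrite lerBlDr addrC -lerBlDr (le_trans _ K')// ltW.
move: al0 uM ul; case: (nat_of_ord l) => [|l'] al0 uM ul.
  by rewrite mul0r sub0r (le_trans _ (ltW h0))// oppr_le0.
rewrite leNgt; apply/negP => /= uh.
have ul' : u <= l'%:R * h.
  by move: uh; rewrite -natr1 mulrDl mul1r; move: (_ * h) => z; lra.
have := A_flat (th0 l') (thS l'); move: al0; rewrite /grid_increment subr_gt0 => al0 /(_ _ al0).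
rewrite uM ltNge; apply/negP/negPn.
by apply: (msup_ub (@cX x.1)) => //; rewrite u0.
Qed.

End lower.

(* Capacity is installed only when X is at its running maximum, so sup_[0,s] X = sup_[t,s] X. *)
Lemma discounted_drawdown_ge :
  ((r * kp)%:E * JA <=
   \int[P \x leb]_(x in [set x | 0 <= x.2]%R) (disc x * ratio 0 x * A x.2 x.1)%:E)%E.
Proof.
pose h (m : nat) : R := m.+1%:R^-1.
have h0 m : 0 < h m by rewrite invr_gt0.
have C0 : 0 <= r * kp by rewrite mulr_ge0// ltW.
pose f_ m (x : TR) : \bar R := (r * kp * (disc x * gridsum (h m) x))%:E.
have f_ge0 m x : (0 <= f_ m x)%E by rewrite lee_fin mulr_ge0// mulr_ge0 ?expR_ge0 ?gridsum_ge0.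
have mf m : measurable_fun [set x : TR | 0 <= x.2] (f_ m).
  by apply/measurable_EFinP; apply: measurable_funM => //; exact: measurable_gridsum.
rewrite /JA -ge0_integralZl//; last 3 first.
- exact: measurable_from.
- by apply/measurable_EFinP.
- by move=> x /= x00; rewrite lee_fin mulr_ge0 ?expR_ge0 ?A0.
rewrite (_ : integral _ _ _ = \int[P \x leb]_(x in [set x | 0 <= x.2]%R) limn_einf (f_ ^~ x))%E.
  apply: le_trans (fatou _ (measurable_from 0) mf (fun m x _ => f_ge0 m x)) _.
  rewrite limn_einf_lim; apply: lime_le; first exact: is_cvg_einfs.
  apply: nearW => m; apply: le_trans (discounted_drawdown_ge_grid (h0 m)).
  rewrite -ge0_integralZl//; last 3 first.
  - exact: measurable_from.
  - by apply/measurable_EFinP; exact: measurable_gridsum.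
  - by move=> x /= x00; rewrite lee_fin mulr_ge0 ?expR_ge0 ?gridsum_ge0.
  by apply: ereal_inf_lbound; exists m => //=.
apply: eq_integral => x; rewrite inE/= => x00.
suff /cvg_limn_einf_sup[-> _] : f_ ^~ x @ \oo --> (r * kp * (disc x * A x.2 x.1))%:E by [].
apply: cvg_EFin; first exact: nearW.
apply: cvgM; first exact: cvg_cst.
apply: cvgM; first exact: cvg_cst.
apply/cvgrPdist_le => e e0.
set a := A x.2 x.1.
have a0 : 0 <= a by exact: A0.
(* One half of e is for the damping, which costs at most e1 times A, the other half for the lag of A
   by one mesh. *)
pose e1 := e / 2 / (a + 1).
have e10 : 0 < e1 by rewrite !divr_gt0// ltr_wpDl.
have [dl dl0 hdl] := within_unif_continuous x.2 (@cX x.1) (mulr_gt0 e10 (X_gt0 0 x.1)).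
have e20 : 0 < e / 2 by rewrite divr_gt0.
have [dl2 dl20 hdl2] := within_itv_near (@A_cont x.1) x00 e20.
have : \forall m \near \oo, h m < Num.min dl dl2.
  have := @cvg_harmonic R; move/cvgrPdist_lt => /(_ (Num.min dl dl2)); rewrite lt_min dl0 dl20 => /(_ isT).
  apply: filterS => m /=; rewrite sub0r normrN ger0_norm//.
apply: filterS => m; rewrite lt_min => /andP[h1 h2].
have /andP[l1 l2] := gridsum_near (h0 m) x00 h1 hdl.
rewrite ger0_norm ?subr_ge0//.
have /andP[] := grid_floorP (h0 m) x00; rewrite !add0r.
set y := _%:R * h m => yx xy.
have y0 : 0 <= y by rewrite mulr_ge0// ltW.
have := hdl2 y y0; rewrite distrC ger0_norm ?subr_ge0// => /(_ _)/wrap[].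
  by apply: le_lt_trans h2; rewrite lerBlDl; move: xy; rewrite -natr1 mulrDl mul1r => /ltW.
rewrite distrC => /(le_lt_trans (ler_norm _)); rewrite -/a.
have : A y x.1 <= a by exact: A_incr.
have : e1 * (a + 1) = e / 2 by rewrite divfK// gt_eqF// ltr_wpDl.
move: l1; rewrite -/y -/a; move: (A y x.1) (gridsum (h m) x) => u v K1 K2 K3 K4.
have : e1 * u <= e1 * a by rewrite ler_wpM2l// ltW.
by move: K1 K2; rewrite mulrBl mul1r mulrDr mulr1; lra.
Qed.

End drawdown_of_capital.

(** * Aggregate capacity and shadow price *)

(** Truncation at 0 includes the boundary of [0, +oo[ in the statement. Differentiability of powers
    covers the positive points; the others need the direct estimate. *)
Lemma powR_max_continuous {R : realType} (e : R) : 0 < e ->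
  continuous (fun y : R => Num.max 0 y `^ e).
Proof.
move=> e0 y.
have cm : {for y, continuous (fun z : R => Num.max 0 z)}.
  by apply: continuous_max; [exact: cst_continuous|exact: cvg_id].
have [y0|y0] := ltP 0 y.
  apply: (cvg_comp _ (fun u : R => u `^ e) cm).
  by apply: powR_continuous_gt0; rewrite lt_max y0 orbT.
apply/cvgrPdist_lt => eps eps0.
have -> : Num.max 0 y `^ e = 0 by rewrite (max_l y0) powR0// gt_eqF.
near=> z; rewrite sub0r normrN ger0_norm ?powR_ge0//.
have [z0|z0] := ltP 0 z; last by rewrite powR0// gt_eqF.
have -> : eps = (eps `^ e^-1) `^ e by rewrite -powRrM mulVf ?gt_eqF// powRr1// ltW.
apply: gt0_ltr_powR => //; rewrite ?nnegrE ?powR_ge0 ?(ltW z0)//.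
near: z; exists (eps `^ e^-1) => /=; first by rewrite powR_gt0.
by move=> z /=; rewrite ltr_norml => /andP[]; move: (_ `^ _) => q; lra.
Unshelve. all: by end_near. Qed.

Lemma measurable_fun_powR {R : realType} {d} {T : measurableType d} (f g : T -> R) :
  (forall x, 0 < f x) -> measurable_fun setT f -> measurable_fun setT g ->
  measurable_fun setT (fun x => f x `^ g x).
Proof.
move=> f0 mf mg; rewrite (_ : (fun x => _) = (fun x => expR (g x * ln (f x)))).
  apply: measurableT_comp => //; apply: measurable_funM => //.
  exact: (measurableT_comp (@measurable_ln R)).
by apply/funext => x; rewrite /powR gt_eqF.
Qed.

Lemma Rintegral_gt0 {R : realType} {d} {T : measurableType d}
    (mu : {measure set T -> \bar R}) (D : set T) (f : T -> R) :
  measurable D -> (0 < mu D)%E -> mu.-integrable D (EFin \o f) ->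
  (forall x, D x -> 0 < f x) -> 0 < \int[mu]_(x in D) f x.
Proof.
move=> mD D0 fi f0.
have I0 : 0 <= \int[mu]_(x in D) f x by apply: Rintegral_ge0 => x /f0 /ltW.
rewrite lt_neqAle I0 andbT eq_sym; apply/eqP => E.
have /integrableP[mf _] := fi.
have : (\int[mu]_(x in D) `|(EFin \o f) x| = 0)%E.
  transitivity (\int[mu]_(x in D) (f x)%:E)%E.
    by apply: eq_integral => x; rewrite inE => /f0 /ltW fx; rewrite /= ger0_norm.
  have := integrable_fin_num mD fi; move: E; rewrite /Rintegral /=.
  by move: (integral _ _ _) => [z| |]//= ->.
move/(ae_eq_integral_abs mu mD mf) => [N [mN N0 sN]].
have : (mu D <= mu N)%E.
  apply: le_measure; rewrite ?inE// => x Dx; apply: sN => /= /(_ Dx) [] /eqP.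
  by rewrite gt_eqF// f0.
by rewrite N0 leNgt D0.
Qed.

Lemma ge0_integrable {R : realType} {d} {T : measurableType d}
    (mu : {measure set T -> \bar R}) (f : T -> R) :
  measurable_fun setT f -> (forall x, 0 <= f x) ->
  (\int[mu]_x (f x)%:E < +oo)%E -> mu.-integrable setT (EFin \o f).
Proof.
move=> mf f0 foo; apply/integrableP; split; first exact/measurable_EFinP.
by under eq_integral do rewrite /= ger0_norm//.
Qed.

Section capacity.
Context {R : realType} {d : measure_display} {I : measurableType d}.
Variables (iota : {measure set I -> \bar R}).
Variables (l A K e : I -> R) (b : R).
Hypotheses (l0 : forall i, 0 < l i) (A0 : forall i, 0 < A i) (K0 : forall i, 0 < K i)
  (e0 : forall i, 0 < e i) (b0 : 0 < b).
Hypotheses (ml : measurable_fun setT l) (mA : measurable_fun setT A)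
  (mK : measurable_fun setT K) (me : measurable_fun setT e).
Hypothesis lA_fin : (\int[iota]_i (l i * A i)%:E < +oo)%E.
Hypothesis lK_fin : forall q, 0 < q -> (\int[iota]_i (l i * (q * K i) `^ e i)%:E < +oo)%E.
Hypothesis iota0 : (0 < iota setT)%E.

Lemma measurable_capacity_power y : 0 <= y -> measurable_fun setT (fun i => (K i * y) `^ e i).
Proof.
rewrite le_eqVlt => /predU1P[<-|y0].
  rewrite (_ : (fun i => _) = cst 0)//; apply/funext => i.
  by rewrite mulr0 powR0// gt_eqF.
apply: measurable_fun_powR => //; first by move=> i; rewrite mulr_gt0.
exact: measurable_funM.
Qed.

Lemma integrable_capacity_floor : iota.-integrable setT (EFin \o (fun i => l i * A i)).
Proof.
apply: ge0_integrable => //; first exact: measurable_funM.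
by move=> i; rewrite mulr_ge0// ltW.
Qed.

Lemma integrable_capacity_power y : 0 <= y ->
  iota.-integrable setT (EFin \o (fun i => l i * (K i * y) `^ e i)).
Proof.
move=> y0; apply: ge0_integrable.
- by apply: measurable_funM => //; exact: measurable_capacity_power.
- by move=> i; rewrite mulr_ge0 ?powR_ge0// ltW.
move: y0; rewrite le_eqVlt => /predU1P[<-|y0].
  by under eq_integral do rewrite mulr0 powR0 ?gt_eqF// mulr0; rewrite integral0 ltry.
by under eq_integral do rewrite [K _ * y]mulrC; exact: lK_fin.
Qed.

Definition capacity_term (y : R) i := l i * Num.max (A i) ((K i * y) `^ e i).

Lemma capacity_term_gt0 y i : 0 < capacity_term y i.
Proof. by rewrite mulr_gt0// lt_max A0. Qed.

Lemma capacity_term_mono y z i : 0 <= y -> y <= z -> capacity_term y i <= capacity_term z i.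
Proof.
move=> y0 yz; rewrite ler_wpM2l ?(ltW (l0 _))// ge_max le_max lexx/= le_max.
by rewrite ge0_ler_powR ?orbT ?nnegrE ?mulr_ge0 ?(ltW (K0 _)) ?(ltW (e0 _)) ?(le_trans y0)// ler_wpM2l// ltW.
Qed.

Lemma integrable_capacity y : 0 <= y -> iota.-integrable setT (EFin \o capacity_term y).
Proof.
move=> y0.
apply: (le_integrable _ _ _ (integrableD _ integrable_capacity_floor (integrable_capacity_power y0))) => //.
  apply/measurable_EFinP; apply: measurable_funM => //; apply: measurable_maxr => //.
  exact: measurable_capacity_power.
move=> i _; rewrite /= lee_fin ger0_norm ?(ltW (capacity_term_gt0 _ _))//.
rewrite ger0_norm; last by rewrite addr_ge0// mulr_ge0 ?powR_ge0// ltW.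
rewrite -mulrDr ler_wpM2l ?(ltW (l0 _))// ge_max lerDl powR_ge0/= lerDr.
exact: ltW.
Qed.

Definition capacity (y : R) : R := b * \int[iota]_i capacity_term y i.

Lemma capacity_gt0 y : 0 <= y -> 0 < capacity y.
Proof.
move=> y0; rewrite mulr_gt0// Rintegral_gt0//; first exact: integrable_capacity.
by move=> i _; exact: capacity_term_gt0.
Qed.

Lemma capacity_mono y z : 0 <= y -> y <= z -> capacity y <= capacity z.
Proof.
move=> y0 yz; rewrite ler_wpM2l ?(ltW b0)//; apply: le_Rintegral => //.
- exact: integrable_capacity.
- by apply: integrable_capacity; exact: le_trans yz.
- by move=> i _; exact: capacity_term_mono.
Qed.

Lemma Rintegral_max_continuous (f : R -> I -> R) :
  (forall y, 0 <= y -> iota.-integrable setT (EFin \o f y)) ->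
  (forall i, continuous (fun y : R => f (Num.max 0 y) i)) ->
  (forall y, 0 <= y -> exists2 g, iota.-integrable setT (EFin \o g) &
     forall z i, 0 <= z -> z <= y -> `|f z i| <= g i) ->
  continuous (fun y : R => \int[iota]_i f (Num.max 0 y) i).
Proof.
move=> fi cf fg y.
have [|g ig gf] := fg (Num.max 0 (y + 1)); first by rewrite le_max lexx.
have yI : y \in [set` `](y - 1), (y + 1)[] by rewrite inE/= in_itv/=; apply/andP; split; lra.
apply: (@continuity_under_integral _ _ _ iota (fun y i => f (Num.max 0 y) i) setT _ (y - 1) (y + 1)
   _ _ g ig _ y yI) => //.
- by move=> x _; apply: fi; rewrite le_max lexx.
- by apply: aeW => i _ x _; exact: cf.
- move=> x /=; rewrite in_itv/= => /andP[_ xy].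
  apply: aeW => i _; apply: gf; first by rewrite le_max lexx.
  by rewrite ge_max le_max lexx/= le_max (ltW xy) orbT.
Qed.

Lemma capacity_continuous : continuous (fun y : R => capacity (Num.max 0 y)).
Proof.
move=> y; apply: cvgM; first exact: cvg_cst.
apply: (Rintegral_max_continuous integrable_capacity).
- move=> i z; apply: cvgM; first exact: cvg_cst.
  apply: (@continuous_max _ _ (cst (A i)) (fun y : R => (K i * Num.max 0 y) `^ e i));
    first exact: cst_continuous.
  rewrite (_ : (fun y => _) = (fun y : R => K i `^ e i * Num.max 0 y `^ e i)).
    by apply: cvgM; [exact: cvg_cst|exact: powR_max_continuous].
  by apply/funext => u; rewrite powRM// ?le_max ?lexx// ltW.
- move=> z z0; exists (capacity_term z); first exact: integrable_capacity.
  by move=> x i x0 xz; rewrite ger0_norm ?(ltW (capacity_term_gt0 _ _))// capacity_term_mono.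
Qed.

(** For e_i >= s and y >= 1 one has (K_i y)^e_i >= K_i^e_i y^s, and the types concerned have
    positive mass, whence k > 0. *)
Lemma capacity_growth (s : R) : 0 <= s -> (0 < iota [set i | s <= e i]%R)%E ->
  exists2 k : R, 0 < k & forall y, 1 <= y -> k * y `^ s <= capacity y.
Proof.
move=> s0 D0; set D := [set i | s <= e i] in D0 *.
have mD : measurable D.
  rewrite (_ : D = e @^-1` `[s, +oo[); last by apply/seteqP; split => i /=; rewrite in_itv/= andbT.
  by rewrite -[X in measurable X]setTI; exact: me.
have iD y : 0 <= y -> iota.-integrable D (EFin \o (fun i => l i * (K i * y) `^ e i)).
  by move=> y0; apply: integrableS (integrable_capacity_power y0).
set k := \int[iota]_(i in D) (l i * (K i * 1) `^ e i).
have k0 : 0 < k.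
  apply: Rintegral_gt0 => //; first exact: iD.
  by move=> i _; rewrite mulr_gt0// powR_gt0// mulr_gt0.
exists (b * k); first by rewrite mulr_gt0.
move=> y y1; have y0 : 0 <= y by exact: le_trans y1.
rewrite -mulrA ler_wpM2l ?(ltW b0)// mulrC -RintegralZl//; last exact: iD.
apply: (@le_trans _ _ (\int[iota]_(i in D) capacity_term y i)).
  apply: le_Rintegral => //.
  - by have := integrableZl mD (y `^ s) (iD 1 ler01).
  - by apply: integrableS (integrable_capacity y0).
  - move=> i Di; rewrite mulrCA ler_wpM2l ?(ltW (l0 _))// le_max; apply/orP; right.
    rewrite mulr1 powRM ?(ltW (K0 _))// mulrC ler_wpM2l ?powR_ge0//.
    exact: ler_powR.
rewrite [leLHS]Rintegral_mkcond; apply: le_Rintegral => //.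
- have := (integrable_mkcond _ mD).1 (integrableS measurableT mD (@subsetT _ _) (integrable_capacity y0)).
  by rewrite restrict_EFin.
- exact: integrable_capacity.
- by move=> i _; rewrite patchE; case: ifP => // _; rewrite ltW// capacity_term_gt0.
Qed.

End capacity.

(** * The shadow price and the residual demand *)

Section shadow_price.
Context {R : realType}.
Variables (capacity : R -> R) (ga : R).
Hypothesis ga0 : 0 < ga.
Hypotheses (capacity_gt0 : forall y, 0 <= y -> 0 < capacity y)
  (capacity_mono : forall y z, 0 <= y -> y <= z -> capacity y <= capacity z)
  (capacity_continuous : continuous (fun y : R => capacity (Num.max 0 y))).

Let powR_capacity_mono y z : 0 <= y -> y <= z -> capacity y `^ ga <= capacity z `^ ga.
Proof.
move=> y0 yz; apply: ge0_ler_powR; rewrite ?nnegrE ?(ltW ga0)//.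
- exact/ltW/capacity_gt0.
- exact/ltW/capacity_gt0/(le_trans y0).
- exact: capacity_mono.
Qed.

Let powR_capacity_gt0 y s : 0 <= y -> 0 < capacity y `^ s.
Proof. by move=> y0; rewrite powR_gt0// capacity_gt0. Qed.

Definition shadow_demand (y : R) : R := y * capacity y `^ ga.

Lemma shadow_demand_mono y z : 0 <= y -> y < z -> shadow_demand y < shadow_demand z.
Proof.
move=> y0 yz; have z0 : 0 < z by exact: le_lt_trans yz.
rewrite /shadow_demand; apply: (@le_lt_trans _ _ (y * capacity z `^ ga)).
  by rewrite ler_wpM2l// powR_capacity_mono// ltW.
by rewrite ltr_pM2r// powR_capacity_gt0// ltW.
Qed.

Lemma shadow_demand_le y z : 0 <= y -> y <= z -> shadow_demand y <= shadow_demand z.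
Proof.
move=> y0; rewrite le_eqVlt => /predU1P[->//|yz].
by rewrite ltW// shadow_demand_mono.
Qed.

Lemma shadow_demand_continuous : continuous (fun y : R => shadow_demand (Num.max 0 y)).
Proof.
move=> y; apply: cvgM.
  by apply: continuous_max; [exact: cst_continuous|exact: cvg_id].
apply: (cvg_comp _ (fun u : R => u `^ ga) (@capacity_continuous y)).
by apply: powR_continuous_gt0; rewrite capacity_gt0// le_max lexx.
Qed.

Lemma shadow_demand_ge y : 0 <= y -> y * capacity 0 `^ ga <= shadow_demand y.
Proof.
by move=> y0; rewrite ler_wpM2l// powR_capacity_mono.
Qed.

Lemma shadow_demand_onto x : 0 <= x -> exists2 y, 0 <= y & shadow_demand y = x.
Proof.
move=> x0; have k0 : 0 < capacity 0 `^ ga by exact: powR_capacity_gt0.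
pose u := x / capacity 0 `^ ga.
have u0 : 0 <= u by rewrite divr_ge0// ltW.
have [|||y] := @IVT R (fun y => shadow_demand (Num.max 0 y)) 0 u x.
- exact: u0.
- by apply: continuous_subspaceT; exact: shadow_demand_continuous.
- rewrite ge_min le_max maxxx {1}/shadow_demand mul0r x0/=; apply/orP; right.
  apply: le_trans (shadow_demand_ge _); last by rewrite le_max lexx.
  by rewrite (max_r u0) divfK// gt_eqF.
- rewrite in_itv/= => /andP[y0 _]; rewrite (max_r y0) => yx.
  by exists y.
Qed.

(** For x >= 0 [xget] picks the unique preimage under [shadow_demand]; 0 is the default value
    elsewhere. *)
Definition shadow_price (x : R) : R := xget 0 [set y | 0 <= y /\ shadow_demand y = x].

Lemma shadow_priceP x : 0 <= x ->
  0 <= shadow_price x /\ shadow_demand (shadow_price x) = x.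
Proof.
move=> x0; rewrite /shadow_price; case: xgetP => [y -> []//|].
by have [y y0 yx] := shadow_demand_onto x0 => /(_ y) [].
Qed.

Lemma shadow_priceK y : 0 <= y -> shadow_price (shadow_demand y) = y.
Proof.
move=> y0; have s0 : 0 <= shadow_demand y by rewrite mulr_ge0// powR_ge0.
have [u0 uE] := shadow_priceP s0; move: u0 uE; move: (shadow_price _) => u u0 uE.
apply/eqP; case: (ltgtP u y) => // H.
  by have := shadow_demand_mono u0 H; rewrite uE ltxx.
by have := shadow_demand_mono y0 H; rewrite uE ltxx.
Qed.

Lemma shadow_price_mono x z : 0 <= x -> x < z -> shadow_price x < shadow_price z.
Proof.
move=> x0 xz; have [u0 uE] := shadow_priceP x0.
have [v0 vE] := shadow_priceP (le_trans x0 (ltW xz)).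
by rewrite ltNge; apply/negP => /(shadow_demand_le v0); rewrite uE vE leNgt xz.
Qed.

Lemma shadow_price_le x z : 0 <= x -> x <= z -> shadow_price x <= shadow_price z.
Proof.
move=> x0; rewrite le_eqVlt => /predU1P[->//|xz].
by rewrite ltW// shadow_price_mono.
Qed.

Lemma shadow_price_gt0 x : 0 < x -> 0 < shadow_price x.
Proof.
move=> x0; apply: le_lt_trans (shadow_price_mono (lexx 0) x0).
by have [] := shadow_priceP (lexx 0).
Qed.

Definition residual_demand (x : R) : R := capacity (shadow_price x) `^ (- ga).

Lemma residual_demand_gt0 x : 0 <= x -> 0 < residual_demand x.
Proof.
by move=> x0; apply: powR_capacity_gt0; have [] := shadow_priceP x0.
Qed.

Lemma mul_residual_demand x : 0 <= x -> x * residual_demand x = shadow_price x.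
Proof.
move=> x0; have [u0 uE] := shadow_priceP x0.
rewrite /residual_demand -{1}uE /shadow_demand -mulrA -powRD.
  by rewrite subrr powRr0 mulr1.
by rewrite (gt_eqF (capacity_gt0 u0)) implybT.
Qed.

Lemma residual_demand_anti x z : 0 <= x -> x <= z -> residual_demand z <= residual_demand x.
Proof.
move=> x0 xz; have [u0 uE] := shadow_priceP x0.
have [v0 vE] := shadow_priceP (le_trans x0 xz).
have uv : shadow_price x <= shadow_price z by exact: shadow_price_le.
rewrite /residual_demand; move: uv u0 v0; move: (shadow_price x) (shadow_price z) => u v uv u0 v0.
by rewrite !powRN lef_pV2 ?posrE ?powR_capacity_gt0// powR_capacity_mono.
Qed.

(** As capacity increases, [shadow_demand] expands distances by a factor of at least
    [capacity 0 ^ ga]. *)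
Lemma shadow_price_lipschitz x z : 0 <= x -> x <= z ->
  shadow_price z - shadow_price x <= capacity 0 `^ (- ga) * (z - x).
Proof.
move=> x0 xz; have [] := shadow_priceP x0.
have [] := shadow_priceP (le_trans x0 xz).
have := shadow_price_le x0 xz.
move: (shadow_price x) (shadow_price z) => u v uv v0 vE u0 uE.
have k0 := powR_capacity_gt0 ga (lexx 0).
rewrite powRN ler_pdivlMl// -uE -vE /shadow_demand.
have h1 := powR_capacity_mono (lexx 0) u0; have h2 := powR_capacity_mono u0 uv.
rewrite -subr_ge0 in uv; have := ler_wpM2l uv h1; have := ler_wpM2l v0 h2.
by move: (capacity 0 `^ ga) (capacity u `^ ga) (capacity v `^ ga) => p q s; lra.
Qed.

Lemma shadow_price_continuous : continuous (fun x : R => shadow_price (Num.max 0 x)).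
Proof.
have k0 : 0 < capacity 0 `^ (- ga) by exact: powR_capacity_gt0.
have lip (x z : R) : `|shadow_price (Num.max 0 x) - shadow_price (Num.max 0 z)| <=
    capacity 0 `^ (- ga) * `|x - z|.
  wlog xz : x z / x <= z.
    by move=> H; case: (leP x z) => [/H//|/ltW/H]; rewrite distrC [`|z - x|]distrC.
  have mxz : Num.max 0 x <= Num.max 0 z by rewrite ge_max !le_max lexx xz orbT.
  have m0 : 0 <= Num.max 0 x by rewrite le_max lexx.
  rewrite distrC [`|x - z|]distrC !ger0_norm ?subr_ge0//; last exact: shadow_price_le.
  apply: le_trans (shadow_price_lipschitz m0 mxz) _; rewrite ler_pM2l//.
  by have [?|?] := leP 0 x; have [?|?] := leP 0 z; move: xz; lra.
move=> x; apply/cvgrPdist_lt => eps eps0.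
exists (eps / capacity 0 `^ (- ga)) => /=; first by rewrite divr_gt0.
by move=> z /= xz; apply: le_lt_trans (lip x z) _; rewrite mulrC -ltr_pdivlMr.
Qed.

Lemma residual_demand_continuous : continuous (fun x : R => residual_demand (Num.max 0 x)).
Proof.
move=> x; have m0 : 0 <= Num.max 0 x by rewrite le_max lexx.
have cc : capacity (Num.max 0 (shadow_price (Num.max 0 z))) @[z --> x] -->
    capacity (Num.max 0 (shadow_price (Num.max 0 x))).
  exact: (cvg_comp _ (fun u : R => capacity (Num.max 0 u)) (@shadow_price_continuous x)
           (@capacity_continuous _)).
have mE (z : R) : Num.max 0 (shadow_price (Num.max 0 z)) = shadow_price (Num.max 0 z).
  by rewrite max_r//; have [] := @shadow_priceP (Num.max 0 z); rewrite ?le_max ?lexx.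
rewrite (_ : (fun z => _) = (fun z : R => capacity (Num.max 0 (shadow_price (Num.max 0 z))) `^ (- ga))).
  have cp := @powR_continuous_gt0 R (- ga) _ (capacity_gt0 _).
  by apply: (cvg_comp _ (fun u : R => u `^ (- ga)) cc); apply: cp; rewrite le_max lexx.
by apply/funext => z; rewrite mE.
Qed.

(** For y >= 1 the demand x = y capacity(y)^ga is at least of order y^(1 + ga s); inverting gives
    the exponent, and prices below 1 are absorbed in the constant. *)
Lemma shadow_price_growth (s k : R) : 0 <= s -> 0 < k ->
  (forall y, 1 <= y -> k * y `^ s <= capacity y) ->
  exists2 C : R, 0 < C & forall x, 0 <= x -> shadow_price x <= C * (1 + x `^ (1 + ga * s)^-1).
Proof.
move=> s0 k0 kap_ge.
pose th := (1 + ga * s)^-1.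
have th0 : 0 < 1 + ga * s by rewrite ltr_wpDr// mulr_ge0// ltW.
pose c := (k `^ ga)^-1.
have c0 : 0 < c by rewrite invr_gt0 powR_gt0.
exists (1 + c `^ th); first by rewrite ltr_wpDr// powR_ge0.
move=> x x0; have [] := shadow_priceP x0; move: (shadow_price x) => u u0 uE.
rewrite -/th.
have [u1|u1] := leP u 1.
  apply: (le_trans u1); rewrite -[leLHS]mulr1 ler_pM// lerDl powR_ge0//.
have xge : u `^ (1 + ga * s) <= c * x.
  rewrite -ler_pdivrMl// invrK -uE /shadow_demand powRD ?(gt_eqF (lt_trans ltr01 u1)) ?implybT//.
  rewrite powRr1// mulrCA ler_wpM2l// mulrC [ga * s]mulrC powRrM mulrC -powRM ?powR_ge0 ?(ltW k0)//.
  apply: ge0_ler_powR; rewrite ?nnegrE ?(ltW ga0)//.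
  - by rewrite mulr_ge0 ?powR_ge0// ltW.
  - exact/ltW/capacity_gt0.
  - exact/kap_ge/ltW.
have : u <= (c * x) `^ th.
  rewrite -[leLHS](@powRr1 _ u)// -(mulfV (lt0r_neq0 th0)) powRrM.
  apply: ge0_ler_powR => //; rewrite ?nnegrE ?powR_ge0 ?invr_ge0 ?(ltW th0)//.
  by rewrite mulr_ge0// ltW.
move/le_trans; apply; rewrite powRM ?(ltW c0)// mulrDr mulr1 mulrDl mul1r.
by rewrite addrA lerDr !addr_ge0 ?powR_ge0.
Qed.

End shadow_price.

(** * Differences of convex functions *)

Section convex_on.
Context {R : realType}.
Implicit Types (D : set R) (f u : R -> R).

Definition convex_on D f := forall x y t, D x -> D y -> 0 <= t -> t <= 1 ->
  f (t * x + (1 - t) * y) <= t * f x + (1 - t) * f y.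

Definition convex_domain D := forall x y t, D x -> D y -> 0 <= t -> t <= 1 ->
  D (t * x + (1 - t) * y).

Lemma convex_domain_ge0 : convex_domain `[0, +oo[.
Proof.
move=> x y t /=; rewrite !in_itv/= !andbT => x0 y0 t0 t1.
by rewrite addr_ge0// mulr_ge0// subr_ge0.
Qed.

Lemma convex_domain_itv (a b : R) : convex_domain `[a, b].
Proof.
move=> x y t /=; rewrite !in_itv/= => /andP[ax xb] /andP[ay yb] t0 t1.
have t1' : 0 <= 1 - t by rewrite subr_ge0.
have := ler_wpM2l t0 ax; have := ler_wpM2l t0 xb; have := ler_wpM2l t1' ay; have := ler_wpM2l t1' yb.
by move=> *; apply/andP; split; lra.
Qed.

Lemma convex_on_function f : convex_on `[0, +oo[ f ->
  convex_function (`[0, +oo[%classic : set R) f.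
Proof.
move=> cf t x y; rewrite !inE => x0 y0.
exact: (cf x y t%:num).
Qed.

Lemma convex_onS D D' f : D' `<=` D -> convex_on D f -> convex_on D' f.
Proof. by move=> DD' cf x y t /DD' ? /DD' ?; exact: cf. Qed.

Lemma convex_on_cst D (k : R) : convex_on D (fun=> k).
Proof. by move=> x y t _ _ _ _; rewrite le_eqVlt; apply/orP; left; apply/eqP; ring. Qed.

Lemma convex_onD D f u : convex_on D f -> convex_on D u -> convex_on D (fun x => f x + u x).
Proof.
by move=> cf cu x y t Dx Dy t0 t1; have := cf _ _ _ Dx Dy t0 t1; have := cu _ _ _ Dx Dy t0 t1; lra.
Qed.

Lemma convex_onZ D f k : 0 <= k -> convex_on D f -> convex_on D (fun x => k * f x).
Proof.
move=> k0 cf x y t Dx Dy t0 t1; have := ler_wpM2l k0 (cf _ _ _ Dx Dy t0 t1).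
by rewrite mulrDr ![k * (_ * _)]mulrCA.
Qed.

Lemma convex_on_max D f u : convex_on D f -> convex_on D u ->
  convex_on D (fun x => Num.max (f x) (u x)).
Proof.
move=> cf cu x y t Dx Dy t0 t1; rewrite ge_max; have t1' : 0 <= 1 - t by rewrite subr_ge0.
apply/andP; split.
  by apply: le_trans (cf _ _ _ Dx Dy t0 t1) _; rewrite lerD// ler_wpM2l// le_max lexx.
by apply: le_trans (cu _ _ _ Dx Dy t0 t1) _; rewrite lerD// ler_wpM2l// le_max lexx orbT.
Qed.

Lemma convex_on_powR e : 1 <= e -> convex_on `[0, +oo[ (fun x => x `^ e).
Proof.
move=> e1 x y t x0 y0 t0 t1.
have := @convex_powR R e e1 (Itv01 t0 t1) x y.
by rewrite !inE => /(_ x0 y0); rewrite !convRE.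
Qed.

Lemma concave_on_powR e : 0 < e -> e <= 1 -> convex_on `[0, +oo[ (fun x => - x `^ e).
Proof.
move=> e0 e1 x y t; rewrite /= !in_itv/= !andbT => x0 y0 t0 t1.
have t1' : 0 <= 1 - t by rewrite subr_ge0.
have H : convex_on `[0, +oo[ (fun x : R => x `^ e^-1) by apply: convex_on_powR; rewrite invf_ge1.
have := H (x `^ e) (y `^ e) t; rewrite /= !in_itv/= !andbT !powR_ge0 => /(_ isT isT t0 t1).
rewrite -!powRrM mulfV ?gt_eqF// !powRr1// => {}H.
suff : t * x `^ e + (1 - t) * y `^ e <= (t * x + (1 - t) * y) `^ e by lra.
rewrite -[leLHS](@powRr1 _ (t * x `^ e + _)); last by rewrite addr_ge0// mulr_ge0// powR_ge0.
rewrite -[X in _ `^ X <= _](mulVf (lt0r_neq0 e0)) powRrM.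
by apply: ge0_ler_powR => //; rewrite ?nnegrE ?powR_ge0 ?(ltW e0)// addr_ge0// mulr_ge0.
Qed.

(** A line supporting f at z averages to f z over every convex combination equal to z. A combination
    equal to 0 involves only points that are 0 or have weight 0. *)
Lemma subgradient_convex f : (forall z, 0 < z -> exists p, forall x, 0 <= x ->
  f z + p * (x - z) <= f x) -> convex_on `[0, +oo[ f.
Proof.
move=> H x y t; rewrite /= !in_itv/= !andbT => x0 y0 t0 t1.
have t1' : 0 <= 1 - t by rewrite subr_ge0.
set z := t * x + (1 - t) * y.
have z0 : 0 <= z by rewrite addr_ge0// mulr_ge0.
move: z0; rewrite le_eqVlt => /predU1P[z0|/H[p Hp]].
  have /eqP : t * x + (1 - t) * y = 0 by [].
  rewrite paddr_eq0 ?mulr_ge0// !mulf_eq0 => /andP[/orP[/eqP t0'|/eqP x0'] h2].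
    by move: z0 h2; rewrite /z t0' !mul0r !add0r subr0 oner_eq0/= !mul1r => <- _.
  case/orP: h2 => [/eqP t1''|/eqP y0'].
    by rewrite -z0 x0' t1'' !mul0r !addr0 (_ : t = 1) ?mul1r//; apply/esym/eqP; rewrite -subr_eq0; apply/eqP.
  rewrite -z0 x0' y0'; rewrite -mulrDl addrC subrK mul1r//.
have := ler_wpM2l t0 (Hp x x0); have := ler_wpM2l t1' (Hp y y0).
have E : t * (x - z) + (1 - t) * (y - z) = 0 by rewrite /z; ring.
have : p * (t * (x - z) + (1 - t) * (y - z)) = 0 by rewrite E mulr0.
by move: (f z) (f x) (f y) => a1 a2 a3; rewrite !mulrDr; lra.
Qed.

(* A convex function with slopes in [-L, 0] lies above its tangents, so that
   adding L u1 absorbs the defect of convexity of u1 - u2. *)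
Lemma convex_comp_difference D (psi u1 u2 : R -> R) (L : R) :
  convex_domain D -> convex_on D u1 -> convex_on D u2 ->
  (forall z, D z -> exists p, [/\ - L <= p, p <= 0 & forall x, D x ->
     psi (u1 z - u2 z) + p * ((u1 x - u2 x) - (u1 z - u2 z)) <= psi (u1 x - u2 x)]) ->
  convex_on D (fun x => psi (u1 x - u2 x) + L * u1 x).
Proof.
move=> cD c1 c2 H x y t Dx Dy t0 t1; have t1' : 0 <= 1 - t by rewrite subr_ge0.
have [p [Lp p0 Hp]] := H _ (cD _ _ _ Dx Dy t0 t1).
have := ler_wpM2l t0 (Hp x Dx); have := ler_wpM2l t1' (Hp y Dy).
have := c1 _ _ _ Dx Dy t0 t1; have := c2 _ _ _ Dx Dy t0 t1.
move: (t * x + (1 - t) * y) => z.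
have [Lp' p0'] : 0 <= p + L /\ 0 <= - p by split; lra.
move=> d2 d1; have := ler_wpM2l p0' d2; have := ler_wpM2l Lp' d1; clear d1 d2 Hp.
move: (psi (u1 x - u2 x)) (psi (u1 y - u2 y)) (psi (u1 z - u2 z)) => a1 a2 a3.
move: (u1 x) (u1 y) (u1 z) (u2 x) (u2 y) (u2 z) => b1 b2 b3 d1 d2 d3.
by rewrite !mulrDr !mulrDl; lra.
Qed.

Lemma ln_le_sub1 (x : R) : 0 < x -> ln x <= x - 1.
Proof.
by move=> x0; have := @le_ln1Dx R (x - 1); rewrite addrCA subrr addr0; apply; lra.
Qed.

Lemma lnN_tangent (v w : R) : 0 < v -> 0 < w -> - ln v + (- v^-1) * (w - v) <= - ln w.
Proof.
move=> v0 w0; have := ln_le_sub1 (divr_gt0 w0 v0); rewrite ln_div ?posrE// => H.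
have -> : - v^-1 * (w - v) = 1 - w / v by field; rewrite gt_eqF.
by move: H; lra.
Qed.

Lemma powRN_tangent (ga v w : R) : 0 <= ga -> 0 < v -> 0 < w ->
  v `^ (- ga) + (- (ga * v `^ (- ga - 1))) * (w - v) <= w `^ (- ga).
Proof.
move=> ga0 v0 w0; have r0 := divr_gt0 w0 v0.
have -> : w = w / v * v by rewrite divfK// gt_eqF.
rewrite powRM ?(ltW r0) ?(ltW v0)//.
have -> : v `^ (- ga - 1) = v `^ (- ga) / v.
  by rewrite powRD ?(gt_eqF v0) ?implybT// powR_inv1// ltW.
have h : 1 - ga * (w / v - 1) <= (w / v) `^ (- ga).
  rewrite /powR (gt_eqF r0); apply: le_trans (expR_ge1Dx _).
  by have := ler_wpM2l ga0 (ln_le_sub1 r0); lra.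
have := ler_wpM2r (powR_ge0 v (- ga)) h; move: (v `^ _) ((w / v) `^ _) => p q.
have -> : w / v * v - v = (w / v - 1) * v by ring.
have -> : - (ga * (p / v)) * ((w / v - 1) * v) = - ga * (w / v - 1) * p by field; rewrite gt_eqF.
by move: (w / v) => z; lra.
Qed.

Lemma difference_of_convexP (f u1 u2 : R -> R) :
  convex_on `[0, +oo[ u1 -> convex_on `[0, +oo[ u2 ->
  {within `[0, +oo[, continuous u1} -> {within `[0, +oo[, continuous u2} ->
  (forall x, 0 <= x -> f x = u1 x - u2 x) -> difference_of_convex f.
Proof.
move=> c1 c2 k1 k2 fE; exists u1, u2; split => //; exact: convex_on_function.
Qed.

Lemma within_continuous_max (u : R -> R) : continuous (fun x : R => u (Num.max 0 x)) ->
  {within `[0, +oo[, continuous u}.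
Proof.
move=> cu; apply: (@subspace_eq_continuous _ _ _ (fun x : R => u (Num.max 0 x))).
  by move=> x; rewrite inE/= in_itv/= andbT => x0; rewrite max_r.
exact: continuous_subspaceT.
Qed.

End convex_on.

Section capacity_difference.
Context {R : realType} {d : measure_display} {I : measurableType d}.
Variables (iota : {measure set I -> \bar R}).
Variables (l A K e : I -> R) (b : R).
Hypotheses (l0 : forall i, 0 < l i) (A0 : forall i, 0 < A i) (K0 : forall i, 0 < K i)
  (e0 : forall i, 0 < e i) (b0 : 0 < b).
Hypotheses (ml : measurable_fun setT l) (mA : measurable_fun setT A)
  (mK : measurable_fun setT K) (me : measurable_fun setT e).
Hypothesis lA_fin : (\int[iota]_i (l i * A i)%:E < +oo)%E.
Hypothesis lK_fin : forall q, 0 < q -> (\int[iota]_i (l i * (q * K i) `^ e i)%:E < +oo)%E.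
Hypothesis iota0 : (0 < iota setT)%E.

Let pw y i := (K i * y) `^ e i.
(* For e < 1, max (A, pw) = max (A - pw, 0) + pw with pw concave. *)
Let f1 y i := l i * (if 1 <= e i then Num.max (A i) (pw y i) else Num.max (A i - pw y i) 0).
Let f2 y i := l i * (if 1 <= e i then 0 else - pw y i).

Let pw_ge0 y i : 0 <= pw y i. Proof. exact: powR_ge0. Qed.

Let f1_ge0 y i : 0 <= f1 y i.
Proof.
by rewrite mulr_ge0 ?(ltW (l0 _))//; case: ifP => _; rewrite le_max ?lexx ?orbT// ltW.
Qed.

Let f1_le y i : f1 y i <= capacity_term l A K e y i.
Proof.
rewrite ler_wpM2l ?(ltW (l0 _))//; case: ifP => _ //.
by rewrite ge_max !le_max lerBlDr lerDl pw_ge0 (ltW (A0 _)).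
Qed.

Let m1e : measurable_fun setT (fun i => 1 <= e i).
Proof. by apply: measurable_fun_ler. Qed.

Let mf1 y : 0 <= y -> measurable_fun setT (f1 y).
Proof.
move=> y0; have mp := measurable_capacity_power K0 e0 mK me y0.
apply: measurable_funM => //; apply: measurable_fun_ifT => //.
  exact: measurable_maxr.
by apply: measurable_maxr => //; exact: measurable_funB.
Qed.

Let mf2 y : 0 <= y -> measurable_fun setT (f2 y).
Proof.
move=> y0; have mp := measurable_capacity_power K0 e0 mK me y0.
apply: measurable_funM => //; apply: measurable_fun_ifT => //.
exact: measurableT_comp.
Qed.

Let if1 y : 0 <= y -> iota.-integrable setT (EFin \o f1 y).
Proof.
move=> y0; have ic := integrable_capacity l0 A0 K0 e0 ml mA mK me lA_fin lK_fin y0.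
apply: (le_integrable _ _ _ ic) => //; first by apply/measurable_EFinP; exact: mf1.
move=> i _; rewrite /= lee_fin !ger0_norm//.
by rewrite ltW// capacity_term_gt0.
Qed.

Let f2_le y i : `|f2 y i| <= l i * pw y i.
Proof.
rewrite normrM gtr0_norm// ler_wpM2l ?(ltW (l0 _))//; case: ifP => _; rewrite ?normr0//.
by rewrite normrN ger0_norm.
Qed.

Let if2 y : 0 <= y -> iota.-integrable setT (EFin \o f2 y).
Proof.
move=> y0; have ic := integrable_capacity_power l0 K0 e0 ml mK me lK_fin y0.
apply: (le_integrable _ _ _ ic) => //; first by apply/measurable_EFinP; exact: mf2.
move=> i _; rewrite /= lee_fin [leRHS]ger0_norm ?f2_le//.
by rewrite mulr_ge0 ?powR_ge0 ?(ltW (l0 _)).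
Qed.

Let pw_convex i : 1 <= e i -> convex_on `[0, +oo[ (pw ^~ i).
Proof.
move=> e1 x y t x0 y0 t0 t1; have c := @convex_on_powR R _ e1 (K i * x) (K i * y) t.
move: x0 y0 c; rewrite /= !in_itv/= !andbT => x0 y0.
rewrite !mulr_ge0 ?(ltW (K0 _))// => /(_ isT isT t0 t1); apply: le_trans.
by rewrite /pw (_ : K i * _ = t * (K i * x) + (1 - t) * (K i * y))//; ring.
Qed.

Let pw_concave i : e i < 1 -> convex_on `[0, +oo[ (fun y => - pw y i).
Proof.
move=> e1 x y t x0 y0 t0 t1; have c := @concave_on_powR R _ (e0 i) (ltW e1) (K i * x) (K i * y) t.
move: x0 y0 c; rewrite /= !in_itv/= !andbT => x0 y0.
rewrite !mulr_ge0 ?(ltW (K0 _))// => /(_ isT isT t0 t1); apply: le_trans.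
by rewrite /pw (_ : K i * _ = t * (K i * x) + (1 - t) * (K i * y))//; ring.
Qed.

Let f1_convex i : convex_on `[0, +oo[ (f1 ^~ i).
Proof.
rewrite /f1; case: leP => e1; apply: convex_onZ; rewrite ?(ltW (l0 _))//; apply: convex_on_max.
- exact: convex_on_cst.
- exact: pw_convex.
- apply: convex_onD; last exact: pw_concave.
  exact: convex_on_cst.
- exact: convex_on_cst.
Qed.

Let f2_convex i : convex_on `[0, +oo[ (f2 ^~ i).
Proof.
rewrite /f2; case: leP => e1; apply: convex_onZ; rewrite ?(ltW (l0 _))//.
- exact: convex_on_cst.
- exact: pw_concave.
Qed.

Let convex_on_Rintegral (f : R -> I -> R) :
  (forall y, 0 <= y -> iota.-integrable setT (EFin \o f y)) ->
  (forall i, convex_on `[0, +oo[ (f ^~ i)) ->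
  convex_on `[0, +oo[ (fun y => \int[iota]_i f y i).
Proof.
move=> fi fc x y t x0 y0 t0 t1.
have z0 := convex_domain_ge0 x0 y0 t0 t1.
move: (x0) (y0) (z0); rewrite /= !in_itv/= !andbT => x0' y0' z0'.
rewrite -!RintegralZl//; [|exact: fi|exact: fi].
have iZ k u : 0 <= u -> iota.-integrable setT (EFin \o (fun i => k * f u i)).
  by move=> u0; have := integrableZl measurableT k (fi u u0).
rewrite -RintegralD//; [|exact: iZ|exact: iZ].
apply: le_Rintegral => //; first exact: fi.
  by have := integrableD measurableT (iZ t x x0') (iZ (1 - t) y y0').
by move=> i _; exact: fc.
Qed.

Let pw_cont i : continuous (fun y : R => pw (Num.max 0 y) i).
Proof.
move=> z; rewrite (_ : (fun y => _) = (fun y : R => K i `^ e i * Num.max 0 y `^ e i)).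
  by apply: cvgM; [exact: cvg_cst|exact: powR_max_continuous].
by apply/funext => u; rewrite /pw powRM// ?le_max ?lexx// ltW.
Qed.

Lemma capacity_difference : exists u1 u2 : R -> R,
  [/\ convex_on `[0, +oo[ u1, convex_on `[0, +oo[ u2,
      {within `[0, +oo[, continuous u1}, {within `[0, +oo[, continuous u2} &
      forall y, 0 <= y -> capacity iota l A K e b y = u1 y - u2 y].
Proof.
have mono y z i : 0 <= z -> z <= y -> pw z i <= pw y i.
  move=> z0 zy; apply: ge0_ler_powR; rewrite ?nnegrE ?mulr_ge0 ?(ltW (e0 _)) ?(ltW (K0 _))//.
  - exact: le_trans zy.
  - by rewrite ler_wpM2l// ltW.
exists (fun y => b * \int[iota]_i f1 y i), (fun y => b * \int[iota]_i f2 y i); split.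
- by apply: convex_onZ; rewrite ?(ltW b0)//; apply: convex_on_Rintegral.
- by apply: convex_onZ; rewrite ?(ltW b0)//; apply: convex_on_Rintegral.
- apply: within_continuous_max => y; apply: cvgM; first exact: cvg_cst.
  apply: (Rintegral_max_continuous if1).
  + move=> i z; apply: cvgM; first exact: cvg_cst.
    case: leP => _.
      apply: (@continuous_max _ _ (cst (A i)) (fun y : R => pw (Num.max 0 y) i)); first exact: cst_continuous.
      exact: pw_cont.
    apply: (@continuous_max _ _ (fun y : R => A i - pw (Num.max 0 y) i) (cst 0)); last exact: cst_continuous.
    by apply: cvgB; [exact: cvg_cst|exact: pw_cont].
  + move=> z z0; exists (capacity_term l A K e z); first exact: integrable_capacity.
    move=> x i x0 xz; rewrite ger0_norm//; apply: le_trans (f1_le _ _) _.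
    exact: capacity_term_mono.
- apply: within_continuous_max => y; apply: cvgM; first exact: cvg_cst.
  apply: (Rintegral_max_continuous if2).
  + move=> i z; apply: cvgM; first exact: cvg_cst.
    case: leP => _; first exact: cvg_cst.
    by apply: cvgN; exact: pw_cont.
  + move=> z z0; exists (fun i => l i * pw z i); first exact: integrable_capacity_power.
    move=> x i x0 xz; apply: le_trans (f2_le _ _) _.
    by rewrite ler_wpM2l ?(ltW (l0 _))// mono.
- move=> y y0; rewrite -mulrBr -RintegralB//; [|exact: if1|exact: if2].
  congr (_ * _); apply: eq_Rintegral => i _; rewrite -mulrBr; congr (_ * _).
  case: leP => _; first by rewrite subr0.
  rewrite opprK -/(pw y i); case: leP => h1; case: leP => h2; move: h1 h2; lra.
Qed.

End capacity_difference.

(** On v >= k the slopes of v^(-ga) lie in [-L, 0] with L = ga k^(-ga - 1); this is where the lower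
    bound on u enters. *)
Lemma difference_of_convex_powRN {R : realType} (f u u1 u2 : R -> R) (ga k : R) :
  0 <= ga -> 0 < k -> (forall x, 0 <= x -> k <= u x) ->
  convex_on `[0, +oo[ u1 -> convex_on `[0, +oo[ u2 ->
  {within `[0, +oo[, continuous u1} -> continuous (fun x : R => u (Num.max 0 x)) ->
  (forall x, 0 <= x -> u x = u1 x - u2 x) ->
  (forall x, 0 <= x -> f x = u x `^ (- ga)) -> difference_of_convex f.
Proof.
move=> ga0 k0 ku c1 c2 k1 cu uE fE.
pose L := ga * k `^ (- ga - 1).
have L0 : 0 <= L by rewrite mulr_ge0// powR_ge0.
have kL1 : {within `[0, +oo[, continuous (fun x => L * u1 x)}.
  by move=> x; apply: cvgM; [exact: cvg_cst|exact: k1].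
have cp : {within `[0, +oo[, continuous (fun x => u x `^ (- ga))}.
  apply: within_continuous_max => x.
  apply: (cvg_comp _ (fun v : R => v `^ (- ga)) (cu x)); apply: powR_continuous_gt0.
  by apply: lt_le_trans (ku _ _); rewrite // le_max lexx.
apply: (@difference_of_convexP _ _ (fun x => u x `^ (- ga) + L * u1 x) (fun x => L * u1 x)).
- move=> x y t x0 y0 t0 t1.
  have := @convex_comp_difference R `[0, +oo[ (fun v => v `^ (- ga)) u1 u2 L
    (@convex_domain_ge0 R) c1 c2 _ x y t x0 y0 t0 t1.
  have z0 := convex_domain_ge0 x0 y0 t0 t1.
  move: x0 y0 z0; rewrite /= !in_itv/= !andbT => x0 y0 z0.
  rewrite -!uE//; apply => z; rewrite /= in_itv/= andbT => zz.
  have kz := ku z zz; have z1 : 0 < u z by exact: lt_le_trans kz.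
  exists (- (ga * u z `^ (- ga - 1))); split.
  + rewrite lerN2 ler_wpM2l//.
    have -> : - ga - 1 = - (ga + 1) by ring.
    rewrite !powRN lef_pV2 ?posrE ?powR_gt0//.
    by apply: ge0_ler_powR; rewrite ?nnegrE ?(ltW k0) ?(ltW z1)// addr_ge0.
  + by rewrite oppr_le0 mulr_ge0// powR_ge0.
  + move=> v; rewrite in_itv/= andbT => v0; rewrite -!uE//.
    by apply: powRN_tangent => //; exact: lt_le_trans (ku v v0).
- exact: convex_onZ.
- by move=> x; apply: cvgD; [exact: cp|exact: kL1].
- exact: kL1.
- by move=> x x0; rewrite fE// addrK.
Qed.

(** * Left slopes of convex functions *)

Section slopes.
Context {R : realType}.
Variables (D : set R) (f : R -> R).
Hypotheses (cD : convex_domain D) (cf : convex_on D f).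

Lemma convex_three_chords x z w : D x -> D w -> x < z -> z < w ->
  (f z - f x) / (z - x) <= (f w - f z) / (w - z).
Proof.
move=> Dx Dw xz zw; have zx0 : 0 < z - x by rewrite subr_gt0.
have wz0 : 0 < w - z by rewrite subr_gt0.
have wx0 : 0 < w - x by rewrite subr_gt0 (lt_trans xz).
pose t := (w - z) / (w - x).
have t0 : 0 <= t by rewrite divr_ge0// ltW.
have t1 : t <= 1 by rewrite ler_pdivrMr// mul1r lerD2l lerN2 ltW.
have := cf Dx Dw t0 t1.
have -> : t * x + (1 - t) * w = z by rewrite /t; field; rewrite gt_eqF.
rewrite -(ler_pM2r wx0).
have -> : (t * f x + (1 - t) * f w) * (w - x) = (w - z) * f x + (z - x) * f w.
  by rewrite /t; field; rewrite gt_eqF.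
by rewrite ler_pdivrMr// mulrAC ler_pdivlMr//; lra.
Qed.

Lemma convex_left_chords x y z : D x -> D z -> x < y -> y < z ->
  (f z - f x) / (z - x) <= (f z - f y) / (z - y).
Proof.
move=> Dx Dz xy yz; have xz := lt_trans xy yz.
have := convex_three_chords Dx Dz xy yz.
have a0 : 0 < y - x by rewrite subr_gt0.
have b0 : 0 < z - y by rewrite subr_gt0.
have c0 : 0 < z - x by rewrite subr_gt0.
by rewrite !ler_pdivrMr// mulrAC ler_pdivlMr// mulrAC ler_pdivlMr//; lra.
Qed.

(** Chords ending at z get steeper as their left end approaches z, so at an interior point this
    supremum is the left derivative. *)
Definition left_slope z := sup [set (f z - f x) / (z - x) | x in [set x | D x /\ x < z]].

Section interior.
Variables (x0 z w0 : R).
Hypotheses (Dx0 : D x0) (Dw0 : D w0) (Dz : D z) (xz : x0 < z) (zw : z < w0).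

Lemma left_slope_ub x : D x -> x < z -> (f z - f x) / (z - x) <= left_slope z.
Proof.
move=> Dx xz'; apply: ub_le_sup; last by exists x.
exists ((f w0 - f z) / (w0 - z)) => _ [y [Dy yz] <-].
exact: convex_three_chords.
Qed.

Lemma left_slope_le_right w : D w -> z < w -> left_slope z <= (f w - f z) / (w - z).
Proof.
move=> Dw zw'; apply: ge_sup; first by exists ((f z - f x0) / (z - x0)), x0.
by move=> _ [y [Dy yz] <-]; exact: convex_three_chords.
Qed.

Lemma left_slope_subgradient x : D x -> f z + left_slope z * (x - z) <= f x.
Proof.
move=> Dx; have [xz'|zx|->] := ltgtP x z.
- have := left_slope_ub Dx xz'; rewrite ler_pdivrMr ?subr_gt0//; lra.
- have := left_slope_le_right Dx zx; rewrite ler_pdivlMr ?subr_gt0//; lra.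
- by rewrite subrr mulr0 addr0.
Qed.

Lemma left_slope_cvg : h^-1 * (f (z + h) - f z) @[h --> 0^'-] --> left_slope z.
Proof.
apply/cvgrPdist_le => e e0.
have : left_slope z - e < left_slope z by rewrite ltrBlDr ltrDl.
have hs : has_sup [set (f z - f x) / (z - x) | x in [set x | D x /\ x < z]].
  split; first by exists ((f z - f x0) / (z - x0)), x0.
  by exists (left_slope z) => _ [y [Dy yz] <-]; exact: left_slope_ub.
move=> /(sup_gt hs.1)[_ [x1 [Dx1 x1z] <-] hx1].
have z1 : 0 < z - x1 by rewrite subr_gt0.
near=> h.
have h0 : h < 0 by near: h; exact: nbhs_left_lt.
have hz : x1 < z + h.
  by rewrite -ltrBlDl; near: h; apply: nbhs_left_gt; rewrite subr_lt0.
have zh : z + h < z by rewrite gtrDl.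
have Dzh : D (z + h).
  have -> : z + h = - h / (z - x1) * x1 + (1 - - h / (z - x1)) * z by field; rewrite gt_eqF.
  apply: cD => //; first by rewrite divr_ge0 ?oppr_ge0 ?(ltW h0)// ltW.
  by rewrite ler_pdivrMr// mul1r; move: hz; lra.
have -> : h^-1 * (f (z + h) - f z) = (f z - f (z + h)) / (z - (z + h)).
  by rewrite (_ : z - (z + h) = - h); [field; rewrite lt_eqF|ring].
have H1 := convex_left_chords Dx1 Dz hz zh.
have H2 := left_slope_ub Dzh zh.
by rewrite ger0_norm ?subr_ge0//; move: hx1 H1 H2; lra.
Unshelve. all: by end_near. Qed.

End interior.

Lemma left_slope_mono x0 z1 z2 w0 : D x0 -> D z1 -> D z2 -> D w0 ->
  x0 < z1 -> z1 < z2 -> z2 < w0 -> left_slope z1 <= left_slope z2.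
Proof.
move=> Dx0 D1 D2 Dw0 xz z12 zw.
apply: le_trans (left_slope_le_right Dx0 xz D2 z12) _.
exact: (left_slope_ub Dw0 zw).
Qed.

End slopes.

(** Convexity of u^p is applied to w1 / a and w2 / c with the weights t a / x and (1 - t) c / x,
    which sum to 1. This normalization is the usual route to Minkowski's inequality. *)
Lemma powR_perspective {R : realType} (p t w w1 w2 a c x : R) : 1 <= p ->
  0 < a -> 0 < c -> 0 <= t -> t <= 1 -> 0 <= w -> 0 <= w1 -> 0 <= w2 ->
  w <= t * w1 + (1 - t) * w2 -> x = t * a + (1 - t) * c -> 0 < x ->
  w `^ p / x `^ p <= t * a / x / a `^ p * w1 `^ p + (1 - t) * c / x / c `^ p * w2 `^ p.
Proof.
move=> p1 a0 c0 t0 t1 w0 w10 w20 wle xE x0.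
have p0 : 0 < p by exact: lt_le_trans p1.
have t1' : 0 <= 1 - t by rewrite subr_ge0.
pose s := t * a / x.
have s0 : 0 <= s by rewrite divr_ge0 ?(ltW x0)// mulr_ge0// ltW.
have s1E : 1 - s = (1 - t) * c / x by rewrite /s xE; field; rewrite gt_eqF// -xE.
have s1 : s <= 1 by rewrite -subr_ge0 s1E divr_ge0 ?(ltW x0)// mulr_ge0// ltW.
have wc : w / x <= s * (w1 / a) + (1 - s) * (w2 / c).
  rewrite s1E /s ler_pdivrMr//.
  have -> : (t * a / x * (w1 / a) + (1 - t) * c / x * (w2 / c)) * x =
    t * w1 + (1 - t) * w2 by field; rewrite !gt_eqF.
  exact: wle.
have := @convex_on_powR R p p1 (w1 / a) (w2 / c) s.
have I1 : `[0, +oo[%classic (w1 / a) by rewrite /= in_itv/= andbT divr_ge0// ltW.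
have I2 : `[0, +oo[%classic (w2 / c) by rewrite /= in_itv/= andbT divr_ge0// ltW.
move=> /(_ I1 I2 s0 s1) h.
have : (w / x) `^ p <= (s * (w1 / a) + (1 - s) * (w2 / c)) `^ p.
  apply: ge0_ler_powR; rewrite ?nnegrE ?(ltW p0)// ?divr_ge0 ?(ltW x0)//.
  by apply: le_trans wc; rewrite divr_ge0 ?(ltW x0).
move/le_trans => /(_ _ h).
have dv (u v : R) : 0 <= u -> 0 < v -> (u / v) `^ p = u `^ p / v `^ p.
  by move=> u0 v0; rewrite powRM ?invr_ge0 ?(ltW v0)// -powR_inv1 ?(ltW v0)// -powRrM mulN1r powRN.
rewrite !dv// s1E /s => /le_trans; apply.
by rewrite ![_ * (_ / _ `^ p)]mulrA !(mulrAC _ (_ `^ p) (_ `^ p)^-1).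
Qed.

Lemma perspective_scale {R : realType} (l w x a1 b1 w1 a2 b2 w2 : R) :
  l * (w / x) <= l * (a1 / b1 * w1 + a2 / b2 * w2) ->
  x^-1 * l * w <= a1 / b1 * l * w1 + a2 / b2 * l * w2.
Proof. by rewrite mulrDr; lra. Qed.

(** After integration over the types each quotient Y (b J) / H on the right is 1, so the right-hand
    side adds up to x / x = 1. *)
Lemma perspective_sum {R : realType} (b t h1 h2 x X Y J H1 Y1 J1 H2 Y2 J2 : R) :
  X^-1 * Y * J <= t * h1 / x / H1 * Y1 * J1 + (1 - t) * h2 / x / H2 * Y2 * J2 ->
  0 < b -> 0 < X -> 0 < x -> 0 < H1 -> 0 < H2 ->
  H1 = Y1 * (b * J1) -> H2 = Y2 * (b * J2) -> x = t * h1 + (1 - t) * h2 ->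
  Y * (b * J) <= X.
Proof.
move=> + b0 X0 x0 H10 H20 E1 E2 xE; move=> /(ler_wpM2l (ltW b0)).
have -> : b * (t * h1 / x / H1 * Y1 * J1 + (1 - t) * h2 / x / H2 * Y2 * J2) =
  t * h1 / x * ((Y1 * (b * J1)) / H1) + (1 - t) * h2 / x * ((Y2 * (b * J2)) / H2) by ring.
rewrite -E1 -E2 !divff ?gt_eqF// !mulr1 -mulrDl -xE divff ?gt_eqF//.
have -> : b * (X^-1 * Y * J) = Y * (b * J) / X by ring.
by rewrite ler_pdivrMr// mul1r.
Qed.

(** * Convexity of the demand, behind the concavity of the shadow price *)

Section shadow_price_concave.
Context {R : realType} {d : measure_display} {I : measurableType d}.
Variables (iota : {measure set I -> \bar R}).
Variables (l A K e : I -> R) (b ga : R).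
Hypotheses (l0 : forall i, 0 < l i) (A0 : forall i, 0 < A i) (K0 : forall i, 0 < K i)
  (e0 : forall i, 0 < e i) (b0 : 0 < b) (ga0 : 0 < ga) (ga1 : ga <= 1).
Hypotheses (ml : measurable_fun setT l) (mA : measurable_fun setT A)
  (mK : measurable_fun setT K) (me : measurable_fun setT e).
Hypothesis lA_fin : (\int[iota]_i (l i * A i)%:E < +oo)%E.
Hypothesis lK_fin : forall q, 0 < q -> (\int[iota]_i (l i * (q * K i) `^ e i)%:E < +oo)%E.
Hypothesis iota0 : (0 < iota setT)%E.
Local Notation kap := (capacity iota l A K e b).
Local Notation H := (shadow_demand kap ga).
Local Notation p := ga^-1.

Let kap_gt0 y : 0 <= y -> 0 < kap y. Proof. by move=> y0; exact: capacity_gt0. Qed.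
Let w i y := y * Num.max (A i) ((K i * y) `^ e i) `^ ga.

Let w_ge0 i y : 0 <= y -> 0 <= w i y.
Proof. by move=> y0; rewrite mulr_ge0// powR_ge0. Qed.

(** It is the larger of a linear function of y and of a multiple of a power with exponent 1 + e_i ga
    >= 1. *)
Let w_convex i : convex_on `[0, +oo[ (w i).
Proof.
have E y : 0 <= y -> w i y = Num.max (A i `^ ga * y) ((K i)^-1 * (K i * y) `^ (1 + e i * ga)).
  rewrite le_eqVlt => /predU1P[<-|y0].
    by rewrite /w mul0r !mulr0 powR0 ?gt_eqF// ?mulr0 ?maxxx// ltr_wpDr// mulr_ge0 ?(ltW (e0 _))// ltW.
  have Ky : 0 < K i * y by rewrite mulr_gt0.
  rewrite powRD ?(gt_eqF Ky) ?implybT// powRr1 ?(ltW Ky)// powRrM !mulrA mulVf ?gt_eqF// mul1r.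
  rewrite /w mulrC [y * _]mulrC -maxr_pMl ?(ltW y0)//; congr (_ * _).
  have m (u v : R) : 0 <= u -> u <= v -> u `^ ga <= v `^ ga.
    by move=> u0 uv; apply: ge0_ler_powR => //; rewrite ?nnegrE ?(ltW ga0)// (le_trans u0).
  have [h|h] := leP (A i) ((K i * y) `^ e i).
    by rewrite max_r// m// ltW.
  by rewrite max_l// m ?powR_ge0// ltW.
move=> x y t x0 y0 t0 t1; have z0 := convex_domain_ge0 x0 y0 t0 t1.
have := convex_on_max (D := `[0, +oo[) (f := fun y => A i `^ ga * y)
  (u := fun y => (K i)^-1 * (K i * y) `^ (1 + e i * ga)) _ _ x0 y0 t0 t1.
move: (x0) (y0) (z0); rewrite /= !in_itv/= !andbT => x0' y0' z0'; rewrite -!E//; apply.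
- apply: convex_onZ; first exact: powR_ge0.
  by move=> u v s _ _ _ _.
- apply: convex_onZ; first by rewrite invr_ge0 ltW.
  move=> u v s; rewrite /= !in_itv/= !andbT => u0 v0 s0 s1.
  have := @convex_on_powR R (1 + e i * ga) _ (K i * u) (K i * v) s.
  rewrite /= !in_itv/= !andbT !mulr_ge0 ?(ltW (K0 _))// => /(_ _ isT isT s0 s1).
  rewrite (_ : s * (K i * u) + _ = K i * (s * u + (1 - s) * v)); last by ring.
  by apply; rewrite lerDl mulr_ge0 ?(ltW (e0 _))// ltW.
Qed.

Let w_powR i y : 0 <= y -> l i * w i y `^ p = y `^ p * capacity_term l A K e y i.
Proof.
move=> y0; rewrite /w powRM ?powR_ge0// -powRrM mulfV ?gt_eqF// powRr1; last by rewrite le_max (ltW (A0 _)).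
by rewrite /capacity_term mulrCA.
Qed.

Let H_powR y : 0 <= y -> H y `^ p = y `^ p * kap y.
Proof.
move=> y0; rewrite /shadow_demand powRM ?powR_ge0// -powRrM mulfV ?gt_eqF// powRr1//.
exact/ltW/kap_gt0.
Qed.

Let H_gt0 y : 0 < y -> 0 < H y.
Proof. by move=> y0; rewrite mulr_gt0// powR_gt0// kap_gt0// ltW. Qed.

(* Up to the power 1 / ga, shadow_demand is the L^(1/ga) norm of the convex
   functions w i y; this is Minkowski's inequality. *)
Lemma shadow_demand_convex y1 y2 t : 0 < y1 -> 0 < y2 -> 0 <= t -> t <= 1 ->
  H (t * y1 + (1 - t) * y2) <= t * H y1 + (1 - t) * H y2.
Proof.
move=> y10 y20 t0 t1; have t1' : 0 <= 1 - t by rewrite subr_ge0.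
set y := t * y1 + _; set x := t * H y1 + _.
have y0 : 0 <= y by rewrite addr_ge0// mulr_ge0// ltW.
have x0 : 0 < x.
  have [t0'|t0'] := eqVneq t 0; first by rewrite /x t0' mul0r add0r subr0 mul1r H_gt0.
  have t00 : 0 < t by rewrite lt_neqAle eq_sym t0'.
  by rewrite ltr_pwDl ?(mulr_gt0 t00) ?H_gt0// mulr_ge0// ltW// H_gt0.
have p1 : 1 <= p by rewrite invf_ge1.
suff S : y `^ p * kap y <= x `^ p.
  have : (y `^ p * kap y) `^ ga <= (x `^ p) `^ ga.
    by apply: ge0_ler_powR => //; rewrite ?nnegrE ?powR_ge0 ?(ltW ga0)// mulr_ge0 ?powR_ge0// ltW// kap_gt0.
  rewrite powRM ?powR_ge0 ?(ltW (kap_gt0 _))// -!powRrM mulVf ?gt_eqF// !powRr1//; exact: ltW.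
have E1 := H_powR (ltW y10); have E2 := H_powR (ltW y20).
have h10 := H_gt0 y10; have h20 := H_gt0 y20.
have wc i : w i y <= t * w i y1 + (1 - t) * w i y2.
  by apply: w_convex; rewrite //= in_itv/= ltW.
have pt i := powR_perspective p1 h10 h20 t0 t1 (w_ge0 i y0) (w_ge0 i (ltW y10)) (w_ge0 i (ltW y20))
  (wc i) (erefl x) x0.
have xE : x = t * H y1 + (1 - t) * H y2 by [].
move: pt E1 E2 h10 h20 xE x0; move: (H y1) (H y2) x => h1 h2 x pt E1 E2 h10 h20 xE x0.
have ptl i : (x `^ p)^-1 * y `^ p * capacity_term l A K e y i <=
    t * h1 / x / h1 `^ p * y1 `^ p * capacity_term l A K e y1 i +
    (1 - t) * h2 / x / h2 `^ p * y2 `^ p * capacity_term l A K e y2 i.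
  rewrite -!mulrA -!w_powR ?(ltW y10) ?(ltW y20)// !mulrA.
  exact: (perspective_scale (ler_wpM2l (ltW (l0 i)) (pt i))).
have ic u : 0 <= u -> iota.-integrable setT (EFin \o capacity_term l A K e u).
  by move=> u0; exact: integrable_capacity.
have iZ k u : 0 <= u -> iota.-integrable setT (EFin \o (fun i => k * capacity_term l A K e u i)).
  by move=> u0; have := integrableZl measurableT k (ic u u0).
have := @le_Rintegral _ _ _ iota setT _ _ measurableT (iZ _ _ y0)
  (integrableD measurableT (iZ (t * h1 / x / h1 `^ p * y1 `^ p) y1 (ltW y10))
                (iZ ((1 - t) * h2 / x / h2 `^ p * y2 `^ p) y2 (ltW y20))) (fun i _ => ptl i).
rewrite RintegralD//; [|exact/iZ/ltW|exact/iZ/ltW].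
rewrite !RintegralZl//; [|exact/ic/ltW|exact/ic/ltW|exact: ic].
by move/perspective_sum; apply; rewrite ?powR_gt0.
Qed.

End shadow_price_concave.

Lemma integrable_itv_bounded {R : realType} (u v C : R) (f : R -> R) :
  measurable_fun `]u, v] f -> (forall s, u < s -> s <= v -> `|f s| <= C) ->
  (@lebesgue_measure R).-integrable `]u, v] (EFin \o f).
Proof.
move=> mf fC; apply: measurable_bounded_integrable => //.
  rewrite [X in (X < _)%E](lebesgue_measure_itv `]u, v])/=.
  by case: ifP => _; rewrite ?ltry// -EFinB ltry.
exists C; split; first exact: num_real.
move=> y Cy s /=; rewrite in_itv/= => /andP[us sv].
by apply: le_trans (ltW Cy); exact: fC.
Qed.

Lemma integrable_affine {R : realType} (u v p q : R) :
  (@lebesgue_measure R).-integrable `]u, v] (EFin \o (fun s : R => p + q * s)).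
Proof.
apply: (@integrable_itv_bounded _ _ _ (`|p| + `|q| * (`|u| + `|v|))).
  apply: measurable_funTS; apply: continuous_measurable_fun => s.
  by apply: cvgD; [exact: cvg_cst|apply: cvgM; [exact: cvg_cst|exact: cvg_id]].
move=> s us sv; apply: le_trans (ler_normD _ _) _; rewrite lerD2l normrM ler_wpM2l//.
have := ler_norm v; have := ler_norm (- u); have := normr_ge0 u; have := normr_ge0 v.
by rewrite normrN ler_norml => *; apply/andP; split; lra.
Qed.

Lemma Rintegral_affine {R : realType} (u v p q : R) : u <= v ->
  \int[lebesgue_measure]_(s in `]u, v]) (p + q * s) = p * (v - u) + q * (v ^+ 2 - u ^+ 2) / 2.
Proof.
rewrite le_eqVlt => /predU1P[->|uv].
  by rewrite set_itvoc0 Rintegral_set0 !subrr !mulr0 mul0r addr0.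
have ca : continuous (fun s : R => p + q * s).
  by move=> s; apply: cvgD; [exact: cvg_cst|apply: cvgM; [exact: cvg_cst|exact: cvg_id]].
pose A (s : R) := p * s + q / 2 * s ^+ 2.
have dA (s : R) : is_derive s 1 A (p + q * s).
  rewrite (_ : A = (cst p : R -> R) * id + cst (q / 2) * (id ^+ 2))//.
  apply: is_derive_eq; rewrite /= /GRing.scale/=; by field.
have cA : continuous A.
  by move=> s; apply: differentiable_continuous; apply/derivable1_diffP; exact: ex_derive.
rewrite Rintegral_itv_obnd_cbnd; last exact: integrable_affine.
rewrite /Rintegral (@continuous_FTC2 _ _ A)//.
- by rewrite -EFinB/= /A; field.
- exact: continuous_subspaceT.
- split.
  + by move=> s _; exact: ex_derive.
  + by apply: cvg_at_right_filter; exact: cA.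
  + by apply: cvg_at_left_filter; exact: cA.
- by move=> s _; rewrite derive1E; exact: derive_val.
Qed.

(** The inequality at x = 0 follows by continuity: x1 is so close to 0 that f and the linear term
    each move by at most e / 2. *)
Lemma subgradient_convex_pos {R : realType} (f : R -> R) : {within `[0, +oo[, continuous f} ->
  (forall z, 0 < z -> exists p, forall x, 0 < x -> f z + p * (x - z) <= f x) ->
  convex_on `[0, +oo[ f.
Proof.
move=> cf H; apply: subgradient_convex => z z0; have [p Hp] := H z z0; exists p => x.
rewrite le_eqVlt => /predU1P[<-|]; last exact: Hp.
apply/ler_addgt0Pr => e e0.
have e2 : 0 < e / 2 by rewrite divr_gt0.
have [dl dl0 hdl] := within_itv_near cf (lexx 0) e2.
pose x1 := Num.min (dl / 2) (e / 2 / (`|p| + 1)).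
have p1 : 0 < `|p| + 1 by rewrite ltr_wpDl.
have x10 : 0 < x1 by rewrite lt_min !divr_gt0.
have := hdl x1 (ltW x10); rewrite subr0 gtr0_norm// => /(_ _)/wrap[].
  by rewrite (@le_lt_trans _ _ (dl / 2))// ?ge_min ?lexx// ltr_pdivrMr// ltr_pMr// ltr1n.
move=> /(le_lt_trans (ler_norm _)) h1.
have h2 : `|p| * x1 <= e / 2.
  apply: (@le_trans _ _ ((`|p| + 1) * x1)); first by rewrite ler_wpM2r ?(ltW x10)// lerDl.
  by rewrite mulrC -ler_pdivlMr// ge_min lexx orbT.
have h3 : - (`|p| * x1) <= p * x1 by rewrite -mulNr ler_wpM2r ?(ltW x10)// lerNnormlW.
have := Hp x1 x10; move: h1 h2 h3; rewrite !mulrBr mulr0.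
by move: (p * x1) (`|p| * x1) (p * z) => a1 a2 a3; lra.
Qed.

(** The perspective x N (1 / x) of an affine function is affine, so supporting lines are carried to
    supporting lines. *)
Lemma perspective_subgradient {R : realType} (N : R -> R) :
  (forall z, 0 < z -> exists p, forall u, 0 < u -> N z + p * (u - z) <= N u) ->
  forall z, 0 < z -> exists p, forall x, 0 < x ->
    z * N z^-1 + p * (x - z) <= x * N x^-1.
Proof.
move=> H z z0; have zi0 : 0 < z^-1 by rewrite invr_gt0.
have [p Hp] := H _ zi0; exists (N z^-1 - p * z^-1) => x x0.
have xi0 : 0 < x^-1 by rewrite invr_gt0.
have := ler_wpM2l (ltW x0) (Hp _ xi0); apply: le_trans.
by rewrite le_eqVlt; apply/orP; left; apply/eqP; field; rewrite !gt_eqF.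
Qed.

(** * The residual demand as a difference of convex functions *)

Section residual_difference.
Context {R : realType}.
Variable phi : R -> R.
Hypotheses (phi_gt0 : forall x, 0 <= x -> 0 < phi x)
  (phi_anti : forall x z, 0 <= x -> x <= z -> phi z <= phi x)
  (phi_cont : continuous (fun x : R => phi (Num.max 0 x)))
  (conc : forall x1 x2 t, 0 < x1 -> 0 < x2 -> 0 <= t -> t <= 1 ->
    t * (x1 * phi x1) + (1 - t) * (x2 * phi x2) <=
    (t * x1 + (1 - t) * x2) * phi (t * x1 + (1 - t) * x2)).
Local Notation leb := (@lebesgue_measure R).

(** Since u (1 / u) phi (1 / u) = phi (1 / u), this is the perspective of the concave function x phi
    x, hence concave. *)
Let yc (u : R) := phi u^-1.

Let yc_mono u v : 0 < u -> u <= v -> yc u <= yc v.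
Proof.
move=> u0 uv; have v0 : 0 < v by exact: lt_le_trans uv.
by apply: phi_anti; rewrite ?invr_ge0 ?(ltW v0)// lef_pV2.
Qed.

Let yc_le u : 0 <= u -> yc u <= phi 0.
Proof. by move=> u0; apply: phi_anti => //; rewrite invr_ge0. Qed.

Let yc_ge0 u : 0 <= u -> 0 <= yc u.
Proof. by move=> u0; apply/ltW/phi_gt0; rewrite invr_ge0. Qed.

Let yc_supergradient z : 0 < z -> exists s, forall u, 0 < u -> yc u <= yc z + s * (u - z).
Proof.
move=> z0; have zi0 : 0 < z^-1 by rewrite invr_gt0.
have DE (x : R) : `]0, +oo[%classic x = (0 < x) by rewrite /= in_itv/= andbT.
have cf : convex_on `]0, +oo[ (fun x => - (x * phi x)).
  by move=> x y t; rewrite !DE => x0 y0 t0 t1; have := conc x0 y0 t0 t1; lra.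
have h0 : z^-1 / 2 < z^-1 by rewrite ltr_pdivrMr// ltr_pMr// ltr1n.
have h1 : z^-1 < z^-1 + 1 by rewrite ltrDl.
have D0 : `]0, +oo[%classic (z^-1 / 2) by rewrite DE divr_gt0.
have D1 : `]0, +oo[%classic (z^-1 + 1) by rewrite DE addr_gt0.
have H := @left_slope_subgradient _ _ _ cf (z^-1 / 2) z^-1 (z^-1 + 1) D0 D1 h0 h1.
move: H; move: (left_slope _ _ _) => p H.
exists (yc z / z + p / z) => u u0; have ui0 : 0 < u^-1 by rewrite invr_gt0.
have Du : `]0, +oo[%classic u^-1 by rewrite DE.
have := H u^-1 Du => /(ler_wpM2l (ltW u0)); rewrite -/(yc u) -/(yc z).
have -> : u * - (u^-1 * yc u) = - yc u by field; rewrite gt_eqF.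
have -> : u * (- (z^-1 * yc z) + p * (u^-1 - z^-1)) = - (yc z + (yc z / z + p / z) * (u - z)).
  by field; rewrite !gt_eqF.
by rewrite lerN2.
Qed.

Let yc_measurable u : 0 <= u -> measurable_fun (`]u, +oo[%classic : set R) yc.
Proof.
move=> u0; apply: (eq_measurable_fun (fun s : R => phi (Num.max 0 s^-1))).
  by move=> s; rewrite inE/= in_itv/= andbT => us; rewrite max_r// invr_ge0 (le_trans u0)// ltW.
apply: (measurableT_comp (continuous_measurable_fun phi_cont)).
apply: measurable_funV_gt0 => // s /=; rewrite in_itv/= andbT.
exact: le_lt_trans.
Qed.

Let yc_integrable u v : 0 <= u -> leb.-integrable `]u, v] (EFin \o yc).
Proof.
move=> u0; apply: (@integrable_itv_bounded _ _ _ (phi 0)).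
  by apply: measurable_funS (yc_measurable u0) => // s /=; rewrite !in_itv/= => /andP[->].
move=> s us _; have s0 : 0 <= s by rewrite (le_trans u0)// ltW.
by rewrite ger0_norm ?yc_ge0// yc_le.
Qed.

(** Formally N' = 2 yc, which increases, and M u = N u - u yc u satisfies M'' = - u yc'' >= 0. The
    factor 2 is what cancels yc' in M''. No derivative is available, so both convexities are proved
    by subgradients. *)
Let N u := 2 * \int[leb]_(s in `]0, u]) yc s.

Let N_sub u v : 0 <= u -> u <= v -> N v - N u = 2 * \int[leb]_(s in `]u, v]) yc s.
Proof.
move=> u0 uv; rewrite /N -mulrBr; congr (_ * _).
by rewrite Rintegral_itvB ?bnd_simp//; exact: yc_integrable.
Qed.

Let N_ge_affine (u v p q : R) : 0 <= u -> u <= v -> (forall s, u < s -> s <= v -> p + q * s <= yc s) ->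
  2 * p * (v - u) + q * (v ^+ 2 - u ^+ 2) <= N v - N u.
Proof.
move=> u0 uv H; rewrite N_sub//.
have : \int[leb]_(s in `]u, v]) (p + q * s) <= \int[leb]_(s in `]u, v]) yc s.
  apply: le_Rintegral => //; [exact: integrable_affine|exact: yc_integrable|].
  by move=> s /=; rewrite in_itv/= => /andP[us sv]; exact: H.
by rewrite Rintegral_affine//; lra.
Qed.

Let N_le_affine (u v p q : R) : 0 <= u -> u <= v -> (forall s, u < s -> s <= v -> yc s <= p + q * s) ->
  N v - N u <= 2 * p * (v - u) + q * (v ^+ 2 - u ^+ 2).
Proof.
move=> u0 uv H; rewrite N_sub//.
have : \int[leb]_(s in `]u, v]) yc s <= \int[leb]_(s in `]u, v]) (p + q * s).
  apply: le_Rintegral => //; [exact: yc_integrable|exact: integrable_affine|].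
  by move=> s /=; rewrite in_itv/= => /andP[us sv]; exact: H.
by rewrite Rintegral_affine//; lra.
Qed.

Let N_ge u v : 0 < u -> u <= v -> 2 * yc u * (v - u) <= N v - N u.
Proof.
move=> u0 uv; have := @N_ge_affine u v (yc u) 0 (ltW u0) uv; rewrite mul0r addr0; apply.
by move=> s us _; rewrite mul0r addr0 yc_mono// ltW.
Qed.

Let N_le u v : 0 <= u -> u <= v -> N v - N u <= 2 * yc v * (v - u).
Proof.
move=> u0 uv; have := @N_le_affine u v (yc v) 0 u0 uv; rewrite mul0r addr0; apply.
by move=> s us sv; rewrite mul0r addr0 yc_mono// (le_lt_trans u0).
Qed.

(** The trapezoid rule: a concave function lies above its chord. *)
Let N_chord u v : 0 < u -> u <= v -> (v - u) * (yc u + yc v) <= N v - N u.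
Proof.
move=> u0; rewrite le_eqVlt => /predU1P[<-|uv]; first by rewrite !subrr mul0r.
have vu0 : 0 < v - u by rewrite subr_gt0.
pose q := (yc v - yc u) / (v - u).
have := @N_ge_affine u v (yc u - q * u) q (ltW u0) (ltW uv).
have -> : 2 * (yc u - q * u) * (v - u) + q * (v ^+ 2 - u ^+ 2) = (v - u) * (yc u + yc v).
  by rewrite /q; field; rewrite gt_eqF.
apply => s us sv; have s0 : 0 < s by exact: lt_trans us.
have [a Ha] := yc_supergradient s0.
have := Ha u u0; have := Ha v (lt_trans u0 uv) => h1 h2.
have vs : 0 <= v - s by rewrite subr_ge0.
have su : 0 <= s - u by rewrite subr_ge0 ltW.
rewrite -(ler_pM2r vu0).
have -> : (yc u - q * u + q * s) * (v - u) = (v - s) * yc u + (s - u) * yc v.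
  by rewrite /q; field; rewrite gt_eqF.
have := ler_wpM2l vs h2; have := ler_wpM2l su h1.
by move: (yc s) (yc u) (yc v) => *; lra.
Qed.

(** The line supporting the concave [yc] at z from above, integrated from u to z. *)
Let N_tangent u z s : 0 <= u -> u <= z -> (forall v, 0 < v -> yc v <= yc z + s * (v - z)) ->
  N z - N u <= 2 * (z - u) * yc z - s * (z - u) ^+ 2.
Proof.
move=> u0 uz H; have := @N_le_affine u z (yc z - s * z) s u0 uz.
have -> : 2 * (yc z - s * z) * (z - u) + s * (z ^+ 2 - u ^+ 2) = 2 * (z - u) * yc z - s * (z - u) ^+ 2.
  by ring.
apply => v uv _; have := H v (le_lt_trans u0 uv); lra.
Qed.

Let N_subgradient z : 0 < z -> exists p, forall u, 0 < u -> N z + p * (u - z) <= N u.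
Proof.
move=> z0; exists (2 * yc z) => u u0; have [zu|/ltW uz] := leP z u.
  by have := N_ge z0 zu; lra.
by have := N_le (ltW u0) uz; lra.
Qed.

Let M u := N u - u * yc u.

Let M_subgradient z : 0 < z -> exists p, forall u, 0 < u -> M z + p * (u - z) <= M u.
Proof.
(* The slope is the formal derivative M' z = yc z - z yc' z. To the right of z the chord bound is
   used, to the left the tangent bound. *)
move=> z0; have [s Hs] := yc_supergradient z0; exists (yc z - z * s) => u u0.
rewrite /M; have [zu|/ltW uz] := leP z u.
  by have := N_chord z0 zu; have := ler_wpM2l (ltW z0) (Hs u u0); lra.
have := N_tangent (ltW u0) uz Hs; have := ler_wpM2l (ltW u0) (Hs u u0); lra.
Qed.

(* Fx x = 2 \int_0^1 phi (x / t) dt, the perspective of N, continued at 0. *)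
Let Fx x := if x == 0 then 2 * phi 0 else x * N x^-1.

Let Fx_gt0 x : 0 < x -> Fx x = x * N x^-1.
Proof. by move=> x0; rewrite /Fx gt_eqF. Qed.

Let Fx_sub x : 0 < x -> Fx x - phi x = x * M x^-1.
Proof. by move=> x0; rewrite Fx_gt0// /M /yc invrK; field; rewrite gt_eqF. Qed.

Let N0 : N 0 = 0. Proof. by rewrite /N set_itvoc0 Rintegral_set0 mulr0. Qed.

Let Fx_le x : 0 < x -> Fx x <= 2 * phi 0.
Proof.
move=> x0; rewrite Fx_gt0//; have xi0 : 0 <= x^-1 by rewrite invr_ge0 ltW.
have := N_le (lexx 0) xi0; rewrite N0 !subr0 => /(ler_wpM2l (ltW x0)) /le_trans; apply.
rewrite mulrCA divff ?gt_eqF// mulr1 ler_wpM2l//; exact: yc_le.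
Qed.

Let Fx_ge x v : 0 < x -> 0 < v -> v * x <= 1 -> 2 * yc v * (1 - v * x) <= Fx x.
Proof.
move=> x0 v0 vx; rewrite Fx_gt0//.
have vxi : v <= x^-1 by rewrite -[x^-1]mul1r ler_pdivlMr.
have := N_ge v0 vxi; have := N_ge_affine (lexx 0) (ltW v0) (p := 0) (q := 0) => H.
have : 0 <= N v.
  rewrite N0 mulr0 !mul0r addr0 subr0 in H; apply: H => s s0 _.
  by rewrite mul0r addr0 yc_ge0// ltW.
move=> Nv => /(ler_wpM2l (ltW x0)).
have -> : x * (2 * yc v * (x^-1 - v)) = 2 * yc v * (1 - v * x) by field; rewrite gt_eqF.
move=> h; by apply: le_trans h _; rewrite mulrBr lerBlDr lerDl mulr_ge0 ?(ltW x0).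
Qed.

Let N_lipschitz u v : 0 < u -> 0 < v -> `|N u - N v| <= 2 * phi 0 * `|u - v|.
Proof.
wlog uv : u v / u <= v.
  by move=> H u0 v0; case: (leP u v) => [uv|/ltW vu]; [exact: H|rewrite distrC [`|u - v|]distrC; exact: H].
move=> u0 v0; rewrite distrC [`|u - v|]distrC [X in _ * X]ger0_norm ?subr_ge0//.
rewrite ger0_norm; last first.
  by apply: le_trans (N_ge u0 uv); rewrite mulr_ge0 ?subr_ge0// mulr_ge0// yc_ge0// ltW.
apply: le_trans (N_le (ltW u0) uv) _; rewrite ler_wpM2r ?subr_ge0// ler_wpM2l//.
exact/yc_le/ltW.
Qed.

Let N_continuous u : 0 < u -> {for u, continuous N}.
Proof.
move=> u0; apply/cvgrPdist_lt => e e0.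
have p0 : 0 < 2 * phi 0 by rewrite mulr_gt0// phi_gt0.
near=> v; apply: le_lt_trans (N_lipschitz u0 _) _; first by near: v; exact: lt_nbhsr.
rewrite mulrC -ltr_pdivlMr//; near: v.
by exists (e / (2 * phi 0)) => //=; rewrite divr_gt0.
Unshelve. all: by end_near. Qed.

Let Fx_continuous : {within `[0, +oo[, continuous Fx}.
Proof.
apply/continuous_within_itvcyP; split.
  move=> x; rewrite in_itv/= andbT => x0.
  have xi0 : 0 < x^-1 by rewrite invr_gt0.
  rewrite /continuous_at Fx_gt0//.
  have cN : y * N y^-1 @[y --> x] --> x * N x^-1.
    apply: (@cvgM _ _ _ _ (fun y : R => y) (fun y => N y^-1)); first exact: cvg_id.
    apply: (cvg_comp (fun y : R => y^-1) N _ (N_continuous xi0)).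
    by apply: cvgV; [rewrite gt_eqF|exact: cvg_id].
  apply: cvg_trans cN; apply: near_eq_cvg; near=> y.
  by rewrite Fx_gt0//; near: y; exact: lt_nbhsr.
rewrite (_ : Fx 0 = 2 * phi 0); last by rewrite /Fx eqxx.
(* Squeeze at 0 through [Fx_ge] with v = 1 / sqrt x: v tends to infinity while v x = sqrt x tends to
   0. *)
have low : 2 * phi (Num.sqrt x) * (1 - Num.sqrt x) @[x --> 0^'+] --> 2 * phi 0 * (1 - 0).
  have sq : Num.sqrt x @[x --> (0:R)^'+] --> (0 : R).
    by apply: cvg_at_right_filter; rewrite -{2}(@sqrtr0 R); exact: sqrt_continuous.
  have ps : phi (Num.sqrt x) @[x --> 0^'+] --> phi 0.
    have := cvg_comp _ (fun u : R => phi (Num.max 0 u)) sq (@phi_cont 0); rewrite maxxx.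
    rewrite (_ : _ \o _ = (fun x : R => phi (Num.sqrt x)))//; apply/funext => x.
    by rewrite /= max_r// sqrtr_ge0.
  apply: cvgM; first by apply: cvgM; [exact: cvg_cst|exact: ps].
  by apply: cvgB; [exact: cvg_cst|exact: sq].
rewrite subr0 mulr1 in low.
apply: (squeeze_cvgr _ low (cvg_cst _)); near=> x.
have x0 : 0 < x by near: x; exact: nbhs_right_gt.
have x1 : x < 1 by near: x; exact: nbhs_right_lt.
rewrite Fx_le// andbT.
have s0 : 0 < Num.sqrt x by rewrite sqrtr_gt0.
have si0 : 0 < (Num.sqrt x)^-1 by rewrite invr_gt0.
have xE : (Num.sqrt x)^-1 * x = Num.sqrt x.
  by rewrite -{2}(sqr_sqrtr (ltW x0)) expr2 mulKf// gt_eqF.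
have := @Fx_ge x (Num.sqrt x)^-1 x0 si0; rewrite xE /yc invrK; apply.
by rewrite -(@sqrtr1 R) ler_wsqrtr// ltW.
Unshelve. all: by end_near. Qed.

Lemma difference_of_convex_residual : difference_of_convex phi.
Proof.
have cphi := within_continuous_max phi_cont.
have cG : {within `[0, +oo[, continuous (fun x => Fx x - phi x)}.
  by move=> x; apply: cvgB; [exact: Fx_continuous|exact: cphi].
apply: (@difference_of_convexP _ _ Fx (fun x => Fx x - phi x)) => //.
- apply: subgradient_convex_pos; first exact: Fx_continuous.
  move=> z z0; have [p Hp] := perspective_subgradient N_subgradient z0.
  by exists p => x x0; rewrite !Fx_gt0//; exact: Hp.
- apply: subgradient_convex_pos; first exact: cG.
  move=> z z0; have [p Hp] := perspective_subgradient M_subgradient z0.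
  by exists p => x x0; rewrite !Fx_sub//; exact: Hp.
- by move=> x _; rewrite opprB addrC subrK.
Qed.

End residual_difference.

(** * Stieltjes integration along a nondecreasing clock *)

Section stieltjes.
Context {R : realType}.
Variable G : R -> R.
Hypotheses (G_nd : nondecreasing G) (G_rc : right_continuous G).

(** [stieltjes] packs its cumulative function with proofs obtained from [pselect]; the existential
    hides them. *)
Lemma stieltjes_cumulative : exists f : cumulative R R,
  f = G :> (R -> R) /\ stieltjes G = lebesgue_stieltjes_measure f :> (set (measurableTypeR R) -> \bar R).
Proof.
rewrite /stieltjes; case: pselect => [H|[]//].
by eexists; split; last reflexivity.
Qed.

Lemma stieltjes_itv_oc a b : a <= b -> stieltjes G `]a, b]%classic = (G b - G a)%:E.
Proof.
move=> ab; have [f [fG ->]] := stieltjes_cumulative.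
rewrite -fG /lebesgue_stieltjes_measure /measure_extension measurable_mu_extE/=; last exact: is_ocitv.
by rewrite wlength_itv_bnd.
Qed.

End stieltjes.

Section stieltjes_chain_rule.
Context {R : realType}.
Variables (G K Phi : R -> R) (t : R).
Hypotheses (G_nd : nondecreasing G) (G_cont : continuous G).
Hypotheses (t0 : 0 <= t) (K_nd : nondecreasing K).
Hypothesis Phi_le : forall u v, 0 <= u -> u <= v -> v <= t ->
  K u * (G v - G u) <= Phi v - Phi u <= K v * (G v - G u).
Local Notation mu := (stieltjes G).

Let G_rc : right_continuous G.
Proof. by move=> x; apply: cvg_at_right_filter; exact: G_cont. Qed.

Let mK (D : set (measurableTypeR R)) : measurable D -> measurable_fun D K.
Proof. by move=> mD; apply: nondecreasing_measurable. Qed.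

Let fin_itv u v : (mu `]u, v]%classic < +oo)%E.
Proof.
have [uv|vu] := leP u v; first by rewrite stieltjes_itv_oc// ltry.
by rewrite set_itv_ge ?measure0 ?ltry// -leNgt bnd_simp ltW.
Qed.

Let iK u v : mu.-integrable `]u, v] (EFin \o K).
Proof.
apply: measurable_bounded_integrable => //.
  exact: mK.
exists (Num.max `|K u| `|K v|); split; first exact: num_real.
move=> y Cy s /=; rewrite in_itv/= => /andP[us sv]; apply: le_trans (ltW Cy).
have h1 : K u <= K s by apply: K_nd; exact: ltW.
have h2 : K s <= K v by exact: K_nd.
rewrite le_max; have [Ks|Ks] := leP 0 (K s).
  by rewrite ger0_norm// (le_trans h2 (ler_norm _)) orbT.
by rewrite ltr0_norm// ler0_norm ?lerN2 ?h1// (le_trans h1)// ltW.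
Qed.

Let I u := \int[mu]_(s in `]0, u]) K s.

Let I_sub u v : 0 <= u -> u <= v -> K u * (G v - G u) <= I v - I u <= K v * (G v - G u).
Proof.
move=> u0 uv.
have -> : I v - I u = \int[mu]_(s in `]u, v]) K s.
  have E : `]0, v]%classic = `]0, u]%classic `|` `]u, v]%classic :> set R.
    by rewrite -itv_bndbnd_setU// bnd_simp.
  rewrite /I E Rintegral_setU//; first by rewrite addrAC subrr add0r.
  - by rewrite -E; exact: iK.
  - apply/disj_setPRL => s /=; rewrite !in_itv/= => /andP[us _]; apply/negP.
    by rewrite negb_and -!leNgt -ltNge us orbT.
have ic c : mu.-integrable `]u, v] (EFin \o cst c).
  apply: measurable_bounded_integrable => //.
  exists `|c|; split; first exact: num_real.
  by move=> y Cy s _; exact: ltW.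
have cE c : c * (G v - G u) = \int[mu]_(s in `]u, v]) c.
  by rewrite Rintegral_cst// stieltjes_itv_oc.
rewrite !cE; apply/andP; split; apply: le_Rintegral => //; try exact: iK; try exact: ic.
- by move=> s /=; rewrite in_itv/= => /andP[us sv]; apply: K_nd; exact: ltW.
- by move=> s /=; rewrite in_itv/= => /andP[us sv]; exact: K_nd.
Qed.

(** The increments of the integral of K and of Phi obey the same bounds, so over [u, v] they differ
    by at most (K v - K u) (G v - G u). On a fine partition the second factor is uniformly small, as
    G is continuous, and the first factors telescope; K itself may jump. *)
Lemma stieltjes_Rintegral : \int[mu]_(s in `]0, t]) K s = Phi t - Phi 0.
Proof.
pose E u := I u - Phi u.
have E_sub u v : 0 <= u -> u <= v -> v <= t -> `|E v - E u| <= (K v - K u) * (G v - G u).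
  move=> u0 uv vt; have := I_sub u0 uv; have := Phi_le u0 uv vt.
  by rewrite /E ler_norml => /andP[? ?] /andP[? ?]; apply/andP; split; lra.
suff : E t = E 0.
  rewrite /E /I [X in X - Phi 0](_ : _ = 0); last by rewrite set_itvoc0 Rintegral_set0.
  by lra.
have Kt : 0 <= K t - K 0 by rewrite subr_ge0 K_nd.
apply/eqP; rewrite -subr_eq0 -normr_le0; apply/ler_addgt0Pr => e e0; rewrite add0r.
pose e1 := e / (K t - K 0 + 1).
have e10 : 0 < e1 by rewrite divr_gt0// ltr_wpDl.
have cG : {within `[0, +oo[, continuous G} by exact: continuous_subspaceT.
have [dl dl0 hdl] := within_unif_continuous t cG e10.
have [N hN] : exists N : nat, t / N.+1%:R < dl.
  exists (Num.truncn (t / dl)); rewrite ltr_pdivrMr// mulrC -ltr_pdivrMr//.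
  by have /andP[] := truncn_itv (divr_ge0 t0 (ltW dl0)).
pose s (j : nat) := j%:R * (t / N.+1%:R).
have h0 : 0 <= t / N.+1%:R by rewrite divr_ge0.
have s0 j : 0 <= s j by rewrite mulr_ge0.
have sS j : s j <= s j.+1 by rewrite ler_wpM2r// ler_nat.
have sN : s N.+1 = t by rewrite /s mulrC divfK.
have sm j k : (j <= k)%N -> s j <= s k by move=> jk; rewrite ler_wpM2r// ler_nat.
have : forall j, (j <= N.+1)%N -> `|E (s j) - E 0| <= e1 * (K (s j) - K 0).
  elim=> [|j IH] jN; first by rewrite /s mul0r !subrr normr0 mulr0.
  apply: le_trans (ler_distD (E (s j)) _ _) _.
  have jt : s j.+1 <= t by rewrite -sN sm.
  have := IH (ltnW jN); have := E_sub _ _ (s0 j) (sS j) jt.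
  have : `|G (s j.+1) - G (s j)| < e1.
    apply: hdl => //; first exact: le_trans jt.
    by rewrite /s -mulrBl -natrB// subSnn mul1r ger0_norm.
  have : 0 <= G (s j.+1) - G (s j) by rewrite subr_ge0 G_nd.
  move=> g0; rewrite (ger0_norm g0) => /ltW g1.
  have k0 : 0 <= K (s j.+1) - K (s j) by rewrite subr_ge0 K_nd.
  have := ler_wpM2l k0 g1; lra.
move/(_ N.+1 (leqnn _)); rewrite sN => /le_trans; apply.
by rewrite /e1 mulrAC ler_pdivrMr ?ltr_wpDl// ler_wpM2l ?(ltW e0)// lerDl.
Qed.

Lemma stieltjes_integrable : mu.-integrable `]0, t] (EFin \o K).
Proof. exact: iK. Qed.

End stieltjes_chain_rule.

Section log_chain_rule.
Context {R : realType}.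
Variables (f f1 f2 : R -> R).
Hypotheses (c1 : convex_on `[0, +oo[ f1) (c2 : convex_on `[0, +oo[ f2).
Hypotheses (fE : forall x, 0 <= x -> f x = f1 x - f2 x)
  (f_gt0 : forall x, 0 <= x -> 0 < f x) (f_anti : forall x y, 0 <= x -> x <= y -> f y <= f x)
  (f_cont : continuous (fun x : R => f (Num.max 0 x))).
Variables (G : R -> R) (t : R).
Hypotheses (G_nd : nondecreasing G) (G_cont : continuous G) (G0 : 0 < G 0) (t0 : 0 <= t).
Local Notation mu := (stieltjes G).

(** The margin 1 keeps the values of G up to time t in the interior of D, where left slopes exist.
    As f decreases, 1 / f b bounds the slopes of ln on the values f takes over D. *)
Let b := G t + 1.
Let D := `[0, b]%classic.
Let L := (f b)^-1.
Let Gt0 : 0 < G t. Proof. by apply: lt_le_trans G0 _; exact: G_nd. Qed.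
Let b0 : 0 < b. Proof. by rewrite addr_gt0. Qed.
Let fb0 : 0 < f b. Proof. exact/f_gt0/ltW. Qed.

Let w1 x := L * f1 x.
Let w2 x := - ln (f x) + L * f1 x.

Let cD : convex_domain D. Proof. exact: convex_domain_itv. Qed.

Let DS : D `<=` `[0, +oo[.
Proof. by move=> x; rewrite /D/= !in_itv/= => /andP[->]. Qed.

Let cw1 : convex_on D w1.
Proof. by apply: convex_onZ; [rewrite invr_ge0 ltW|exact: convex_onS DS c1]. Qed.

Let cw2 : convex_on D w2.
Proof.
have H := @convex_comp_difference R D (fun v => - ln v) f1 f2 L cD (convex_onS DS c1) (convex_onS DS c2).
move=> x y s Dx Dy s0 s1; have Dz := cD Dx Dy s0 s1.
have g0 z : D z -> 0 <= z by move/DS; rewrite /= in_itv/= andbT.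
have := H _ x y s Dx Dy s0 s1; rewrite -!fE ?g0//; apply => z Dz'.
have zb : z <= b by move: Dz'; rewrite /D/= in_itv/= => /andP[].
exists (- (f z)^-1); split.
- by rewrite lerN2 lef_pV2 ?posrE ?fb0 ?f_gt0 ?g0//; apply: f_anti => //; exact: g0.
- by rewrite oppr_le0 invr_ge0 ltW// f_gt0// g0.
- by move=> v Dv; rewrite -!fE ?g0//; apply: lnN_tangent; apply: f_gt0; exact: g0.
Qed.

Let interior y : G 0 <= y -> y <= G t -> [/\ D 0, D y, D b, 0 < y & y < b].
Proof.
move=> y1 y2; have y0 : 0 < y by exact: lt_le_trans y1.
have yb : y < b by rewrite (le_lt_trans y2)// ltrDl.
by split => //; rewrite /D/= in_itv/= ?lexx ?(ltW b0)// ?(ltW y0) ?(ltW yb).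
Qed.

(** [left_derivative] is a [lim], so convergence has to be shown: that of the quotients of f comes
    from its two convex parts. The tangent inequality for ln then squeezes the quotients of ln f,
    whose limit is also the difference of the slopes of [w1] and [w2]. *)
Let ln_left_derivative y : G 0 <= y -> y <= G t ->
  left_derivative f y / f y = left_slope D w1 y - left_slope D w2 y.
Proof.
move=> y1 y2; have [D0 Dy Db y0 yb] := interior y1 y2.
have s1 := left_slope_cvg cD cw1 D0 Db Dy y0 yb.
have s2 := left_slope_cvg cD cw2 D0 Db Dy y0 yb.
have sd : h^-1 * (ln (f (y + h)) - ln (f y)) @[h --> 0^'-] --> left_slope D w1 y - left_slope D w2 y.
  apply: cvg_trans (cvgB s1 s2); apply: near_eq_cvg; near=> h.
  by rewrite /w1 /w2 !fctE /=; ring.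
have DI := convex_domain_ge0 (R := R).
have I0 : `[0, +oo[%classic (0 : R) by rewrite /= in_itv/= lexx.
have Ib : `[0, +oo[%classic b by rewrite /= in_itv/= (ltW b0).
have Iy : `[0, +oo[%classic y by rewrite /= in_itv/= (ltW y0).
have d1 := left_slope_cvg DI c1 I0 Ib Iy y0 yb.
have d2 := left_slope_cvg DI c2 I0 Ib Iy y0 yb.
pose p := left_slope `[0, +oo[ f1 y - left_slope `[0, +oo[ f2 y.
have h_pos : \forall h \near 0^'-, 0 < y + h.
  by near=> h; rewrite -ltrBlDl sub0r; near: h; apply: nbhs_left_gt; rewrite oppr_lt0.
have df : h^-1 * (f (y + h) - f y) @[h --> 0^'-] --> p.
  apply: cvg_trans (cvgB d1 d2); apply: near_eq_cvg; near=> h.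
  have yh : 0 < y + h by near: h.
  by rewrite !fE ?(ltW yh) ?(ltW y0)// !fctE /=; ring.
have -> : left_derivative f y = p by apply: cvg_lim.
have cf : f (y + h) @[h --> 0^'-] --> f y.
  have cy : y + h @[h --> (0:R)^'-] --> y.
    rewrite -[X in _ --> X]addr0; apply: cvgD; first exact: cvg_cst.
    by apply: cvg_at_left_filter; exact: cvg_id.
  have := cvg_comp _ (fun u : R => f (Num.max 0 u)) cy (@f_cont y); rewrite (max_r (ltW y0)).
  apply: cvg_trans; apply: near_eq_cvg; near=> h.
  have yh : 0 < y + h by near: h.
  by rewrite /= (max_r (ltW yh)).
have fy0 : 0 < f y by exact/f_gt0/ltW.
have lo : h^-1 * (f (y + h) - f y) / f y @[h --> 0^'-] --> p / f y.
  by apply: cvgM; [exact: df|exact: cvg_cst].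
have up : h^-1 * (f (y + h) - f y) / f (y + h) @[h --> 0^'-] --> p / f y.
  by apply: cvgM; [exact: df|apply: cvgV; [rewrite gt_eqF|exact: cf]].
have sq : h^-1 * (ln (f (y + h)) - ln (f y)) @[h --> 0^'-] --> p / f y.
  apply: (squeeze_cvgr _ lo up); near=> h.
  have yh : 0 < y + h by near: h.
  have h0 : h < 0 by near: h; exact: nbhs_left_lt.
  have fh0 : 0 < f (y + h) by exact/f_gt0/ltW.
  have hi : h^-1 < 0 by rewrite invr_lt0.
  rewrite -!mulrA !ler_nM2l//.
  have := lnN_tangent fy0 fh0; have := lnN_tangent fh0 fy0.
  by rewrite !mulNr ![_^-1 * _]mulrC => *; apply/andP; split; lra.
exact: (cvg_unique _ sq sd).
Unshelve. all: by end_near. Qed.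

Lemma stieltjes_log_derivative :
  (\int[mu]_(s in `]0%R, t]) (left_derivative f (G s) / f (G s))%:E = (ln (f (G t)) - ln (f (G 0)))%:E)%E.
Proof.
(* Clamping time to [0, t] makes the slopes nondecreasing on the whole line, as the chain rule
   asks. *)
pose cl s := G (Num.max 0 (Num.min s t)).
have clE s : 0 <= s -> s <= t -> cl s = G s by move=> s0 st; rewrite /cl (min_l st) (max_r s0).
have cl_nd : nondecreasing cl.
  by move=> x y xy; apply: G_nd; rewrite ge_max !le_max lexx/= le_min !ge_min xy lexx !orbT.
have cl_in s : G 0 <= cl s /\ cl s <= G t.
  by split; apply: G_nd; rewrite ?le_max ?lexx// ge_max t0 ge_min lexx orbT.
have key w : convex_on D w -> nondecreasing (fun s => left_slope D w (cl s)) /\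
   forall u v, 0 <= u -> u <= v -> v <= t ->
    left_slope D w (cl u) * (G v - G u) <= w (G v) - w (G u) <= left_slope D w (cl v) * (G v - G u).
  move=> cw; split.
    move=> x y xy; have cxy : cl x <= cl y by exact: cl_nd.
    have [->//|cxy'] := eqVneq (cl x) (cl y).
    have {}xy : cl x < cl y by rewrite lt_neqAle cxy'.
    have [x1 x2] := cl_in x; have [y1 y2] := cl_in y.
    have [D0 Dx Db x0 xb] := interior x1 x2; have [_ Dy _ y0 yb] := interior y1 y2.
    exact: (left_slope_mono cw D0 Dx Dy Db).
  move=> u v u0 uv vt; rewrite (clE u)//; last exact: le_trans vt.
  rewrite (clE v)//; last exact: le_trans uv.
  have Guv' : G u <= G v by exact: G_nd.
  have [->|Guv] := eqVneq (G u) (G v).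
    by rewrite !subrr !mulr0 lexx.
  have {Guv'}Guv : G u < G v by rewrite lt_neqAle Guv.
  have [D0 Du Db u1 ub] := interior (G_nd u0) (G_nd (le_trans uv vt)).
  have [_ Dv _ v1 vb] := interior (G_nd (le_trans u0 uv)) (G_nd vt).
  have := left_slope_subgradient cw D0 Db u1 ub Dv.
  have := left_slope_subgradient cw D0 Db v1 vb Du.
  by move=> *; apply/andP; split; lra.
have [K1 P1] := key w1 cw1; have [K2 P2] := key w2 cw2.
have i1 := stieltjes_integrable t G_nd G_cont K1.
have i2 := stieltjes_integrable t G_nd G_cont K2.
have E1 := stieltjes_Rintegral G_nd G_cont t0 K1 P1.
have E2 := stieltjes_Rintegral G_nd G_cont t0 K2 P2.
transitivity (\int[mu]_(s in `]0%R, t]) ((left_slope D w1 (cl s))%:E - (left_slope D w2 (cl s))%:E))%E.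
  apply: eq_integral => s; rewrite inE/= in_itv/= => /andP[/ltW s0 st].
  by rewrite clE// ln_left_derivative// G_nd.
rewrite integralB_EFin//.
have fin k : mu.-integrable `]0, t] (EFin \o k) -> (\int[mu]_(s in `]0%R, t]) (k s)%:E)%E = (\int[mu]_(s in `]0, t]) k s)%:E.
  by move=> ik; rewrite /Rintegral fineK//; exact: integrable_fin_num.
rewrite (fin _ i1) (fin _ i2) E1 E2 -EFinB; congr EFin; rewrite /w1 /w2; ring.
Qed.

End log_chain_rule.

Section stieltjes_discount.
Context {R : realType}.
Variables (C : R -> R) (c r : R).
Hypotheses (C_nd : nondecreasing C) (C_rc : right_continuous C)
  (C_neg : forall t, t < 0 -> C t = c) (r0 : 0 < r).
Local Notation mu := (stieltjes C).
Local Notation leb := (@lebesgue_measure R).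
Local Notation T2 := (measurableTypeR R * measurableTypeR R)%type.

(** The jump C 0 - c is counted: C equals c before 0, and [0, s] is the intersection of the
    intervals ]- 1 / (k + 1), s]. *)
Lemma stieltjes_itv_cc s : 0 <= s -> mu `[0, s]%classic = (C s - c)%:E.
Proof.
move=> s0.
pose A (n : nat) := `](- n.+1%:R^-1), s]%classic : set (measurableTypeR R).
have neg n : - n.+1%:R^-1 < 0 :> R by rewrite oppr_lt0 invr_gt0.
have As n : - n.+1%:R^-1 <= s by rewrite (le_trans _ s0)// ltW.
have muA n : mu (A n) = (C s - c)%:E by rewrite /A (stieltjes_itv_oc C_nd C_rc (As n)) (C_neg (neg n)).
have AE : \bigcap_n A n = `[0, s]%classic.
  apply/seteqP; split => x; rewrite /A/= in_itv/=; last first.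
    by move=> /andP[x0 xs] n _ /=; rewrite in_itv/= xs (lt_le_trans (neg n)).
  move=> H; have := H 0%N I; rewrite /= in_itv/= => /andP[_ ->]; rewrite andbT.
  apply/ler_addgt0Pl => e e0.
  have [n ne] : exists n : nat, n.+1%:R^-1 < e.
    exists (Num.truncn e^-1); rewrite invf_plt ?posrE//.
    have ei : 0 <= e^-1 by rewrite invr_ge0 ltW.
    by have /andP[] := truncn_itv ei.
  have := H n I; rewrite /= in_itv/= => /andP[h _].
  by rewrite addrC -lerBlDr sub0r ltW// (lt_trans _ h)// ltrN2.
have := @nonincreasing_cvg_mu _ _ _ mu A; rewrite AE => H.
have : mu \o A @ \oo --> mu `[0, s]%classic.
  apply: H => //; first by rewrite muA ltry.
  - by move=> n; exact: measurable_itv.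
  - apply/nonincreasing_seqP => n; apply/subsetPset => x; rewrite /A/= !in_itv/= => /andP[h ->].
    rewrite andbT (le_lt_trans _ h)// lerN2 lef_pV2 ?posrE// ler_nat//.
rewrite (_ : mu \o A = cst (C s - c)%:E); last by apply/funext => n /=; rewrite muA.
by move=> h; have := cvg_lim (@ereal_hausdorff R) h; rewrite lim_cst// => <-.
Qed.

(** Integration by parts in the form of Tonelli: exp (- r t) is the integral of r exp (- r s) over s
    >= t. It holds in the extended reals, hence also along paths of infinite cost. *)
Lemma stieltjes_discount :
  (\int[mu]_(t in `[0%R, +oo[) (expR (- r * t))%:E =
   \int[leb]_(s in `[0%R, +oo[) (r * (expR (- r * s) * (C s - c)))%:E)%E.
Proof.
have [f [fC muE]] := stieltjes_cumulative C_nd C_rc.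
pose nu := lebesgue_stieltjes_measure f.
have nuE : mu = nu :> {measure set (measurableTypeR R) -> \bar R}.
  by apply: eq_measure.
pose B := [set x : T2 | 0 <= x.1 /\ x.1 <= x.2].
have mB : measurable B.
  have -> : B = [set x : T2 | 0 <= x.1] `&` [set x : T2 | 0 <= x.2 - x.1].
    by apply/seteqP; split => x /=; rewrite subr_ge0.
  have ge0 (g : T2 -> R) : measurable_fun setT g -> measurable [set x | 0 <= g x].
    move=> mg; rewrite (_ : [set x | _] = g @^-1` `[0, +oo[).
      by rewrite -[X in measurable X]setTI; exact: mg.
    by apply/seteqP; split => x /=; rewrite in_itv/= andbT.
  apply: measurableI; apply: ge0 => //.
  by apply: measurable_funB.
pose h := (fun x : T2 => (r * expR (- r * x.2))%:E) \_ B.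
have h0 x : (0 <= h x)%E.
  by apply: erestrict_ge0 => y _; rewrite lee_fin mulr_ge0 ?(ltW r0)// expR_ge0.
have mh : measurable_fun setT h.
  apply/(measurable_restrictT _ mB); apply/measurable_EFinP; apply: measurable_funTS.
  apply: measurable_funM => //; apply: measurableT_comp => //.
  exact: measurable_funM.
have := @fubini_tonelli _ _ _ _ _ nu leb h mh h0.
have -> : (\int[nu]_x \int[leb]_y h (x, y) = \int[mu]_(t in `[0%R, +oo[) (expR (- r * t))%:E)%E.
  rewrite nuE [RHS]integral_mkcond; apply: eq_integral => t _; rewrite patchE.
  case: ifPn => [|]; rewrite ?notin_setE ?inE/= in_itv/= andbT => t0; last first.
    rewrite integral0_eq// => s _; rewrite /h patchE memNset// /B/= => -[t0' _].
    by apply: t0.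
  have := @integral_expR_from R r t (r * expR (- r * t)) r0.
  rewrite mulr_ge0 ?expR_ge0 ?(ltW r0)// => /(_ isT).
  have -> : r * expR (- r * t) / r = expR (- r * t) by field; rewrite gt_eqF.
  move=> <-; rewrite [RHS]integral_mkcond; apply: eq_integral => s _.
  rewrite /h !patchE; have [ts|ts] := leP t s.
    rewrite !mem_set//= ?in_itv/= ?ts//; congr EFin.
    by rewrite -mulrA -expRD; congr (_ * expR _); ring.
  by rewrite !memNset//= ?in_itv/= ?andbT => [|[_]]; rewrite leNgt ts.
move=> ->; rewrite [RHS]integral_mkcond; apply: eq_integral => s _; rewrite patchE.
case: ifPn => [|]; rewrite ?notin_setE ?inE/= in_itv/= andbT => s0; last first.
  rewrite integral0_eq// => t _; rewrite /h patchE memNset// /B/= => -[t0 ts].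
  by apply: s0; exact: le_trans ts.
transitivity (\int[nu]_(t in `[0%R, s]) (r * expR (- r * s))%:E)%E.
  rewrite [RHS]integral_mkcond; apply: eq_integral => t _; rewrite /h !patchE.
  have [/andP[t0 ts]|H] := boolP ((0 <= t) && (t <= s)).
    by rewrite !mem_set//= ?in_itv/= ?t0.
  by rewrite !memNset//= ?in_itv/=; [exact/negP|move=> [t0 ts]; move: H; rewrite t0 ts].
rewrite (@integral_cst _ _ _ nu _ (measurable_itv `[0%R, s]) (r * expR (- r * s))%:E).
transitivity ((r * expR (- r * s))%:E * (C s - c)%:E)%E; last by rewrite -EFinM mulrA.
by congr (_ * _)%E; rewrite -(stieltjes_itv_cc s0) muE.
Qed.

End stieltjes_discount.

(** * Optimality of the reflected strategy *)

Section payoff.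
Context {R : realType} {d : measure_display} {Omega : measurableType d}.
Variable P : probability Omega R.
Local Notation TR := (Omega * measurableTypeR R)%type.
Local Notation leb := (@lebesgue_measure R).

Lemma measurable_fun_fst_from (a : R) (f : R -> Omega -> R) :
  measurable_fun [set x : TR | a <= x.2] (fun x => f x.2 x.1) ->
  (forall t w, a <= t -> 0 <= f t w) ->
  measurable_fun setT (fun w => \int[leb]_(t in `[a, +oo[) (f t w)%:E)%E.
Proof.
move=> mf f0.
pose G := (fun x : TR => (f x.2 x.1)%:E) \_ [set x : TR | a <= x.2].
have mG : measurable_fun setT G.
  apply/(measurable_restrictT _ (measurable_from a)).
  exact/measurable_EFinP.
have G0 x : (0 <= G x)%E.
  by apply: erestrict_ge0 => y ay; rewrite lee_fin f0.
have := @measurable_fun_fubini_tonelli_F _ _ _ _ _ leb G mG G0.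
apply: eq_measurable_fun => w _; rewrite /fubini_F [RHS]integral_mkcond.
apply: eq_integral => t _; rewrite /G !patchE.
have [at_|at_] := leP a t; first by rewrite !mem_set//= in_itv/= at_.
by rewrite !memNset//= ?in_itv/= ?andbT; apply/negP; rewrite -ltNge.
Qed.

Lemma integral_payoff_fin (b s : Omega -> \bar R) :
  measurable_fun setT b -> measurable_fun setT s ->
  (forall w, 0 <= b w)%E -> (forall w, 0 <= s w)%E ->
  (\int[P]_w b w < +oo)%E -> (\int[P]_w s w < +oo)%E ->
  (\int[P]_w (b w - s w) = \int[P]_w b w - \int[P]_w s w)%E.
Proof.
move=> mb ms b0 s0 bfin sfin; apply: integralB => //.
- by apply/integrableP; split => //; under eq_integral do rewrite gee0_abs//.
- by apply/integrableP; split => //; under eq_integral do rewrite gee0_abs//.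
Qed.

(** With a finite mean revenue the positive part of the difference stays integrable, while an
    infinite mean cost makes the negative part infinite; such a strategy cannot compete. *)
Lemma integral_payoff_infinite (b s : Omega -> \bar R) :
  measurable_fun setT b -> measurable_fun setT s ->
  (forall w, 0 <= b w)%E -> (forall w, 0 <= s w)%E ->
  (\int[P]_w b w < +oo)%E -> (\int[P]_w s w = +oo)%E ->
  (\int[P]_w (b w - s w) = -oo)%E.
Proof.
move=> mb ms b0 s0 bfin sinf; set f := (fun w => b w - s w)%E.
have mf : measurable_fun setT f by exact: emeasurable_funB.
have fp w : (f^\+ w <= b w)%E.
  rewrite funeposE /f ge_max b0 andbT; case: (b w) (s w) (b0 w) (s0 w) => [x| |] [y| |]//= _ y0;
    rewrite ?addeNy ?leNye ?leey//.
  by rewrite lee_fin lerBlDr lerDl.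
have fn w : (s w <= f^\- w + b w)%E.
  rewrite funenegE /f; have := b0 w; have := s0 w.
  have m0 (u : \bar R) : maxe u 0 != -oo%E.
    by rewrite gt_eqF// (lt_le_trans (ltNyr 0))// le_max lexx orbT.
  case: (b w) => [x| |]//; last by move=> _ _; rewrite addey// leey.
  case: (s w) => [y| |]// _ _.
  by rewrite -EFinB -EFinN -EFin_max -EFinD lee_fin opprB -lerBlDr le_max lexx.
have p_fin : (\int[P]_w f^\+ w < +oo)%E.
  apply: le_lt_trans bfin; apply: ge0_le_integral => //.
  exact: measurable_funepos.
have n_inf : (\int[P]_w f^\- w = +oo)%E.
  apply/eqP; rewrite -leye_eq -sinf.
  have : (\int[P]_w s w <= \int[P]_w (f^\- w + b w))%E.
    apply: ge0_le_integral => //.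
    - by apply: emeasurable_funD => //; exact: measurable_funeneg.

  rewrite ge0_integralD//; last exact: measurable_funeneg.
  rewrite sinf !leye_eq; move: bfin.
  have : (0 <= \int[P]_w b w)%E by exact: integral_ge0.
  have : (0 <= \int[P]_w f^\- w)%E by exact: integral_ge0.
  by case: (\int[P]_w f^\- w)%E => [x| |]//; case: (\int[P]_w b w)%E.
rewrite integralE n_inf; move: p_fin.
have : (0 <= \int[P]_w f^\+ w)%E by exact: integral_ge0.
by case: (\int[P]_w f^\+ w)%E.
Qed.

End payoff.

Lemma powR_concave_tangent {R : realType} (a u v : R) : 0 < a -> a < 1 -> 0 < u -> 0 < v ->
  u `^ a <= v `^ a + a * v `^ (a - 1) * (u - v).
Proof.
move=> a0 a1 u0 v0.
have ai : 1 <= a^-1 by rewrite invf_ge1// ltW.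
have uv0 : 0 < u / v by rewrite divr_gt0.
have := powR_bernoulli ai (powR_gt0 a uv0).
rewrite -powRrM mulfV ?gt_eqF// powRr1 ?(ltW uv0)// => H.
have H1 : (u / v) `^ a <= 1 + a * (u / v - 1).
  have := ler_wpM2l (ltW a0) H; rewrite mulrDr mulr1 mulrA mulfV ?gt_eqF// mul1r; lra.
have -> : u `^ a = (u / v) `^ a * v `^ a.
  by rewrite -powRM ?(ltW uv0) ?(ltW v0)// divfK// gt_eqF.
have -> : v `^ (a - 1) = v `^ a / v.
  by rewrite powRD ?(gt_eqF v0) ?implybT// powR_inv1// ltW.
have := ler_wpM2r (powR_ge0 v a) H1; move: (_ `^ a) (v `^ a) => p q /le_trans; apply.
by rewrite le_eqVlt; apply/orP; left; apply/eqP; field; rewrite gt_eqF.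
Qed.

Lemma powR_1D {R : realType} (u p : R) : 0 <= u -> 0 <= p ->
  (1 + u) `^ p <= 2 `^ p * (1 + u `^ p).
Proof.
move=> u0 p0.
have [u1|u1] := leP u 1.
  apply: (@le_trans _ _ (2 `^ p)); last by rewrite ler_peMr ?powR_ge0// lerDl powR_ge0.
  by apply: ge0_ler_powR; rewrite ?nnegrE ?addr_ge0//; lra.
apply: (@le_trans _ _ ((2 * u) `^ p)).
  by apply: ge0_ler_powR; rewrite ?nnegrE ?addr_ge0 ?mulr_ge0//; lra.
by rewrite powRM// ler_wpM2l ?powR_ge0// lerDr.
Qed.

Lemma powR_le1D {R : realType} (x p q : R) : 0 <= x -> 0 <= p -> p <= q -> x `^ p <= 1 + x `^ q.
Proof.
move=> x0 p0 pq; have [x1|x1] := leP x 1.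
  rewrite (@le_trans _ _ 1)// ?lerDl ?powR_ge0//.
  have := ge0_ler_powR p0 (_ : x \in Num.nneg) (_ : 1 \in Num.nneg) x1.
  by rewrite !nnegrE powR1 => ->.
by rewrite (@le_trans _ _ (x `^ q))// ?lerDr// ler_powR// ltW.
Qed.

(** b1 and b2 are revenues, s1 and s2 discounted capacities above the floor, r1 and r2 the same
    weighted by the drawdown ratio. The weighted terms are exchanged for costs, with an inequality
    for the first strategy and an equality for the second. *)
Lemma payoff_comparison {R : realType} (b1 b2 r1 r2 s1 s2 : \bar R) (m g : R) :
  0 < m -> (0 <= b1 -> 0 <= b2 -> 0 <= r1 -> 0 <= r2 -> 0 <= s1 -> 0 <= s2 ->
  b1 < +oo -> b2 < +oo -> s1 < +oo -> s2 < +oo ->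
  r1 <= g%:E * s1 -> r2 <= g%:E * s2 -> g%:E * s2 <= r2 ->
  b1 + m%:E * r2 <= b2 + m%:E * r1 -> b1 - (m * g)%:E * s1 <= b2 - (m * g)%:E * s2)%E.
Proof.
case: b1 b2 r1 r2 s1 s2 => [b1| |] [b2| |] [r1| |] [r2| |] [s1| |] [s2| |]//.
rewrite -!EFinM -!EFinN -!EFinD !lee_fin => m0 _ _ _ _ _ _ _ _ _ _ c1 _ c2 H.
by have := ler_wpM2l (ltW m0) c1; have := ler_wpM2l (ltW m0) c2; lra.
Qed.

Lemma le_integral_lincomb {d : measure_display} {T : measurableType d} {R : realType}
  (mu : {measure set T -> \bar R}) (D : set T) (f1 f2 g1 g2 : T -> R) (m : R) :
  measurable D -> 0 <= m ->
  measurable_fun D f1 -> measurable_fun D f2 -> measurable_fun D g1 -> measurable_fun D g2 ->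
  (forall x, D x -> 0 <= f1 x) -> (forall x, D x -> 0 <= f2 x) ->
  (forall x, D x -> 0 <= g1 x) -> (forall x, D x -> 0 <= g2 x) ->
  (forall x, D x -> f1 x + m * g1 x <= f2 x + m * g2 x) ->
  (\int[mu]_(x in D) (f1 x)%:E + m%:E * \int[mu]_(x in D) (g1 x)%:E <=
   \int[mu]_(x in D) (f2 x)%:E + m%:E * \int[mu]_(x in D) (g2 x)%:E)%E.
Proof.
move=> mD m0 mf1 mf2 mg1 mg2 f10 f20 g10 g20 fg.
have E (f g : T -> R) : measurable_fun D f -> measurable_fun D g ->
    (forall x, D x -> 0 <= f x) -> (forall x, D x -> 0 <= g x) ->
    (\int[mu]_(x in D) (f x)%:E + m%:E * \int[mu]_(x in D) (g x)%:E =
     \int[mu]_(x in D) (f x + m * g x)%:E)%E.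
  move=> mf mg f0 g0; under [RHS]eq_integral do rewrite EFinD EFinM.
  rewrite ge0_integralD//; first by rewrite ge0_integralZl//; exact/measurable_EFinP.
  - exact/measurable_EFinP.
  - by move=> x Dx; rewrite mule_ge0// lee_fin g0.
  - by apply: measurable_funeM; exact/measurable_EFinP.
rewrite !E//; apply: ge0_le_integral => //.
- by move=> x Dx; rewrite lee_fin addr_ge0 ?f10// mulr_ge0// g10.
- by apply/measurable_EFinP; apply: measurable_funD => //; exact: measurable_funM.
- by apply/measurable_EFinP; apply: measurable_funD => //; exact: measurable_funM.
Qed.

Section producer.
Context {R : realType} {d : measure_display} {Omega : measurableType d}.
Variables (P : probability Omega R) (F : R -> set (set Omega)).
Variable W : R -> Omega -> R.
Hypotheses (hF : is_filtration F) (hW : is_brownian F P W).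
Variables (x0 nu sg : R).
Hypothesis x0_gt0 : 0 < x0.
Local Notation fmeas := (filtration_measurable F).
Local Notation TR := (Omega * measurableTypeR R)%type.
Local Notation leb := (@lebesgue_measure R).
Local Notation X := (gbm W x0 nu sg).
Variables (n r : R).
Hypotheses (n1 : 1 < n) (r_growth : growth nu sg n = r) (r0 : 0 < r).
Hypothesis cr : growth nu sg 1 < r.
Variables (al k K c : R).
Hypotheses (al0 : 0 < al) (al1 : al < 1) (k0 : 0 < k) (K0 : 0 < K) (c0 : 0 < c).
Hypothesis KE : al / K * ((1 - n^-1) / (r - growth nu sg 1)) = k.
Variable phi : R -> R.
Hypotheses (phi_gt0 : forall x, 0 <= x -> 0 < phi x)
  (phi_anti : forall x z, 0 <= x -> x <= z -> phi z <= phi x)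
  (phi_cont : continuous (fun x : R => phi (Num.max 0 x)))
  (xphi_mono : forall x z, 0 <= x -> x <= z -> x * phi x <= z * phi z).
Variables (A th : R).
Hypotheses (A0 : 0 < A) (th0 : 0 <= th) (th1 : th <= 1)
  (th_n : th < (n - 1) * (1 - al) / al)
  (xphi_growth : forall x, 0 <= x -> x * phi x <= A * (1 + x `^ th)).

Let Xbar t w := msup (X^~ w) 0 t.
Let Y t w := X t w * phi (Xbar t w).
(** The capacity that balances marginal revenue and cost when X stands at its running maximum x;
    there x phi x is the price to the power 1 + beta. *)
Let cap_of x := Num.max c ((K * (x * phi x)) `^ (1 - al)^-1).

Definition reflected_capital t w := if t < 0 then c else cap_of (Xbar t w).
Local Notation Cs := reflected_capital.

(** Integrability is put over the product space, and left limits are set aside; [admissibleP]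
    recovers [admissible] from this by Tonelli and by restoring them. *)
Definition strategy (C : R -> Omega -> R) :=
  [/\ forall t, 0 <= t -> fmeas t (C t),
      forall w, nondecreasing (C^~ w),
      forall w, right_continuous (C^~ w),
      forall t w, t < 0 -> C t w = c &
      (\int[P \x leb]_(x in [set x | 0 <= x.2]%R)
        (expR (- r * x.2) * C x.2 x.1 `^ al * X x.2 x.1)%:E < +oo)%E].

Definition payoff (C : R -> Omega -> R) :=
  (\int[P]_w
     (\int[leb]_(t in `[0%R, +oo[) (expR (- r * t) * C t w `^ al * Y t w)%:E
      - k%:E * \int[stieltjes (C^~ w)]_(t in `[0%R, +oo[) (expR (- r * t))%:E))%E.

Let phi_ge0 x : 0 <= x -> 0 <= phi x. Proof. by move/phi_gt0/ltW. Qed.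
Let X_gt0 t w : 0 < X t w. Proof. exact: gbm_gt0. Qed.
Let cX w : {within `[0, +oo[, continuous (X^~ w)}. Proof. exact: (gbm_continuous hW). Qed.
Let mX t : 0 <= t -> fmeas t (X t). Proof. exact: (gbm_fmeas hF hW). Qed.
Let M_gt0 s w : 0 <= s -> 0 < Xbar s w.
Proof. by move=> s0; exact: (msup_gbm_gt0 hW). Qed.
Let X_le s w : 0 <= s -> X s w <= Xbar s w.
Proof. by move=> s0; apply: (msup_ub (@cX w)) => //; rewrite s0 lexx. Qed.
Let al1' : 0 < 1 - al. Proof. by rewrite subr_gt0. Qed.

Let cap_c x : c <= cap_of x. Proof. by rewrite le_max lexx. Qed.
Let cap_gt0 x : 0 < cap_of x. Proof. exact: lt_le_trans (cap_c x). Qed.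

Let cap_mono x z : 0 <= x -> x <= z -> cap_of x <= cap_of z.
Proof.
move=> x00 xz; have z0 := le_trans x00 xz.
have y0 u : 0 <= u -> 0 <= K * (u * phi u).
  by move=> u0; rewrite mulr_ge0 ?(ltW K0)// mulr_ge0// ltW// phi_gt0.
rewrite ge_max !le_max lexx/=; apply/orP; right.
apply: ge0_ler_powR; rewrite ?nnegrE ?y0 ?invr_ge0 ?(ltW al1')//.
by rewrite ler_wpM2l ?(ltW K0)// xphi_mono.
Qed.

Let cap_cont : continuous (fun x : R => cap_of (Num.max 0 x)).
Proof.
move=> x.
apply: (@continuous_max _ _ (cst c) (fun y : R => (K * (Num.max 0 y * phi (Num.max 0 y))) `^ (1 - al)^-1)).
  exact: cst_continuous.
have m0 (z : R) : 0 <= K * (Num.max 0 z * phi (Num.max 0 z)).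
  by rewrite mulr_ge0 ?(ltW K0)// mulr_ge0 ?le_max ?lexx// ltW// phi_gt0// le_max lexx.
rewrite (_ : (fun y => _) = (fun y : R => Num.max 0 (K * (Num.max 0 y * phi (Num.max 0 y))) `^ (1 - al)^-1)); last first.
  by apply/funext => z; rewrite (max_r (m0 z)).
have cy : {for x, continuous (fun y : R => K * (Num.max 0 y * phi (Num.max 0 y)))}.
  apply: cvgM; first exact: cvg_cst.
  apply: cvgM; last exact: phi_cont.
  by apply: continuous_max; [exact: cst_continuous|exact: cvg_id].
apply: (cvg_comp _ (fun u : R => Num.max 0 u `^ (1 - al)^-1) cy).
by apply: powR_max_continuous; rewrite invr_gt0.
Qed.

Let CsE t w : 0 <= t -> Cs t w = cap_of (Num.max 0 (Xbar t w)).
Proof. by move=> t0; rewrite /reflected_capital ltNge t0/= max_r// ltW// M_gt0. Qed.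

Let mCs t : 0 <= t -> fmeas t (Cs t).
Proof.
move=> t0; rewrite (_ : Cs t = (fun x : R => cap_of (Num.max 0 x)) \o Xbar t); last first.
  by apply/funext => w; rewrite CsE.
apply: (measurableT_comp (continuous_measurable_fun cap_cont)).
exact: (msup_filtration_measurable hF (gbm_continuous hW (x0 := x0) (nu := nu) (sg := sg)) (@mX)).
Qed.

Let Cs_nd w : nondecreasing (Cs^~ w).
Proof.
move=> s t st; rewrite /reflected_capital; case: (ltP s 0) => s0; case: (ltP t 0) => t0 //.
- by have := lt_le_trans t0 (le_trans s0 st); rewrite ltxx.
- apply: cap_mono; first by rewrite ltW// M_gt0.
  exact: (msup_monor (@cX w)).
Qed.

Let Xbar_cont w : continuous (fun s : R => Xbar (Num.max 0 s) w).
Proof. exact: (msup_continuous (@cX w)). Qed.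

Let Cs_cont w : continuous (fun s : R => Cs (Num.max 0 s) w).
Proof.
rewrite (_ : (fun s => _) = (fun x : R => cap_of (Num.max 0 x)) \o (fun s : R => Xbar (Num.max 0 s) w)).
  by move=> s; apply: continuous_comp; [exact: Xbar_cont|exact: cap_cont].
by apply/funext => s; rewrite /= CsE// le_max lexx.
Qed.

(** The only possible jump is at time 0, from c to the initial target; on either side the path is
    continuous. *)
Lemma reflected_capital_right_continuous w : right_continuous (Cs^~ w).
Proof.
move=> t; have [t0|t0] := leP 0 t.
  have E : Num.max 0 t = t by exact: max_r.
  have H : Cs (Num.max 0 s) w @[s --> t^'+] --> Cs t w.
    by rewrite -{2}E; apply: cvg_at_right_filter; exact: Cs_cont.
  apply: cvg_trans H; apply: near_eq_cvg; near=> s.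
  rewrite max_r// (le_trans t0)// ltW//; near: s; exact: nbhs_right_gt.
apply: cvg_near_cst; near=> s.
have s0 : s < 0 by near: s; exact: nbhs_right_lt.
by rewrite /reflected_capital s0 t0.
Unshelve. all: by end_near. Qed.

Lemma reflected_capital_left_limit w t : cvg (Cs x w @[x --> t^'-]).
Proof.
have [t0|t0] := ltP 0 t.
  apply/cvg_ex; exists (Cs (Num.max 0 t) w).
  have H : Cs (Num.max 0 s) w @[s --> t^'-] --> Cs (Num.max 0 t) w.
    by apply: cvg_at_left_filter; exact: Cs_cont.
  apply: cvg_trans H; apply: near_eq_cvg; near=> s.
  rewrite max_r// ltW//; near: s; exact: nbhs_left_gt.
apply/cvg_ex; exists c; apply: cvg_near_cst; near=> s.
have s0 : s < 0 by apply: lt_le_trans t0; near: s; exact: nbhs_left_lt.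
by rewrite /reflected_capital s0.
Unshelve. all: by end_near. Qed.

(** At a running maximum x the capacity is at most of order x^(th / (1 - al)), so the output C^al X
    is at most of order x^q. The hypothesis [th_n] amounts to q < n, and th <= 1 makes q large
    enough to control the capacity itself. *)
Let q := 1 + th * al / (1 - al).
Let q0 : 0 < q.
Proof. by rewrite ltr_wpDr// divr_ge0 ?(ltW al1')// mulr_ge0// ltW. Qed.
Let qn : q < n.
Proof.
rewrite /q addrC -ltrBrDr ltr_pdivrMr// -ltr_pdivlMr//; exact: th_n.
Qed.
Let thq : th / (1 - al) <= q.
Proof. by rewrite /q ler_pdivrMr// mulrDl mul1r divfK ?gt_eqF//; move: th1 al1; nra. Qed.

Let cap_bound : exists2 B : R, 0 < B & forall x, 0 <= x -> cap_of x <= B * (1 + x `^ (th / (1 - al))).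
Proof.
pose e1 := (1 - al)^-1.
have e10 : 0 <= e1 by rewrite invr_ge0 ltW.
pose B1 := (K * A) `^ e1 * 2 `^ e1.
have B10 : 0 <= B1 by rewrite mulr_ge0 ?powR_ge0.
exists (c + B1) => [|x x00]; first by rewrite ltr_wpDr.
have xt : 0 <= x `^ (th / (1 - al)) by exact: powR_ge0.
rewrite ge_max; apply/andP; split.
  by rewrite mulrDr mulr1 -addrA lerDl addr_ge0// mulr_ge0// addr_ge0// ltW.
have xx : 0 <= x * phi x by rewrite mulr_ge0// ltW// phi_gt0.
apply: (@le_trans _ _ ((K * (A * (1 + x `^ th))) `^ e1)).
  apply: ge0_ler_powR => //; rewrite ?nnegrE ?mulr_ge0 ?(ltW K0) ?(ltW A0) ?addr_ge0 ?powR_ge0 ?phi_ge0//.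
  by rewrite ler_wpM2l ?(ltW K0)// xphi_growth.
rewrite mulrA powRM ?mulr_ge0 ?(ltW K0) ?(ltW A0) ?addr_ge0 ?powR_ge0//.
apply: (@le_trans _ _ (B1 * (1 + x `^ (th / (1 - al))))).
  rewrite /B1 -mulrA ler_wpM2l ?powR_ge0// powRrM; exact: powR_1D (powR_ge0 _ _) e10.
by rewrite ler_wpM2r ?addr_ge0// lerDr ltW.
Qed.

Let disc (x : TR) := expR (- r * x.2).
Let D0 := [set x : TR | 0 <= x.2].
Let mD0 : measurable D0. Proof. exact: measurable_from. Qed.

Let mdisc (D : set TR) : measurable_fun D disc.
Proof.
by apply: measurable_funTS; apply: measurableT_comp => //; exact: measurable_funM.
Qed.

Let mXj : measurable_fun D0 (fun x => X x.2 x.1).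
Proof. exact: (process_joint_measurable hF (gbm_continuous hW (x0 := x0) (nu := nu) (sg := sg)) (@mX)). Qed.

Let mXb : measurable_fun D0 (fun x => Xbar x.2 x.1).
Proof. exact: (msup_joint_measurable hF (gbm_continuous hW (x0 := x0) (nu := nu) (sg := sg)) (@mX)). Qed.

Let mphi : measurable_fun D0 (fun x => phi (Xbar x.2 x.1)).
Proof.
apply: (eq_measurable_fun (fun x : TR => (fun u : R => phi (Num.max 0 u)) (Xbar x.2 x.1))).
  by move=> x; rewrite inE /D0/= => x00; rewrite max_r// ltW// M_gt0.
exact: (measurableT_comp (continuous_measurable_fun phi_cont)).
Qed.

Let mYj : measurable_fun D0 (fun x => Y x.2 x.1).
Proof. exact: measurable_funM. Qed.

Let mXbq : measurable_fun D0 (fun x => Xbar x.2 x.1 `^ q).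
Proof. exact: (measurableT_comp (measurable_powR q) mXb). Qed.

Let moment_fin a b : 0 <= a -> 0 <= b ->
  (\int[P \x leb]_(x in D0) (disc x * (a + b * Xbar x.2 x.1 `^ q))%:E < +oo)%E.
Proof.
move=> a0 b0.
have f10 x : D0 x -> 0 <= a * disc x by move=> _; rewrite mulr_ge0 ?expR_ge0.
have f20 x : D0 x -> 0 <= disc x * Xbar x.2 x.1 `^ q.
  by move=> _; rewrite mulr_ge0 ?expR_ge0 ?powR_ge0.
have m2 : measurable_fun D0 (fun x => disc x * Xbar x.2 x.1 `^ q) by exact: measurable_funM.
rewrite (_ : integral _ _ _ = \int[P \x leb]_(x in D0)
    ((a * disc x)%:E + b%:E * (disc x * Xbar x.2 x.1 `^ q)%:E))%E; last first.
  by apply: eq_integral => x _; rewrite -EFinM -EFinD; congr EFin; ring.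
rewrite ge0_integralD//; last 3 first.
- by apply/measurable_EFinP; exact: measurable_funM.
- by move=> x Dx; rewrite mule_ge0// lee_fin f20.
- by apply: measurable_funeM; apply/measurable_EFinP.
rewrite ge0_integralZl//; last by apply/measurable_EFinP.
apply: lte_add_pinfty.
  under eq_integral do rewrite mulrC.
  rewrite (integral_discounted P 0 r0 (b := fun=> a))//.
  apply: lte_mul_pinfty => //; first by rewrite lee_fin divr_ge0 ?expR_ge0 ?(ltW r0).
  have aE : (\int[P]_w a%:E = a%:E)%E.
    rewrite (integral_cst P measurableT a%:E) -[RHS]mule1; congr (_ * _)%E.
    exact: (probability_setT P).
  by apply: le_lt_trans (ltry a); rewrite le_eqVlt; apply/orP; left; apply/eqP.
apply: lte_mul_pinfty; rewrite ?lee_fin//.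
have := @running_max_moment _ _ _ P F W hF hW x0 nu sg x0_gt0 n r q q0 qn r_growth r0.
move/(le_lt_trans _); apply; rewrite le_eqVlt; apply/orP; left; apply/eqP.
by apply: eq_integral => x _; rewrite subr0.
Qed.

Let le_J (f g : TR -> R) : measurable_fun D0 f -> measurable_fun D0 g ->
  (forall x, D0 x -> 0 <= f x) -> (forall x, D0 x -> f x <= g x) ->
  (\int[P \x leb]_(x in D0) (f x)%:E <= \int[P \x leb]_(x in D0) (g x)%:E)%E.
Proof.
move=> mf mg f0 fg; apply: ge0_le_integral => //.
- by apply/measurable_EFinP.
- by apply/measurable_EFinP.
Qed.

Let mCj C : (forall t, 0 <= t -> fmeas t (C t)) -> (forall w, right_continuous (C^~ w)) ->
  measurable_fun D0 (fun x => C x.2 x.1).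
Proof.
move=> mC rC; apply: joint_measurable; last by move=> w t _; exact: rC.
move=> t t0; apply: (filtration_measurable_fun hF t0); exact: mC.
Qed.

Let mCs' : measurable_fun D0 (fun x => Cs x.2 x.1).
Proof. by apply: mCj; [exact: mCs|exact: reflected_capital_right_continuous]. Qed.

Let m_bound a b : measurable_fun D0 (fun x => disc x * (a + b * Xbar x.2 x.1 `^ q)).
Proof.
apply: measurable_funM => //; apply: measurable_funD => //.
exact: measurable_funM.
Qed.

Let CsE' t w : 0 <= t -> Cs t w = cap_of (Xbar t w).
Proof. by move=> t0; rewrite CsE// max_r// ltW// M_gt0. Qed.

Lemma reflected_capital_strategy : strategy Cs.
Proof.
split; first exact: mCs.
- exact: Cs_nd.
- exact: reflected_capital_right_continuous.
- by move=> t w t0; rewrite /reflected_capital t0.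
have [B B0 capB] := cap_bound.
pose B1 := B `^ al * 2 `^ al.
have B10 : 0 <= B1 by rewrite mulr_ge0 ?powR_ge0.
apply: le_lt_trans (moment_fin B10 (addr_ge0 B10 B10)); apply: le_J => //.
- apply: measurable_funM => //; apply: measurable_funM => //.
  exact: (measurableT_comp (measurable_powR al) mCs').
- by move=> x Dx; rewrite mulr_ge0 ?(ltW (X_gt0 _ _))// mulr_ge0 ?expR_ge0 ?powR_ge0.
move=> x Dx; rewrite -mulrA ler_wpM2l ?expR_ge0// CsE'//.
have := M_gt0 x.1 Dx; have := X_le x.1 Dx; have := X_gt0 x.2 x.1.
move: (X x.2 x.1) (Xbar x.2 x.1) => y z y0 yz z0.
have h1 : cap_of z `^ al <= B1 * (1 + z `^ (th * al / (1 - al))).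
  apply: (@le_trans _ _ ((B * (1 + z `^ (th / (1 - al)))) `^ al)).
    apply: ge0_ler_powR => //; rewrite ?nnegrE ?(ltW al0) ?(ltW (cap_gt0 _))//.
    - by rewrite mulr_ge0 ?(ltW B0)// addr_ge0 ?powR_ge0.
    - exact/capB/ltW.
  rewrite powRM ?(ltW B0) ?addr_ge0 ?powR_ge0// /B1 -mulrA ler_wpM2l ?powR_ge0//.
  have -> : th * al / (1 - al) = th / (1 - al) * al by ring.
  rewrite [z `^ (_ * al)]powRrM.
  exact: powR_1D (powR_ge0 _ _) (ltW al0).
apply: (@le_trans _ _ (B1 * (1 + z `^ (th * al / (1 - al))) * z)).
  apply: ler_pM => //; [exact: powR_ge0|exact: ltW].
have E : z `^ (th * al / (1 - al)) * z = z `^ q.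
  by rewrite /q powRD ?(gt_eqF z0) ?implybT// powRr1 ?(ltW z0)// mulrC.
rewrite -mulrA mulrDl mul1r E.
have q1 : 1 <= q by rewrite /q lerDl divr_ge0 ?(ltW al1')// mulr_ge0// ltW.
have := powR_le1D (ltW z0) ler01 q1; rewrite powRr1 ?(ltW z0)// => h2.
by have := ler_wpM2l B10 h2; lra.
Qed.

Let capital_fin : (\int[P \x leb]_(x in D0) (disc x * (Cs x.2 x.1 - c))%:E < +oo)%E.
Proof.
have [B B0 capB] := cap_bound.
have B2 : 0 <= B + B by rewrite addr_ge0 ?(ltW B0).
apply: le_lt_trans (moment_fin B2 (ltW B0)); apply: le_J => //.
- by apply: measurable_funM => //; exact: measurable_funB.
- by move=> x Dx; rewrite mulr_ge0 ?expR_ge0// subr_ge0 CsE'.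
move=> x Dx; rewrite ler_wpM2l ?expR_ge0// CsE'//.
have := M_gt0 x.1 Dx; move: (Xbar x.2 x.1) => z z0.
have t0 : 0 <= th / (1 - al) by rewrite divr_ge0 ?(ltW al1').
have := ler_wpM2l (ltW B0) (powR_le1D (ltW z0) t0 thq).
by have := capB z (ltW z0); have := c0; lra.
Qed.

Section comparison.
Variable C : R -> Omega -> R.
Hypothesis sC : strategy C.

Let mC t : 0 <= t -> fmeas t (C t). Proof. by move: t; have [] := sC. Qed.
Let C_nd w : nondecreasing (C^~ w). Proof. by have [] := sC. Qed.
Let C_rc w : right_continuous (C^~ w). Proof. by have [] := sC. Qed.
Let C_neg t w : t < 0 -> C t w = c. Proof. by have [_ _ _ + _] := sC; exact. Qed.

Lemma strategy_ge t w : 0 <= t -> c <= C t w.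
Proof.
move=> t0; rewrite -(@C_neg (-1) w) ?ltrN10//.
by apply: C_nd; rewrite (le_trans _ t0)// lerN10.
Qed.

Let mCj' : measurable_fun D0 (fun x => C x.2 x.1).
Proof. by apply: mCj; [exact: mC|exact: C_rc]. Qed.

Let B := (\int[P \x leb]_(x in D0) (disc x * C x.2 x.1 `^ al * Y x.2 x.1)%:E)%E.
Let S := (\int[P \x leb]_(x in D0) (disc x * (C x.2 x.1 - c))%:E)%E.

Let mB : measurable_fun D0 (fun x => disc x * C x.2 x.1 `^ al * Y x.2 x.1).
Proof.
apply: measurable_funM => //; apply: measurable_funM => //.
exact: (measurableT_comp (measurable_powR al) mCj').
Qed.

Let mS : measurable_fun D0 (fun x => disc x * (C x.2 x.1 - c)).
Proof. by apply: measurable_funM => //; exact: measurable_funB. Qed.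

Let Y_ge0 t w : 0 <= t -> 0 <= Y t w.
Proof. by move=> t0; rewrite mulr_ge0 ?(ltW (X_gt0 _ _))// phi_ge0// ltW// M_gt0. Qed.

Let B_ge0 x : D0 x -> 0 <= disc x * C x.2 x.1 `^ al * Y x.2 x.1.
Proof. by move=> Dx; rewrite mulr_ge0 ?Y_ge0// mulr_ge0 ?expR_ge0 ?powR_ge0. Qed.

Let S_ge0 x : D0 x -> 0 <= disc x * (C x.2 x.1 - c).
Proof. by move=> Dx; rewrite mulr_ge0 ?expR_ge0// subr_ge0 strategy_ge. Qed.

(** As phi is at most phi 0, the price to the power 1 + beta is at most phi 0 times X, so the
    integrability required of a strategy bounds its revenue. *)
Let B_fin : (B < +oo)%E.
Proof.
have [_ _ _ _ fin] := sC.
have p0 : 0 <= phi 0 by exact: phi_ge0.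
apply: (@le_lt_trans _ _ ((phi 0)%:E * \int[P \x leb]_(x in D0) (disc x * C x.2 x.1 `^ al * X x.2 x.1)%:E)%E).
  have mf : measurable_fun D0 (fun x => disc x * C x.2 x.1 `^ al * X x.2 x.1).
    apply: measurable_funM => //; apply: measurable_funM => //.
    exact: (measurableT_comp (measurable_powR al) mCj').
  have f0 x : D0 x -> 0 <= disc x * C x.2 x.1 `^ al * X x.2 x.1.
    by move=> Dx; rewrite mulr_ge0 ?(ltW (X_gt0 _ _))// mulr_ge0 ?expR_ge0 ?powR_ge0.
  rewrite -ge0_integralZl//; last exact/measurable_EFinP.
  apply: le_J => //; first exact: measurable_funM.
  move=> x Dx; rewrite [leRHS]mulrC -[leRHS]mulrA ler_wpM2l ?mulr_ge0 ?expR_ge0 ?powR_ge0//.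
  by rewrite ler_wpM2l ?(ltW (X_gt0 _ _))// phi_anti// ltW// M_gt0.
by apply: lte_mul_pinfty; rewrite ?lee_fin.
Qed.

Let b w := (\int[leb]_(t in `[0%R, +oo[) (expR (- r * t) * C t w `^ al * Y t w)%:E)%E.
Let s w := (k%:E * \int[stieltjes (C^~ w)]_(t in `[0%R, +oo[) (expR (- r * t))%:E)%E.

(** Writes the Stieltjes cost as a Lebesgue integral of C - c, a form measurable in w and comparable
    with the drawdown integrals. *)
Let sE w : s w = ((k * r)%:E * \int[leb]_(t in `[0%R, +oo[) (expR (- r * t) * (C t w - c))%:E)%E.
Proof.
have C_neg' t : t < 0 -> C t w = c by exact: C_neg.
rewrite /s (stieltjes_discount (@C_nd w) (@C_rc w) C_neg' r0).
under eq_integral do rewrite EFinM.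
rewrite ge0_integralZl// ?lee_fin ?(ltW r0)//.
- by rewrite muleA -EFinM.
- apply/measurable_EFinP; apply: measurable_funM.
    by apply: measurable_funTS; apply: measurableT_comp => //; exact: measurable_funM.
  by apply: measurable_funB => //; apply: nondecreasing_measurable => //; exact: C_nd.
- by move=> t /=; rewrite in_itv/= andbT lee_fin => t0; exact: (@S_ge0 (w, t)).
Qed.

Let mb : measurable_fun setT b.
Proof.
apply: (measurable_fun_fst_from (f := fun t w => expR (- r * t) * C t w `^ al * Y t w)); first exact: mB.
by move=> t w t0; exact: (@B_ge0 (w, t)).
Qed.

Let ms : measurable_fun setT s.
Proof.
rewrite (_ : s = fun w => ((k * r)%:E * \int[leb]_(t in `[0%R, +oo[) (expR (- r * t) * (C t w - c))%:E)%E).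
  apply: measurable_funeM.
  apply: (measurable_fun_fst_from (f := fun t w => expR (- r * t) * (C t w - c))); first exact: mS.
  by move=> t w t0; exact: (@S_ge0 (w, t)).
by apply/funext => w; exact: sE.
Qed.

Let b_ge0 w : (0 <= b w)%E.
Proof. by apply: integral_ge0 => t /=; rewrite in_itv/= andbT lee_fin => t0; exact: (@B_ge0 (w, t)). Qed.

Let s_ge0 w : (0 <= s w)%E.
Proof.
rewrite mule_ge0 ?lee_fin ?(ltW k0)//; apply: integral_ge0 => t _.
by rewrite lee_fin expR_ge0.
Qed.

Let intb : (\int[P]_w b w = B)%E.
Proof.
rewrite /b (@integral_fst_from _ _ _ P 0 (fun t w => expR (- r * t) * C t w `^ al * Y t w))//.
by move=> t w t0; exact: (@B_ge0 (w, t)).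
Qed.

Let ints : (\int[P]_w s w = (k * r)%:E * S)%E.
Proof.
under eq_integral do rewrite sE.
rewrite ge0_integralZl//.
- by rewrite (@integral_fst_from _ _ _ P 0 (fun t w => expR (- r * t) * (C t w - c)))// => t w t0; exact: (@S_ge0 (w, t)).
- apply: (measurable_fun_fst_from (f := fun t w => expR (- r * t) * (C t w - c))); first exact: mS.
  by move=> t w t0; exact: (@S_ge0 (w, t)).
- by move=> w _; apply: integral_ge0 => t /=; rewrite in_itv/= andbT lee_fin => t0; exact: (@S_ge0 (w, t)).
- by rewrite lee_fin mulr_ge0// ltW.
Qed.

Lemma payoff_fin : (S < +oo)%E -> payoff C = (B - (k * r)%:E * S)%E.
Proof.
move=> Sfin.
have Bi : (\int[P]_w b w < +oo)%E by rewrite intb; exact: B_fin.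
have Si : (\int[P]_w s w < +oo)%E.
  by rewrite ints lte_mul_pinfty// lee_fin mulr_ge0// ltW.
by have := integral_payoff_fin mb ms b_ge0 s_ge0 Bi Si; rewrite intb ints.
Qed.

Lemma payoff_infinite : S = +oo%E -> payoff C = -oo%E.
Proof.
move=> Sinf.
have Bi : (\int[P]_w b w < +oo)%E by rewrite intb; exact: B_fin.
have Si : (\int[P]_w s w = +oo)%E by rewrite ints Sinf gt0_muley// lte_fin mulr_gt0.
exact: (integral_payoff_infinite mb ms b_ge0 s_ge0 Bi Si).
Qed.

Lemma production_measurable : measurable_fun D0 (fun x => disc x * C x.2 x.1 `^ al * Y x.2 x.1).
Proof. exact: mB. Qed.

Lemma production_ge0 x : D0 x -> 0 <= disc x * C x.2 x.1 `^ al * Y x.2 x.1.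
Proof. exact: B_ge0. Qed.

Lemma production_fin :
  (\int[P \x leb]_(x in D0) (disc x * C x.2 x.1 `^ al * Y x.2 x.1)%:E < +oo)%E.
Proof. exact: B_fin. Qed.

Lemma strategy_measurable : measurable_fun D0 (fun x => C x.2 x.1).
Proof. exact: mCj'. Qed.

End comparison.

Let ratio (x : TR) := X x.2 x.1 / msup (X^~ x.1) 0 x.2.

Let ratio_ge0 x : D0 x -> 0 <= ratio x.
Proof. by move=> Dx; rewrite divr_ge0 ?(ltW (X_gt0 _ _))// ltW// M_gt0. Qed.

Let mratio : measurable_fun D0 ratio.
Proof. by have := measurable_drawdown hF hW nu sg x0_gt0 (lexx 0). Qed.

(* The marginal value of capacity at Cs is al / K times the drawdown ratio of X, as long as
   Cs exceeds c. *)
Let pointwise C x : D0 x -> c <= C x.2 x.1 ->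
  disc x * C x.2 x.1 `^ al * Y x.2 x.1 + al / K * (disc x * ratio x * (Cs x.2 x.1 - c)) <=
  disc x * Cs x.2 x.1 `^ al * Y x.2 x.1 + al / K * (disc x * ratio x * (C x.2 x.1 - c)).
Proof.
move=> Dx cC; rewrite CsE'// /ratio /Y -/(Xbar x.2 x.1).
have := X_gt0 x.2 x.1; have := M_gt0 x.1 Dx; have := expR_ge0 (- r * x.2).
rewrite -/(disc x).
move: (X x.2 x.1) (Xbar x.2 x.1) (C x.2 x.1) cC (disc x) => y z u cu dd dd0 z0 y0.
have phz := phi_gt0 (ltW z0).
pose ZZ := K * (z * phi z).
have ZZ0 : 0 < ZZ by rewrite mulr_gt0// mulr_gt0.
have v0 := cap_gt0 z; have u0 : 0 < u by exact: lt_le_trans cu.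
set v := cap_of z in v0 *.
have tg := powR_concave_tangent al0 al1 u0 v0.
have vZ : v `^ (al - 1) <= ZZ^-1.
  have -> : al - 1 = - (1 - al) by ring.
  rewrite powRN lef_pV2 ?posrE ?powR_gt0//.
  rewrite -[leLHS](@powRr1 _ ZZ) ?(ltW ZZ0)// -[X in _ `^ X <= _](mulVf (lt0r_neq0 al1')) powRrM.
  by apply: ge0_ler_powR; rewrite ?nnegrE ?powR_ge0 ?(ltW al1') ?(ltW v0)// le_max lexx orbT.
(* Above the floor the marginal output at v is exactly al / ZZ. At the floor it is at most al / ZZ,
   but there v - c = 0 and u - c >= 0. *)
have cmp : al * v `^ (al - 1) * (u - v) <= al / ZZ * (u - c) - al / ZZ * (v - c).
  have alZ : 0 <= al / ZZ - al * v `^ (al - 1).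
    by rewrite subr_ge0 ler_wpM2l// ltW.
  have [vc|vc] := leP v c.
    have -> : v = c by apply/eqP; rewrite eq_le vc cap_c.
    rewrite subrr mulr0 subr0 -subr_ge0 -mulrBl mulr_ge0 ?subr_ge0//.
    have /eqP vE : v == c by rewrite eq_le vc cap_c.
    by move: alZ; rewrite vE; lra.
  have vE : v `^ (al - 1) = ZZ^-1.
    have -> : v = ZZ `^ (1 - al)^-1.
      move: vc; rewrite /v /cap_of lt_max ltxx/= => h; rewrite max_r//; exact: ltW.
    rewrite -powRrM (_ : (1 - al)^-1 * (al - 1) = -1) ?powR_inv1 ?(ltW ZZ0)//.
    by field; rewrite gt_eqF.
  by rewrite vE; lra.
have yph : 0 <= dd * (y * phi z) by rewrite mulr_ge0// mulr_ge0// ltW.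
have := ler_wpM2l yph (le_trans tg (lerD (lexx (v `^ al)) cmp)).
have E : al / K * (dd * (y / z) * (v - c)) = dd * (y * phi z) * (al / ZZ * (v - c)).
  by rewrite /ZZ; field; rewrite !gt_eqF.
have E' : al / K * (dd * (y / z) * (u - c)) = dd * (y * phi z) * (al / ZZ * (u - c)).
  by rewrite /ZZ; field; rewrite !gt_eqF.
rewrite E E'; move: (al / ZZ * (u - c)) (al / ZZ * (v - c)) (u `^ al) (v `^ al) => a1 a2 a3 a4.
by lra.
Qed.

Lemma payoff_le_reflected C : strategy C -> (payoff C <= payoff Cs)%E.
Proof.
move=> sC; have sCs := reflected_capital_strategy.
rewrite [leRHS](payoff_fin sCs capital_fin).
have [Sfin|Sinf] := ltP (\int[P \x leb]_(x in D0) (disc x * (C x.2 x.1 - c))%:E)%E +oo%E; last first.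
  by rewrite payoff_infinite ?leNye//; apply/eqP; rewrite -leye_eq.
rewrite (payoff_fin sC Sfin).
have [mC C_nd C_rc C_neg _] := sC; have [_ _ Cs_rc _ _] := sCs.
have rcB (E : R -> Omega -> R) : (forall w, right_continuous (E^~ w)) ->
    forall w t, 0 <= t -> (E x w - c) @[x --> t^'+] --> E t w - c.
  by move=> rE w t _; apply: cvgB; [exact: rE|exact: cvg_cst].
have mEc (E : R -> Omega -> R) : (forall t, 0 <= t -> fmeas t (E t)) ->
    forall t, 0 <= t -> fmeas t (fun w => E t w - c).
  by move=> mE t t0; apply: measurable_funB => //; exact: mE.
have claim1 E : strategy E ->
    (\int[P \x leb]_(x in D0) (disc x * (E x.2 x.1 - c))%:E < +oo)%E ->
    (\int[P \x leb]_(x in D0) (disc x * ratio x * (E x.2 x.1 - c))%:E <=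
     (r * ((1 - n^-1) / (r - growth nu sg 1)))%:E *
     \int[P \x leb]_(x in D0) (disc x * (E x.2 x.1 - c))%:E)%E.
  move=> sE Efin; have [mE E_nd E_rc _ _] := sE.
  apply: (@discounted_drawdown_le _ _ _ P F W hF hW x0 nu sg x0_gt0 n r n1 r_growth r0 cr
    (fun t w => E t w - c)) => //.
  - exact: mEc.
  - by move=> t w t0; rewrite subr_ge0 strategy_ge.
  - by move=> s t w s0 st; rewrite lerD2r E_nd.
  - exact: rcB.
have As_cont w : {within `[0, +oo[, continuous (fun t => Cs t w - c)}.
  apply: within_continuous_max => u; apply: cvgB; last exact: cvg_cst.
  exact: Cs_cont.
(* [reflected_capital] is a nondecreasing function of the running maximum from time 0 on, so it
   grows only when the maximum does. *)
have As_flat s t w : 0 <= s -> s <= t -> Cs s w - c < Cs t w - c ->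
    msup (X^~ w) 0 s < msup (X^~ w) 0 t.
  move=> s0 st; rewrite ltrD2r; apply: contraTT; rewrite -!leNgt => Mts.
  have t0 := le_trans s0 st.
  by rewrite !CsE'//; apply: cap_mono => //; rewrite ltW// M_gt0.
have claim2 : ((r * ((1 - n^-1) / (r - growth nu sg 1)))%:E *
     \int[P \x leb]_(x in D0) (disc x * (Cs x.2 x.1 - c))%:E <=
    \int[P \x leb]_(x in D0) (disc x * ratio x * (Cs x.2 x.1 - c))%:E)%E.
  apply: (@discounted_drawdown_ge _ _ _ P F W hF hW x0 nu sg x0_gt0 n r n1 r_growth r0 cr
    (fun t w => Cs t w - c)).
  - by apply: mEc => t t0; exact: mCs.
  - by move=> t w t0; rewrite subr_ge0 strategy_ge.
  - by move=> s t w s0 st; rewrite lerD2r Cs_nd.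
  - exact: rcB.
  - exact: capital_fin.
  - exact: As_cont.
  - exact: As_flat.
have mBr E : strategy E -> measurable_fun D0 (fun x => disc x * ratio x * (E x.2 x.1 - c)).
  move=> sE; apply: measurable_funM; last by apply: measurable_funB => //; exact: strategy_measurable.
  exact: measurable_funM.
have r_ge0 E : strategy E -> forall x, D0 x -> 0 <= disc x * ratio x * (E x.2 x.1 - c).
  by move=> sE x Dx; rewrite mulr_ge0 ?subr_ge0 ?strategy_ge// mulr_ge0 ?expR_ge0 ?ratio_ge0.
(* By [KE] the unit cost k is the marginal factor al / K times the discounted mean of the drawdown
   ratio. *)
have -> : k * r = al / K * (r * ((1 - n^-1) / (r - growth nu sg 1))).
  by rewrite -KE; move: (al / K) (_ / (_ - _)) => u v; ring.
have alK : 0 < al / K by exact: divr_gt0.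
have mBC := production_measurable sC; have mBS := production_measurable sCs; have mRC := mBr C sC; have mRS := mBr Cs sCs.
have BC0 := @production_ge0 C; have BS0 := @production_ge0 Cs; have RC0 := r_ge0 C sC; have RS0 := r_ge0 Cs sCs.
apply: (payoff_comparison
  (r1 := (\int[P \x leb]_(x in D0) (disc x * ratio x * (C x.2 x.1 - c))%:E)%E)
  (r2 := (\int[P \x leb]_(x in D0) (disc x * ratio x * (Cs x.2 x.1 - c))%:E)%E)
  alK).
- by apply: integral_ge0 => x Dx; rewrite lee_fin BC0.
- by apply: integral_ge0 => x Dx; rewrite lee_fin BS0.
- by apply: integral_ge0 => x Dx; rewrite lee_fin RC0.
- by apply: integral_ge0 => x Dx; rewrite lee_fin RS0.
- by apply: integral_ge0 => x Dx; rewrite lee_fin mulr_ge0 ?expR_ge0// subr_ge0 strategy_ge.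
- by apply: integral_ge0 => x Dx; rewrite lee_fin mulr_ge0 ?expR_ge0// subr_ge0 strategy_ge.
- exact: production_fin sC.
- exact: production_fin sCs.
- exact: Sfin.
- exact: capital_fin.
- exact: claim1.
- exact: claim1 capital_fin.
- exact: claim2.
by apply: le_integral_lincomb => // [|x Dx]; [exact: ltW|apply: pointwise; rewrite ?strategy_ge].
Qed.

End producer.

(** * The equilibrium functions *)

(** The polynomial factors as q (x - m) (x - n), and its value at 1 is negative because m < 1 < n.
    For the market this says mu < r. *)
Lemma characteristic_lt0 {R : realType} (q p r m n : R) :
  0 < q -> m < 0 -> 1 < n -> q * m ^+ 2 + p * m - r = 0 -> q * n ^+ 2 + p * n - r = 0 ->
  q + p < r.
Proof.
move=> q0 m0 n1 em en.
have nm : n - m != 0 by rewrite gt_eqF//; lra.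
have pE : p = - q * (n + m).
  apply: (mulfI nm); rewrite mulrA.
  by have : q * n ^+ 2 + p * n - (q * m ^+ 2 + p * m) = 0; [lra|rewrite !expr2; lra].
have rE : r = - q * (n * m) by move: en; rewrite pE expr2; lra.
have : 0 < q * ((1 - m) * (n - 1)) by rewrite mulr_gt0// mulr_gt0; lra.
by rewrite pE rE; lra.
Qed.

(** Makes the positive root an explicit, hence measurable, function of the discounting rate. *)
Lemma characteristic_root {R : realType} (q p r m n : R) :
  0 < q -> m < 0 -> 0 < n -> q * m ^+ 2 + p * m - r = 0 -> q * n ^+ 2 + p * n - r = 0 ->
  n = (Num.sqrt (p ^+ 2 + 4 * q * r) - p) / (2 * q).
Proof.
move=> q0 m0 n1 em en.
have nm : n - m != 0 by rewrite gt_eqF//; lra.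
have pE : p = - q * (n + m).
  apply: (mulfI nm); rewrite mulrA.
  by have : q * n ^+ 2 + p * n - (q * m ^+ 2 + p * m) = 0; [lra|rewrite !expr2; lra].
have rE : r = - q * (n * m) by move: en; rewrite pE expr2; lra.
have -> : p ^+ 2 + 4 * q * r = (q * (n - m)) ^+ 2 by rewrite pE rE; ring.
rewrite sqrtr_sqr ger0_norm; last by rewrite mulr_ge0; lra.
by rewrite pE; field; rewrite gt_eqF.
Qed.

Section market_functions.
Context {R : realType} {dI : measure_display} {I : measurableType dI}.
Variables (iota : {sigma_finite_measure set I -> \bar R}) (M : market R I) (n : I -> R).
Local Notation b := (1 + beta M).
Local Notation ga := (gamma M).
Local Notation K := (Psi_const M n).
Local Notation Psi := (Psi_star M n).
Local Notation Phi := (Phi_star iota M n).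
Let e i := alpha M i / (1 - alpha M i).
Let A i := cap M i `^ alpha M i.
Hypotheses (b0 : 0 < b) (ga0 : 0 < ga) (ga1 : ga < 1) (iota0 : (0 < iota setT)%E).
Hypotheses (cap0 : forall i, 0 < cap M i) (alpha0 : forall i, 0 < alpha M i)
  (alpha1 : forall i, alpha M i < 1) (lam0 : forall i, 0 < lam M i) (K0 : forall i, 0 < K i).
Hypotheses (mcap : measurable_fun setT (cap M)) (malpha : measurable_fun setT (alpha M))
  (mlam : measurable_fun setT (lam M)) (mK : measurable_fun setT K).
Hypothesis floor_fin : (\int[iota]_i (lam M i * cap M i `^ alpha M i)%:E < +oo)%E.
Hypothesis power_fin : forall q : R, 0 < q ->
  (\int[iota]_i (lam M i * (q * K i) `^ (alpha M i / (1 - alpha M i)))%:E < +oo)%E.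

Definition market_capacity : R -> R := capacity iota (lam M) A K e b.
Definition market_shadow_price : R -> R := shadow_price market_capacity ga.
Definition market_residual : R -> R := residual_demand market_capacity ga.
Local Notation kap := market_capacity.
Local Notation y_ := market_shadow_price.
Local Notation res := market_residual.
Local Notation H := (shadow_demand kap ga).

Let al1' i : 0 < 1 - alpha M i. Proof. by rewrite subr_gt0. Qed.
Let e0 i : 0 < e i. Proof. by rewrite divr_gt0. Qed.
Let A0 i : 0 < A i. Proof. exact: powR_gt0. Qed.
Let bn0 : b != 0. Proof. by rewrite gt_eqF. Qed.
Let bi0 : 0 < b^-1. Proof. by rewrite invr_gt0. Qed.

Let me : measurable_fun setT e.
Proof.
apply: measurable_funM => //; apply: measurable_funV_gt0 => //.
exact: measurable_funB.
Qed.

Let mA : measurable_fun setT A. Proof. exact: measurable_fun_powR. Qed.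

Let kap_gt0 y : 0 <= y -> 0 < kap y.
Proof. exact: (capacity_gt0 lam0 A0 K0 e0 b0 mlam mA mK me floor_fin power_fin iota0). Qed.
Let kap_mono y z : 0 <= y -> y <= z -> kap y <= kap z.
Proof. exact: (capacity_mono lam0 A0 K0 e0 b0 mlam mA mK me floor_fin power_fin). Qed.
Let kap_cont : continuous (fun y : R => kap (Num.max 0 y)).
Proof. exact: (capacity_continuous lam0 A0 K0 e0 mlam mA mK me floor_fin power_fin). Qed.

Lemma Iop_eq (XX YY : I -> R -> R) (x y : R) :
  (forall i, XX i x = YY i y) -> Iop iota M XX x = Iop iota M YY y.
Proof.
by move=> E; rewrite /Iop; under eq_Rintegral => i _ do rewrite E.
Qed.

Lemma Psi_starE i p : 0 <= p -> Psi i p = (K i * p `^ b) `^ (1 - alpha M i)^-1.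
Proof.
by move=> p0; rewrite /Psi_star powRM ?(ltW (K0 i)) ?powR_ge0// -powRrM.
Qed.

Lemma Psi_star_powR i p : 0 <= p -> Psi i p `^ alpha M i = (K i * p `^ b) `^ e i.
Proof. by move=> p0; rewrite Psi_starE// -powRrM [_^-1 * _]mulrC. Qed.

Lemma Iop_Psi p : 0 <= p -> Iop iota M Psi p = kap (p `^ b) `^ (- ga).
Proof.
move=> p0; rewrite /Iop; under eq_Rintegral => i _ do rewrite Psi_star_powR//.
by [].
Qed.

Let h_star_def p : h_star iota M n p = p `^ b / Iop iota M Psi p. Proof. by []. Qed.
Let phi_star_def x : phi_star iota M n x = Iop iota M Psi (h_star_inv iota M n x). Proof. by []. Qed.
Let Phi_star_def i x : Phi i x = Psi i ((x * phi_star iota M n x) `^ b^-1). Proof. by []. Qed.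
Let h_star_inv_def : h_star_inv iota M n = 'pinv_(fun=> 0) `[0, +oo[%classic (h_star iota M n).
Proof. by []. Qed.
Let kap_def : kap = capacity iota (lam M) A K e b. Proof. by []. Qed.
Let shadow_demandE y : H y = y * kap y `^ ga. Proof. by []. Qed.

Local Opaque Iop Psi_star h_star phi_star h_star_inv Phi_star market_capacity powR
  shadow_demand shadow_price residual_demand.

Lemma market_shadow_priceP x : 0 <= x -> 0 <= y_ x /\ H (y_ x) = x.
Proof. exact: (shadow_priceP ga0 kap_gt0 kap_mono kap_cont). Qed.
Lemma market_shadow_priceK y : 0 <= y -> y_ (H y) = y.
Proof. exact: (shadow_priceK ga0 kap_gt0 kap_mono kap_cont). Qed.
Lemma market_shadow_price_le x z : 0 <= x -> x <= z -> y_ x <= y_ z.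
Proof. exact: (shadow_price_le ga0 kap_gt0 kap_mono kap_cont). Qed.
Lemma market_shadow_price_gt0 x : 0 < x -> 0 < y_ x.
Proof. exact: (shadow_price_gt0 ga0 kap_gt0 kap_mono kap_cont). Qed.
Lemma mul_market_residual x : 0 <= x -> x * res x = y_ x.
Proof. exact: (mul_residual_demand ga0 kap_gt0 kap_mono kap_cont). Qed.
Lemma market_residual_gt0 x : 0 <= x -> 0 < res x.
Proof. exact: (residual_demand_gt0 ga0 kap_gt0 kap_mono kap_cont). Qed.
Lemma market_residual_anti x z : 0 <= x -> x <= z -> res z <= res x.
Proof. exact: (residual_demand_anti ga0 kap_gt0 kap_mono kap_cont). Qed.
Lemma market_residual_continuous : continuous (fun x : R => res (Num.max 0 x)).
Proof. exact: (residual_demand_continuous ga0 kap_gt0 kap_mono kap_cont). Qed.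

Let kap_powR_gt0 (p s : R) : 0 < kap (p `^ b) `^ s.
Proof. exact/powR_gt0/kap_gt0/powR_ge0. Qed.

Lemma Iop_Psi_gt0 (p : R) : 0 <= p -> 0 < Iop iota M Psi p.
Proof. by move=> p0; rewrite (Iop_Psi p0); exact: kap_powR_gt0. Qed.

Lemma Iop_Psi_anti (p q : R) : 0 <= p -> p <= q -> Iop iota M Psi q <= Iop iota M Psi p.
Proof.
move=> p0 pq; have q0 := le_trans p0 pq.
have pq' : p `^ b <= q `^ b by apply: ge0_ler_powR => //; rewrite ?nnegrE ?(ltW b0).
rewrite (Iop_Psi p0) (Iop_Psi q0).
have := kap_mono (powR_ge0 p b) pq'; have := kap_gt0 (powR_ge0 p b); have := kap_gt0 (powR_ge0 q b).
move: (kap (p `^ b)) (kap (q `^ b)) => u v v0 u0 uv.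
rewrite !powRN lef_pV2 ?posrE ?powR_gt0//.
by apply: ge0_ler_powR; rewrite ?nnegrE ?(ltW ga0) ?(ltW u0) ?(ltW v0).
Qed.

Lemma Iop_Psi_continuous : continuous (fun p : R => Iop iota M Psi (Num.max 0 p)).
Proof.
have m0 (p : R) : 0 <= Num.max 0 p by rewrite le_max lexx.
rewrite (_ : (fun p => _) = (fun p : R => kap (Num.max 0 (Num.max 0 p `^ b)) `^ (- ga))); last first.
  by apply/funext => p; rewrite (Iop_Psi (m0 p)) (max_r (powR_ge0 _ _)).
move=> p; have cp : {for p, continuous (fun p : R => kap (Num.max 0 (Num.max 0 p `^ b)))}.
  apply: (cvg_comp _ (fun u : R => kap (Num.max 0 u)) (powR_max_continuous b0 (x := p))).
  exact: kap_cont.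
apply: (cvg_comp _ (fun u : R => u `^ (- ga)) cp).
by apply: powR_continuous_gt0; exact: kap_gt0.
Qed.

Lemma h_starE (p : R) : 0 <= p -> h_star iota M n p = H (p `^ b).
Proof. by move=> p0; rewrite h_star_def (Iop_Psi p0) powRN invrK shadow_demandE. Qed.

Let powRK (p : R) : 0 <= p -> (p `^ b) `^ b^-1 = p.
Proof. by move=> p0; rewrite -powRrM (mulfV bn0) powRr1. Qed.
Let powRVK (p : R) : 0 <= p -> (p `^ b^-1) `^ b = p.
Proof. by move=> p0; rewrite -powRrM (mulVf bn0) powRr1. Qed.

Lemma h_star_inj : {in `[0, +oo[%classic &, injective (h_star iota M n)}.
Proof.
move=> p q; rewrite !inE/= !in_itv/= !andbT => p0 q0; rewrite (h_starE p0) (h_starE q0) => E.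
rewrite -(powRK p0) -(powRK q0) -(market_shadow_priceK (powR_ge0 p b)) E.
by rewrite (market_shadow_priceK (powR_ge0 q b)).
Qed.

Let h_star_shadow (x : R) : 0 <= x -> h_star iota M n (y_ x `^ b^-1) = x.
Proof.
move=> x0; have [u0 uE] := market_shadow_priceP x0.
by rewrite (h_starE (powR_ge0 _ _)) (powRVK u0).
Qed.

Lemma h_star_bij : set_bij `[0, +oo[%classic `[0, +oo[%classic (h_star iota M n).
Proof.
split; last 2 first.
- exact: h_star_inj.
- move=> x /=; rewrite in_itv/= andbT => x0.
  exists (y_ x `^ b^-1); first by rewrite /= in_itv/= powR_ge0.
  exact: h_star_shadow.
- move=> p /=; rewrite !in_itv/= !andbT => p0.
  by rewrite (h_starE p0) shadow_demandE; apply: mulr_ge0; exact: powR_ge0.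
Qed.

Lemma h_star_invE (x : R) : 0 <= x -> h_star_inv iota M n x = y_ x `^ b^-1.
Proof.
move=> x0; rewrite -[in LHS](h_star_shadow x0) h_star_inv_def (pinvKV _ h_star_inj)//.
by rewrite inE/= in_itv/= powR_ge0.
Qed.

Lemma phi_starE (x : R) : 0 <= x -> phi_star iota M n x = res x.
Proof.
move=> x0; have [u0 _] := market_shadow_priceP x0.
by rewrite phi_star_def (h_star_invE x0) (Iop_Psi (powR_ge0 _ _)) (powRVK u0).
Qed.

Lemma Phi_starE i (x : R) : 0 <= x -> Phi i x = Psi i (y_ x `^ b^-1).
Proof. by move=> x0; rewrite Phi_star_def (phi_starE x0) (mul_market_residual x0). Qed.

Lemma Iop_Phi (x : R) : 0 <= x -> Iop iota M Phi x = res x.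
Proof.
move=> x0; rewrite -(phi_starE x0) phi_star_def (h_star_invE x0).
by apply: Iop_eq => i; rewrite (Phi_starE i x0).
Qed.

Lemma Iop_Psi_shadow_price (x : R) : 0 <= x -> Iop iota M Psi (y_ x `^ b^-1) = res x.
Proof. by move=> x0; rewrite -(phi_starE x0) phi_star_def (h_star_invE x0). Qed.

Lemma h_star_ge0 (p : R) : 0 <= p -> 0 <= h_star iota M n p.
Proof. by move=> p0; rewrite (h_starE p0) shadow_demandE; apply: mulr_ge0; exact: powR_ge0. Qed.

(** Read with x = h p: the price equation then expresses the same residual demand through the
    running supremum of P or through that of X. *)
Lemma Iop_Psi_h_star (p : R) : 0 <= p -> Iop iota M Psi p = res (h_star iota M n p).
Proof.
move=> p0; rewrite -(Iop_Psi_shadow_price (h_star_ge0 p0)) (h_starE p0).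
by rewrite (market_shadow_priceK (powR_ge0 _ _)) (powRK p0).
Qed.

Lemma h_star_le (p q : R) : 0 <= p -> p <= q -> h_star iota M n p <= h_star iota M n q.
Proof.
move=> p0 pq; have q0 := le_trans p0 pq; rewrite (h_starE p0) (h_starE q0).
apply: (shadow_demand_le ga0 kap_gt0 kap_mono (powR_ge0 _ _)).
by apply: ge0_ler_powR => //; rewrite ?nnegrE ?(ltW b0).
Qed.

Lemma Iop_Phi_difference_of_convex : difference_of_convex (Iop iota M Phi).
Proof.
suff : difference_of_convex res.
  by move=> [f1 [f2 [c1 c2 k1 k2 E]]]; exists f1, f2; split; [exact: c1|exact: c2|exact: k1|exact: k2|move=> x x0; rewrite (Iop_Phi x0) (E x x0)].
apply: difference_of_convex_residual market_residual_gt0 market_residual_anti market_residual_continuous _.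
move=> x1 x2 t x10 x20 t0 t1.
have z0 : 0 <= t * x1 + (1 - t) * x2 by rewrite addr_ge0 ?mulr_ge0 ?subr_ge0 ?(ltW x10) ?(ltW x20).
rewrite (mul_market_residual (ltW x10)) (mul_market_residual (ltW x20)) (mul_market_residual z0).
have [_ E1] := market_shadow_priceP (ltW x10); have [_ E2] := market_shadow_priceP (ltW x20).
have y10 := market_shadow_price_gt0 x10; have y20 := market_shadow_price_gt0 x20.
(* Convexity of [shadow_demand] and monotonicity of its inverse give the concavity of the shadow
   price x res x. *)
have := shadow_demand_convex lam0 A0 K0 e0 b0 ga0 (ltW ga1) mlam mA mK me floor_fin power_fin iota0 y10 y20 t0 t1.
rewrite -/kap E1 E2.
have v0 : 0 <= t * y_ x1 + (1 - t) * y_ x2 by rewrite addr_ge0 ?mulr_ge0 ?subr_ge0 ?(ltW y10) ?(ltW y20).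
have Hv : 0 <= H (t * y_ x1 + (1 - t) * y_ x2) by rewrite shadow_demandE mulr_ge0 ?powR_ge0.
by move/(market_shadow_price_le Hv); rewrite market_shadow_priceK.
Qed.

Lemma Iop_Psi_difference_of_convex : difference_of_convex (Iop iota M Psi).
Proof.
(* In the variable p the exponents become b e_i and the constants K_i^(1 / b), as K_i p^b = (K_i^(1
   / b) p)^b; the result on [capacity] then applies directly. *)
pose K' i := K i `^ b^-1; pose e' i := b * e i.
have K'0 i : 0 < K' i by exact: powR_gt0.
have e'0 i : 0 < e' i by rewrite mulr_gt0.
have mK' : measurable_fun setT K' by exact: (measurableT_comp (measurable_powR _) mK).
have me' : measurable_fun setT e' by exact: measurable_funM.
have KE i y : 0 <= y -> (K' i * y) `^ e' i = (K i * y `^ b) `^ e i.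
  move=> y0; rewrite /e' powRrM powRM ?(ltW (K'0 i))//.
  by rewrite /K' -powRrM mulVf// powRr1// ltW.
have power_fin' q : 0 < q -> (\int[iota]_i (lam M i * (q * K' i) `^ e' i)%:E < +oo)%E.
  move=> q0; have := power_fin (powR_gt0 b q0).
  by under eq_integral => i _ do rewrite [q `^ b * _]mulrC -(KE i q (ltW q0)) [K' i * q]mulrC.
pose kap' := capacity iota (lam M) A K' e' b.
have kapE p : 0 <= p -> kap' p = kap (p `^ b).
  move=> p0; rewrite kap_def /kap' /capacity.
  by under eq_Rintegral => i _ do rewrite /capacity_term (KE i p p0).
have [u1 [u2 [c1 c2 k1 _ uE]]] := capacity_difference lam0 A0 K'0 e'0 b0 mlam mA mK' me' floor_fin power_fin'.
apply: (@difference_of_convex_powRN _ _ kap' u1 u2 ga (kap' 0)).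
- exact: ltW.
- by rewrite (kapE _ (lexx 0)); exact/kap_gt0/powR_ge0.
- move=> p p0; exact: (capacity_mono lam0 A0 K'0 e'0 b0 mlam mA mK' me' floor_fin power_fin' (lexx 0) p0).
- exact: c1.
- exact: c2.
- exact: k1.
- exact: (capacity_continuous lam0 A0 K'0 e'0 mlam mA mK' me' floor_fin power_fin').
- exact: uE.
- by move=> p p0; rewrite (Iop_Psi p0) (kapE p p0).
Qed.

Lemma alpha_bar_ge0 : 0 <= alpha_bar iota M.
Proof.
apply: lb_le_inf; first by exists 1; right.
by move=> a [[/andP[/ltW]]|->].
Qed.

Lemma alpha_bar_le (a : R) : 0 < a -> a < 1 -> iota [set i | a < alpha M i] = 0%E -> alpha_bar iota M <= a.
Proof.
move=> a0 a1 ia; apply: ge_inf; last by left; split => //; rewrite a0.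
by exists 0 => x [[/andP[/ltW]]|->].
Qed.

Lemma alpha_bar_le1 : alpha_bar iota M <= 1.
Proof.
apply: ge_inf; last by right.
by exists 0 => x [[/andP[/ltW]]|->].
Qed.

(** An exponent a in ]0, 1[ strictly below [alpha_bar] is exceeded on a set of types of positive
    mass, and a can be taken so close that the strict inequality with E persists. The choice a = 0,
    when it occurs, uses all types. *)
Lemma market_shadow_price_growth (E : R) :
  (1 - alpha_bar iota M) / (1 - alpha_bar iota M + alpha_bar iota M * ga) < E ->
  exists th B : R, [/\ 0 < B, 0 <= th, th <= 1, th < E &
    forall x, 0 <= x -> x * res x <= B * (1 + x `^ th)].
Proof.
move=> abE; have := alpha_bar_ge0; have := alpha_bar_le1; have := alpha_bar_le.
move: (alpha_bar iota M) abE => ab abE ab_le ab1 ab0.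
have den (a : R) : 0 <= a -> a <= 1 -> 0 < 1 - a + a * ga.
  move=> a0 a1; have [->|an] := eqVneq a 0; first by rewrite mul0r addr0 subr0.
  by rewrite ltr_wpDl ?subr_ge0// mulr_gt0// lt_neqAle eq_sym an.
have E0 : 0 < E.
  by apply: le_lt_trans abE; rewrite divr_ge0 ?subr_ge0// ltW// den.
have [a [a0 a1 aE ia]] : exists a, [/\ 0 <= a, a < 1, (1 - a) / (1 - a + a * ga) < E &
    (0 < iota [set i | (a / (1 - a) <= e i)%R])%E].
  have i0 : [set i | 0 / (1 - 0) <= e i] = setT.
    by apply/seteqP; split => // i _ /=; rewrite mul0r ltW.
  have [ab_eq|abn] := eqVneq ab 0.
    by exists 0; rewrite i0; split => //; rewrite -ab_eq.
  have ab_gt0 : 0 < ab by rewrite lt_neqAle eq_sym abn.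
  pose g := E * (1 - ab + ab * ga) - (1 - ab).
  have g0 : 0 < g by move: abE; rewrite ltr_pdivrMr ?den// /g subr_gt0.
  (* Lowering [ab] by eta takes eta out of the gap g, while the side multiplied by E only gains
     because ga < 1; so g / 2 is small enough. *)
  pose eta := Num.min ab (g / 2).
  have eta0 : 0 < eta by rewrite lt_min ab_gt0 divr_gt0.
  have eta1 : eta <= ab by rewrite ge_min lexx.
  have eta2 : eta <= g / 2 by rewrite ge_min lexx orbT.
  have a0 : 0 <= ab - eta by rewrite subr_ge0.
  have a1 : ab - eta < 1 by lra.
  exists (ab - eta); split => //.
    rewrite ltr_pdivrMr ?den ?(ltW a1)//.
    have : 0 <= E * eta * (1 - ga) by rewrite !mulr_ge0 ?(ltW E0) ?(ltW eta0)// subr_ge0 ltW.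
    by move: (eta) eta0 eta2 g0; rewrite /g => u *; lra.
  have [az|an] := eqVneq (ab - eta) 0; first by rewrite az i0.
  have a_gt0 : 0 < ab - eta by rewrite lt_neqAle eq_sym an.
  have ms : measurable [set i | ab - eta < alpha M i].
    have := malpha measurableT (measurable_itv `]ab - eta, +oo[).
    by rewrite setTI; congr measurable; apply/seteqP; split => i /=; rewrite in_itv/= andbT.
  apply: (@lt_le_trans _ _ (iota [set i | ab - eta < alpha M i])).
    rewrite lt_neqAle measure_ge0 andbT eq_sym; apply/eqP => z.
    by have := ab_le _ a_gt0 a1 z; rewrite leNgt ltrBlDr ltrDl eta0.
  apply: le_measure; rewrite ?inE//.
    have := me measurableT (measurable_itv `[(ab - eta) / (1 - (ab - eta)), +oo[).
    by rewrite setTI; congr measurable; apply/seteqP; split => i /=; rewrite in_itv/= andbT.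
  move=> i /= /ltW ai; have := al1' i; have : 0 < 1 - (ab - eta) by rewrite subr_gt0.
  move: ai; rewrite /e; move: (ab - eta) (alpha M i) => u v uv u1 v1.
  by rewrite ler_pdivrMr// mulrAC ler_pdivlMr//; lra.
pose s := a / (1 - a).
have a1' : 0 < 1 - a by rewrite subr_gt0.
have s0 : 0 <= s by rewrite divr_ge0// ltW.
have [k k0 kap_ge] := capacity_growth lam0 A0 K0 e0 b0 mlam mA mK me floor_fin power_fin s0 ia.
have [B B0 hB] := shadow_price_growth ga0 kap_gt0 kap_mono kap_cont s0 k0 kap_ge.
have d0 : 0 < 1 + ga * s by rewrite ltr_wpDr// mulr_ge0// ltW.
exists (1 + ga * s)^-1, B; split => //.
- by rewrite invr_ge0 ltW.
- by rewrite invf_le1// lerDl mulr_ge0// ltW.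
- apply: le_lt_trans aE; rewrite le_eqVlt; apply/orP; left; apply/eqP.
  rewrite /s; field; rewrite !gt_eqF//=.
  by apply: den => //; exact: ltW.
- by move=> x x0; rewrite mul_market_residual//; exact: hB.
Qed.

End market_functions.

(** * The equilibrium *)

Section reflected_price.
Context {R : realType} {d : measure_display} {Omega : measurableType d}.
Variables (F : R -> set (set Omega)) (X : R -> Omega -> R) (res : R -> R) (b : R).
Local Notation fmeas := (filtration_measurable F).
Hypotheses (hF : is_filtration F) (X_gt0 : forall t w, 0 < X t w)
  (cX : continuous_paths X) (mX : forall t, 0 <= t -> fmeas t (X t)).
Hypotheses (b0 : 0 < b) (res_gt0 : forall x, 0 <= x -> 0 < res x)
  (res_cont : continuous (fun x : R => res (Num.max 0 x)))
  (xres_mono : forall x z, 0 <= x -> x <= z -> x * res x <= z * res z).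
Local Notation Xbar t w := (msup (X^~ w) 0 t).

Definition reflected_price t w := (X t w * res (Xbar t w)) `^ b^-1.
Local Notation P := reflected_price.

Let Xbar_ge t w : 0 <= t -> X t w <= Xbar t w.
Proof. by move=> t0; apply: (msup_ub (@cX w)) => //; rewrite t0 lexx. Qed.
Let Xbar_gt0 t w : 0 <= t -> 0 < Xbar t w.
Proof. by move=> t0; exact: lt_le_trans (Xbar_ge w t0). Qed.
Let Xres_gt0 t w : 0 <= t -> 0 < X t w * res (Xbar t w).
Proof. by move=> t0; rewrite mulr_gt0// res_gt0// ltW// Xbar_gt0. Qed.
Let bi0 : 0 < b^-1. Proof. by rewrite invr_gt0. Qed.

Lemma reflected_price_powR t w : 0 <= t -> P t w `^ b = X t w * res (Xbar t w).
Proof.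
by move=> t0; rewrite /P -powRrM mulVf ?gt_eqF// powRr1// ltW// Xres_gt0.
Qed.

Lemma reflected_price_continuous : continuous_paths P.
Proof.
move=> w; apply/subspace_continuousP => t tin.
have t0 : 0 <= t by move: tin; rewrite /= in_itv/= andbT.
have c1 : X s w @[s --> within `[0, +oo[ (nbhs t)] --> X t w.
  by move/subspace_continuousP : (@cX w); exact.
have c2 : res (Xbar s w) @[s --> within `[0, +oo[ (nbhs t)] --> res (Xbar t w).
  have c : {within `[0, +oo[, continuous (fun s => res (Xbar s w))}.
    apply: within_continuous_max => s.
    rewrite (_ : (fun s => _) = (fun x : R => res (Num.max 0 x)) \o (fun s : R => Xbar (Num.max 0 s) w)).
      by apply: continuous_comp; [exact: (msup_continuous (@cX w))|exact: res_cont].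
    apply/funext => u /=; rewrite [Num.max 0 (msup _ _ _)]max_r//; apply/ltW/Xbar_gt0; rewrite le_max lexx//.
  by move/subspace_continuousP : c; exact.
apply: (cvg_comp _ (fun u : R => u `^ b^-1) (cvgM c1 c2)).
exact/powR_continuous_gt0/Xres_gt0.
Qed.

Lemma reflected_price_adapted t : 0 <= t -> fmeas t (P t).
Proof.
move=> t0; apply: (measurableT_comp (measurable_powR _)).
apply: measurable_funM; first exact: mX.
rewrite (_ : (fun w => _) = (fun x : R => res (Num.max 0 x)) \o (fun w => Xbar t w)).
  apply: (measurableT_comp (continuous_measurable_fun res_cont)).
  exact: (msup_filtration_measurable hF cX (@mX)).
by apply/funext => w /=; rewrite max_r// ltW// Xbar_gt0.
Qed.

(** The price is at its running maximum when X is, because x res x increases. *)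
Lemma reflected_price_msup t w : 0 <= t ->
  msup (P^~ w) 0 t = (Xbar t w * res (Xbar t w)) `^ b^-1.
Proof.
move=> t0; apply/eqP; rewrite eq_le; apply/andP; split.
  apply: (msup_le t0) => s /andP[s0 st].
  have Xst : Xbar s w <= Xbar t w by exact: (msup_monor (@cX w)).
  have y0 : 0 <= Xbar s w by rewrite ltW// Xbar_gt0.
  have h : X s w * res (Xbar s w) <= Xbar t w * res (Xbar t w).
    by apply: (le_trans _ (xres_mono y0 Xst)); rewrite ler_pM2r ?res_gt0// Xbar_ge.
  apply: ge0_ler_powR h; rewrite ?nnegrE ?(ltW bi0) ?(ltW (Xres_gt0 _ _))//.
  by rewrite mulr_ge0// ltW ?res_gt0 ?Xbar_gt0// ltW// Xbar_gt0.
have [s /andP[s0 st] E] := msup_attained (@cX w) (lexx 0) t0.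
have Es : Xbar s w = Xbar t w.
  apply/eqP; rewrite eq_le (msup_monor (@cX w))//=.
  by rewrite [leLHS]E Xbar_ge.
apply: le_trans (msup_ub (@reflected_price_continuous w) (lexx 0) (_ : 0 <= s <= t)); last by rewrite s0 st.
by rewrite /P Es -E.
Qed.

(** At a maximizer of Q on [0, t] the equation reads X = h (sup Q), and at the other times X <= h
    (sup Q). Hence h (sup Q) = sup X, and X determines Q. *)
Lemma reflected_price_unique (g h : R -> R) (Q : R -> Omega -> R) :
  (forall p, 0 <= p -> 0 < g p) -> (forall p, 0 <= p -> h p = p `^ b / g p) ->
  (forall p q, 0 <= p -> p <= q -> h p <= h q) ->
  (forall p, 0 <= p -> g p = res (h p)) ->
  continuous_paths Q ->
  (forall t w, 0 <= t -> Q t w = (X t w * g (msup (Q^~ w) 0 t)) `^ b^-1) ->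
  forall t w, 0 <= t -> Q t w = P t w.
Proof.
move=> g0 hE h_le gE cQ QE t w t0.
have Q0 s : 0 <= s -> 0 <= Q s w by move=> s0; rewrite QE// powR_ge0.
have Qb s : 0 <= s -> 0 <= msup (Q^~ w) 0 s.
  by move=> s0; apply: (le_trans (Q0 s s0)); apply: (msup_ub (@cQ w)) => //; rewrite s0 lexx.
have XE s : 0 <= s -> X s w = Q s w `^ b / g (msup (Q^~ w) 0 s).
  move=> s0; have gs := g0 _ (Qb s s0).
  rewrite QE// -powRrM mulVf ?gt_eqF// powRr1 ?mulfK ?gt_eqF//.
  by rewrite mulr_ge0// ltW.
suff E : h (msup (Q^~ w) 0 t) = Xbar t w by rewrite QE// gE ?Qb// E.
apply/eqP; rewrite eq_le; apply/andP; split.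
  have [s /andP[s0 st] E] := msup_attained (@cQ w) (lexx 0) t0.
  have Es : msup (Q^~ w) 0 s = msup (Q^~ w) 0 t.
    apply/eqP; rewrite eq_le (msup_monor (@cQ w))//=.
    by rewrite [leLHS]E; apply: (msup_ub (@cQ w)) => //; rewrite s0 lexx.
  have st' : 0 <= s <= t by rewrite s0 st.
  apply: le_trans (msup_ub (@cX w) (lexx 0) st').
  by rewrite /= XE// Es E hE// -E Qb.
apply: (msup_le t0) => s /andP[s0 st].
have Qst : msup (Q^~ w) 0 s <= msup (Q^~ w) 0 t by exact: (msup_monor (@cQ w)).
apply: (le_trans _ (h_le _ _ (Qb s s0) Qst)).
rewrite XE// hE ?Qb// ler_pM2r ?invr_gt0 ?g0 ?Qb//.
apply: ge0_ler_powR; rewrite ?nnegrE ?(ltW b0) ?Q0 ?Qb//.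
by apply: (msup_ub (@cQ w)) => //; rewrite s0 lexx.
Qed.

End reflected_price.

(** * Progressive measurability of families driven by one increasing process *)

Section progressive_measurability.
Context {R : realType} {d : measure_display} {Omega : measurableType d}.
Variables (F : R -> set (set Omega)) (Z : R -> Omega -> R).
Hypotheses (hF : is_filtration F).
Hypothesis mZ : forall t, 0 <= t -> filtration_measurable F t (Z t).
Hypothesis Z_nd : forall s t w, 0 <= s -> s <= t -> Z s w <= Z t w.
Hypothesis Z_cont : forall w, continuous (fun t : R => Z (Num.max 0 t) w).

Let ltZP t w x : 0 <= t ->
  x < Z t w <-> exists q : rat, [/\ 0 <= q, ratr q <= t & x < Z (ratr q) w].
Proof.
move=> t0; split=> [xZ|[q [q0 qt xq]]]; last first.
  by apply: (lt_le_trans xq); apply: Z_nd => //; rewrite ler0q.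
have [t_eq|tn] := eqVneq t 0.
  by exists 0; rewrite rmorph0 -t_eq; split.
have tgt : 0 < t by rewrite lt_neqAle eq_sym tn.
have mt : Num.max 0 t = t by exact: max_r.
have : \forall s \near t, x < Z (Num.max 0 s) w.
  have : Z (Num.max 0 s) w @[s --> t] --> Z t w by rewrite -{2}mt; exact: Z_cont.
  move/cvgrPdist_lt => /(_ (Z t w - x)).
  rewrite subr_gt0 xZ => /(_ isT); apply: filterS => s.
  by rewrite ltr_norml => /andP[_]; move: (Z (Num.max 0 s) w) (Z t w) => u v; lra.
move=> [e /= e0 He].
have te : Num.max 0 (t - e) < t by rewrite gt_max tgt ltrBlDr ltrDl.
have [q] := rat_in_itvoo te.
rewrite in_itv/= gt_max => /andP[/andP[q0 qe] qt].
exists q; split; [by rewrite -(@ler0q R) ltW|exact: ltW|].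
have := He (ratr q); rewrite max_r ?(ltW q0)//; apply.
by rewrite /= ger0_norm; lra.
Qed.

(** By monotonicity and continuity, the set where Z > x on [0, T] is the union over rational q in
    [0, T] of the rectangles {Z q > x} times [q, T], which belong to the generating family; general
    B follow from the half-lines. *)
Lemma nondecreasing_progressive (B : set R) : measurable B ->
  progressive F [set x : Omega * R | 0 <= x.2 /\ B (Z x.2 x.1)].
Proof.
move=> mB; split; first by move=> x [].
move=> T T0; set D := [set x : Omega * R | 0 <= x.2 <= T]; set G := [set _ | _ in _ & _ in _].
suff : image_set_system D (fun x : Omega * R => Z x.2 x.1) <<s D, G>> B.
  rewrite /image_set_system/=; congr (smallest _ _ _); apply/seteqP; split => x /=.
    by move=> [/andP[x0 xT] Bx]; split=> //; rewrite /D/= x0.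
  by move=> [[x0 Bx] /andP[_ xT]]; split=> //; rewrite /D/= x0.
have := sigma_algebra_image (fun x : Omega * R => Z x.2 x.1) (smallest_sigma_algebra D G).
have {}mB : (RGenOInfty.G (R:=R)).-sigma.-measurable B by rewrite -RGenOInfty.measurableE.
move=> sI; apply: (smallest_sub sI _ mB) => _ [x ->] /=; rewrite /image_set_system/=.
pose S (k : nat) : set (Omega * R) := if unpickle k is Some q then
  if (0 <= (q : rat)) && (ratr q <= T) then [set w | x < Z (ratr q) w] `*` `[ratr q, T] else set0
  else set0.
rewrite (_ : _ `&` _ = \bigcup_k S k).
  apply: sigma_algebra_bigcup => k; rewrite /S.
  case: (unpickle k) => [q|]; last exact: sigma_algebra0.
  case: ifPn => [/andP[q0 qT]|_]; last exact: sigma_algebra0.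
  have rq0 : (0 : R) <= ratr q by rewrite ler0q.
  apply: sub_sigma_algebra; exists [set w | x < Z (ratr q) w].
    have [_ _ FF] := hF; apply: (FF _ _ rq0 qT).
    have := (filtration_measurableP hF _ rq0).1 (mZ rq0) _ (measurable_itv `]x, +oo[).
    by congr (F _ _); apply/seteqP; split => w /=; rewrite in_itv/= andbT.
  exists `[ratr q, T]%classic => //; split; first exact: measurable_itv.
  by move=> u /=; rewrite !in_itv/= => /andP[qu ->]; rewrite (le_trans rq0).
apply/seteqP; split => -[w t] /=.
  rewrite in_itv/= andbT => -[/andP[t0 tT] /(ltZP _ _ t0)[q [q0 qt xq]]].
  exists (pickle q); first by [].
  rewrite /S pickleK q0 (le_trans qt tT)/=; split; first exact: xq.
  by rewrite /= in_itv/= qt.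
move=> [k _]; rewrite /S; case: (unpickle k) => [q|]//; case: ifPn => // /andP[q0 qT] /= [xq].
rewrite in_itv/= => /andP[qt tT]; have t0 : 0 <= t by apply: le_trans qt; rewrite ler0q.
split; first by rewrite /D/= t0 tT.
by rewrite in_itv/= andbT; apply/(ltZP _ _ t0); exists q; split.
Qed.

Context {dI : measure_display} {I : measurableType dI}.

(** Time and scenario enter the whole family through the single process Z, so the question reduces
    to generating rectangles of R * I. *)
Lemma nondecreasing_family_progressive (f : R * I -> R) (B : set R) :
  measurable_fun setT f -> measurable B ->
  <<s [set x : (Omega * R) * I | 0 <= x.1.2],
      [set A `*` J | A in progressive F & J in measurable] >>
    [set x | 0 <= x.1.2 /\ B (f (Z x.1.2 x.1.1, x.2))].
Proof.
move=> mf mB; set D := [set x : (Omega * R) * I | 0 <= x.1.2]; set G := [set _ | _ in _ & _ in _].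
pose g (x : (Omega * R) * I) : R * I := (Z x.1.2 x.1.1, x.2).
suff : image_set_system D g <<s D, G>> (f @^-1` B) by [].
have := sigma_algebra_image g (smallest_sigma_algebra D G).
have mfB : measurable (f @^-1` B) by rewrite -[X in measurable X]setTI; exact: mf.
move: mfB; rewrite measurable_prod_measurableType => mfB sI.
apply: (smallest_sub sI _ mfB) => _ [B1 mB1 [J mJ <-]]; rewrite /image_set_system/=.
apply: sub_sigma_algebra; exists [set x : Omega * R | 0 <= x.2 /\ B1 (Z x.2 x.1)].
  exact: nondecreasing_progressive.
exists J => //; apply/seteqP; split => -[[w t] i] /=.
  by move=> [[? ?] ?].
by move=> [? [? ?]].
Qed.

End progressive_measurability.

Lemma convex_function_on {R : realType} (f : R -> R) :
  convex_function (`[0, +oo[%classic : set R) f -> convex_on `[0, +oo[ f.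
Proof.
move=> cf x y t x0 y0 t0 t1.
by apply: (cf (Itv01 t0 t1) x y); rewrite inE.
Qed.

Lemma log_increment {R : realType} (b nu sg t x w v u l l0 : R) : 0 < b ->
  l = b^-1 * (x + (nu * t + sg * w) + v) -> l0 = b^-1 * (x + (nu * 0 + sg * 0) + u) ->
  l = l0 + nu / b * t + b^-1 * (v - u) + sg / b * w.
Proof. by move=> b0 -> ->; field; rewrite gt_eqF. Qed.

(** * Price, strategies and dynamics of the market *)

Section market_equilibrium.
Context {R : realType} {dI : measure_display} {I : measurableType dI}.
Variables (iota : {sigma_finite_measure set I -> \bar R}) (M : market R I) (n : I -> R).
Context {d : measure_display} {Omega : measurableType d}.
Variables (P : probability Omega R) (F : R -> set (set Omega)) (W : R -> Omega -> R).
Local Notation b := (1 + beta M).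
Local Notation ga := (gamma M).
Local Notation K := (Psi_const M n).
Local Notation Psi := (Psi_star M n).
Local Notation Phi := (Phi_star iota M n).
Local Notation y_ := (market_shadow_price iota M n).
Local Notation res := (market_residual iota M n).
Local Notation TR := (Omega * measurableTypeR R)%type.
Local Notation leb := (@lebesgue_measure R).
Hypotheses (b0 : 0 < b) (ga0 : 0 < ga) (ga1 : ga < 1) (iota0 : (0 < iota setT)%E).
Hypotheses (cap0 : forall i, 0 < cap M i) (alpha0 : forall i, 0 < alpha M i)
  (alpha1 : forall i, alpha M i < 1) (lam0 : forall i, 0 < lam M i) (K0 : forall i, 0 < K i).
Hypotheses (mcap : measurable_fun setT (cap M)) (malpha : measurable_fun setT (alpha M))
  (mlam : measurable_fun setT (lam M)) (mK : measurable_fun setT K).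
Hypothesis floor_fin : (\int[iota]_i (lam M i * cap M i `^ alpha M i)%:E < +oo)%E.
Hypothesis power_fin : forall q : R, 0 < q ->
  (\int[iota]_i (lam M i * (q * K i) `^ (alpha M i / (1 - alpha M i)))%:E < +oo)%E.
Hypotheses (hF : is_filtration F) (hW : is_brownian F P W) (D00 : 0 < D0 M).

Let x0 := D0 M `^ ga.
Let nu := ga * mu_tilde M.
Let sg := sigma M.
Local Notation Xg := (gbm W x0 nu sg).
Local Notation Xbar t w := (msup (Xg^~ w) 0 t).

Hypotheses (n1 : forall i, 1 < n i) (rate0 : forall i, 0 < rate M i)
  (cost0 : forall i, 0 < cost M i)
  (root : forall i, growth nu sg (n i) = rate M i)
  (mu_lt : forall i, growth nu sg 1 < rate M i).
Hypothesis excess : forall i,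
  (1 - alpha_bar iota M) / (1 - alpha_bar iota M + alpha_bar iota M * ga) <
  (n i - 1) * (1 - alpha M i) / alpha M i.

Let x0_gt0 : 0 < x0. Proof. exact: powR_gt0. Qed.

Lemma market_X_gbm : X M W = Xg.
Proof.
apply/funext => t; apply/funext => w; rewrite /X /base_demand /gbm.
rewrite powRM ?(ltW D00) ?expR_ge0// -expRM; congr (_ * expR _).
by rewrite /nu /sg /sigma; ring.
Qed.

Let res_gt0 (x : R) : 0 <= x -> 0 < res x.
Proof. exact: market_residual_gt0. Qed.
Let res_anti (x z : R) : 0 <= x -> x <= z -> res z <= res x.
Proof. exact: market_residual_anti. Qed.
Let res_cont : continuous (fun x : R => res (Num.max 0 x)).
Proof. exact: market_residual_continuous. Qed.
Let xresE (x : R) : 0 <= x -> x * res x = y_ x.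
Proof. exact: mul_market_residual. Qed.
Let y_ge0 (x : R) : 0 <= x -> 0 <= y_ x.
Proof. by move=> x00; have [] := market_shadow_priceP b0 ga0 iota0 cap0 alpha0 alpha1 lam0 K0 mcap malpha mlam mK floor_fin power_fin x00. Qed.
Let xres_mono (x z : R) : 0 <= x -> x <= z -> x * res x <= z * res z.
Proof.
move=> x00 xz; rewrite (xresE x00) (xresE (le_trans x00 xz)).
exact: (market_shadow_price_le b0 ga0 iota0 cap0 alpha0 alpha1 lam0 K0 mcap malpha mlam mK floor_fin power_fin).
Qed.
Let IPhi (x : R) : 0 <= x -> Iop iota M Phi x = res x.
Proof. exact: Iop_Phi. Qed.
Let IPsi_y (x : R) : 0 <= x -> Iop iota M Psi (y_ x `^ b^-1) = res x.
Proof. exact: Iop_Psi_shadow_price. Qed.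
Let IPsi_gt0 (p : R) : 0 <= p -> 0 < Iop iota M Psi p.
Proof. exact: Iop_Psi_gt0. Qed.
Let IPsi_anti (p q : R) : 0 <= p -> p <= q -> Iop iota M Psi q <= Iop iota M Psi p.
Proof. exact: Iop_Psi_anti. Qed.
Let IPsi_cont : continuous (fun p : R => Iop iota M Psi (Num.max 0 p)).
Proof. exact: Iop_Psi_continuous. Qed.
Let IPsi_h (p : R) : 0 <= p -> Iop iota M Psi p = res (h_star iota M n p).
Proof. exact: Iop_Psi_h_star. Qed.
Let h_le (p q : R) : 0 <= p -> p <= q -> h_star iota M n p <= h_star iota M n q.
Proof. exact: h_star_le. Qed.
Let PhiE i (x : R) : 0 <= x -> Phi i x = Psi i (y_ x `^ b^-1).
Proof. exact: Phi_starE. Qed.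
Let PsiE i (p : R) : 0 <= p -> Psi i p = (K i * p `^ b) `^ (1 - alpha M i)^-1.
Proof. exact: Psi_starE. Qed.
Let DC_Psi : difference_of_convex (Iop iota M Psi).
Proof. exact: Iop_Psi_difference_of_convex. Qed.
Let DC_Phi : difference_of_convex (Iop iota M Phi).
Proof. exact: Iop_Phi_difference_of_convex. Qed.
Let growth_bound i : exists th B : R, [/\ 0 < B, 0 <= th, th <= 1,
  th < (n i - 1) * (1 - alpha M i) / alpha M i &
  forall x, 0 <= x -> x * res x <= B * (1 + x `^ th)].
Proof. exact: market_shadow_price_growth (excess i). Qed.

Let IopE (XX : I -> R -> R) (z : R) : Iop iota M XX z =
  (b * \int[iota]_i (lam M i * Num.max (cap M i `^ alpha M i) (XX i z `^ alpha M i))) `^ (- ga).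
Proof. by []. Qed.

Local Opaque Iop Psi_star h_star Phi_star market_capacity market_shadow_price market_residual powR.

Let X_gt0 t w : 0 < Xg t w. Proof. exact: gbm_gt0. Qed.
Let cX : continuous_paths Xg. Proof. exact: (gbm_continuous hW). Qed.
Let mX t : 0 <= t -> filtration_measurable F t (Xg t). Proof. exact: (gbm_fmeas hF hW). Qed.
Let Xbar_gt0 t w : 0 <= t -> 0 < Xbar t w.
Proof. by move=> t0; exact: (msup_gbm_gt0 hW). Qed.
Let Xbar_ge0 t w : 0 <= t -> 0 <= Xbar t w.
Proof. by move=> t0; exact/ltW/Xbar_gt0. Qed.

Definition market_price := reflected_price Xg res b.
Local Notation p_ := market_price.

Let p_cont : continuous_paths p_.
Proof. exact: (reflected_price_continuous X_gt0 cX res_gt0 res_cont). Qed.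

Let running_supE (Y : R -> Omega -> R) t w : running_sup Y t w = msup (Y^~ w) 0 t.
Proof. by []. Qed.

Let pbarE t w : 0 <= t -> running_sup p_ t w = y_ (Xbar t w) `^ b^-1.
Proof.
move=> t0; rewrite running_supE (reflected_price_msup X_gt0 cX b0 res_gt0 res_cont xres_mono w t0).
by rewrite (xresE (Xbar_ge0 w t0)).
Qed.

Lemma market_price_process : price_process F p_.
Proof.
split; first exact: p_cont.
move=> t t0 B mB; apply: (filtration_measurableP hF _ t0).1 => //.
exact: reflected_price_adapted.
Qed.

Lemma market_priceE t w : 0 <= t -> p_ t w = (X M W t w * Iop iota M Phi (running_sup (X M W) t w)) `^ b^-1.
Proof.
by move=> t0; rewrite market_X_gbm running_supE (IPhi (Xbar_ge0 w t0)).
Qed.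

Lemma market_price_equation : price_equation iota M F W n p_.
Proof.
split; first exact: market_price_process.
move=> t w t0; rewrite market_X_gbm (pbarE w t0) (IPsi_y (Xbar_ge0 w t0)).
by [].
Qed.

Lemma market_price_unique Q : price_equation iota M F W n Q ->
  forall t w, 0 <= t -> Q t w = p_ t w.
Proof.
move=> [[cQ _]]; rewrite market_X_gbm => QE.
apply: (reflected_price_unique X_gt0 cX b0 IPsi_gt0 _ h_le IPsi_h cQ QE).
by move=> p p0.
Qed.

Lemma expansionE i : expansion M n p_ i = reflected_capital W x0 nu sg (alpha M i) (K i) (cap M i) res.
Proof.
apply/funext => t; apply/funext => w; rewrite /expansion /reflected_capital.
have [//|t0] := ltP t 0; rewrite (pbarE w t0) (PsiE i (powR_ge0 _ _)).
rewrite -powRrM mulVf ?gt_eqF// powRr1 ?y_ge0 ?Xbar_ge0//.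
by rewrite (xresE (Xbar_ge0 w t0)).
Qed.

Lemma expansion_Phi i t w : 0 <= t ->
  expansion M n p_ i t w = Num.max (cap M i) (Phi i (running_sup (X M W) t w)).
Proof.
move=> t0; rewrite /expansion ltNge t0/= (pbarE w t0) market_X_gbm running_supE.
by rewrite (PhiE i (Xbar_ge0 w t0)).
Qed.

Lemma discounted_output_joint i (C : R -> Omega -> R) :
  (forall t, 0 <= t -> filtration_measurable F t (C t)) -> (forall w, right_continuous (C^~ w)) ->
  (\int[P]_w \int[leb]_(t in `[0%R, +oo[) (expR (- rate M i * t) * C t w `^ alpha M i * Xg t w)%:E =
   \int[P \x leb]_(x in [set x | (0 <= x.2)%R])
     (expR (- rate M i * x.2) * C x.2 x.1 `^ alpha M i * Xg x.2 x.1)%:E)%E.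
Proof.
move=> mC rC.
apply: (@integral_fst_from _ _ _ P 0 (fun t w => expR (- rate M i * t) * C t w `^ alpha M i * Xg t w)); last first.
  by move=> t w t0; apply: mulr_ge0; [apply: mulr_ge0; [exact: expR_ge0|exact: powR_ge0]|exact: ltW].
apply: measurable_funM; last exact: (process_joint_measurable hF cX (@mX)).
apply: measurable_funM.
  by apply: measurable_funTS; apply: measurableT_comp => //; exact: measurable_funM.
apply: (measurableT_comp (measurable_powR _)); apply: joint_measurable; last by move=> w t _; exact: rC.
by move=> t t0; apply: (filtration_measurable_fun hF t0); exact: mC.
Qed.

Lemma admissibleP i (C : R -> Omega -> R) : admissible M P F W i C <->
  strategy P F W x0 nu sg (rate M i) (alpha M i) (cap M i) C /\
  forall w t, cvg (C x w @[x --> t^'-]).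
Proof.
split=> [[aC ndC cC C_neg]|[[mC ndC rC C_neg fin] lC]].
  rewrite market_X_gbm => fin.
  have mC t : 0 <= t -> filtration_measurable F t (C t).
    by move=> t0; apply/(filtration_measurableP hF _ t0); exact: aC.
  have rC w : right_continuous (C^~ w) by have [] := cC w.
  split; last by move=> w; have [] := cC w.
  by split => //; rewrite -discounted_output_joint.
split.
- by move=> t t0; apply: (filtration_measurableP hF _ t0).1; exact: mC.
- exact: ndC.
- by move=> w; split; [exact: rC|exact: lC].
- exact: C_neg.
- by rewrite market_X_gbm discounted_output_joint.
Qed.

Lemma performance_payoff i (C : R -> Omega -> R) :
  performance M P i p_ C = payoff P W x0 nu sg (rate M i) (alpha M i) (cost M i) res C.
Proof.
apply: eq_integral => w _; congr (_ - _)%E.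
apply: eq_integral => t; rewrite inE/= in_itv/= andbT => t0.
by rewrite (reflected_price_powR X_gt0 cX b0 res_gt0 w t0).
Qed.

Lemma expansion_admissible i : admissible M P F W i (expansion M n p_ i).
Proof.
have [th [B [B0 th0 th1 thn hB]]] := growth_bound i.
apply/admissibleP; rewrite expansionE; split.
  exact: (reflected_capital_strategy hF hW x0_gt0 (root i) (rate0 i) (alpha0 i) (alpha1 i)
    (K0 i) (cap0 i) res_gt0 res_cont xres_mono B0 th0 thn hB).
by move=> w t; exact: (reflected_capital_left_limit hW x0_gt0 (alpha1 i) (K0 i) res_gt0 res_cont).
Qed.

Lemma expansion_optimal i C : admissible M P F W i C ->
  (performance M P i p_ C <= performance M P i p_ (expansion M n p_ i))%E.
Proof.
move=> /admissibleP[sC _]; rewrite !performance_payoff expansionE.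
have [th [B [B0 th0 th1 thn hB]]] := growth_bound i.
apply: (payoff_le_reflected hF hW x0_gt0 (n1 i) (root i) (rate0 i) (mu_lt i) (alpha0 i) (alpha1 i)
  (cost0 i) (K0 i) (cap0 i) _ res_gt0 res_anti res_cont xres_mono B0 th0 th1 thn hB sC).
have muE : growth nu sg 1 = mu M by rewrite /growth /mu /nu /sg /sigma; field.
have := mu_lt i; rewrite muE /Psi_const => h.
have := n1 i; have := alpha0 i; have := cost0 i; move: h.
move: (n i) (alpha M i) (cost M i) (rate M i) (mu M) => v a k r m rm k0 a0 v1.
have v0 : 0 < v by exact: lt_trans v1.
have v1' : 0 < v - 1 by rewrite subr_gt0.
have rm' : 0 < r - m by rewrite subr_gt0.
by field; rewrite !gt_eqF.
Qed.

Let al1' i : 0 < 1 - alpha M i. Proof. by rewrite subr_gt0. Qed.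

Let mexp : measurable_fun setT (fun i => (1 - alpha M i)^-1).
Proof. by apply: measurable_funV_gt0 => //; exact: measurable_funB. Qed.

Lemma expansion_admissible_family : admissible_family M P F W (expansion M n p_).
Proof.
split; first exact: expansion_admissible.
move=> B mB.
(* The logarithm of the shadow price is used so that the base K exp z is positive for every real z,
   and f is measurable on all of R * I. *)
pose Z t w := ln (y_ (Xbar t w)).
pose f (x : R * I) := Num.max (cap M x.2) ((K x.2 * expR x.1) `^ (1 - alpha M x.2)^-1).
have y_gt0 t w : 0 <= t -> 0 < y_ (Xbar t w).
  by move=> t0; rewrite -(xresE (Xbar_ge0 w t0)); apply: mulr_gt0; [exact: Xbar_gt0|exact/res_gt0/Xbar_ge0].
have CE i t w : 0 <= t -> expansion M n p_ i t w = f (Z t w, i).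
  move=> t0; rewrite /expansion ltNge t0/= (pbarE w t0) (PsiE i (powR_ge0 _ _)).
  rewrite -powRrM mulVf ?gt_eqF// powRr1 ?y_ge0 ?Xbar_ge0// /f /Z/=.
  by rewrite lnK// posrE y_gt0.
have mf : measurable_fun setT f.
  apply: measurable_maxr; first exact: (measurableT_comp mcap measurable_snd).
  apply: measurable_fun_powR; last exact: (measurableT_comp mexp measurable_snd).
    by move=> x; rewrite mulr_gt0 ?expR_gt0.
  apply: measurable_funM; first exact: (measurableT_comp mK measurable_snd).
  exact: (measurableT_comp (@measurable_expR R) measurable_fst).
rewrite (_ : [set x | _] = [set x | 0 <= x.1.2 /\ B (f (Z x.1.2 x.1.1, x.2))]); last first.
  by apply/seteqP; split => -[[w t] i] /= [t0 Bx]; split => //; move: Bx; rewrite CE.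
have Xbar_le s t w : 0 <= s -> s <= t -> Xbar s w <= Xbar t w.
  by move=> s0 st; exact: (msup_monor (@cX w)).
pose g (x : R) := Num.max 0 x * res (Num.max 0 x).
have gE t w : 0 <= t -> g (Xbar t w) = y_ (Xbar t w).
  by move=> t0; rewrite /g (max_r (Xbar_ge0 w t0)) (xresE (Xbar_ge0 w t0)).
have cg : continuous g.
  move=> x; apply: cvgM; last exact: res_cont.
  by apply: continuous_max; [exact: cst_continuous|exact: cvg_id].
apply: (nondecreasing_family_progressive hF _ _ _ mf mB).
- move=> t t0; rewrite (_ : Z t = (@ln R \o g) \o (fun w => Xbar t w)); last first.
    by apply/funext => w; rewrite /Z/= gE.
  apply: (@measurableT_comp _ _ _ _ _ _ (@ln R \o g)).
    by apply: measurableT_comp => //; exact: continuous_measurable_fun.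
  exact: (msup_filtration_measurable hF cX (@mX)).
- move=> s t w s0 st; have t0 := le_trans s0 st.
  rewrite ler_ln ?posrE ?y_gt0// -(xresE (Xbar_ge0 w s0)) -(xresE (Xbar_ge0 w t0)).
  by apply: xres_mono; [exact: Xbar_ge0|exact: Xbar_le].
- move=> w t; have m0 (s : R) : 0 <= Num.max 0 s by rewrite le_max lexx.
  have E : (fun s : R => y_ (Xbar (Num.max 0 s) w)) = g \o (fun s : R => Xbar (Num.max 0 s) w).
    by apply/funext => s /=; rewrite gE.
  have c1 : {for t, continuous (fun s : R => y_ (Xbar (Num.max 0 s) w))}.
    by rewrite E; apply: continuous_comp; [exact: (msup_continuous (@cX w))|exact: cg].
  by apply: (cvg_comp _ (@ln R) c1); apply: continuous_ln; exact: y_gt0.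
Qed.

(** Taking the maximum with c_i commutes with the power alpha_i, so [Iop] at the running supremum is
    the aggregate output to the power - gamma. *)
Lemma market_clearing_expansion : market_clearing iota M W p_ (expansion M n p_).
Proof.
move=> t w t0; rewrite market_X_gbm.
have Xb := Xbar_ge0 w t0; have pb0 : 0 <= running_sup p_ t w by rewrite (pbarE w t0) powR_ge0.
have -> : p_ t w = Xg t w `^ b^-1 * res (Xbar t w) `^ b^-1.
  by rewrite -powRM ?(ltW (X_gt0 t w)) ?(ltW (res_gt0 Xb)).
congr (_ * _).
have -> : - (ga / b) = - ga * b^-1 by rewrite mulNr.
rewrite powRrM -(IPsi_y Xb) -(pbarE w t0) IopE.
have IE : \int[iota]_i (expansion M n p_ i t w `^ alpha M i * lam M i) =
  \int[iota]_i (lam M i * Num.max (cap M i `^ alpha M i) (Psi i (running_sup p_ t w) `^ alpha M i)); last by rewrite IE.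
apply: eq_Rintegral => i _; rewrite mulrC; congr (_ * _).
rewrite /expansion ltNge t0/=.
have := PsiE i pb0; have := powR_ge0 (K i * running_sup p_ t w `^ b) (1 - alpha M i)^-1.
move: (Psi i _) => u u0 uE; rewrite -uE in u0.
have c0 := ltW (cap0 i).
by case: (leP (cap M i) u) => uc; [rewrite max_r|rewrite max_l//]; rewrite ?ge0_ler_powR ?nnegrE ?(ltW (alpha0 i)) ?(ltW uc).
Qed.

Lemma market_equilibrium : equilibrium iota M P F W p_ (expansion M n p_).
Proof.
split; [exact: market_price_process|exact: expansion_admissible_family|exact: market_clearing_expansion|].
move=> i; apply/eqP; rewrite eq_le; apply/andP; split.
  by apply: ereal_sup_ubound; exists (expansion M n p_ i) => //; exact: expansion_admissible.
by apply: ge_ereal_sup => _ [C aC <-]; exact: expansion_optimal.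
Qed.

Lemma market_price0 w : p_ 0 w = (X M W 0 w * Iop iota M Phi (X M W 0 w)) `^ b^-1.
Proof. by rewrite (market_priceE w (lexx 0)) running_supE msup_point. Qed.

(** ln P is (ln X + ln of the residual demand) / (1 + beta), and ln X is affine in t and W, so the
    chain rule concerns the second term alone. Both forms of the dynamics are instances: f at the
    running supremum of Y is in each case the residual demand at that of X. *)
Lemma market_price_dynamics (f : R -> R) (Y : R -> Omega -> R) :
  difference_of_convex f -> (forall x, 0 <= x -> 0 < f x) ->
  (forall x z, 0 <= x -> x <= z -> f z <= f x) ->
  continuous (fun x : R => f (Num.max 0 x)) ->
  continuous_paths Y -> (forall w, 0 < Y 0 w) ->
  (forall t w, 0 <= t -> f (running_sup Y t w) = res (Xbar t w)) ->
  price_dynamics M P W p_ f Y.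
Proof.
move=> [f1 [f2 [c1 c2 _ _ fE]]] f0 fanti fcont cY Y0 fY.
apply: aeW => w t t0.
pose G s := running_sup Y (Num.max s 0) w.
have GE s : 0 <= s -> G s = running_sup Y s w by move=> s0; rewrite /G max_l.
have G_cont : continuous G.
  rewrite (_ : G = (fun s : R => msup (Y^~ w) 0 (Num.max 0 s))).
    exact: (msup_continuous (@cY w)).
  by apply/funext => s; rewrite /G maxC.
have G_nd : nondecreasing G.
  move=> u v uv; apply: (msup_monor (@cY w)) => //; first by rewrite le_max lexx orbT.
  by rewrite ge_max !le_max lexx uv orbT.
have G0 : 0 < G 0 by rewrite (GE _ (lexx 0)) running_supE msup_point Y0.
have := stieltjes_log_derivative (convex_function_on c1) (convex_function_on c2) fE f0 fanti fcont G_nd G_cont G0 t0.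
rewrite (GE _ t0) (GE _ (lexx 0)) (fY _ _ t0) (fY _ _ (lexx 0)) => H.
rewrite (_ : integral _ _ _ = (ln (res (Xbar t w)) - ln (res (Xbar 0 w)))%:E); last first.
  rewrite -H; apply: eq_integral => s; rewrite inE/= in_itv/= => /andP[s0 _].
  by rewrite (GE _ (ltW s0)).
rewrite -EFinM -!EFinD; congr EFin.
have lnp s : 0 <= s -> ln (p_ s w) = b^-1 * (ln x0 + (nu * s + sg * W s w) + ln (res (Xbar s w))).
  move=> s0; have r0 := res_gt0 (Xbar_ge0 w s0).
  rewrite (_ : p_ s w = (Xg s w * res (Xbar s w)) `^ b^-1)// ln_powR lnM ?posrE//.
  by rewrite /gbm lnM ?posrE ?expR_gt0// expRK.
have -> : mu M - sigma M ^+ 2 / 2 = nu by rewrite /mu /nu /sigma; field.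
rewrite -/sg; have [/(_ w) W0 _ _ _ _] := hW.
have E0 := lnp _ (lexx 0); rewrite W0 in E0.
exact: log_increment b0 (lnp _ t0) E0.
Qed.

Lemma market_price_dynamics_Psi : price_dynamics M P W p_ (Iop iota M Psi) p_.
Proof.
apply: market_price_dynamics DC_Psi IPsi_gt0 IPsi_anti IPsi_cont p_cont _ _.
- by move=> w; apply/powR_gt0/mulr_gt0; [exact: X_gt0|exact/res_gt0/Xbar_ge0].
- by move=> t w t0; rewrite (pbarE w t0) (IPsi_y (Xbar_ge0 w t0)).
Qed.

Lemma market_price_dynamics_Phi : price_dynamics M P W p_ (Iop iota M Phi) (X M W).
Proof.
rewrite market_X_gbm; apply: market_price_dynamics DC_Phi _ _ _ cX _ _.
- by move=> x x00; rewrite (IPhi x00); exact: res_gt0.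
- by move=> x z x00 xz; rewrite (IPhi x00) (IPhi (le_trans x00 xz)); exact: res_anti.
- rewrite (_ : (fun x => _) = (fun x : R => res (Num.max 0 x))); first exact: res_cont.
  by apply/funext => x; rewrite IPhi// le_max lexx.
- by move=> w; exact: X_gt0.
- by move=> t w t0; rewrite running_supE (IPhi (Xbar_ge0 w t0)).
Qed.

End market_equilibrium.

Theorem theorem4p2 (R : realType)
    (d : measure_display) (Omega : measurableType d)
    (P : probability Omega R) (F : R -> set (set Omega)) (W : R -> Omega -> R)
    (dI : measure_display) (I : measurableType dI)
    (iota : {sigma_finite_measure set I -> \bar R})
    (M : market R I) (m n : I -> R) :
  standing_assumptions iota M P F W ->
  characteristic_roots M m n ->
  (forall i, [/\ 0 < cap M i, 0 < alpha M i, 0 < lam M i, 0 < cost M i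
     & 0 < rate M i]) ->
  [/\ measurable_fun setT (cap M), measurable_fun setT (alpha M),
      measurable_fun setT (lam M), measurable_fun setT (cost M)
    & measurable_fun setT (rate M)] ->
  ((1 + beta M)%:E *
     \int[iota]_i (lam M i * cap M i `^ alpha M i)%:E < +oo)%E ->
  (forall i, 0 < alpha M i < 1 /\ 0 < epsilon iota M n i) ->
  (forall q : R, 0 < q ->
     (\int[iota]_i (lam M i *
        (q * Psi_const M n i) `^ (alpha M i / (1 - alpha M i)))%:E < +oo)%E) ->
  let Psi := Psi_star M n in
  let Phi := Phi_star iota M n in
  let Xbar := running_sup (X M W) in
  set_bij `[0, +oo[%classic `[0, +oo[%classic (h_star iota M n) /\
  exists Pstar : R -> Omega -> R,
    let Cstar := expansion M n Pstar in
    [/\ price_equation iota M F W n Pstar,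
        forall Q, price_equation iota M F W n Q ->
          forall t w, 0 <= t -> Q t w = Pstar t w &
        equilibrium iota M P F W Pstar Cstar] /\
    [/\ forall t w, 0 <= t ->
          Pstar t w =
          (X M W t w * Iop iota M Phi (Xbar t w)) `^ (1 + beta M)^-1
      & forall i t w, 0 <= t ->
          Cstar i t w = Num.max (cap M i) (Phi i (Xbar t w))] /\
    [/\ difference_of_convex (Iop iota M Psi)
      & difference_of_convex (Iop iota M Phi)] /\
    [/\ price_dynamics M P W Pstar (Iop iota M Psi) Pstar,
        price_dynamics M P W Pstar (Iop iota M Phi) (X M W)
      & forall w, Pstar 0 w =
          (X M W 0 w * Iop iota M Phi (X M W 0 w)) `^ (1 + beta M)^-1].
Proof.
move=> [[beta0 _ /andP[ga0 ga1]] [D00 st0] [hF hW] [_ iota0] _] roots pos [mcap malpha mlam mcost mrate].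
move=> floor_fin' eps power_fin.
have b0 : 0 < 1 + beta M by rewrite ltr_wpDr// ltW.
have cap0 i : 0 < cap M i by have [] := pos i.
have alpha0 i : 0 < alpha M i by have [] := pos i.
have lam0 i : 0 < lam M i by have [] := pos i.
have cost0 i : 0 < cost M i by have [] := pos i.
have rate0 i : 0 < rate M i by have [] := pos i.
have alpha1 i : alpha M i < 1 by have [/andP[]] := eps i.
have floor_fin : (\int[iota]_i (lam M i * cap M i `^ alpha M i)%:E < +oo)%E.
  move: floor_fin'; have : (0 <= \int[iota]_i (lam M i * cap M i `^ alpha M i)%:E)%E.
    by apply: integral_ge0 => i _; rewrite lee_fin mulr_ge0 ?powR_ge0// ltW.
  case: (integral _ _ _) => [r _ _|_|//]; first exact: ltry.
  by rewrite gt0_muley ?lte_fin.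
have excess i : (1 - alpha_bar iota M) / (1 - alpha_bar iota M + alpha_bar iota M * gamma M) <
    (n i - 1) * (1 - alpha M i) / alpha M i.
  by have [_] := eps i; rewrite /epsilon subr_gt0.
(* A positive [epsilon] forces n > 1, since the fraction subtracted in it is nonnegative. *)
have n1 i : 1 < n i.
  have : 0 < (n i - 1) * (1 - alpha M i) / alpha M i.
    apply: le_lt_trans (excess i).
    have := alpha_bar_ge0 iota M; have := alpha_bar_le1 iota M => ab1 ab0.
    have abg : 0 <= alpha_bar iota M * gamma M by rewrite mulr_ge0// ltW.
    by apply: divr_ge0; rewrite ?subr_ge0//; apply: addr_ge0; rewrite ?subr_ge0.
  by rewrite pmulr_lgt0 ?invr_gt0// pmulr_lgt0 subr_gt0.
have sg2 : 0 < sigma M ^+ 2 / 2 by rewrite divr_gt0// exprn_gt0// mulr_gt0.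
have root i : growth (gamma M * mu_tilde M) (sigma M) (n i) = rate M i.
  have [_ _ _] := roots i; rewrite /characteristic /growth => /eqP; rewrite subr_eq0 => /eqP <-.
  by rewrite /mu /sigma; field.
have growth1 : growth (gamma M * mu_tilde M) (sigma M) 1 = mu M.
  by rewrite /mu /growth /sigma; field.
have mu_lt i : growth (gamma M * mu_tilde M) (sigma M) 1 < rate M i.
  have [m0 _ em en] := roots i.
  by have := characteristic_lt0 sg2 m0 (n1 i) em en; rewrite growth1 addrC subrK.
have K0 i : 0 < Psi_const M n i.
  have n0 : 0 < n i by exact: lt_trans (n1 i).
  have := mu_lt i; rewrite growth1 => ml.
  by rewrite divr_gt0 ?mulr_gt0 ?subr_gt0.
(* Measurability of n over the types comes from the closed form of the root, with the square root
   written as a power. *)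
have mn : measurable_fun setT n.
  rewrite (_ : n = fun i => (((mu M - sigma M ^+ 2 / 2) ^+ 2 + 4 * (sigma M ^+ 2 / 2) * rate M i) `^ 2^-1
      - (mu M - sigma M ^+ 2 / 2)) / (2 * (sigma M ^+ 2 / 2))); last first.
    apply/funext => i; have [m0 n0 em en] := roots i.
    rewrite {1}(characteristic_root sg2 m0 n0 em en) powR12_sqrt//.
    by rewrite addr_ge0 ?sqr_ge0// mulr_ge0 ?(ltW (rate0 i))// mulr_ge0 ?(ltW sg2).
  apply: measurable_funM => //; apply: measurable_funB => //.
  apply: (measurableT_comp (measurable_powR _)); apply: measurable_funD => //.
  exact: measurable_funM.
have mK : measurable_fun setT (Psi_const M n).
  have n0 i : 0 < n i by exact: lt_trans (n1 i).
  have den i : 0 < (rate M i - mu M) * n i * cost M i.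
    by have := mu_lt i; rewrite growth1 => ml; rewrite !mulr_gt0 ?subr_gt0.
  apply: measurable_funM; first by apply: measurable_funM => //; exact: measurable_funB.
  apply: measurable_funV_gt0 => //; apply: measurable_funM => //.
  by apply: measurable_funM => //; exact: measurable_funB.
move=> Psi Phi Xbar; split; first exact: h_star_bij.
exists (market_price iota M n W).
split; first split.
- by apply: (market_price_equation (P := P)).
- by move=> Q hQ t w t0; apply: (market_price_unique (P := P)) hQ _ _ t0.
- by apply: market_equilibrium.
split; first split.
- by move=> t w t0; apply: (market_priceE (P := P) (F := F)) t0.
- by move=> i t w t0; apply: (expansion_Phi (P := P) (F := F)) t0.
split; first split.
- by apply: Iop_Psi_difference_of_convex.
- by apply: Iop_Phi_difference_of_convex.
split.
- by apply: (market_price_dynamics_Psi (F := F)).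
- by apply: (market_price_dynamics_Phi (F := F)).
- by move=> w; apply: (market_price0 (P := P) (F := F)).
Qed.
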